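(* Let $\mathbb{G}$ be a Carnot group of homogeneous dimension $Q$ and let $\mathcal{L}$ be a left-invariant linear differential operator on $\mathbb{G}$, homogeneous of degree $\lambda\in[1,Q)$, such that both $\mathcal{L}$ and its transpose $\mathcal{L}^t$ are hypoelliptic. Let $\delta\in(0,1)$. Then for every compact set $K\subset\mathbb{G}$, $$\mathcal{H}_\infty^{Q-\lambda+\delta}(K)\lesssim\kappa^{\delta}(K)\lesssim\mathcal{H}_\infty^{Q-\lambda+\delta}(K),$$ where $\kappa^\delta$ is the Hölder capacity $$\kappa^\delta(K)=\sup\{|\langle\mathcal{L}f,1\rangle| : f\in \mathrm{Lip}_\delta,\ \|f\|_\delta\le1,\ \operatorname{supp}(\mathcal{L}f)\subset K\}.$$
   Context: Carnot groups. A Carnot group $\mathbb{G}$ is a connected, simply connected, nilpotent Lie group whose Lie algebra has a stratification $\mathfrak{g}=\mathfrak{v}_1\oplus\cdots\oplus\mathfrak{v}_s$ into non-zero subspaces with $[\mathfrak{v}_1,\mathfrak{v}_i]=\mathfrak{v}_{i+1}$ for $1\le i\le s-1$ and $[\mathfrak{v}_1,\mathfrak{v}_s]=\{0\}$. Via the exponential map $\mathbb{G}$ is identified with $\mathbb{R}^N$, $N=\sum_i\dim\mathfrak{v}_i$, with identity $0$; $m_1=\dim\mathfrak{v}_1$; the homogeneous dimension is $Q=\sum_i i\dim\mathfrak{v}_i$. Elements of $\mathfrak{g}$ act as left-invariant vector fields, and the Jacobian basis $X_1,\dots,X_{m_1}$ of $\mathfrak{v}_1$ is the one with $X_j|_0=\partial_j|_0$.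 The Carnot-Carathéodory distance $d(x,y)$ is the infimum of all $T$ for which there is a piecewise smooth $\gamma:[0,T]\to\mathbb{G}$ with $\gamma(0)=x$, $\gamma(T)=y$ and $\langle\dot\gamma(t),\xi\rangle^2\le\sum_{j=1}^{m_1}\langle X_jI(\gamma(t)),\xi\rangle^2$ for all $\xi\in\mathbb{R}^N$ and a.e. $t$, where $X_jI(x)$ is the coefficient vector of $X_j$ at $x$. For $t>0$ the dilation $\delta_t$ is $\delta_t(X)=t^iX$ for $X\in\mathfrak{v}_i$, extended linearly and transferred to $\mathbb{G}$ by $\exp$. Operators. $\mathcal{L}$ is left-invariant if $\mathcal{L}(T\circ\tau_\alpha)=(\mathcal{L}T)\circ\tau_\alpha$ for all $\alpha\in\mathbb{G}$ and distributions $T$, where $\tau_\alpha(x)=\alpha\cdot x$; homogeneous of degree $\lambda$ if $\mathcal{L}(T\circ\delta_t)=t^\lambda(\mathcal{L}T)\circ\delta_t$ for all $t>0$ and all distributions $T$; hypoelliptic if for every open $\Omega$ and distributions $T,F$ on $\Omega$ with $\mathcal{L}T=F$, $F\in C^\infty(\Omega)$ implies $T\in C^\infty(\Omega)$. Hölder space. $\mathrm{Lip}_\delta=\mathrm{Lip}_\delta(\mathbb{G})$ is the set of $f:\mathbb{G}\to\mathbb{R}$ for which there is $C>0$ with $|f(x)-f(y)|\le C\,d(x,y)^\delta$ for all $x,y\in\mathbb{G}$; $\|f\|_\delta$ is the least such $C$. $\mathcal{L}f$ and its support are distributional; $\langle\mathcal{L}f,1\rangle$ means $\langle\mathcal{L}f,\psi\rangle$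 for any $\psi\in C_0^\infty$ equal to $1$ near $K$. $\mathcal{H}_\infty^s(K)=\inf\sum_i(\operatorname{diam}E_i)^s$ over countable coverings of $K$, diameters with respect to $d$. $A\lesssim B$ means $A\le CB$ with a constant $C>0$ depending only on $\mathbb{G},\mathcal{L},\delta$ (not on $K$). *)

(* Defs.v *)
From HB Require Import structures.
From mathcomp Require Import all_boot all_order all_algebra.
From mathcomp Require Import all_classical all_reals all_analysis.

Set Implicit Arguments.
Unset Strict Implicit.
Unset Printing Implicit Defensive.

Import Order.TTheory GRing.Theory Num.Theory.
Import numFieldNormedType.Exports.

Local Open Scope classical_set_scope.
Local Open Scope ring_scope.

Section Smooth.
Context {R : realType}.

Definition evec {n : nat} (i : 'I_n) : 'rV[R]_n := delta_mx ord0 i.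

(* The word l = [:: i1; ...; ik] stands for d_{i1} ... d_{ik}. *)
Definition partials {n : nat} (l : seq 'I_n) (f : 'rV[R]_n -> R) :
    'rV[R]_n -> R :=
  foldr (fun i (g : 'rV[R]_n -> R) x => 'D_(evec i) g x) f l.

(* C^oo on U, for U open. *)
Definition smooth_on {n : nat} (U : set 'rV[R]_n) (f : 'rV[R]_n -> R) : Prop :=
  forall (l : seq 'I_n) (x : 'rV[R]_n), U x ->
    {for x, continuous (partials l f)} /\
    (forall i : 'I_n, derivable (partials l f) x (evec i)).

Definition test_fun {n : nat} (U : set 'rV[R]_n) (phi : 'rV[R]_n -> R) : Prop :=
  smooth_on setT phi /\
  exists K : set 'rV[R]_n,
    [/\ compact K, K `<=` U & forall x, ~ K x -> phi x = 0].

(* Integration over R^n with respect to Lebesgue measure, as an iterated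
   integral; it is only applied to continuous compactly supported functions,
   for which it is the integral against the n-fold product measure. *)
Fixpoint integral_rV (n : nat) : ('rV[R]_n -> R) -> R :=
  match n with
  | 0%N => fun f => f 0
  | m.+1 => fun f => (\int[@lebesgue_measure R]_x
      integral_rV (fun v : 'rV[R]_m => f (row_mx (x%:M : 'rV[R]_1) v)))%R
  end.

End Smooth.

Section Distributions.
Context {R : realType} {N : nat}.
Local Notation V := 'rV[R]_N.

(* Distributions on U are represented by their values on test functions;
   values at other functions are irrelevant. *)
Definition prefunctional : Type := (V -> R) -> R.

Definition is_distribution (U : set V) (T : prefunctional) : Prop :=
  (forall (a : R) (phi psi : V -> R), test_fun U phi -> test_fun U psi ->
     T (fun x => a * phi x + psi x) = a * T phi + T psi) /\
  (forall K : set V, compact K -> K `<=` U ->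
     exists (C : R) (m : nat), forall (phi : V -> R) (M : R),
       test_fun U phi -> (forall x, ~ K x -> phi x = 0) ->
       (forall (l : seq 'I_N) x, (size l <= m)%N -> `|partials l phi x| <= M) ->
       `|T phi| <= C * M).

Definition eq_dist (U : set V) (S T : prefunctional) : Prop :=
  forall phi, test_fun U phi -> S phi = T phi.

Definition dist_of (f : V -> R) : prefunctional :=
  fun phi => integral_rV (fun x => f x * phi x).

(* T \o g for a diffeomorphism g whose inverse is ginv, that is
   <T \o g, phi> = <T, phi \o g^-1 * |det J(g^-1)|>. *)
Definition dist_comp_inv (ginv : V -> V) (T : prefunctional) : prefunctional :=
  fun phi => T (fun y => phi (ginv y) * `|\det (jacobian ginv y)|).

Definition dist_support (T : prefunctional) : set V :=
  [set x | ~ exists U : set V,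
    [/\ open U, U x & forall phi, test_fun U phi -> T phi = 0]].

(* Linear differential operators sum_k a_k(x) d^{l_k} with smooth
   coefficients. *)
Record diffop := Diffop {
  diffop_size : nat;
  diffop_coef : 'I_diffop_size -> V -> R;
  diffop_word : 'I_diffop_size -> seq 'I_N;
  diffop_smooth : forall k, smooth_on setT (diffop_coef k)
}.
Arguments diffop_coef : clear implicits.
Arguments diffop_word : clear implicits.

Definition diffop_fun (L : diffop) (phi : V -> R) : V -> R :=
  fun x => \sum_k diffop_coef L k x * partials (diffop_word L k) phi x.

Definition diffop_tr_fun (L : diffop) (phi : V -> R) : V -> R :=
  fun x => \sum_k (-1) ^+ size (diffop_word L k) *
    partials (diffop_word L k) (fun y => diffop_coef L k y * phi y) x.

(* Actions of L and of its transpose on distributions, by duality: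
   <L T, phi> = <T, L^t phi> and <L^t T, phi> = <T, L phi>. *)
Definition diffop_dist (L : diffop) (T : prefunctional) : prefunctional :=
  fun phi => T (diffop_tr_fun L phi).

Definition diffop_tr_dist (L : diffop) (T : prefunctional) : prefunctional :=
  fun phi => T (diffop_fun L phi).

Definition hypoelliptic (P : prefunctional -> prefunctional) : Prop :=
  forall (U : set V) (T : prefunctional) (F : V -> R),
    open U -> is_distribution U T -> smooth_on U F ->
    eq_dist U (P T) (dist_of F) ->
    exists2 u : V -> R, smooth_on U u & eq_dist U T (dist_of u).

End Distributions.

Section Carnot.
Context {R : realType} {N : nat}.
Local Notation V := 'rV[R]_N.

(* For a group law on R^N with identity 0: the left-invariant vector field
   with value u at 0, through its coefficient vector at x. *)
Definition left_inv_field (mul : V -> V -> V) (u x : V) : V :=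
  'D_u (mul x) 0.

(* The Lie bracket on T_0 = R^N: value at 0 of the commutator of the
   left-invariant vector fields extending u and v. *)
Definition lie (mul : V -> V -> V) (u v : V) : V :=
  'D_u (left_inv_field mul v) 0 - 'D_v (left_inv_field mul u) 0.

Definition lie_space (mul : V -> V -> V) (A B : {vspace V}) : {vspace V} :=
  <<[seq lie mul u v | u <- vbasis A, v <- vbasis B]>>%VS.

Definition stratum_of (deg : 'I_N -> nat) (i : nat) : {vspace V} :=
  <<[seq evec j | j <- enum 'I_N & deg j == i]>>%VS.

(* A Carnot group in exponential coordinates adapted to the stratification:
   the layer v_i is spanned by the basis vectors of weight i, so the direct sum
   decomposition holds by construction.  Since R^N is connected and simply
   connected, and the stratification makes the Lie algebra nilpotent, no further
   axiom is needed; inverses are x |-> - x by carnot_exp, which says that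
   t |-> t x is the one-parameter subgroup with velocity x, i.e. that the
   exponential map is the identity. *)
Record carnot := Carnot {
  carnot_mul : V -> V -> V;
  carnot_step : nat;
  carnot_deg : 'I_N -> nat;
  carnot_mulA : associative carnot_mul;
  carnot_mul0x : left_id 0 carnot_mul;
  carnot_mulx0 : right_id 0 carnot_mul;
  carnot_smooth : forall i : 'I_N,
    smooth_on [set: 'rV[R]_(N + N)]
      (fun z => carnot_mul (lsubmx z) (rsubmx z) ord0 i);
  carnot_exp : forall (s t : R) (x : V),
    carnot_mul (s *: x) (t *: x) = (s + t) *: x;
  carnot_step_gt0 : (0 < carnot_step)%N;
  carnot_deg_bounds : forall j, (0 < carnot_deg j <= carnot_step)%N;
  carnot_deg_homo : forall i j : 'I_N,
    (i <= j)%N -> (carnot_deg i <= carnot_deg j)%N;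
  carnot_stratum_neq0 : forall i, (0 < i <= carnot_step)%N ->
    stratum_of carnot_deg i != 0%VS;
  carnot_lie : forall i, (0 < i < carnot_step)%N ->
    lie_space carnot_mul (stratum_of carnot_deg 1) (stratum_of carnot_deg i)
    = stratum_of carnot_deg i.+1;
  carnot_lie_last :
    lie_space carnot_mul (stratum_of carnot_deg 1)
      (stratum_of carnot_deg carnot_step) = 0%VS
}.

Definition stratum (G : carnot) (i : nat) : {vspace V} :=
  stratum_of (carnot_deg G) i.

Definition hom_dim (G : carnot) : nat :=
  (\sum_(1 <= i < (carnot_step G).+1) i * \dim (stratum G i))%N.

Definition left_trans (G : carnot) (a x : V) : V := carnot_mul G a x.

Definition dilation (G : carnot) (t : R) (x : V) : V :=
  \row_j (t ^+ carnot_deg G j * x ord0 j).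

Definition dotv (u v : V) : R := \sum_j u ord0 j * v ord0 j.

Definition smooth_curve (g : R -> V) : Prop :=
  forall (n : nat) (t : R), derivable (derive1n n g) t 1.

(* Continuous on [0, T], and C^oo up to the end points on each interval of some
   subdivision 0 < s_1 < ... < s_k = T. *)
Definition piecewise_smooth (T : R) (g : R -> V) : Prop :=
  {within `[0, T], continuous g} /\
  exists s : seq R,
    [/\ path <%R 0 s, last 0 s = T &
      forall i, (i < size s)%N -> exists2 h : R -> V, smooth_curve h &
        forall t, nth 0 (0 :: s) i <= t <= nth 0 s i -> g t = h t].

(* The Jacobian basis of v_1 consists of the left-invariant fields equal to
   evec j at 0, for j of weight 1. *)
Definition subunit (G : carnot) (T : R) (g : R -> V) : Prop :=
  {ae (@lebesgue_measure R), forall t, 0 <= t <= T ->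
    forall xi : V, dotv (derive1 g t) xi ^+ 2 <=
      \sum_(j | carnot_deg G j == 1%N)
        dotv (left_inv_field (carnot_mul G) (evec j) (g t)) xi ^+ 2}.

(* The set is never empty (Chow's theorem), so inf is the true infimum. *)
Definition cc_dist (G : carnot) (x y : V) : R :=
  inf [set T : R | 0 <= T /\ exists g : R -> V,
    [/\ piecewise_smooth T g, g 0 = x, g T = y & subunit G T g]].

Definition left_invariant (G : carnot) (L : @diffop R N) : Prop :=
  forall (a : V) (T : prefunctional), is_distribution setT T ->
    eq_dist setT
      (diffop_dist L (dist_comp_inv (left_trans G (- a)) T))
      (dist_comp_inv (left_trans G (- a)) (diffop_dist L T)).

Definition homogeneous (G : carnot) (L : @diffop R N) (lambda : R) : Prop :=
  forall (t : R) (T : prefunctional), 0 < t -> is_distribution setT T ->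
    eq_dist setT
      (diffop_dist L (dist_comp_inv (dilation G t^-1) T))
      (fun phi =>
         t `^ lambda * dist_comp_inv (dilation G t^-1) (diffop_dist L T) phi).

Definition lip_bounds (G : carnot) (delta : R) (f : V -> R) : set R :=
  [set C | 0 < C /\ forall x y, `|f x - f y| <= C * cc_dist G x y `^ delta].

Definition Lip (G : carnot) (delta : R) (f : V -> R) : Prop :=
  lip_bounds G delta f !=set0.

Definition lip_norm (G : carnot) (delta : R) (f : V -> R) : R :=
  inf (lip_bounds G delta f).

(* Any psi in C_0^oo equal to 1 near K gives the same value <L f, psi>. *)
Definition holder_capacity (G : carnot) (L : @diffop R N) (delta : R)
    (K : set V) : \bar R :=
  ereal_sup [set r : \bar R | exists f psi : V -> R,
    [/\ Lip G delta f, lip_norm G delta f <= 1,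
        dist_support (diffop_dist L (dist_of f)) `<=` K,
        test_fun setT psi /\ set_nbhs K [set x | psi x = 1] &
        r = (`|diffop_dist L (dist_of f) psi|)%:E]].

(* The maximum with 0 only matters for E = set0. *)
Definition cc_diam (G : carnot) (E : set V) : \bar R :=
  Order.max 0%E (ereal_sup [set r : \bar R |
    exists x y, [/\ E x, E y & r = (cc_dist G x y)%:E]]).

Definition hausdorff_content (G : carnot) (s : R) (K : set V) : \bar R :=
  ereal_inf [set r : \bar R | exists E : nat -> set V,
    K `<=` \bigcup_i E i /\
    r = (\sum_(0 <= i <oo) poweR (cc_diam G (E i)) s)%E].

End Carnot.

Arguments carnot : clear implicits.
Arguments diffop : clear implicits.

(* Main.v *)
(** Write L for the operator, L^t for its transpose, s = Q - lambda + delta.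

    Lower bound.  Hypoellipticity of L^t, applied to a sum of shrinking humps accumulating at 0, gives
    by contradiction an a priori estimate |phi| <= C sup |d^l (L^t phi)| for test functions phi of the
    unit ball; by Hahn-Banach there is T with L T equal to the Dirac mass near 0, and hypoellipticity of
    L makes T smooth off 0.  Cutting T off and subtracting a dilate, one gets smooth compactly supported
    D and omega with integral omega = 1 and L D = omega - (the dilate of omega by 2).  Summing the
    dilates of D telescopes: this replaces convolution with a global homogeneous fundamental solution.
    A Frostman measure on K for the gauge content of dimension s, discretized at scale 2^-n, then
    yields potentials which are uniformly delta-Hoelder (each layer is bounded by t^delta and has
    horizontal gradient at most t^(delta - 1)), and an ultralimit of them is an f with L f carried by K
    and <L f, 1> at least the content.

    Upper bound.  Cover K by gauge balls, thin them by a Vitali selection, and cut 1 near K into the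
    pieces of a partition of unity ordered by decreasing radius.  Rescaled to unit size, these pieces
    have uniformly bounded derivatives, because in a packed family the sum of the ratios of radii is
    bounded; since L^t kills constants against compactly supported functions, f may be replaced by
    f - f(center), and a ball of radius r contributes at most C r^(Q - lambda + delta).

    The gauge balls compare with the balls of the Carnot-Caratheodory distance by Chow's theorem in one
    direction and by the Lipschitz estimate along horizontal curves in the other. *)
Require Import Defs.
From HB Require Import structures.
From mathcomp Require Import all_boot all_order all_algebra.
From mathcomp Require Import all_classical all_reals all_analysis.
From mathcomp Require Import ring lra zify.
Set Implicit Arguments.
Unset Strict Implicit.
Unset Printing Implicit Defensive.
Import Order.TTheory GRing.Theory Num.Theory.
Import numFieldNormedType.Exports.
Local Open Scope classical_set_scope.
Local Open Scope ring_scope.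

(** * Differential calculus on R^n *)

Section RowVectors.
Context {R : realType}.

(** L enters only through [inv_ops]: locality, duality, linearity, and the behaviour of L^t on test
    functions under translations and dilations, which is read off by testing invariance and
    homogeneity on Dirac masses. The group axioms grade only the brackets; that dilations are
    automorphisms and left translations are triangular with unit diagonal is derived, and gives the
    invariance of Lebesgue measure one coordinate at a time.

    The exponent s = Q - lambda + delta comes from scaling: at scale t the kernel has size t^(lambda
    - Q) and a box of radius t carries mass at most C t^s, so a layer has size t^delta. L maps the
    dilate of D at scale t to the dilate of omega at scale t minus the one at scale 2 t; the layers
    from 2^-n to 2^n leave a mollified measure and an error of order 2^(-(n + 1) Q). A discrete
    measure has no growth bound below its own scale, whence the truncation at 2^-n. *)

Lemma rV_normP n (x : 'rV[R]_n) (M : R) : 0 <= M ->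
  (`|x| <= M) <-> (forall i, `|x ord0 i| <= M).
Proof.
move=> M0; rewrite [`|x|]/Num.Def.normr/= mx_normrE; split=> [h i|h].
  by apply: le_trans h; exact: (le_bigmax _ (fun i : 'I_1 * 'I_n => `|x i.1 i.2|) (ord0, i)).
by apply: bigmax_le => // -[i j] _ /=; rewrite (ord1 i).
Qed.

Lemma rV_coord_le n (x : 'rV[R]_n) i : `|x ord0 i| <= `|x|.
Proof. by have [h _] := rV_normP x (normr_ge0 x); exact: h. Qed.

Lemma evecE n (i j : 'I_n) : (evec i : 'rV[R]_n) ord0 j = (i == j)%:R.
Proof. by rewrite /evec mxE eqxx eq_sym. Qed.

Lemma norm_evec n (i : 'I_n) : `|evec i : 'rV[R]_n| <= 1.
Proof. by apply/rV_normP => // j; rewrite evecE; case: eqP; rewrite ?normr1 ?normr0. Qed.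

Lemma rV_sum_evec n (x : 'rV[R]_n) : x = \sum_i x ord0 i *: evec i.
Proof. exact: row_sum_delta. Qed.

Lemma derivable_line (V W : normedModType R) (f : V -> W) (x v : V) (t : R) :
  derivable f (x + t *: v) v -> is_derive t 1 (fun s => f (x + s *: v)) ('D_v f (x + t *: v)).
Proof.
move=> df; have E : (fun h : R => h^-1 *: (((fun s => f (x + s *: v)) \o shift t) (h *: 1) - f (x + t *: v)))
   = (fun h : R => h^-1 *: ((f \o shift (x + t *: v)) (h *: v) - f (x + t *: v))).
  apply/funext => h /=; congr (_ *: (f _ - _)).
  by rewrite [h *: 1]mulr1 scalerDl addrCA addrA.
by split; rewrite /derivable /derive /= ?E.
Qed.

(** The segment is parametrized by [0, 1] rather than by its length, so that h may be negative or
    zero. *)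
Lemma MVT_line (V : normedModType R) (f : V -> R) (x v : V) (h : R) :
  (forall s : R, 0 <= s <= 1 -> derivable f (x + (s * h) *: v) v) ->
  exists2 s : R, 0 <= s <= 1 & f (x + h *: v) - f x = h * 'D_v f (x + (s * h) *: v).
Proof.
move=> df.
have d' : forall s : R, s \in `[0, 1]%R ->
    is_derive s 1 (fun s => f (x + s *: (h *: v))) (h * 'D_v f (x + (s * h) *: v)).
  move=> s; rewrite in_itv /= => sI.
  have ds := derivable_line (df s sI).
  have dm : is_derive s 1 (fun s : R => s * h) (h : R).
    have := @is_deriveM R R (@idfun R) (cst h) s 1 1 0 (is_derive_id _ _) (is_derive_cst _ _ _).
    by rewrite scaler0 add0r [_ *: _]mulr1.
  split.
    rewrite (_ : (fun s => _) = (fun u => f (x + u *: v)) \o (fun s : R => s * h)); last first.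
      by apply/funext => u /=; rewrite scalerA.
    apply/derivable1_diffP; apply: differentiable_comp.
      by apply/derivable1_diffP; case: dm.
    by apply/derivable1_diffP; case: ds.
  rewrite (_ : (fun s => _) = (fun u => f (x + u *: v)) \o (fun s : R => s * h)); last first.
    by apply/funext => u /=; rewrite scalerA.
  rewrite -derive1E derive1_comp.
  - rewrite derive1E [X in X * _]derive_val derive1E [X in _ * X]derive_val.
    by rewrite mulrC.
  - by case: dm.
  - by case: ds.
pose g := fun s : R => f (x + s *: (h *: v)).
pose dg := fun s : R => h * 'D_v f (x + (s * h) *: v).
have h1 : forall s : R, s \in `]0, 1[%R -> is_derive s 1 g (dg s).
  by move=> s sI; apply: d'; move: sI; rewrite !in_itv /= => /andP[/ltW-> /ltW->].
have h2 : {within `[0, 1], continuous g}.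
  by apply: derivable_within_continuous => s sI; case: (d' s sI).
have [s sI Es] := @MVT_segment R g dg 0 1 ler01 h1 h2.
exists s; first by move: sI; rewrite in_itv.
by move: Es; rewrite /g /dg scale1r scale0r addr0 subr0 mulr1.
Qed.

Definition lform n (a : 'I_n -> R) (v : 'rV[R]_n) : R := \sum_i v ord0 i * a i.

Lemma lform_linear n (a : 'I_n -> R) : linear (lform a).
Proof.
move=> k u v; rewrite /lform scaler_sumr -big_split /=; apply: eq_bigr => i _.
by rewrite !mxE mulrDl -mulrA.
Qed.
HB.instance Definition _ n (a : 'I_n -> R) :=
  GRing.isLinear.Build R 'rV[R]_n R _ (lform a) (lform_linear a).

Lemma lform_evec n (a : 'I_n -> R) i : lform a (evec i) = a i.
Proof.
rewrite /lform (bigD1 i) //= evecE eqxx mul1r big1 ?addr0 // => j ji.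
by rewrite evecE eq_sym (negbTE ji) mul0r.
Qed.

Lemma lform_le n (a : 'I_n -> R) v : `|lform a v| <= (\sum_i `|a i|) * `|v|.
Proof.
rewrite /lform; apply: le_trans (ler_norm_sum _ _ _) _.
rewrite mulr_suml; apply: ler_sum => i _.
by rewrite normrM mulrC ler_wpM2l // rV_coord_le.
Qed.

Lemma linear_bound_continuous (V W : normedModType R) (f : {linear V -> W}) (C : R) :
  (forall v, `|f v| <= C * `|v|) -> continuous f.
Proof.
move=> h; apply: bounded_linear_continuous; apply/bounded_funP => r.
exists (`|C| * `|r|) => x xr; apply: le_trans (h x) _.
apply: le_trans (_ : `|C| * `|x| <= _); first by rewrite ler_wpM2r // ler_norm.
by rewrite ler_wpM2l // (le_trans xr) // ler_norm.
Qed.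

Lemma lform_continuous n (a : 'I_n -> R) : continuous (lform a).
Proof. exact: linear_bound_continuous (lform_le a). Qed.

Lemma differentiableI (V W : normedModType R) (f : V -> W) (x : V) (df : {linear V -> W}) :
  continuous df ->
  (forall e, 0 < e -> \forall h \near (0 : V), `|f (x + h) - f x - df h| <= e * `|h|) ->
  differentiable f x /\ 'd f x = df :> (V -> W).
Proof.
move=> cdf H.
have E : f \o shift x = cst (f x) + df +o_ (0 : V) id.
  apply/eqaddoP => e e0; have := H e e0; apply: filterS => h /=.
  suff -> : (f \o shift x - (cst (f x) + df)) h = f (x + h) - f x - df h by [].
  by rewrite !fctE /= opprD addrA [h + x]addrC.
have E2 := diff_unique cdf E.
by split => //; apply/diff_locallyP; rewrite E2.
Qed.

(* Partial derivatives continuous at x: move from x to x + h one coordinate at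
   a time and apply the mean value theorem on each edge. *)
Lemma C1_differentiable n (U : set 'rV[R]_n) (f : 'rV[R]_n -> R) (x : 'rV[R]_n) :
  open U -> U x ->
  (forall i y, U y -> derivable f y (evec i)) ->
  (forall i, {for x, continuous (fun y => 'D_(evec i) f y)}) ->
  differentiable f x /\ (forall v, 'd f x v = lform (fun i => 'D_(evec i) f x) v).
Proof.
move=> oU Ux df cf.
suff [d1 d2] : differentiable f x /\
    'd f x = lform (fun i => 'D_(evec i) f x) :> ('rV[R]_n -> R).
  by split=> // v; rewrite d2.
apply: differentiableI; first exact: lform_continuous.
move=> e e0.
(* The n edges share the error e; n + 1 in place of n also covers n = 0. *)
have : \forall y \near x, U y /\ forall i, `|'D_(evec i) f x - 'D_(evec i) f y| <= e / n.+1%:R.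
  near=> y; split; first by near: y; exact: open_nbhs_nbhs.
  near: y; apply: filter_forall => i.
  by have /cvgrPdist_le := cf i; apply; rewrite divr_gt0.
move=> /nbhs_ballP [d /= d0 Hd]; apply/nbhs_ballP; exists d => //= h.
rewrite -ball_normE /= sub0r normrN => hd.
(* h truncated to its first k coordinates. As the norm is the sup norm, no point of the edges strays
   further than |h| from x. *)
pose p (k : nat) : 'rV[R]_n := \row_j (if (j < k)%N then h ord0 j else 0).
have pd : forall k : 'I_n, p k.+1 = p k + h ord0 k *: evec k.
  move=> k; apply/rowP => j; rewrite !mxE ltnS leq_eqVlt eqxx /=.
  case: (ltngtP j k) => // jk; rewrite ?add0r ?addr0 ?mulr0 ?addr0 ?add0r.
  - have /negbTE -> : j != k by apply: contraTN jk => /eqP ->; rewrite ltnn.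
    by rewrite mulr0 addr0.
  - have /negbTE -> : j != k by apply: contraTN jk => /eqP ->; rewrite ltnn.
    by rewrite mulr0.
  - have -> : j = k by apply: val_inj.
    by rewrite eqxx mulr1.
have E1 : f (x + h) - f x = \sum_(k < n) (f (x + p k.+1) - f (x + p k)).
  rewrite -(big_mkord xpredT (fun k => f (x + p k.+1) - f (x + p k))) telescope_sumr //.
  have -> : p n = h by apply/rowP => j; rewrite mxE ltn_ord.
  suff -> : p 0%N = 0 by rewrite addr0.
  by apply/rowP => j; rewrite !mxE.
rewrite E1 /lform -sumrB; apply: le_trans (ler_norm_sum _ _ _) _.
apply: le_trans (_ : \sum_(k < n) (e / n.+1%:R * `|h|) <= _); last first.
  rewrite sumr_const card_ord -mulrnAl ler_wpM2r // -mulr_natr -mulrA.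
  by rewrite ger_pMr // mulrC ler_pdivrMr // mul1r ler_nat.
apply: ler_sum => k _.
have key : forall s : R, 0 <= s <= 1 -> U (x + p k + (s * h ord0 k) *: evec k) /\
   forall i, `|'D_(evec i) f x - 'D_(evec i) f (x + p k + (s * h ord0 k) *: evec k)| <= e / n.+1%:R.
  move=> s /andP[s0 s1]; apply: Hd; rewrite -ball_normE /= -addrA opprD addNKr normrN.
  apply: le_lt_trans hd; apply/rV_normP => // j; rewrite !mxE eqxx /=.
  case: (ltnP j k) => jk.
    have /negbTE -> : j != k by apply: contraTN jk => /eqP ->; rewrite ltnn.
    by rewrite mulr0 addr0 rV_coord_le.
  rewrite add0r; case: eqVneq => _; last by rewrite mulr0 normr0.
  rewrite mulr1 normrM ger0_norm //; apply: le_trans (rV_coord_le h k).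
  by rewrite -[leRHS]mul1r ler_wpM2r.
have [s sI] := @MVT_line _ f (x + p k) (evec k) (h ord0 k) (fun s sI => df k _ (key s sI).1).
rewrite -addrA -pd => ->; rewrite -mulrBr normrM mulrC distrC.
by apply: ler_pM => //; [exact: (key s sI).2 | exact: rV_coord_le].
Unshelve. all: by end_near. Qed.

End RowVectors.

(** * Chain rule *)

Section Chain.
Context {R : realType}.

(** h is differentiable along v only; restricted to the line t |-> t v + x it becomes a
    differentiable function of one variable, to which the usual chain rule applies. *)
Lemma is_derive_comp_diff (V W X : normedModType R) (h : V -> W) (a : W -> X) (x v : V) :
  derivable h x v -> differentiable a (h x) ->
  is_derive x v (a \o h) ('d a (h x) ('D_v h x)).
Proof.
move=> dh da.
pose c := fun t : R => h (t *: v + x).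
have c0 : c 0 = h x by rewrite /c scale0r add0r.
have dc : differentiable c 0 by apply/derivable1_diffP; exact/(derivable1P h x v).
have da' : differentiable a (c 0) by rewrite c0.
have dac : differentiable (a \o c) 0 by exact: differentiable_comp.
have E (Y : normedModType R) (g : V -> Y) : 'D_v g x = 'D_1 (fun t : R => g (t *: v + x)) 0.
  rewrite /derive; set g1 := fun h => h^-1 *: _; set g2 := fun h => h^-1 *: _.
  suff -> : g1 = g2 by [].
  by rewrite funeqE /g1 /g2 => u /=; rewrite addr0 scale0r add0r [_%:A]mulr1.
split; first by apply/(derivable1P (a \o h) x v)/derivable1_diffP.
have -> : 'D_v (a \o h) x = 'D_1 (a \o c) 0 by exact: (E _ (a \o h)).
have -> : 'D_v h x = 'D_1 c 0 by exact: (E _ h).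
by rewrite (deriveE (1 : R) dac) (diff_comp dc da') /= c0 (deriveE (1 : R) dc).
Qed.

Lemma chain_rV (V : normedModType R) n (h : V -> 'rV[R]_n) (a : 'rV[R]_n -> R) (x v : V) :
  (forall j, derivable (fun y => h y ord0 j) x v) -> differentiable a (h x) ->
  is_derive x v (a \o h) (\sum_j 'D_v (fun y => h y ord0 j) x * 'D_(evec j) a (h x)).
Proof.
move=> dh da.
have dh' : derivable h x v by apply/derivable_mxP => i j; rewrite (ord1 i).
have [d e] := is_derive_comp_diff dh' da; split=> //; rewrite e.
rewrite (derive_mx dh') [X in 'd a _ X]rV_sum_evec linear_sum /=; apply: eq_bigr => j _.
by rewrite linearZ /= -deriveE // !mxE.
Qed.

End Chain.

Notation pd i f := (fun x => 'D_(evec i) f x).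

(** * Smooth functions and their algebra *)

Section Smooth.
Context {R : realType}.

Lemma partials_rcons n (l : seq 'I_n) i (f : 'rV[R]_n -> R) :
  partials (rcons l i) f = partials l (pd i f).
Proof. by rewrite /partials -cats1 foldr_cat. Qed.

Lemma partials_cat n (l l' : seq 'I_n) (f : 'rV[R]_n -> R) :
  partials (l ++ l') f = partials l (partials l' f).
Proof. by rewrite /partials foldr_cat. Qed.

Lemma smooth_cont n (U : set 'rV[R]_n) f x : smooth_on U f -> U x -> {for x, continuous f}.
Proof. by move=> h Ux; have [] := h [::] x Ux. Qed.

Lemma smooth_derivable n (U : set 'rV[R]_n) f x i : smooth_on U f -> U x -> derivable f x (evec i).
Proof. by move=> h Ux; have [_] := h [::] x Ux. Qed.

Lemma smooth_pd n (U : set 'rV[R]_n) f i : smooth_on U f -> smooth_on U (pd i f).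
Proof. by move=> h l x Ux; have := h (rcons l i) x Ux; rewrite partials_rcons. Qed.

Lemma smooth_partials n (U : set 'rV[R]_n) f l : smooth_on U f -> smooth_on U (partials l f).
Proof. by move=> h l' x Ux; have := h (l' ++ l) x Ux; rewrite partials_cat. Qed.

Lemma smooth_sub n (U U' : set 'rV[R]_n) f : U' `<=` U -> smooth_on U f -> smooth_on U' f.
Proof. by move=> s h l x /s; exact: h. Qed.

(** Smoothness as a greatest fixed point: this spares inductions over words of derivatives, for
    which products and compositions have no convenient closed formula. *)
Lemma smooth_coind n (U : set 'rV[R]_n) (P : ('rV[R]_n -> R) -> Prop) :
  (forall f, P f -> [/\ forall x, U x -> {for x, continuous f},
     forall i x, U x -> derivable f x (evec i) & forall i, P (pd i f)]) ->
  forall f, P f -> smooth_on U f.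
Proof.
move=> h f Pf l; have {Pf}: P (partials l f).
  by elim: l => //= i l IH; have [_ _] := h _ IH; exact.
by move=> /h [c d _] x Ux; split; [exact: c | move=> i; exact: d].
Qed.

Lemma near_eq_on n (U : set 'rV[R]_n) (T : Type) (f g : 'rV[R]_n -> T) x : open U -> U x ->
  (forall y, U y -> f y = g y) -> \near x, f x = g x.
Proof.
move=> oU Ux e; near=> y; apply: e; near: y; exact: open_nbhs_nbhs.
Unshelve. all: by end_near. Qed.

Lemma eq_on_cont n (U : set 'rV[R]_n) (T : topologicalType) (f g : 'rV[R]_n -> T) x : open U -> U x ->
  (forall y, U y -> f y = g y) -> {for x, continuous f} -> {for x, continuous g}.
Proof.
move=> oU Ux e; rewrite /prop_for /continuous_at -(e x Ux); apply: cvg_trans.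
exact: (@near_eq_cvg _ _ (nbhs x) _ f g (near_eq_on oU Ux e)).
Qed.

Lemma eq_on_pd n (U : set 'rV[R]_n) (f g : 'rV[R]_n -> R) x v : open U -> U x ->
  (forall y, U y -> f y = g y) -> 'D_v f x = 'D_v g x.
Proof. by move=> oU Ux e; apply: near_eq_derive; exact: (near_eq_on oU Ux e). Qed.

Lemma eq_on_derivable n (U : set 'rV[R]_n) (f g : 'rV[R]_n -> R) x v : open U -> U x ->
  (forall y, U y -> f y = g y) -> derivable f x v -> derivable g x v.
Proof. by move=> oU Ux e; apply: near_eq_derivable; exact: (near_eq_on oU Ux e). Qed.

Lemma eq_on_partials n (U : set 'rV[R]_n) (f g : 'rV[R]_n -> R) l : open U ->
  (forall y, U y -> f y = g y) -> forall y, U y -> partials l f y = partials l g y.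
Proof. by move=> oU e; elim: l => //= i l IH y Uy; exact: eq_on_pd IH. Qed.

Lemma smooth_eq n (U : set 'rV[R]_n) (f g : 'rV[R]_n -> R) : open U ->
  (forall y, U y -> f y = g y) -> smooth_on U f -> smooth_on U g.
Proof.
move=> oU e sf l x Ux; have e' := eq_on_partials l oU e; have [c d] := sf l x Ux.
by split; [exact: eq_on_cont e' c | move=> i; exact: eq_on_derivable e' (d i)].
Qed.

Lemma smooth_local n (U : set 'rV[R]_n) (f : 'rV[R]_n -> R) :
  (forall x, U x -> exists2 W : set 'rV[R]_n, W x & smooth_on W f) -> smooth_on U f.
Proof. by move=> h l x /h [W Wx]; exact. Qed.

(* Smoothness of a family B is shown coinductively up to sums and products. *)
Inductive alg n (U : set 'rV[R]_n) (B : ('rV[R]_n -> R) -> Prop) : ('rV[R]_n -> R) -> Prop :=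
| alg_base f : B f -> alg U B f
| alg_add f g : alg U B f -> alg U B g -> alg U B (fun x => f x + g x)
| alg_mul f g : alg U B f -> alg U B g -> alg U B (fun x => f x * g x)
| alg_cst c : alg U B (fun=> c)
| alg_eq f g : (forall y, U y -> f y = g y) -> alg U B f -> alg U B g.

Lemma alg_sum n (U : set 'rV[R]_n) (B : ('rV[R]_n -> R) -> Prop) (I : Type) (r : seq I)
    (F : I -> 'rV[R]_n -> R) :
  (forall i, alg U B (F i)) -> alg U B (fun x => \sum_(i <- r) F i x).
Proof.
move=> h; elim: r => [|i r IH].
  by apply: (@alg_eq _ _ _ (fun=> 0)); [move=> y _; rewrite big_nil | exact: alg_cst].
apply: (@alg_eq _ _ _ (fun x => F i x + \sum_(i <- r) F i x)).
  by move=> y _; rewrite big_cons.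
exact: alg_add.
Qed.

Lemma smooth_alg n (U : set 'rV[R]_n) (B : ('rV[R]_n -> R) -> Prop) : open U ->
  (forall f, B f -> [/\ forall x, U x -> {for x, continuous f},
     forall i x, U x -> derivable f x (evec i) & forall i, alg U B (pd i f)]) ->
  forall f, alg U B f -> smooth_on U f.
Proof.
move=> oU hB; apply: smooth_coind => f; elim.
- by move=> g /hB [].
- move=> {}f g _ [cf df pf] _ [cg dg pg]; split.
  + by move=> x Ux; apply: continuousD; [exact: cf | exact: cg].
  + by move=> i x Ux; apply: derivableD; [exact: df | exact: dg].
  + move=> i; apply: alg_eq (alg_add (pf i) (pg i)) => y Uy.
    by rewrite [RHS](deriveD (df i y Uy) (dg i y Uy)).
- move=> {}f g af [cf df pf] ag [cg dg pg]; split.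
  + by move=> x Ux; apply: continuousM; [exact: cf | exact: cg].
  + by move=> i x Ux; apply: derivableM; [exact: df | exact: dg].
  + move=> i; apply: alg_eq (alg_add (alg_mul af (pg i)) (alg_mul ag (pf i))) => y Uy.
    by rewrite [RHS](deriveM (df i y Uy) (dg i y Uy)).
- move=> c; split.
  + by move=> x _; exact: cst_continuous.
  + by move=> i x _; exact: derivable_cst.
  + move=> i; apply: alg_eq (alg_cst U B 0) => y _; by rewrite derive_cst.
- move=> {}f g e _ [cf df pf]; split.
  + by move=> x Ux; apply: eq_on_cont e (cf x Ux).
  + by move=> i x Ux; apply: eq_on_derivable e (df i x Ux).
  + move=> i; apply: alg_eq (pf i) => y Uy; exact: eq_on_pd e.
Qed.

Lemma smooth_base n (U : set 'rV[R]_n) f : smooth_on U f ->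
  [/\ forall x, U x -> {for x, continuous f},
     forall i x, U x -> derivable f x (evec i) & forall i, smooth_on U (pd i f)].
Proof.
move=> sf; split.
- by move=> x Ux; exact: (smooth_cont sf Ux).
- by move=> i x; exact: smooth_derivable.
by move=> i; exact: smooth_pd.
Qed.

Lemma alg_smooth n (U : set 'rV[R]_n) f : open U -> alg U (smooth_on U) f -> smooth_on U f.
Proof.
move=> oU; apply: smooth_alg => // g /smooth_base [c d p]; split=> // i.
exact: alg_base.
Qed.

Section Closure.
Variables (n : nat) (U : set 'rV[R]_n).
Hypothesis oU : open U.
Implicit Types f g : 'rV[R]_n -> R.

Lemma smooth_cst c : smooth_on U (fun=> c).
Proof. by apply: alg_smooth => //; exact: alg_cst. Qed.

Lemma smoothD f g : smooth_on U f -> smooth_on U g -> smooth_on U (fun x => f x + g x).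
Proof. by move=> sf sg; apply: alg_smooth => //; apply: alg_add; exact: alg_base. Qed.

Lemma smoothM f g : smooth_on U f -> smooth_on U g -> smooth_on U (fun x => f x * g x).
Proof. by move=> sf sg; apply: alg_smooth => //; apply: alg_mul; exact: alg_base. Qed.

Lemma smoothZ c f : smooth_on U f -> smooth_on U (fun x => c * f x).
Proof. by move=> sf; exact: (smoothM (smooth_cst c) sf). Qed.

Lemma smoothN f : smooth_on U f -> smooth_on U (fun x => - f x).
Proof.
by move=> sf; apply: smooth_eq (smoothZ (-1) sf) => // y _; rewrite mulN1r.
Qed.

Lemma smoothB f g : smooth_on U f -> smooth_on U g -> smooth_on U (fun x => f x - g x).
Proof. by move=> sf sg; exact: (smoothD sf (smoothN sg)). Qed.

Lemma smooth_sum (I : Type) (r : seq I) (F : I -> 'rV[R]_n -> R) :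
  (forall i, smooth_on U (F i)) -> smooth_on U (fun x => \sum_(i <- r) F i x).
Proof. by move=> h; apply: alg_smooth => //; apply: alg_sum => i; exact: alg_base. Qed.

Lemma smooth_prod (I : Type) (r : seq I) (F : I -> 'rV[R]_n -> R) :
  (forall i, smooth_on U (F i)) -> smooth_on U (fun x => \prod_(i <- r) F i x).
Proof.
move=> h; elim: r => [|i r IH].
  by apply: smooth_eq (smooth_cst 1) => // y _; rewrite big_nil.
by apply: smooth_eq (smoothM (h i) IH) => // y _; rewrite big_cons.
Qed.

Lemma derive_coord (i : 'I_n) (x v : 'rV[R]_n) : is_derive x v (fun y => y ord0 i) (v ord0 i).
Proof.
have L : (fun y : 'rV[R]_n => y ord0 i) = lform (fun j => (i == j)%:R).
  apply/funext => y; rewrite /lform (bigD1 i) //= eqxx mulr1 big1 ?addr0 // => j.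
  by rewrite eq_sym => /negbTE ->; rewrite mulr0.
rewrite L; have d : differentiable (lform (fun j => (i == j)%:R)) x.
  by apply: linear_differentiable; exact: lform_continuous.
split; first exact: diff_derivable.
by rewrite deriveE // diff_lin; [exact: (congr1 (@^~ v) (esym L)) | exact: lform_continuous].
Qed.

Lemma smooth_coord (i : 'I_n) : smooth_on U (fun y => y ord0 i).
Proof.
apply: (@smooth_alg _ _ (fun f => f = fun y => y ord0 i)) => //; last exact: alg_base.
move=> _ ->; split.
- by move=> x _; exact: coord_continuous.
- by move=> j x _; case: (derive_coord i x (evec j)).
- move=> j; apply: alg_eq (alg_cst _ _ ((evec j : 'rV[R]_n) ord0 i)) => y _.
  by have [_ ->] := derive_coord i y (evec j).
Qed.

Lemma smooth_diff f x : smooth_on U f -> U x -> differentiable f x.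
Proof.
move=> sf Ux.
by have [] := C1_differentiable oU Ux (fun i y => @smooth_derivable n U f y i sf)
  (fun i => smooth_cont (smooth_pd i sf) Ux).
Qed.

Lemma smooth_deriveE f x v : smooth_on U f -> U x ->
  'D_v f x = \sum_i v ord0 i * 'D_(evec i) f x.
Proof.
move=> sf Ux; rewrite deriveE; last exact: smooth_diff Ux.
by have [_ ->] := C1_differentiable oU Ux (fun i y => @smooth_derivable n U f y i sf)
  (fun i => smooth_cont (smooth_pd i sf) Ux).
Qed.

End Closure.

Lemma cont_rV (T : topologicalType) n (h : T -> 'rV[R]_n) (x : T) :
  (forall j, {for x, continuous (fun y => h y ord0 j)}) -> {for x, continuous h}.
Proof.
move=> c; apply/cvgrPdist_le => /= e e0.
have H : \forall y \near x, forall j, `|h x ord0 j - h y ord0 j| <= e.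
  by apply: filter_forall => j; have /cvgrPdist_le := c j; apply.
apply: filterS H => y Hy; apply/rV_normP; first exact: ltW.
by move=> j; rewrite !mxE.
Qed.

Section Composition.
Variables (p n : nat) (U : set 'rV[R]_p) (W : set 'rV[R]_n) (h : 'rV[R]_p -> 'rV[R]_n).
Hypotheses (oU : open U) (oW : open W).
Hypothesis sh : forall j, smooth_on U (fun y => h y ord0 j).
Hypothesis hUW : forall x, U x -> W (h x).

Lemma pd_comp (a : 'rV[R]_n -> R) i x : smooth_on W a -> U x ->
  is_derive x (evec i) (a \o h)
    (\sum_j 'D_(evec i) (fun y => h y ord0 j) x * 'D_(evec j) a (h x)).
Proof.
move=> sa Ux; apply: chain_rV; first by move=> j; exact: smooth_derivable Ux.
by apply: smooth_diff sa _ => //; exact: hUW.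
Qed.

(** By the chain rule, the algebra generated by the smooth functions on U and the pullbacks of
    smooth functions on W is stable under partial derivatives. *)
Lemma smooth_comp (a : 'rV[R]_n -> R) : smooth_on W a -> smooth_on U (a \o h).
Proof.
move=> sa.
apply: (@smooth_alg _ _ (fun f => smooth_on U f \/ exists2 a, smooth_on W a & f = a \o h)) => //;
  last by apply: alg_base; right; exists a.
move=> f [|[{sa}a sa ->]].
  by move=> /smooth_base [c d q]; split; [exact: c|exact: d|] => i; apply: alg_base; left; exact: q.
split.
- move=> x Ux; apply: continuous_comp; last exact: smooth_cont sa (hUW Ux).
  by apply: cont_rV => j; exact: smooth_cont (sh j) Ux.
- by move=> i x Ux; case: (pd_comp i sa Ux).
- move=> i; apply: (@alg_eq _ _ _ (fun x =>
    \sum_j 'D_(evec i) (fun y => h y ord0 j) x * 'D_(evec j) a (h x))).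
    by move=> y Uy; have [_ ->] := pd_comp i sa Uy.
  apply: alg_sum => j; apply: alg_mul; apply: alg_base.
    by left; exact: smooth_pd.
  by right; exists (pd j a); [exact: smooth_pd|].
Qed.

End Composition.

(** The derivative of 1/f is - (1/f)^2 f', a polynomial in 1/f and smooth functions. *)
Lemma smoothV n (U : set 'rV[R]_n) f : open U -> (forall x, U x -> f x != 0) ->
  smooth_on U f -> smooth_on U (fun x => (f x)^-1).
Proof.
move=> oU f0 sf.
apply: (@smooth_alg _ _ (fun g => smooth_on U g \/ g = fun x => (f x)^-1)) => //;
  last by apply: alg_base; right.
move=> g [/smooth_base [c d q]|->].
  split; [exact: c|exact: d|] => i; apply: alg_base; left; exact: q.
split.
- move=> x Ux; apply: continuous_comp; first exact: smooth_cont sf Ux.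
  by apply: inv_continuous; exact: f0.
- move=> i x Ux; apply: derivableV; [exact: f0 | exact: smooth_derivable Ux].
- move=> i; apply: (@alg_eq _ _ _ (fun x => (fun x => -1 * ((f x)^-1 * (f x)^-1)) x * pd i f x)).
    move=> y Uy /=; rewrite [RHS](deriveV (f0 _ Uy) (smooth_derivable sf Uy)).
    by rewrite -exprVn expr2 mulN1r.
  apply: alg_mul; last by apply: alg_base; left; exact: smooth_pd.
  by apply: alg_mul; [exact: alg_cst | apply: alg_mul; apply: alg_base; right].
Qed.

End Smooth.

(** * Symmetry of second derivatives *)

Section Schwarz.
Context {R : realType}.

(** The mean value theorem twice: along u for y |-> f (y + t v) - f y, then along v for the
    derivative of f along u. *)
Lemma mixed_difference (V : normedModType R) (U : set V) (f : V -> R) (x u v : V) (t : R) :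
  (forall a b : R, 0 <= a <= 1 -> 0 <= b <= 1 -> U (x + (a * t) *: u + (b * t) *: v)) ->
  (forall y, U y -> derivable f y u) ->
  (forall y, U y -> derivable (fun y => 'D_u f y) y v) ->
  exists a b : R, [/\ 0 <= a <= 1, 0 <= b <= 1 &
    f (x + t *: u + t *: v) - f (x + t *: v) - (f (x + t *: u) - f x)
    = t * (t * 'D_v (fun y => 'D_u f y) (x + (a * t) *: u + (b * t) *: v))].
Proof.
move=> hU du dvu.
have i01 : 0 <= (1 : R) <= 1 by rewrite ler01 lexx.
have i00 : 0 <= (0 : R) <= 1 by rewrite ler01 lexx.
pose g y := f (y + t *: v) - f y.
have sh y : derivable f (y + t *: v) u -> is_derive y u (fun y => f (y + t *: v)) ('D_u f (y + t *: v)).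
  move=> d.
  have E : (fun h : R => h^-1 *: (((fun y => f (y + t *: v)) \o shift y) (h *: u) - f (y + t *: v)))
     = (fun h : R => h^-1 *: ((f \o shift (y + t *: v)) (h *: u) - f (y + t *: v))).
    by apply/funext => h /=; rewrite addrA.
  by split; rewrite /derivable /derive /= ?E.
have dg : forall s : R, 0 <= s <= 1 ->
    is_derive (x + (s * t) *: u) u g ('D_u f (x + (s * t) *: u + t *: v) - 'D_u f (x + (s * t) *: u)).
  move=> s sI; have d1 := hU s 1 sI i01; have d0 := hU s 0 sI i00.
  rewrite mul1r in d1; rewrite mul0r scale0r addr0 in d0.
  exact: (is_deriveB (sh _ (du _ d1)) (derivableP (du _ d0))).
have [a aI Ea] := @MVT_line R V g x u t (fun s sI => @ex_derive _ _ _ _ _ _ _ (dg s sI)).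
have [b bI Eb] := @MVT_line R V (fun y => 'D_u f y) (x + (a * t) *: u) v t
   (fun s sI => dvu _ (hU a s aI sI)).
exists a, b; split=> //; have [_ E] := dg a aI.
by rewrite -Eb -E -Ea /g; ring.
Qed.

(** The second difference in [mixed_difference] is symmetric in u and v, so the two mixed
    derivatives agree at some points arbitrarily close to x; continuity at x concludes. *)
Lemma schwarz (V : normedModType R) (U : set V) (f : V -> R) (x u v : V) :
  open U -> U x ->
  (forall y, U y -> derivable f y u) -> (forall y, U y -> derivable f y v) ->
  (forall y, U y -> derivable (fun y => 'D_u f y) y v) ->
  (forall y, U y -> derivable (fun y => 'D_v f y) y u) ->
  {for x, continuous (fun y => 'D_v (fun y => 'D_u f y) y)} ->
  {for x, continuous (fun y => 'D_u (fun y => 'D_v f y) y)} ->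
  'D_v (fun y => 'D_u f y) x = 'D_u (fun y => 'D_v f y) x.
Proof.
move=> oU Ux du dv dvu duv c1 c2; apply/eqP; rewrite -subr_eq0 -normr_le0.
apply/ler_addgt0Pl => e e0; rewrite addr0.
pose F := fun y => 'D_v (fun y => 'D_u f y) y; pose G := fun y => 'D_u (fun y => 'D_v f y) y.
rewrite -[X in `|X - _|]/(F x) -[X in `|_ - X|]/(G x).
have {}c1 : F @ x --> F x := c1; have {}c2 : G @ x --> G x := c2.
have e2 : 0 < e / 2 by rewrite divr_gt0.
have h1 : \forall y \near x, `|F x - F y| <= e / 2.
  exact: ((cvgrPdist_le _ _).1 c1 _ e2).
have h2 : \forall y \near x, `|G x - G y| <= e / 2.
  exact: ((cvgrPdist_le _ _).1 c2 _ e2).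
have hU : \forall y \near x, U y by exact: open_nbhs_nbhs.
have H3 : nbhs x (U `&` ([set y | `|F x - F y| <= e / 2] `&` [set y | `|G x - G y| <= e / 2])).
  exact: filterI hU (filterI h1 h2).
move: H3 => /nbhs_ballP [d /= d0 Hd].
(* Small enough for the parallelogram spanned by t u and t v at x to stay in the ball of radius d;
   the summand 1 covers u = v = 0. *)
pose t := d / 2 / (1 + `|u| + `|v|).
have D0 : 0 < 1 + `|u| + `|v| by rewrite -addrA ltr_pwDl // addr_ge0.
have t0 : 0 < t by rewrite !divr_gt0.
have near_x : forall a b : R, 0 <= a <= 1 -> 0 <= b <= 1 -> ball x d (x + (a * t) *: u + (b * t) *: v).
  move=> a b /andP[a0 a1] /andP[b0 b1]; rewrite -ball_normE /= -addrA opprD addNKr normrN.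
  have na : `|a * t| = a * t by rewrite ger0_norm // mulr_ge0 // ltW.
  have nb : `|b * t| = b * t by rewrite ger0_norm // mulr_ge0 // ltW.
  apply: le_lt_trans (ler_normD _ _) _; rewrite (normrZ (a * t)) (normrZ (b * t)) na nb.
  apply: le_lt_trans (_ : t * (1 + `|u| + `|v|) < d); last first.
    by rewrite divfK ?gt_eqF // ltr_pdivrMr // ltr_pMr // ltr1n.
  rewrite !mulrDr mulr1 -addrA; apply: ler_wpDl; first exact: ltW.
  by apply: lerD; rewrite ler_wpM2r // ger_pMl.
have [a [b [aI bI E1]]] := mixed_difference
  (fun a b aI bI => (Hd _ (near_x a b aI bI)).1) du dvu.
have near_x' : forall a b : R, 0 <= a <= 1 -> 0 <= b <= 1 -> ball x d (x + (a * t) *: v + (b * t) *: u).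
  by move=> a' b' aI' bI'; rewrite addrAC; exact: near_x.
have [a' [b' [aI' bI' E2]]] := mixed_difference
  (fun a b aI bI => (Hd _ (near_x' a b aI bI)).1) dv duv.
have [_ [k1 _]] := Hd _ (near_x a b aI bI).
have [_ [_ k2]] := Hd _ (near_x' a' b' aI' bI').
have E : F (x + (a * t) *: u + (b * t) *: v) = G (x + (a' * t) *: v + (b' * t) *: u).
  apply: (mulfI (lt0r_neq0 t0)); apply: (mulfI (lt0r_neq0 t0)).
  apply: (etrans (esym E1)); apply: (etrans _ E2); rewrite (addrAC x (t *: v)).
  by move: (f (x + t *: u + t *: v)) (f (x + t *: v)) (f (x + t *: u)) (f x) => q1 q2 q3 q4; ring.
rewrite -(subrKA (F (x + (a * t) *: u + (b * t) *: v))).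
apply: le_trans (ler_normD _ _) _; rewrite [in X in _ + X]E [X in _ + X]distrC (splitr e).
exact: (lerD k1 k2).
Qed.

Lemma smooth_schwarz n (U : set 'rV[R]_n) f i j x : open U -> smooth_on U f -> U x ->
  pd i (pd j f) x = pd j (pd i f) x.
Proof.
move=> oU sf Ux; apply: (@schwarz _ U) => //.
- by move=> y Uy; exact: smooth_derivable Uy.
- by move=> y Uy; exact: smooth_derivable Uy.
- by move=> y Uy; exact: smooth_derivable (smooth_pd _ sf) Uy.
- by move=> y Uy; exact: smooth_derivable (smooth_pd _ sf) Uy.
- exact: (smooth_cont (smooth_pd i (smooth_pd j sf)) Ux).
- exact: (smooth_cont (smooth_pd j (smooth_pd i sf)) Ux).
Qed.

End Schwarz.

(** * Smooth cutoff functions *)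

Section Bump.
Context {R : realType}.

(* The derivatives of exp(-1/x) are of the form p(1/x) exp(-1/x) for x > 0. *)
Definition flat (p : {poly R}) (x : R) : R :=
  if 0 < x then p.[x^-1] * expR (- x^-1) else 0.

Lemma expRN_pow_le (k : nat) : exists2 C : R, 0 <= C &
  forall y : R, 0 < y -> y ^+ k * expR (- y) <= C.
Proof.
case: k => [|k].
  exists 1 => // y y0; rewrite expr0 mul1r -[leRHS]expR0 ler_expR; lra.
exists (k.+1%:R ^+ k.+1); first by rewrite exprn_ge0.
move=> y y0; rewrite expRN ler_pdivrMr ?expR_gt0 //.
have k0 : (0 : R) < k.+1%:R by rewrite ltr0n.
have -> : y = k.+1%:R * (y / k.+1%:R) by rewrite mulrC divfK ?gt_eqF.
rewrite exprMn ler_pM2l ?exprn_gt0 // expRM_natl.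
rewrite lerXn2r ?nnegrE ?divr_ge0 ?expR_ge0 ?(ltW y0) ?(ltW k0) //.
by apply: le_trans (expR_ge1Dx _); rewrite lerDr.
Qed.

Lemma expRN_poly_le (p : {poly R}) (k : nat) : exists2 C : R, 0 <= C &
  forall y : R, 0 < y -> y ^+ k * `|p.[y]| * expR (- y) <= C.
Proof.
elim/poly_ind: p k => [|p c IH] k.
  by exists 0 => // y _; rewrite horner0 normr0 mulr0 mul0r.
have [C1 C10 h1] := IH k.+1; have [C2 C20 h2] := expRN_pow_le k.
exists (C1 + `|c| * C2); first by rewrite addr_ge0 // mulr_ge0.
move=> y y0; rewrite hornerMXaddC.
apply: le_trans (_ : y ^+ k * (`|p.[y]| * y + `|c|) * expR (- y) <= _).
  rewrite ler_wpM2r ?expR_ge0 // ler_wpM2l ?exprn_ge0 ?(ltW y0) //.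
  by apply: le_trans (ler_normD _ _) _; rewrite normrM (gtr0_norm y0).
rewrite mulrDr mulrDl; apply: lerD.
  by apply: le_trans (h1 y y0); rewrite exprSr -!mulrA ler_pM2l ?exprn_gt0 // mulrCA mulrA.
have -> : y ^+ k * `|c| * expR (- y) = `|c| * (y ^+ k * expR (- y)) by ring.
by rewrite ler_wpM2l //; exact: h2.
Qed.

Lemma flat_le (p : {poly R}) : exists2 C : R, 0 <= C & forall x : R, 0 <= x -> `|flat p x| <= C * x.
Proof.
have [C C0 h] := expRN_poly_le p 1; exists C => // x x0.
rewrite /flat; case: ifP => [xp|_]; last by rewrite normr0 mulr_ge0.
have := h x^-1; rewrite invr_gt0 xp => /(_ isT); rewrite expr1 => {}h.
rewrite normrM (ger0_norm (expR_ge0 _)) -[leLHS]mul1r -(mulfV (lt0r_neq0 xp)).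
by rewrite -!mulrA mulrC ler_wpM2r // mulrA.
Qed.

(** With y = 1/x one has dy/dx = - y^2, whence the new polynomial. At 0 the quotient [flat p h] / h
    is [flat ('X * p) h], which is O(h) by [flat_le]. *)
Lemma flat_is_derive (p : {poly R}) (x : R) :
  is_derive x 1 (flat p) (flat ('X^2 * (p - p^`())) x).
Proof.
have [x0|x0|->] := ltgtP x 0.
- have e : \near x, cst 0 x = flat p x.
    near=> y; rewrite /flat ifN // -leNgt; near: y.
    by apply: filterS (lt_nbhsl x0) => y /ltW.
  rewrite {2}/flat ifN -?leNgt ?(ltW x0) //.
  exact: near_eq_is_derive e (is_derive_cst _ _ _).
- have e : \near x, p.[x^-1] * expR (- x^-1) = flat p x.
    by near=> y; rewrite /flat ifT //; near: y; exact: lt_nbhsr.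
  rewrite {2}/flat x0; apply: near_eq_is_derive e _.
  have xn0 : x != 0 by rewrite gt_eqF.
  have di : is_derive x 1 (fun y : R => y^-1) (- (x ^- 2)).
    have did : derivable (@id R) x 1 by case: (is_derive_id x (1 : R)).
    have d := @derivableV R R id x 1 xn0 did.
    split=> //; have := @deriveV R R id x 1 xn0 did.
    by rewrite derive_id [_ *: _]mulr1.
  have dk : is_derive x^-1 1 (fun y : R => p.[y] * expR (- y)) ((p^`()).[x^-1] * expR (- x^-1) - p.[x^-1] * expR (-
    x^-1)).
    have de : is_derive x^-1 1 (fun y : R => expR (- y)) (expR (- x^-1) * (-1)).
      exact: (@is_derive1_comp R expR (fun y => - y) x^-1).
    apply: (is_derive_eq (is_deriveM (is_derive_poly p x^-1) de)).
    by rewrite /GRing.scale /=; ring.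
  apply: (is_derive_eq (is_derive1_comp dk di)).
  by rewrite hornerM hornerXn hornerD hornerN exprVn; ring.
have flat0 q : flat q 0 = 0 by rewrite /flat ltxx.
have H : (fun h : R => h^-1 *: ((flat p \o shift 0) (h *: 1) - flat p 0)) @ 0^' --> (0 : R).
  have [C C0 hC] := flat_le ('X * p).
  apply/cvgrPdist_le => e e0; have C1 : 0 < C + 1 by rewrite ltr_wpDl.
  near=> h; rewrite sub0r normrN /= addr0 [h *: 1]mulr1 flat0 subr0.
  have hn0 : h != 0 by near: h; exact: nbhs_dnbhs_neq.
  have [h0|h0] := leP h 0.
    by rewrite /flat ltNge h0 scaler0 normr0 ltW.
  have -> : h^-1 *: flat p h = flat ('X * p) h.
    by rewrite /flat h0 hornerM hornerX [_ *: _]mulrA.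
  apply: le_trans (hC _ (ltW h0)) _; apply: le_trans (_ : (C + 1) * h <= _).
    by rewrite ler_wpM2r ?(ltW h0) // lerDl.
  rewrite mulrC -ler_pdivlMr // -[h]gtr0_norm //; near: h.
  by apply: dnbhs0_le; rewrite divr_gt0.
rewrite flat0; split; first by apply/cvg_ex; exists 0.
exact: cvg_lim H.
Unshelve. all: by end_near. Qed.

Lemma flat_smooth n (U : set 'rV[R]_n) (g : 'rV[R]_n -> R) p : open U ->
  smooth_on U g -> smooth_on U (fun x => flat p (g x)).
Proof.
move=> oU sg.
have D x i q : U x -> is_derive x (evec i) (fun x => flat q (g x))
    ('D_(evec i) g x * flat ('X^2 * (q - q^`())) (g x)).
  move=> Ux; have dg := smooth_derivable (i := i) sg Ux.
  have df := flat_is_derive q (g x).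
  have df' : differentiable (flat q) (g x) by apply/derivable1_diffP; case: df.
  apply: (is_derive_eq (is_derive_comp_diff dg df')).
  by rewrite -[X in 'd _ _ X]mulr1 linearZ /= -deriveE // (@derive_val _ _ _ _ _ _ _ df).
apply: (@smooth_alg _ _ _ (fun f => smooth_on U f \/ exists q, f = fun x => flat q (g x))) => //;
  last by apply: alg_base; right; exists p.
move=> f [/smooth_base [c d q]|[q ->]].
  by split; [exact: c|exact: d|] => i; apply: alg_base; left; exact: q.
split.
- move=> x Ux; apply: continuous_comp; first exact: (smooth_cont sg Ux).
  by apply: differentiable_continuous; apply/derivable1_diffP; case: (flat_is_derive q (g x)).
- by move=> i x Ux; case: (D x i q Ux).
- move=> i; apply: (@alg_eq _ _ _ _ (fun x => 'D_(evec i) g x * flat ('X^2 * (q - q^`())) (g x))).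
    by move=> y Uy; have [_ ->] := D y i q Uy.
  apply: alg_mul; apply: alg_base; first by left; exact: smooth_pd.
  by right; exists ('X^2 * (q - q^`())).
Qed.

Definition step (x : R) : R := flat 1 x.

Lemma step_gt0 x : 0 < x -> 0 < step x.
Proof. by move=> x0; rewrite /step /flat x0 hornerC mul1r expR_gt0. Qed.

Lemma step_eq0 x : x <= 0 -> step x = 0.
Proof. by move=> x0; rewrite /step /flat ltNge x0. Qed.

Lemma step_ge0 x : 0 <= step x.
Proof. by have [/step_eq0 ->|/step_gt0/ltW] := leP x 0. Qed.

Definition plateau (x : R) : R :=
  step (4 - x ^+ 2) / (step (4 - x ^+ 2) + step (x ^+ 2 - 1)).

Lemma plateau_den (x : R) : 0 < step (4 - x ^+ 2) + step (x ^+ 2 - 1).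
Proof.
have [h|h] := ltP (x ^+ 2) 4.
  by apply: ltr_pwDl; [apply: step_gt0; rewrite subr_gt0|exact: step_ge0].
apply: ltr_wpDl; first exact: step_ge0.
by apply: step_gt0; rewrite subr_gt0 (lt_le_trans _ h) // ltr1n.
Qed.

Lemma plateau01 x : 0 <= plateau x <= 1.
Proof.
rewrite /plateau divr_ge0 ?step_ge0 ?(ltW (plateau_den x)) //=.
by rewrite ler_pdivrMr ?plateau_den // mul1r lerDl step_ge0.
Qed.

Lemma plateau_eq1 x : `|x| <= 1 -> plateau x = 1.
Proof.
move=> h; rewrite /plateau (step_eq0 (x := x ^+ 2 - 1)).
  rewrite addr0 divff // gt_eqF // step_gt0 //.
  rewrite subr_gt0 -real_normK ?num_real // (@le_lt_trans _ _ 1) ?ltr1n //.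
  by rewrite expr_le1.
by rewrite subr_le0 -real_normK ?num_real // expr_le1.
Qed.

Lemma plateau_eq0 x : 2 <= `|x| -> plateau x = 0.
Proof.
move=> h; rewrite /plateau step_eq0 ?mul0r // subr_le0 -real_normK ?num_real //.
by rewrite (_ : 4 = 2 ^+ 2) ?lerXn2r ?nnegrE //; lra.
Qed.

Definition chi n (x : 'rV[R]_n) : R := \prod_i plateau (x ord0 i).

Lemma chi_smooth n : smooth_on setT (@chi n).
Proof.
apply: smooth_prod; first exact: openT.
move=> i; have s := smooth_coord (@openT 'rV[R]_n) i.
have s2 := smoothM openT s s.
have s1 (c : R) := smooth_cst (@openT 'rV[R]_n) c.
have A := flat_smooth 1 openT (smoothB openT (s1 4) s2).
have B := flat_smooth 1 openT (smoothB openT s2 (s1 1)).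
have := smoothM openT A (smoothV openT _ (smoothD openT A B)); apply.
by move=> x _; rewrite gt_eqF //; have := plateau_den (x ord0 i); rewrite expr2.
Qed.

Lemma chi01 n (x : 'rV[R]_n) : 0 <= chi x <= 1.
Proof.
rewrite /chi; apply/andP; split; first by apply: prodr_ge0 => i _; case/andP: (plateau01 (x ord0 i)).
have := @ler_prod R _ (index_enum 'I_n) xpredT (fun i => plateau (x ord0 i)) (fun=> 1).
by rewrite big1_eq; apply => i _; exact: plateau01.
Qed.

Lemma chi_eq1 n (x : 'rV[R]_n) : `|x| <= 1 -> chi x = 1.
Proof.
by move=> h; rewrite /chi big1 // => i _; apply: plateau_eq1; exact: le_trans (rV_coord_le x i) h.
Qed.

Lemma chi_eq0 n (x : 'rV[R]_n) : 2 <= `|x| -> chi x = 0.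
Proof.
move=> h; have [i hi] : exists i, 2 <= `|x ord0 i|.
  apply: contrapT => /forallNP H; have : `|x| < 2; last by rewrite ltNge h.
  rewrite [`|x|]/Num.Def.normr /= mx_normrE; apply: bigmax_lt => // -[i j] _ /=.
  by rewrite (ord1 i) ltNge; apply/negP; exact: H.
by rewrite /chi (bigD1 i) //= plateau_eq0 // mul0r.
Qed.

End Bump.

(** * Iterated integrals *)

Section Compactness.
Context {R : realType}.

Lemma closed_ball0_compact n (A : R) : compact [set x : 'rV[R]_n | `|x| <= A].
Proof.
apply: bounded_closed_compact.
  by exists A; split; [exact: num_real|move=> B AB x /= xA; rewrite (le_trans xA) // ltW].
rewrite (_ : [set _ | _] = (fun x : 'rV[R]_n => `|x|) @^-1` [set r | r <= A]) //.
apply: closed_comp; first by move=> x _; exact: norm_continuous.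
exact: closed_le.
Qed.

Lemma compact_norm_le n (K : set 'rV[R]_n) : compact K -> exists2 A : R, 0 < A & forall x, K x -> `|x| < A.
Proof.
move=> /compact_bounded [M [_ h]].
exists (`|M| + 2); first by rewrite ltr_wpDl.
move=> x Kx; apply: le_lt_trans (h (`|M| + 1) _ x Kx) _.
  by rewrite (le_lt_trans (ler_norm M)) // ltrDl.
by rewrite ltrD2l ltr1n.
Qed.

Lemma heine (V W : normedModType R) (K : set V) (f : V -> W) : compact K ->
  (forall x, K x -> {for x, continuous f}) ->
  forall e : R, 0 < e -> exists2 d : R, 0 < d & forall x y, K x -> `|x - y| < d -> `|f x - f y| < e.
Proof.
move=> /compact_near_coveringP cK cf e e0.
have H := cK R (0^'+) (fun d x => forall y, `|x - y| < d -> `|f x - f y| < e) _.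
have : \forall d \near 0^'+, K `<=` fun x => forall y, `|x - y| < d -> `|f x - f y| < e.
  apply: H => x Kx.
  have e2 : 0 < e / 2 by rewrite divr_gt0.
  have : \forall y \near x, `|f x - f y| < e / 2.
    by have /cvgrPdist_lt := cf x Kx; apply.
  move=> /nbhs_ballP [r /= r0 hr]; have r2 : 0 < r / 2 by rewrite divr_gt0.
  exists (ball x (r / 2), [set d : R | d < r / 2]) => /=.
    by split; [exact: nbhsx_ballx|exact: nbhs_right_lt].
  move=> [x' d] /= [+ dr] y; rewrite -ball_normE /= => xx' x'd.
  have h1 : `|f x - f x'| < e / 2.
    by apply: hr; rewrite -ball_normE /=; apply: lt_trans xx' _; rewrite ltr_pdivrMr // ltr_pMr // ltr1n.
  have h2 : `|f x - f y| < e / 2.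
    apply: hr; rewrite -ball_normE /= -(subrKA x'); apply: le_lt_trans (ler_normD _ _) _.
    by rewrite (splitr r) ltrD // (lt_trans x'd).
  rewrite -(subrKA (f x)) (splitr e); apply: le_lt_trans (ler_normD _ _) _.
  by rewrite ltrD // distrC.
move=> h; have : \forall d \near (0 : R)^'+, 0 < d /\ K `<=` fun x => forall y, `|x - y| < d -> `|f x - f y| < e.
  by apply: filterI; [exact: nbhs_right_gt|exact: h].
move=> /filter_ex [d [d0 hd]]; exists d => // x y Kx; exact: hd.
Qed.

End Compactness.

(** * Integrals in one variable *)

Section OneVariable.
Context {R : realType}.
Notation mu := (@lebesgue_measure R).

(** The radius A is kept explicit because every bound on an integral depends on it. *)
Definition ccont (V : normedModType R) (A : R) (f : V -> R) : Prop :=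
  [/\ 0 < A, continuous f & forall x, A <= `|x| -> f x = 0].

Lemma ccont_widen (V : normedModType R) (A B : R) (f : V -> R) : A <= B -> ccont A f -> ccont B f.
Proof.
move=> AB [A0 cf z]; split=> //; first exact: lt_le_trans AB.
by move=> x Bx; apply: z; exact: le_trans Bx.
Qed.

Lemma ccont_lin (V : normedModType R) (A a : R) (f g : V -> R) :
  ccont A f -> ccont A g -> ccont A (fun x => a * f x + g x).
Proof.
move=> [A0 cf zf] [_ cg zg]; split=> //.
  by move=> x; apply: cvgD; [apply: cvgMr; exact: cf|exact: cg].
by move=> x Ax; rewrite zf // zg // mulr0 addr0.
Qed.

Lemma shift_continuous (V W : normedModType R) (f : V -> W) (a : V) : continuous f ->
  continuous (fun x => f (x + a)).
Proof.
move=> cf x; apply: (@continuous_comp _ _ _ (fun y => y + a) f x); last exact: cf.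
by apply: cvgD; [exact: cvg_id|exact: cvg_cst].
Qed.

Lemma Rint_restrict (f : R -> R) (a b : R) :
  (forall x, ~ (a <= x <= b) -> f x = 0) -> (\int[mu]_x f x = \int[mu]_(x in `[a, b]) f x)%R.
Proof.
move=> z; rewrite [RHS]Rintegral_mkcond; congr Rintegral; apply/funext => x.
rewrite patchE; case: ifPn => // /negP h; apply: z => hx; apply: h.
by rewrite inE /= in_itv.
Qed.

Lemma ccont_integrable (A : R) (f : R -> R) : ccont A f -> mu.-integrable setT (EFin \o f).
Proof.
move=> [A0 cf z].
have -> : EFin \o f = (EFin \o f) \_ `[- A, A]%classic.
  apply/funext => x; rewrite patchE; case: ifPn => // /negP h /=; rewrite z //.
  rewrite leNgt; apply/negP => /ltW; rewrite ler_norml => hx; apply: h.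
  by rewrite inE /= in_itv.
have mD : measurable `[- A, A]%classic by exact: measurable_itv.
apply: (@integrable_mkcond _ _ _ mu _ (EFin \o f) mD).1.
apply: continuous_compact_integrable; first exact: segment_compact.
exact: continuous_subspaceT.
Qed.

Lemma Rint_lin (A a : R) (f g : R -> R) : ccont A f -> ccont A g ->
  (\int[mu]_x (a * f x + g x) = a * \int[mu]_x f x + \int[mu]_x g x)%R.
Proof.
move=> cf cg; have If := ccont_integrable cf; have Ig := ccont_integrable cg.
have caf : ccont A (fun x => a * f x).
  have c0 : ccont A (fun _ : R => 0 : R) by case: cf => A0 _ _; split=> // x; exact: cvg_cst.
  by have := ccont_lin a cf c0; under eq_fun do rewrite addr0.
by rewrite (@RintegralD _ _ _ mu setT _ _ _ (ccont_integrable caf) Ig) // RintegralZl.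
Qed.

Lemma fine_itv (a b : R) : a <= b -> fine (mu `[a, b]%classic) = b - a.
Proof.
move=> ab; rewrite lebesgue_measure_itv /= lte_fin; case: ltP => //= ba.
have -> : a = b by apply/eqP; rewrite eq_le ab ba.
by rewrite subrr.
Qed.

Lemma Rint_bound (A M : R) (f : R -> R) : ccont A f -> (forall x, `|f x| <= M) ->
  `|\int[mu]_x f x|%R <= M * (2 * A).
Proof.
move=> cf fM; have [A0 cc z] := cf.
apply: le_trans (le_normr_Rintegral measurableT (ccont_integrable cf)) _.
rewrite (@Rint_restrict _ (- A) A); last first.
  move=> x /negP h; rewrite z ?normr0 //.
  by rewrite leNgt; apply: contra h => /ltW; rewrite ler_norml.
apply: le_trans (_ : (\int[mu]_(x in `[(- A), A]) M)%R <= _).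
  apply: le_Rintegral => //.
  - apply: continuous_compact_integrable; first exact: segment_compact.
    apply: continuous_subspaceT => x; apply: continuous_comp (cc x) _.
    exact: norm_continuous.
  - apply: continuous_compact_integrable; first exact: segment_compact.
    by apply: continuous_subspaceT => x; exact: cvg_cst.
rewrite Rintegral_cst // fine_itv; last lra.
by rewrite opprK mulr2n mulrDl mul1r.
Qed.

Lemma Rint_gt0 (A : R) (f : R -> R) (x0 : R) : ccont A f -> (forall x, 0 <= f x) -> 0 < f x0 ->
  (0 < \int[mu]_x f x)%R.
Proof.
move=> cf f0 fx0; have [A0 cc z] := cf.
have : \forall y \near x0, f x0 / 2 < f y.
  have /cvgrPdist_lt /(_ (f x0 / 2)) := cc x0; rewrite divr_gt0 // => /(_ isT).
  by apply: filterS => y; rewrite ltr_norml => /andP[_]; lra.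
move=> /nbhs_ballP [r /= r0 hr]; have r2 : 0 < r / 2 by rewrite divr_gt0.
apply: lt_le_trans (_ : (\int[mu]_(x in `[x0 - r / 2, x0 + r / 2]) (f x0 / 2))%R <= _).
  by rewrite Rintegral_cst // fine_itv ?mulr_gt0 //; lra.
rewrite Rintegral_mkcond; apply: le_Rintegral => //.
- have := @integrable_mkcond _ _ _ mu `[x0 - r / 2, x0 + r / 2]%classic (EFin \o (fun=> f x0 / 2)).
  rewrite restrict_EFin; move=> H; apply/H => //.
  apply: continuous_compact_integrable; first exact: segment_compact.
  by apply: continuous_subspaceT => x; exact: cvg_cst.
- exact: ccont_integrable cf.
- move=> x _; rewrite patchE; case: ifPn => // ; rewrite inE /= in_itv /= => /andP[h1 h2].
  apply/ltW/hr; rewrite -ball_normE /= ltr_norml; lra.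
Qed.

Lemma Rint_affine (A : R) (f : R -> R) (c d : R) : ccont A f -> 0 < c ->
  (\int[mu]_x f (c * x + d) = c^-1 * \int[mu]_x f x)%R.
Proof.
move=> cf c0; have [A0 cc z] := cf.
pose B := A + `|d|.
pose F x := c * x + d.
have cF : continuous F.
  by move=> x; apply: cvgD; [apply: cvgMr; exact: cvg_id|exact: cvg_cst].
pose a := (- B - d) / c; pose b := (B - d) / c.
have Fa : F a = - B by rewrite /F /a mulrC divfK ?gt_eqF // subrK.
have Fb : F b = B by rewrite /F /b mulrC divfK ?gt_eqF // subrK.
have B0 : 0 < B by rewrite ltr_wpDr.
have ab : a <= b by rewrite ler_pM2r ?invr_gt0 // lerD2r; lra.
have zB x : ~ (- B <= x <= B) -> f x = 0.
  move=> /negP h; apply: z; rewrite leNgt; apply: contra h; rewrite ltr_norml => /andP[h1 h2].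
  have h3 := normr_ge0 d; apply/andP; split; rewrite /B; lra.
rewrite (@Rint_restrict f (- B) B) // (@Rint_restrict (fun x => f (c * x + d)) a b); last first.
  move=> x /negP h; apply: zB => /andP[h1 h2]; move/negP: h; apply.
  rewrite -Fa /F lerD2r ler_pM2l // in h1; rewrite -Fb /F lerD2r ler_pM2l // in h2.
  by rewrite h1 h2.
have dF (x : R) : is_derive x 1 F c.
  have := is_deriveD (is_deriveM (is_derive_cst c x (1 : R)) (is_derive_id x (1 : R))) (is_derive_cst d x (1 : R)).
  by rewrite scaler0 !addr0 [_ *: _]mulr1.
have F' : derive1 F = cst c by apply/funext => x; rewrite derive1E; case: (dF x).
have := @integration_by_substitution_increasing R F f a b ab.
rewrite Fa Fb F' => H.
have {}H : (\int[mu]_(x in `[(- B)%R, B]) (f x)%:E = \int[mu]_(x in `[a, b]) (((f \o F) * cst c) x)%:E)%E.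
  apply: H.
  - by move=> x y _ _ xy; rewrite /F ltrD2r ltr_pM2l.
  - by move=> x _; exact: cvg_cst.
  - by apply/cvg_ex; exists c; exact: cvg_cst.
  - by apply/cvg_ex; exists c; exact: cvg_cst.
  - split; first by move=> x _; case: (dF x).
      by apply: cvg_at_right_filter; exact: cF.
    by apply: cvg_at_left_filter; exact: cF.
  - exact: continuous_subspaceT.
have -> : (\int[mu]_(x in `[(- B)%R, B]) f x = \int[mu]_(x in `[a, b]) (c * f (c * x + d)))%R.
  rewrite /Rintegral H; congr fine; apply: eq_integral => x _.
  by rewrite /= mulrC.
rewrite RintegralZl //; first by rewrite mulrA mulVf ?gt_eqF // mul1r.
apply: continuous_compact_integrable; first exact: segment_compact.
apply: continuous_subspaceT => x; apply: continuous_comp; first exact: cF.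
exact: cc.
Qed.

End OneVariable.

Section Cons.
Context {R : realType}.

Definition vcons m (x : R) (v : 'rV[R]_m) : 'rV[R]_m.+1 := row_mx (x%:M : 'rV[R]_1) v.

Lemma vcons0 m x (v : 'rV[R]_m) : vcons x v ord0 ord0 = x.
Proof.
rewrite /vcons (_ : ord0 = lshift m (ord0 : 'I_1)); last exact: val_inj.
by rewrite (@row_mxEl _ 1 1 m) mxE eqxx.
Qed.

Lemma vconsS m x (v : 'rV[R]_m) j : vcons x v ord0 (lift ord0 j) = v ord0 j.
Proof.
rewrite /vcons (_ : lift ord0 j = rshift 1 j); last exact: val_inj.
by rewrite (@row_mxEr _ 1 1 m).
Qed.

Lemma vcons_eta m (w : 'rV[R]_m.+1) : w = vcons (w ord0 ord0) (\row_j w ord0 (lift ord0 j)).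
Proof.
apply/rowP => i; case: (unliftP ord0 i) => [j|] ->; first by rewrite vconsS mxE.
by rewrite vcons0.
Qed.

Lemma vconsB m x y (v w : 'rV[R]_m) : vcons x v - vcons y w = vcons (x - y) (v - w).
Proof.
apply/rowP => i; rewrite [LHS]mxE [X in _ + X]mxE.
by case: (unliftP ord0 i) => [j|] ->; rewrite ?vconsS ?vcons0 ?mxE.
Qed.

Lemma vcons_norm_le m x (v : 'rV[R]_m) M : `|x| <= M -> `|v| <= M -> `|vcons x v| <= M.
Proof.
move=> xM vM; have M0 : 0 <= M by exact: le_trans xM.
apply/rV_normP => // i; case: (unliftP ord0 i) => [j|] ->; last by rewrite vcons0.
by rewrite vconsS; move/(rV_normP v M0): vM; exact.
Qed.

Lemma vcons_norm_head m x (v : 'rV[R]_m) : `|x| <= `|vcons x v|.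
Proof. by rewrite -{1}(vcons0 x v) rV_coord_le. Qed.

Lemma vcons_norm_tail m x (v : 'rV[R]_m) : `|v| <= `|vcons x v|.
Proof. by apply/rV_normP => // j; rewrite -(vconsS x) rV_coord_le. Qed.

End Cons.

(** * Linearity, bounds and changes of variables *)

Section Integral.
Context {R : realType}.

Lemma ccont_unif (V : normedModType R) (A : R) (f : V -> R) : compact [set x : V | `|x| <= A] ->
  ccont A f -> forall e : R, 0 < e -> exists2 d : R, 0 < d & forall x y, `|x - y| < d -> `|f x - f y| < e.
Proof.
move=> cK [A0 cf z] e e0.
have [d d0 hd] := heine cK (fun x _ => cf x) e0.
exists d => // x y xy; have [xA|xA] := leP `|x| A; first exact: hd.
have [yA|yA] := leP `|y| A; first by rewrite distrC; apply: hd => //; rewrite distrC.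
by rewrite !z ?ltW // subrr normr0.
Qed.

Lemma ccont_slice m (A : R) (f : 'rV[R]_m.+1 -> R) x : ccont A f -> ccont A (fun v => f (vcons x v)).
Proof.
move=> [A0 cf z]; split=> //.
  move=> v; apply: continuous_comp; last exact: cf.
  apply: cont_rV => i; case: (unliftP ord0 i) => [j|] ->.
    rewrite (_ : (fun y => _) = (fun y : 'rV[R]_m => y ord0 j)).
      exact: coord_continuous.
    by apply/funext => y; rewrite vconsS.
  rewrite (_ : (fun y => _) = (fun y : 'rV[R]_m => x)); first exact: cst_continuous.
  by apply/funext => y; rewrite vcons0.
by move=> v Av; apply: z; exact: le_trans (vcons_norm_tail x v).
Qed.

Lemma ccont0 (V : normedModType R) (A : R) : 0 < A -> ccont A (fun _ : V => 0).
Proof. by move=> A0; split=> // x; exact: cvg_cst. Qed.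

Let lin_at n := forall (A a : R) (f g : 'rV[R]_n -> R), ccont A f -> ccont A g ->
  integral_rV (fun x => a * f x + g x) = a * integral_rV f + integral_rV g.

Let bound_at n := forall (A M : R) (f : 'rV[R]_n -> R), ccont A f -> (forall x, `|f x| <= M) ->
  `|integral_rV f| <= M * (2 * A) ^+ n.

(** The outer integral must again be applied to a continuous function. Linearity and the bound in
    dimension m turn the uniform continuity of f into continuity of the inner integral, which is why
    the two properties are proved by one induction in [integral_main]. *)
Lemma ccont_int_step m (A : R) (f : 'rV[R]_m.+1 -> R) : lin_at m -> bound_at m -> ccont A f ->
  ccont A (fun x => integral_rV (fun v : 'rV[R]_m => f (vcons x v))).
Proof.
move=> lin bnd cf; have [A0 cc z] := cf; split=> //.
  move=> x; apply/cvgrPdist_le => e e0.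
  have P0 : 0 < (2 * A) ^+ m by rewrite exprn_gt0 // mulr_gt0.
  have e1 : 0 < e / (2 * A) ^+ m by rewrite divr_gt0.
  have [d d0 hd] := ccont_unif (@closed_ball0_compact R _ A) cf e1.
  apply/nbhs_ballP; exists d => //= y /= xy.
  rewrite (_ : _ - _ = integral_rV (fun v => -1 * f (vcons y v) + f (vcons x v))).
    apply: le_trans (bnd A (e / (2 * A) ^+ m) _ _ _) _.
    - exact: ccont_lin (ccont_slice y cf) (ccont_slice x cf).
    - move=> v; rewrite mulN1r addrC; apply/ltW/hd.
      rewrite vconsB subrr; apply: le_lt_trans xy; apply: vcons_norm_le => //.
      by rewrite normr0.
    - by rewrite divfK ?gt_eqF.
  by rewrite (lin A) ?mulN1r 1?addrC //; exact: ccont_slice.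
move=> x Ax; rewrite (_ : (fun v => _) = fun=> 0).
  apply/eqP; rewrite -normr_le0.
  have := bnd A 0 (fun=> 0); rewrite mul0r; apply; last by move=> v; rewrite normr0.
  exact: ccont0.
by apply/funext => v; apply: z; exact: le_trans (vcons_norm_head x v).
Qed.

Lemma integral_main n : lin_at n /\ bound_at n.
Proof.
elim: n => [|n [IHl IHb]]; first by split=> // A M f _ h; rewrite expr0 mulr1; exact: h.
have cF A f := @ccont_int_step n A f IHl IHb.
split.
  move=> A a f g cf cg /=.
  rewrite -(Rint_lin a (cF _ _ cf) (cF _ _ cg)); apply: eq_Rintegral => x _.
  by rewrite -(IHl A) //; exact: ccont_slice.
move=> A M f cf fM /=; rewrite exprSr mulrA; apply: Rint_bound (cF _ _ cf) _ => x.
by apply: IHb (ccont_slice x cf) _ => v.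
Qed.

Lemma int_lin n (A a : R) (f g : 'rV[R]_n -> R) : ccont A f -> ccont A g ->
  integral_rV (fun x => a * f x + g x) = a * integral_rV f + integral_rV g.
Proof. by have [h _] := integral_main n; exact: h. Qed.

Lemma int_bound n (A M : R) (f : 'rV[R]_n -> R) : ccont A f -> (forall x, `|f x| <= M) ->
  `|integral_rV f| <= M * (2 * A) ^+ n.
Proof. by have [_ h] := integral_main n; exact: h. Qed.

Lemma int0 n : integral_rV (fun _ : 'rV[R]_n => 0) = 0.
Proof.
apply/eqP; rewrite -normr_le0; have := int_bound (ccont0 'rV[R]_n ltr01) (M := 0).
by rewrite mul0r; apply => x; rewrite normr0.
Qed.

Lemma intZ n (A a : R) (f : 'rV[R]_n -> R) : ccont A f ->
  integral_rV (fun x => a * f x) = a * integral_rV f.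
Proof.
move=> cf; have [A0 _ _] := cf; have := int_lin a cf (ccont0 'rV[R]_n A0).
by under eq_fun do rewrite addr0; rewrite int0 addr0.
Qed.

Lemma ccont_int m (A : R) (f : 'rV[R]_m.+1 -> R) : ccont A f ->
  ccont A (fun x => integral_rV (fun v : 'rV[R]_m => f (vcons x v))).
Proof. by have [l b] := integral_main m; exact: ccont_int_step. Qed.

Lemma int_ge0 n (f : 'rV[R]_n -> R) : (forall x, 0 <= f x) -> 0 <= integral_rV f.
Proof. by elim: n f => [|n IH] f h /=; [exact: h|apply: Rintegral_ge0 => x _; exact: IH]. Qed.

Lemma int_gt0 n (A : R) (f : 'rV[R]_n -> R) x0 : ccont A f -> (forall x, 0 <= f x) -> 0 < f x0 ->
  0 < integral_rV f.
Proof.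
elim: n f x0 => [|n IH] f x0 cf f0 fx0 /=.
  by rewrite (_ : 0 = x0) //; apply/rowP => -[].
apply: (Rint_gt0 (x0 := x0 ord0 ord0) (ccont_int cf)).
  by move=> x; apply: int_ge0 => v; exact: f0.
apply: (IH _ (\row_j x0 ord0 (lift ord0 j))); first exact: ccont_slice.
  by move=> v; exact: f0.
by rewrite -vcons_eta.
Qed.

(* Iterate the one-dimensional affine substitution, starting from the innermost variable. *)
Lemma int_triangular n (A : R) (f : 'rV[R]_n -> R) (T : 'rV[R]_n -> 'rV[R]_n) (c : 'I_n -> R) :
  (forall i, 0 < c i) ->
  (forall (x y : 'rV[R]_n) (j : 'I_n), (forall i : 'I_n, (i < j)%N -> x ord0 i = y ord0 i) ->
     T x ord0 j - c j * x ord0 j = T y ord0 j - c j * y ord0 j) ->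
  ccont A f -> ccont A (f \o T) ->
  integral_rV (f \o T) = (\prod_i c i)^-1 * integral_rV f.
Proof.
elim: n f T c => [|n IH] f T c c0 tri cf cfT.
  by rewrite big_ord0 invr1 mul1r /=; congr f; apply/rowP => -[].
rewrite big_ord_recl invfM -mulrA /=.
pose d := T 0 ord0 ord0.
have T0 w : T w ord0 ord0 = c ord0 * w ord0 ord0 + d.
  have := tri w 0 ord0; rewrite mxE mulr0 subr0 => H.
  by rewrite /d -H // addrC subrK.
pose T' x v := \row_j T (vcons x v) ord0 (lift ord0 j).
have TE x v : T (vcons x v) = vcons (c ord0 * x + d) (T' x v).
  by rewrite [LHS]vcons_eta T0 vcons0.
transitivity (\int[@lebesgue_measure R]_x
   ((\prod_(i < n) c (lift ord0 i))^-1 *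
    integral_rV (fun v : 'rV[R]_n => f (vcons (c ord0 * x + d) v))))%R.
  apply: eq_Rintegral => x _.
  rewrite (_ : (fun v => _) = (fun v => f (vcons (c ord0 * x + d) v)) \o T' x); last first.
    by apply/funext => v /=; rewrite -TE.
  apply: (IH _ _ (fun i => c (lift ord0 i))) => //.
  - move=> v w j h; rewrite !mxE.
    have := tri (vcons x v) (vcons x w) (lift ord0 j); rewrite !vconsS; apply.
    move=> i; case: (unliftP ord0 i) => [k|] ->; last by rewrite !vcons0.
    by rewrite !vconsS /= /bump /= !add1n ltnS; exact: h.
  - exact: ccont_slice.
  - have := ccont_slice x cfT; congr ccont; apply/funext => v /=; by rewrite -TE.
rewrite RintegralZl //; last first.
  have [A0 cc z] := ccont_int cf.
  apply: (@ccont_integrable _ ((A + `|d|) / c ord0)); split.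
  - by rewrite divr_gt0 // ltr_wpDr.
  - move=> x; apply: (@continuous_comp R R R (fun y => c ord0 * y + d)
      (fun y => integral_rV (fun v : 'rV[R]_n => f (vcons y v))) x); last exact: cc.
    by apply: cvgD; [apply: cvgMr; exact: cvg_id|exact: cvg_cst].
  - move=> x; rewrite ler_pdivrMr // => hx; apply: z.
    have := ler_normB (c ord0 * x + d) d; rewrite addrK normrM (gtr0_norm (c0 ord0)); lra.
by rewrite (Rint_affine d (ccont_int cf) (c0 ord0)) mulrCA.
Qed.

Lemma int_shift n (A : R) (f : 'rV[R]_n -> R) (a : 'rV[R]_n) : ccont A f ->
  integral_rV (fun x => f (x + a)) = integral_rV f.
Proof.
move=> cf; have [A0 cc z] := cf.
have cfT : ccont (A + `|a|) (fun x => f (x + a)).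
  split; first by rewrite ltr_wpDr.
    exact: shift_continuous.
  move=> x hx; apply: z; have := ler_normB (x + a) a; rewrite addrK; lra.
rewrite (int_triangular (A := A + `|a|) (T := fun x => x + a) (c := fun=> 1)) //.
- by rewrite big1 ?invr1 ?mul1r.
- by move=> x y j _; rewrite !mxE !mul1r !(addrC _ (a ord0 j)) !addrK.
- by apply: ccont_widen cf; rewrite lerDl.
Qed.

(** A difference quotient has integral 0 by translation invariance, and it converges uniformly to
    the partial derivative with supports in a fixed ball. *)
Lemma int_pd n (A : R) (f : 'rV[R]_n -> R) i : smooth_on setT f -> ccont A f ->
  integral_rV (pd i f) = 0.
Proof.
move=> sf cf; have [A0 cc z] := cf.
have z' x : A < `|x| -> pd i f x = 0.
  move=> Ax; rewrite -(derive_cst (0 : R) x (evec i)).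
  apply: near_eq_derive; near=> y; apply: z; apply: ltW; near: y.
  have /(@cvgr_gt _ _ (nbhs x)) := @norm_continuous R 'rV[R]_n x; exact.
have cdf : ccont (A + 1) (pd i f).
  split; first by rewrite addr_gt0.
    by move=> x; exact: smooth_cont (smooth_pd i sf) I.
  by move=> x hx; apply: z'; rewrite (lt_le_trans _ hx) // ltrDl.
apply/eqP; rewrite -normr_le0; apply/ler_addgt0Pl => e e0; rewrite addr0.
pose B := A + 1 + 1.
have B0 : 0 < B by rewrite !addr_gt0.
have P0 : 0 < (2 * B) ^+ n by rewrite exprn_gt0 // mulr_gt0.
have e1 : 0 < e / (2 * B) ^+ n by rewrite divr_gt0.
have [d d0 hd] := ccont_unif (@closed_ball0_compact R _ _) cdf e1.
pose h := Num.min (d / 2) 1.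
have h0 : 0 < h by rewrite lt_min divr_gt0 //=.
have hd2 : h < d by rewrite gt_min ltr_pdivrMr // ltr_pMr // ltr1n.
have h1 : h <= 1 by rewrite ge_min lexx orbT.
have nh : `|h *: (evec i : 'rV[R]_n)| <= h.
  by rewrite normrZ (gtr0_norm h0) ger_pMr // norm_evec.
have csh : ccont B (fun x => f (x + h *: evec i)).
  split=> //.
    exact: shift_continuous.
  move=> x; rewrite /B => hx; apply: z; have := ler_normB (x + h *: evec i) (h *: evec i).
  by rewrite addrK; lra.
have cfB : ccont B f by apply: ccont_widen cf; rewrite /B; lra.
have E : integral_rV (fun x => h^-1 * (-1 * f x + f (x + h *: evec i))) = 0.
  rewrite (intZ _ (ccont_lin (-1) cfB csh)) (int_lin _ cfB csh) (int_shift _ cf).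
  by rewrite mulN1r addNr mulr0.
rewrite -[integral_rV _]subr0 -E.
have cq : ccont B (fun x => h^-1 * (-1 * f x + f (x + h *: evec i))).
  have := ccont_lin h^-1 (ccont_lin (-1) cfB csh) (ccont0 'rV[R]_n B0).
  by under eq_fun do rewrite addr0.
have cdB : ccont B (pd i f) by apply: ccont_widen cdf; rewrite /B; lra.
rewrite (_ : _ - _ = integral_rV (fun x => -1 * (h^-1 * (-1 * f x + f (x + h *: evec i))) + pd i f x)).
  apply: le_trans (int_bound (M := e / (2 * B) ^+ n) (ccont_lin (-1) cq cdB) _) _; last first.
    by rewrite divfK ?gt_eqF.
  move=> x.
  have [s /andP[s0 s1] Es] := MVT_line (f := f) (x := x) (v := evec i) (h := h)
     (fun s _ => smooth_derivable sf I).
  rewrite (_ : -1 * f x + _ = f (x + h *: evec i) - f x); last by rewrite mulN1r addrC.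
  rewrite Es mulKf ?gt_eqF // mulN1r addrC; apply/ltW/hd.
  rewrite opprD addNKr normrN normrZ; apply: le_lt_trans hd2.
  rewrite normrM (ger0_norm s0) (gtr0_norm h0) -mulrA; apply: le_trans (_ : 1 * (h * 1) <= _);
    last by rewrite mul1r mulr1.
  by rewrite ler_pM // ?mulr_ge0 ?(ltW h0) // ler_wpM2l ?(ltW h0) ?norm_evec.
by rewrite (int_lin _ cq cdB) mulN1r addrC.
Unshelve. all: by end_near. Qed.

End Integral.

(** * Test functions and differential operators *)

Section TestFunctions.
Context {R : realType} {n : nat}.
Local Notation V := 'rV[R]_n.
Implicit Types (U K : set V) (f g : V -> R).

Lemma smoothT_cont f : smooth_on setT f -> continuous f.
Proof. by move=> sf x; exact: smooth_cont sf I. Qed.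

Lemma test_smooth U f : test_fun U f -> smooth_on setT f.
Proof. by case. Qed.

Lemma test_ccont U f : test_fun U f -> exists A : R, ccont A f.
Proof.
move=> [sf [K [cK _ z]]]; have [A A0 hA] := compact_norm_le cK.
exists A; split=> //; first exact: smoothT_cont.
by move=> x Ax; apply: z => /hA; rewrite ltNge Ax.
Qed.

Lemma testI (A : R) f : smooth_on setT f -> (forall x, A <= `|x| -> f x = 0) -> test_fun setT f.
Proof.
move=> sf z; split=> //; exists [set x | `|x| <= A]; split=> //; first exact: closed_ball0_compact.
by move=> x /= h; apply: z; case: (leP A `|x|) => // /ltW.
Qed.

Lemma ccont_test (A : R) f : smooth_on setT f -> ccont A f -> test_fun setT f.
Proof. by move=> sf [_ _ z]; exact: testI z. Qed.

Lemma test_sub U U' f : U `<=` U' -> test_fun U f -> test_fun U' f.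
Proof. by move=> s [sf [K [cK KU z]]]; split=> //; exists K; split=> //; exact: subset_trans s. Qed.

Lemma testT U f : test_fun U f -> test_fun setT f.
Proof. exact: test_sub. Qed.

Lemma compactU K K' : compact K -> compact K' -> compact (K `|` K').
Proof.
move=> cK cK'; apply: bounded_closed_compact.
  have [A A0 hA] := compact_norm_le cK; have [B B0 hB] := compact_norm_le cK'.
  exists (A + B); split; first exact: num_real.
  move=> C hC x [/hA|/hB] h; apply: ltW; lra.
by apply: closedU; apply: compact_closed => //; exact: norm_hausdorff.
Qed.

Lemma test_lin U (a : R) f g : test_fun U f -> test_fun U g -> test_fun U (fun x => a * f x + g x).
Proof.
move=> [sf [K [cK KU z]]] [sg [K' [cK' KU' z']]]; split.
  exact: (smoothD openT (smoothZ openT a sf) sg).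
exists (K `|` K'); split; first exact: compactU.
  by move=> x [/KU|/KU'].
move=> x h; rewrite z ?z' ?mulr0 ?addr0 // => h'; apply: h; [by right|by left].
Qed.

Lemma test0 U : test_fun U (fun=> 0).
Proof.
split; first exact: smooth_cst openT 0.
by exists set0; split=> //; exact: compact0.
Qed.

Lemma testZ U (a : R) f : test_fun U f -> test_fun U (fun x => a * f x).
Proof. by move=> tf; have := test_lin a tf (test0 U); under eq_fun do rewrite addr0. Qed.

Lemma testD U f g : test_fun U f -> test_fun U g -> test_fun U (fun x => f x + g x).
Proof. by move=> tf tg; have := test_lin 1 tf tg; under eq_fun do rewrite mul1r. Qed.

Lemma testB U f g : test_fun U f -> test_fun U g -> test_fun U (fun x => f x - g x).
Proof. by move=> tf tg; have := test_lin (-1) tg tf; under eq_fun do rewrite mulN1r addrC. Qed.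

Lemma test_sum U (I : Type) (r : seq I) (F : I -> V -> R) :
  (forall i, test_fun U (F i)) -> test_fun U (fun x => \sum_(i <- r) F i x).
Proof.
move=> h; elim: r => [|i r IH].
  by under eq_fun do rewrite big_nil; exact: test0.
by under eq_fun do rewrite big_cons; exact: testD.
Qed.

Lemma testM U f g : smooth_on setT g -> test_fun U f -> test_fun U (fun x => g x * f x).
Proof.
move=> sg [sf [K [cK KU z]]]; split; first exact: (smoothM openT sg sf).
by exists K; split=> // x h; rewrite z // mulr0.
Qed.

Lemma partials0 l : partials l (fun _ : V => 0) = fun=> 0.
Proof. by elim: l => //= i l ->; apply/funext => x; exact: derive_cst. Qed.

Lemma partials_zero U f l : open U -> (forall y, U y -> f y = 0) -> forall y, U y -> partials l f y = 0.
Proof.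
move=> oU z y Uy; have := @eq_on_partials R n U f (fun=> 0) l oU z y Uy.
by rewrite partials0.
Qed.

Lemma test_partials U f l : test_fun U f -> test_fun U (partials l f).
Proof.
move=> [sf [K [cK KU z]]]; split; first exact: smooth_partials.
exists K; split=> // x nKx; apply: (@partials_zero (~` K)) => //.
by apply: closed_openC; apply: compact_closed cK; exact: norm_hausdorff.
Qed.

Lemma test_pd U f i : test_fun U f -> test_fun U (pd i f).
Proof. exact: (@test_partials U f [:: i]). Qed.

(** Nothing is known of g off U, but the product vanishes on the open complement of a compact set K
    contained in U; U and this complement cover the whole space. *)
Lemma smooth_mul_test U f g : open U -> smooth_on U g -> test_fun U f -> test_fun U (fun x => g x * f x).
Proof.
move=> oU sg [sf [K [cK KU z]]]; split; last by exists K; split=> // x h; rewrite z // mulr0.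
apply: smooth_local => x _; have [Kx|nKx] := pselect (K x).
  exists U; first exact: KU.
  exact: (smoothM oU sg (smooth_sub (@subsetT _ U) sf)).
have oC : open (~` K) by apply: closed_openC; apply: compact_closed cK; exact: norm_hausdorff.
exists (~` K) => //; apply: smooth_eq (smooth_cst oC 0) => // y /z ->.
by rewrite mulr0.
Qed.

Lemma ball_cover K (r : V -> R) : compact K -> (forall x, K x -> 0 < r x) ->
  exists2 s : seq V, (forall x, x \in s -> K x) & forall y, K y -> exists2 x, x \in s & `|x - y| < r x.
Proof.
rewrite compact_cover => cK r0.
have [||D' D'K cov] := cK V K (fun x => [set y | `|x - y| < r x]).
- move=> x Kx; rewrite (_ : [set y | _] = ball x (r x)); last by rewrite -ball_normE.
  exact: ball_open.
- by move=> x Kx; exists x => //=; rewrite subrr normr0 r0.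
exists (finmap.enum_fset D') => [x /D'K|y /cov [x /= xD' h]]; first by rewrite inE.
by exists x.
Qed.

Definition bump (x : V) (r : R) (y : V) : R := chi (r^-1 *: (y - x)).

Lemma bump_smooth x r : smooth_on setT (bump x r).
Proof.
have := @smooth_comp R n n setT setT (fun y => r^-1 *: (y - x)) openT openT _ (fun _ _ => I) _ (@chi_smooth R n).
apply => j; rewrite (_ : (fun y : V => _) = fun y : V => r^-1 * (y ord0 j - x ord0 j)).
  exact: (smoothZ openT _ (smoothB openT (smooth_coord openT j) (smooth_cst openT _))).
by apply/funext => y; rewrite !mxE.
Qed.

Lemma bump01 x r y : 0 <= bump x r y <= 1.
Proof. exact: chi01. Qed.

Lemma bump_eq1 x (r : R) y : 0 < r -> `|y - x| <= r -> bump x r y = 1.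
Proof.
move=> r0 h; apply: chi_eq1; rewrite normrZ gtr0_norm ?invr_gt0 // mulrC.
by rewrite ler_pdivrMr // mul1r.
Qed.

Lemma bump_eq0 x (r : R) y : 0 < r -> 2 * r <= `|y - x| -> bump x r y = 0.
Proof.
move=> r0 h; apply: chi_eq0; rewrite normrZ gtr0_norm ?invr_gt0 // mulrC.
by rewrite ler_pdivlMr.
Qed.

Lemma bump_test U x (r : R) : 0 < r -> (forall y, `|y - x| <= 2 * r -> U y) -> test_fun U (bump x r).
Proof.
move=> r0 h; split; first exact: bump_smooth.
exists [set y | `|y - x| <= 2 * r]; split.
- rewrite (_ : [set y | _] = (fun z => z + x) @` [set z | `|z| <= 2 * r]).
    apply: continuous_compact; last exact: closed_ball0_compact.
    apply: continuous_subspaceT.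
    exact: (@shift_continuous R V V idfun x (fun _ => cvg_id)).
  apply/seteqP; split=> [y hy|_ [z hz <-]] /=; last by rewrite addrK.
  by exists (y - x) => //; rewrite subrK.
- by move=> y; exact: h.
- move=> y /negP; rewrite -ltNge => /ltW; exact: bump_eq0.
Qed.

Lemma compact_fat K U : compact K -> open U -> K `<=` U ->
  exists2 d : R, 0 < d & forall x y, K x -> `|x - y| < d -> U y.
Proof.
move=> /compact_near_coveringP cK oU KU.
have H := cK R (0^'+) (fun d x => forall y, `|x - y| < d -> U y) _.
have h : \forall d \near 0^'+, K `<=` fun x => forall y, `|x - y| < d -> U y.
  apply: H => x Kx.
  have : nbhs x U by apply: open_nbhs_nbhs; split=> //; exact: KU.
  move=> /nbhs_ballP [r /= r0 hr]; have r2 : 0 < r / 2 by rewrite divr_gt0.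
  exists (ball x (r / 2), [set d : R | d < r / 2]) => /=.
    by split; [exact: nbhsx_ballx|exact: nbhs_right_lt].
  move=> [x' d] /= [+ dr] y; rewrite -ball_normE /= => xx' x'd.
  apply: hr; rewrite -ball_normE /= -(subrKA x'); apply: le_lt_trans (ler_normD _ _) _.
  by rewrite (splitr r) ltrD // (lt_trans x'd).
have : \forall d \near (0 : R)^'+, 0 < d /\ K `<=` fun x => forall y, `|x - y| < d -> U y.
  by apply: filterI; [exact: nbhs_right_gt|exact: h].
by move=> /filter_ex [d [d0 hd]]; exists d => // x y Kx; exact: hd.
Qed.

Lemma compact_thicken K (r : R) : compact K -> compact [set y | exists2 x, K x & `|y - x| <= r].
Proof.
move=> cK; rewrite (_ : [set y | _] = (fun p : V * V => p.1 + p.2) @` (K `*` [set z | `|z| <= r])).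
  apply: continuous_compact; last by apply: compact_setX => //; exact: closed_ball0_compact.
  apply: continuous_subspaceT => p; apply: cvgD; [exact: cvg_fst|exact: cvg_snd].
apply/seteqP; split=> [y [x Kx h]|_ [[x z] /= [Kx h] <-]] /=.
  by exists (x, y - x) => //=; rewrite addrC subrK.
by exists x => //; rewrite addrC addKr.
Qed.

(** One minus the product of the 1 - bump over a finite cover: it stays in [0, 1] and equals 1
    wherever one bump does, without any division. *)
Lemma cutoff K U : compact K -> open U -> K `<=` U -> exists psi (d : R),
  [/\ test_fun U psi, 0 < d, (forall x y, K x -> `|x - y| < d -> psi y = 1) &
      forall x, 0 <= psi x <= 1].
Proof.
move=> cK oU KU; have [d d0 hd] := compact_fat cK oU KU.
pose r := d / 4; have r0 : 0 < r by rewrite divr_gt0.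
have r2 : 0 < r / 2 by rewrite divr_gt0.
have [s sK cov] := ball_cover (r := fun=> r / 2) cK (fun _ _ => r2).
pose P y := \prod_(x <- s) (1 - bump x r y).
have P01 y : 0 <= P y <= 1.
  rewrite /P; elim: (s) => [|x t /andP[IH0 IH1]]; first by rewrite big_nil ler01 lexx.
  rewrite big_cons; have /andP[b0 b1] := bump01 x r y.
  by rewrite mulr_ge0 ?subr_ge0 //= mulr_ile1 ?subr_ge0 // gerBl.
exists (fun y => 1 - P y), (r / 2); split; last 1 first.
- by move=> x; have /andP[p0 p1] := P01 x; rewrite subr_ge0 p1 gerBl.
- split.
    apply: (smoothB openT (smooth_cst openT 1)); apply: smooth_prod; first exact: openT.
    by move=> x; apply: (smoothB openT (smooth_cst openT 1)); exact: bump_smooth.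
  exists [set y | exists2 x, K x & `|y - x| <= 2 * r]; split; first exact: compact_thicken.
    by move=> y [x Kx h]; apply: hd Kx _; rewrite distrC; apply: le_lt_trans h _; rewrite /r; lra.
  move=> y h; rewrite /P big_seq big1 ?subrr // => x xs.
  rewrite bump_eq0 ?subr0 // leNgt; apply/negP => /ltW hy; apply: h.
  by exists x => //; exact: sK.
- by rewrite divr_gt0.
- move=> x y Kx xy; have [z zs hz] := cov x Kx.
  rewrite /P (big_rem z) //= bump_eq1 ?subrr ?mul0r ?subr0 //.
  rewrite -(subrKA x); apply: le_trans (ler_normD _ _) _.
  by rewrite (distrC y) (distrC x z) (splitr r) lerD ?ltW.
Qed.

End TestFunctions.

(** * Integration by parts and the fundamental lemma *)

Section ByParts.
Context {R : realType} {n : nat}.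
Local Notation V := 'rV[R]_n.
Implicit Types (U K : set V) (f g : V -> R).

Lemma ccontM (A : R) f g : continuous g -> ccont A f -> ccont A (fun x => g x * f x).
Proof.
move=> cg [A0 cf z]; split=> //; last by move=> x /z ->; rewrite mulr0.
by move=> x; apply: continuousM; [exact: cg|exact: cf].
Qed.

Lemma test_intD f g : test_fun setT f -> test_fun setT g ->
  integral_rV (fun x => f x + g x) = integral_rV f + integral_rV g.
Proof.
move=> /test_ccont [A cf] /test_ccont [B cg].
have cf' : ccont (A + B) f by apply: ccont_widen cf; case: cg => B0 _ _; rewrite lerDl ltW.
have cg' : ccont (A + B) g by apply: ccont_widen cg; case: cf => A0 _ _; rewrite lerDr ltW.
by have := int_lin 1 cf' cg'; under eq_fun do rewrite mul1r; rewrite mul1r.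
Qed.

Lemma int_by_parts f g i : smooth_on setT g -> test_fun setT f ->
  integral_rV (fun x => pd i g x * f x) = - integral_rV (fun x => g x * pd i f x).
Proof.
move=> sg tf; have sf := test_smooth tf.
have tgf := testM sg tf; have [A cgf] := test_ccont tgf.
have := int_pd i (test_smooth tgf) cgf.
rewrite (_ : pd i (fun x => g x * f x) = fun x => g x * pd i f x + pd i g x * f x).
  rewrite (test_intD (testM sg (test_pd i tf)) (testM (smooth_pd i sg) tf)).
  by move/eqP; rewrite addrC addr_eq0 => /eqP.
apply/funext => x; rewrite [LHS](deriveM (smooth_derivable sg I) (smooth_derivable sf I)).
by rewrite /GRing.scale /= (mulrC (f x)).
Qed.

Lemma pd_partials l i f : smooth_on setT f -> pd i (partials l f) = partials l (pd i f).
Proof.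
move=> sf; elim: l => //= j l IH; apply/funext => x.
by rewrite -IH; apply: (smooth_schwarz _ _ openT) I; exact: smooth_partials.
Qed.

Lemma int_by_parts_word l f g : smooth_on setT g -> test_fun setT f ->
  integral_rV (fun x => partials l g x * f x) = (-1) ^+ size l * integral_rV (fun x => g x * partials l f x).
Proof.
elim: l f => [|i l IH] f sg tf; first by rewrite expr0 mul1r.
rewrite /= (int_by_parts i (smooth_partials l sg) tf) (IH _ sg (test_pd i tf)).
by rewrite -(pd_partials l i (test_smooth tf)) /= exprS mulN1r mulNr.
Qed.

Lemma fundamental_lemma U f : open U -> (forall x, U x -> {for x, continuous f}) ->
  (forall phi, test_fun U phi -> integral_rV (fun x => f x * phi x) = 0) ->
  forall x, U x -> f x = 0.
Proof.
move=> oU; have pos g x : (forall x, U x -> {for x, continuous g}) ->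
    (forall phi, test_fun U phi -> integral_rV (fun x => g x * phi x) = 0) ->
    U x -> 0 < g x -> False.
  move=> cg h Ux gx0.
  have N : \forall y \near x, U y /\ 0 < g y.
    apply: filterI; first exact: open_nbhs_nbhs.
    have /cvgrPdist_lt /(_ (g x) gx0) := cg x Ux; apply: filterS => y.
    by rewrite ltr_norml => /andP[_]; lra.
  move: N => /nbhs_ballP [r /= r0 hr].
  have r4 : 0 < r / 4 by rewrite divr_gt0.
  have hb y : `|y - x| <= 2 * (r / 4) -> U y /\ 0 < g y.
    by move=> hy; apply: hr; rewrite -ball_normE /= distrC; lra.
  have tb : test_fun U (bump x (r / 4)).
    by apply: bump_test => // y /hb [].
  have := h _ tb; apply/eqP; rewrite gt_eqF //.
  have [A cb] := test_ccont tb; have [A0 cc z] := cb.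
  apply: (@int_gt0 _ _ A _ x).
  - split=> //; last by move=> y /z ->; rewrite mulr0.
    move=> y; have [hy|hy] := ltP `|y - x| r.
      apply: continuousM; last exact: cc.
      by apply: cg; have [] := hr y _; rewrite // -ball_normE /= distrC.
    (* At distance at least r from x, g need not be continuous, but the bump vanishes near y and so
       does the product. *)
    have e : \near y, (fun=> 0) y = g y * bump x (r / 4) y.
      have : \forall y' \near y, r / 2 < `|y' - x|.
        have c : continuous (fun z : V => `|z - x|).
          exact: (shift_continuous (a := - x) (@norm_continuous R V)).
        have /(@cvgr_gt _ _ (nbhs y)) := c y; apply; lra.
      by apply: filterS => y' hy'; rewrite bump_eq0 ?mulr0 //; lra.
    rewrite /prop_for /continuous_at -(nbhs_singleton e).
    apply: cvg_trans (@cst_continuous V R 0 y).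
    exact: (@near_eq_cvg _ _ (nbhs y) _ (fun=> 0) _ e).
  - move=> y; have [hy|hy] := leP `|y - x| (2 * (r / 4)).
      by rewrite mulr_ge0 ?(ltW (hb y hy).2) //; case/andP: (bump01 x (r / 4) y).
    by rewrite bump_eq0 ?mulr0 // ltW.
  - by rewrite bump_eq1 ?mulr1 // subrr normr0 ltW.
move=> cf h x Ux; apply/eqP; rewrite eq_le; apply/andP; split; rewrite leNgt; apply/negP => fx.
  exact: pos Ux fx.
apply: (pos (fun x => - f x) x _ _ Ux); last by rewrite oppr_gt0.
  by move=> y Uy; apply: continuousN; exact: cf.
move=> phi tphi; have [A cp] := test_ccont tphi.
have := h _ (testZ (-1) tphi).
by under eq_fun do rewrite mulrA mulrN1.
Qed.

End ByParts.

(** * Differential operators and distributions *)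

Section Operators.
Context {R : realType} {N : nat}.
Local Notation V := 'rV[R]_N.
Implicit Types (U K : set V) (f g phi psi : V -> R).

Lemma int_sum_test (I : Type) (r : seq I) (F : I -> V -> R) :
  (forall i, test_fun setT (F i)) ->
  integral_rV (fun x => \sum_(i <- r) F i x) = \sum_(i <- r) integral_rV (F i).
Proof.
move=> h; elim: r => [|i r IH].
  by under eq_fun do rewrite big_nil; rewrite int0 big_nil.
under eq_fun do rewrite big_cons.
by rewrite (test_intD (h i) (test_sum r h)) IH big_cons.
Qed.

Lemma intZ_test (a : R) f : test_fun setT f -> integral_rV (fun x => a * f x) = a * integral_rV f.
Proof. by move=> /test_ccont [A cf]; exact: intZ cf. Qed.

Lemma int_test_lin (a : R) f g : test_fun setT f -> test_fun setT g ->
  integral_rV (fun x => a * f x + g x) = a * integral_rV f + integral_rV g.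
Proof. by move=> tf tg; rewrite (test_intD (testZ a tf) tg) intZ_test. Qed.

Section Diffop.
Variable L : diffop R N.

Lemma diffop_fun_smooth U phi : open U -> smooth_on U phi -> smooth_on U (diffop_fun L phi).
Proof.
move=> oU s; apply: (smooth_sum oU) => k.
exact: (smoothM oU (smooth_sub (@subsetT _ U) (diffop_smooth k)) (smooth_partials _ s)).
Qed.

Lemma diffop_fun_test U phi : test_fun U phi -> test_fun U (diffop_fun L phi).
Proof. by move=> t; apply: test_sum => k; exact: (testM (diffop_smooth k) (test_partials _ t)). Qed.

Lemma diffop_tr_test U phi : test_fun U phi -> test_fun U (diffop_tr_fun L phi).
Proof.
move=> t; apply: test_sum => k; apply: testZ; apply: test_partials.
exact: (testM (diffop_smooth k) t).
Qed.

Lemma diffop_tr_smooth U phi : open U -> smooth_on U phi -> smooth_on U (diffop_tr_fun L phi).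
Proof.
move=> oU s; apply: (smooth_sum oU) => k; apply: (smoothZ oU); apply: smooth_partials.
exact: (smoothM oU (smooth_sub (@subsetT _ U) (diffop_smooth k)) s).
Qed.

Lemma diffop_fun_local U phi psi : open U -> (forall y, U y -> phi y = psi y) ->
  forall y, U y -> diffop_fun L phi y = diffop_fun L psi y.
Proof.
move=> oU e y Uy; apply: eq_bigr => k _; congr (_ * _).
exact: eq_on_partials oU e y Uy.
Qed.

Lemma diffop_tr_local U phi psi : open U -> (forall y, U y -> phi y = psi y) ->
  forall y, U y -> diffop_tr_fun L phi y = diffop_tr_fun L psi y.
Proof.
move=> oU e y Uy; apply: eq_bigr => k _; congr (_ * _).
by apply: eq_on_partials oU _ y Uy => z Uz; rewrite e.
Qed.

Lemma pd_lin i (a : R) phi psi : smooth_on setT phi -> smooth_on setT psi ->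
  pd i (fun x => a * phi x + psi x) = fun x => a * pd i phi x + pd i psi x.
Proof.
move=> sp sq; apply/funext => x.
have d1 := smooth_derivable (i := i) sp (I : setT x); have d2 := smooth_derivable (i := i) sq (I : setT x).
rewrite [LHS](deriveD (derivableZ (k := a) d1) d2); congr (_ + _).
exact: (deriveZ a d1).
Qed.

Lemma partials_lin l (a : R) phi psi : smooth_on setT phi -> smooth_on setT psi ->
  partials l (fun x => a * phi x + psi x) = fun x => a * partials l phi x + partials l psi x.
Proof.
move=> sp sq; elim: l => //= i l ->.
by rewrite (pd_lin i a (smooth_partials l sp) (smooth_partials l sq)).
Qed.

Lemma diffop_tr_lin (a : R) phi psi : smooth_on setT phi -> smooth_on setT psi ->
  diffop_tr_fun L (fun x => a * phi x + psi x) =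
  fun x => a * diffop_tr_fun L phi x + diffop_tr_fun L psi x.
Proof.
move=> sp sq; apply/funext => x; rewrite /diffop_tr_fun mulr_sumr -big_split /=.
apply: eq_bigr => k _.
rewrite (_ : (fun y => diffop_coef k y * _) =
  fun y => a * (diffop_coef k y * phi y) + diffop_coef k y * psi y); last first.
  by apply/funext => y; rewrite mulrDr mulrCA.
have s1 := smoothM openT (diffop_smooth k) sp; have s2 := smoothM openT (diffop_smooth k) sq.
by rewrite (partials_lin _ a s1 s2) mulrDr mulrCA.
Qed.

Lemma diffop_tr_int g phi : smooth_on setT g -> test_fun setT phi ->
  integral_rV (fun x => g x * diffop_tr_fun L phi x) = integral_rV (fun x => diffop_fun L g x * phi x).
Proof.
move=> sg tp.
have ta k := testM (diffop_smooth (d := L) k) tp.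
transitivity (\sum_k integral_rV (fun x => (-1) ^+ size (diffop_word k) *
    (g x * partials (diffop_word (d := L) k) (fun y => diffop_coef k y * phi y) x))).
  rewrite -int_sum_test; last by move=> k; apply: testZ; exact: (testM sg (test_partials _ (ta k))).
  congr integral_rV; apply/funext => x; rewrite mulr_sumr; apply: eq_bigr => k _.
  by rewrite mulrCA.
transitivity (\sum_k integral_rV (fun x => diffop_coef k x * partials (diffop_word (d := L) k) g x * phi x)).
  apply: eq_bigr => k _; rewrite intZ_test; last exact: (testM sg (test_partials _ (ta k))).
  rewrite -(int_by_parts_word _ sg (ta k)); congr integral_rV; apply/funext => x.
  by rewrite mulrA (mulrC (partials _ _ _)).
rewrite -int_sum_test; last first.
  by move=> k; apply: testM tp; exact: (smoothM openT (diffop_smooth k) (smooth_partials _ sg)).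
by congr integral_rV; apply/funext => x; rewrite mulr_suml.
Qed.

End Diffop.

Section Distributions.
Variables (U : set V) (T : @prefunctional R N).
Hypothesis dT : is_distribution U T.

Lemma dist_lin (a : R) phi psi : test_fun U phi -> test_fun U psi ->
  T (fun x => a * phi x + psi x) = a * T phi + T psi.
Proof. by case: dT => + _; exact. Qed.

Lemma distB phi psi : test_fun U phi -> test_fun U psi -> T (fun x => phi x - psi x) = T phi - T psi.
Proof.
move=> t1 t2; have := dist_lin (-1) t2 t1; under eq_fun do rewrite mulN1r addrC.
by rewrite mulN1r addrC.
Qed.

End Distributions.

Lemma dirac_distribution U (x : V) : is_distribution U (fun phi => phi x).
Proof.
split=> // K _ _; exists 1, 0%N => phi M _ _ h; rewrite mul1r.
exact: (h [::] x).
Qed.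

Lemma ccont_mul_test f phi : continuous f -> test_fun setT phi ->
  exists A, ccont A (fun x => f x * phi x).
Proof. by move=> cf /test_ccont [A cp]; exists A; exact: ccontM. Qed.

Lemma dist_of_lin f (a : R) phi psi : continuous f -> test_fun setT phi -> test_fun setT psi ->
  dist_of f (fun x => a * phi x + psi x) = a * dist_of f phi + dist_of f psi.
Proof.
move=> cf /test_ccont [A cp] /test_ccont [B cq].
have A0 : 0 < A by case: cp. have B0 : 0 < B by case: cq.
have AB : A <= A + B by rewrite lerDl ltW.
have BA : B <= A + B by rewrite lerDr ltW.
rewrite /dist_of -(int_lin a (ccontM cf (ccont_widen AB cp)) (ccontM cf (ccont_widen BA cq))).
by congr integral_rV; apply/funext => x; rewrite mulrDr mulrCA.
Qed.

Lemma continuous_bounded_ball f (A : R) : continuous f -> exists2 M : R, 0 <= M & forall x, `|x| <= A -> `|f x| <= M.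
Proof.
move=> cf; have cK := @closed_ball0_compact R N A.
have := continuous_compact (continuous_subspaceT cf) cK.
move=> /compact_bounded [M [_ hM]]; exists (`|M| + 1); first by rewrite addr_ge0.
move=> x xA; apply: (hM (`|M| + 1)); first by rewrite (le_lt_trans (ler_norm M)) // ltrDl.
by exists x.
Qed.

(* Localize with a finite family of bumps. *)
Lemma support_vanish (T : @prefunctional R N) (O : set V) phi :
  (forall (a : R) phi psi, test_fun setT phi -> test_fun setT psi ->
     T (fun x => a * phi x + psi x) = a * T phi + T psi) ->
  open O -> dist_support T `<=` O -> test_fun setT phi -> (forall x, O x -> phi x = 0) ->
  T phi = 0.
Proof.
move=> lin oO sO tp zO; have [A [A0 cc z]] := test_ccont tp.
have T0 : T (fun=> 0) = 0.
  have := lin 1 _ _ (test0 setT) (test0 setT); rewrite (_ : (fun x => _) = fun=> 0); first by lra.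
  by apply/funext => x; rewrite mulr0 addr0.
pose K := [set x : V | `|x| <= A] `&` ~` O.
have cK : compact K.
  by apply: compact_closedI; [exact: closed_ball0_compact|exact: open_closedC].
have loc x : exists r : R, K x -> 0 < r /\ (forall psi, test_fun setT psi ->
    T (fun y => psi y * bump x r y) = 0).
  have [Kx|nKx] := pselect (K x); last by exists 0 => /nKx.
  have : ~ dist_support T x by move/sO; case: Kx.
  move=> /contrapT [U [oU Ux hU]].
  have /nbhs_ballP [r /= r0 hr] : nbhs x U by apply: open_nbhs_nbhs.
  exists (r / 4) => _; have r4 : 0 < r / 4 by rewrite divr_gt0.
  split=> // psi tpsi; apply: hU; apply: (testM (test_smooth tpsi)); apply: bump_test => // y hy.
  apply: hr; rewrite -ball_normE /= distrC; lra.
have [r hr] := choice loc.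
have [s sK cov] := ball_cover cK (fun x Kx => (hr x Kx).1).
(* A factor 1 - bump does not change the value of T, because T vanishes on psi times the bump. With
   all bumps of the cover, nothing is left of phi: on K some factor is 0, and off K phi itself is
   0. *)
have step : forall (t : seq V) psi, (forall x, x \in t -> K x) -> test_fun setT psi ->
    T psi = T (fun y => psi y * \prod_(x <- t) (1 - bump x (r x) y)).
  elim=> [|x t IH] psi tK tpsi.
    by congr T; apply/funext => y; rewrite big_nil mulr1.
  have tx : K x by apply: tK; rewrite mem_head.
  have tb : test_fun setT (fun y => psi y * bump x (r x) y).
    by apply: (testM (test_smooth tpsi)); apply: bump_test => //; case: (hr x tx).
  rewrite (_ : (fun y => _) = fun y => (fun y => -1 * (psi y * bump x (r x) y) + psi y) y *
      \prod_(x <- t) (1 - bump x (r x) y)); last first.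
    by apply/funext => y /=; rewrite big_cons mulrA; congr (_ * _); ring.
  rewrite -IH; first by rewrite (lin _ _ _ tb tpsi) (hr x tx).2 // mulr0 add0r.
    by move=> y yt; apply: tK; rewrite inE yt orbT.
  exact: (test_lin (-1) tb tpsi).
rewrite (step s) // (_ : (fun y => _) = fun=> 0) //.
apply/funext => y; have [Ky|nKy] := pselect (K y).
  have [x xs xy] := cov y Ky.
  rewrite (big_rem x) //= bump_eq1 ?subrr ?mul0r ?mulr0 //; first by case: (hr x (sK x xs)).
  by rewrite distrC ltW.
have [Oy|nOy] := pselect (O y); first by rewrite zO // mul0r.
rewrite z ?mul0r // leNgt; apply/negP => /ltW yA; exact: nKy.
Qed.

End Operators.

(** * The group law and its dilations *)

Section DeriveRow.
Context {R : realType}.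

Lemma rVD n (u v : 'rV[R]_n) j : (u + v) ord0 j = u ord0 j + v ord0 j.
Proof. by rewrite mxE. Qed.

Lemma rVZ n c (v : 'rV[R]_n) j : (c *: v) ord0 j = c * v ord0 j.
Proof. by rewrite mxE. Qed.

Lemma rVN n (v : 'rV[R]_n) j : (- v) ord0 j = - v ord0 j.
Proof. by rewrite mxE. Qed.

Lemma is_derive_rV (W : normedModType R) n (F : W -> 'rV[R]_n) (w v : W) (d : 'rV[R]_n) :
  (forall j, is_derive w v (fun s => F s ord0 j) (d ord0 j)) -> is_derive w v F d.
Proof.
move=> h; have dF : derivable F w v by apply/derivable_mxP => i j; rewrite (ord1 i); case: (h j).
split=> //; rewrite derive_mx //; apply/rowP => j; rewrite mxE.
by case: (h j).
Qed.

Lemma is_derive_coord (W : normedModType R) n (F : W -> 'rV[R]_n) (w v : W) (d : 'rV[R]_n) j :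
  is_derive w v F d -> is_derive w v (fun s => F s ord0 j) (d ord0 j).
Proof.
move=> [dF <-]; rewrite derive_mx // mxE; apply: derivableP.
by move/derivable_mxP: dF; exact.
Qed.

Lemma is_derive_sumf (V W : normedModType R) (I : finType) (F : I -> W -> V) (w v : W) (d : I -> V) :
  (forall k, is_derive w v (F k) (d k)) -> is_derive w v (fun s => \sum_k F k s) (\sum_k d k).
Proof.
move=> h; elim: (index_enum I) => [|k r IH].
  rewrite big_nil (_ : (fun s => _) = cst 0); first exact: is_derive_cst.
  by apply/funext => s; rewrite big_nil.
rewrite big_cons (_ : (fun s => _) = F k + (fun s => \sum_(i <- r) F i s)).
  exact: is_deriveD.
by apply/funext => s; rewrite big_cons.
Qed.

Lemma is_derive_mulf (W : normedModType R) (f g : W -> R) (w v : W) (a b : R) :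
  is_derive w v f a -> is_derive w v g b -> is_derive w v (fun s => f s * g s) (a * g w + f w * b).
Proof.
move=> h1 h2; apply: (is_derive_eq (is_deriveM h1 h2)).
by rewrite /GRing.scale /= addrC (mulrC (g w)).
Qed.

Lemma is_derive_scale (W : normedModType R) (x : W) (t : R) :
  is_derive t 1 (fun s : R => s *: x) x.
Proof.
have d : differentiable (fun s : R => s *: x) t by exact: differentiableZl.
split; first exact/derivable1_diffP.
rewrite deriveE // diffZl // -deriveE // ?derive_id ?scale1r //; exact/derivable1_diffP.
Qed.

Lemma derive0_const (W : normedModType R) n (f : R -> 'rV[R]_n) :
  (forall s : R, is_derive s 1 f 0) -> forall s, f s = f 0.
Proof.
move=> h s; apply/rowP => j.
have d (u : R) : is_derive u 1 (fun s => f s ord0 j) (0 : R).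
  by have := is_derive_coord j (h u); rewrite mxE.
have [u _] := @MVT_line R R (fun s => f s ord0 j) 0 1 s (fun u _ => @ex_derive _ _ _ _ _ _ _ (d _)).
rewrite derive_val mulr0 => /eqP; rewrite subr_eq0 => /eqP.
by rewrite add0r [_ *: _]mulr1.
Qed.

Lemma is_derive_from0 (W : normedModType R) (f : R -> W) (s : R) (d : W) :
  is_derive (0 : R) (1 : R) (fun h => f (s + h)) d -> is_derive s (1 : R) f d.
Proof.
have E : (fun h : R => h^-1 *: (((fun h => f (s + h)) \o shift 0) (h *: 1) - f (s + 0)))
   = (fun h : R => h^-1 *: ((f \o shift s) (h *: 1) - f s)).
  by apply/funext => h /=; rewrite !addr0 (addrC s).
by move=> [] ; rewrite /derivable /derive E => h1 h2; split.
Qed.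

Lemma is_derive_to0 (W : normedModType R) (f : R -> W) (s : R) (d : W) :
  is_derive s (1 : R) f d -> is_derive (0 : R) (1 : R) (fun h => f (s + h)) d.
Proof.
have E : (fun h : R => h^-1 *: (((fun h => f (s + h)) \o shift 0) (h *: 1) - f (s + 0)))
   = (fun h : R => h^-1 *: ((f \o shift s) (h *: 1) - f s)).
  by apply/funext => h /=; rewrite !addr0 (addrC s).
by move=> [h1 h2]; split; rewrite /derivable /derive E.
Qed.

End DeriveRow.

(** * One-parameter subgroups, conjugation and the bracket *)

Section GroupLaw.
Context {R : realType} {N : nat} (G : carnot R N).
Local Notation V := 'rV[R]_N.
Local Notation mul := (carnot_mul G).
Local Notation deg := (carnot_deg G).
Implicit Types (x y z u v p q : V).

Definition mulc (j : 'I_N) (z : 'rV[R]_(N + N)) : R := mul (lsubmx z) (rsubmx z) ord0 j.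

Lemma mulcE j x y : mulc j (row_mx x y) = mul x y ord0 j.
Proof. by rewrite /mulc row_mxKl row_mxKr. Qed.

Lemma mulc_smooth j : smooth_on setT (mulc j).
Proof. exact: carnot_smooth. Qed.

Lemma pair_is_derive (W : normedModType R) (g : 'rV[R]_(N + N) -> R) (a b : W -> V) (w v : W) (a' b' : V) :
  smooth_on setT g -> is_derive w v a a' -> is_derive w v b b' ->
  is_derive w v (fun s => g (row_mx (a s) (b s)))
    (\sum_k a' ord0 k * 'D_(evec (lshift N k)) g (row_mx (a w) (b w)) +
     \sum_k b' ord0 k * 'D_(evec (rshift N k)) g (row_mx (a w) (b w))).
Proof.
move=> sg da db.
have dl k : is_derive w v (fun s => row_mx (a s) (b s) ord0 (lshift N k)) (a' ord0 k).
  rewrite (_ : (fun s => _) = fun s => a s ord0 k); first exact: is_derive_coord.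
  by apply/funext => s; rewrite row_mxEl.
have dr k : is_derive w v (fun s => row_mx (a s) (b s) ord0 (rshift N k)) (b' ord0 k).
  rewrite (_ : (fun s => _) = fun s => b s ord0 k); first exact: is_derive_coord.
  by apply/funext => s; rewrite row_mxEr.
have dc j : derivable (fun s => row_mx (a s) (b s) ord0 j) w v.
  by case: (split_ordP j) => k ->; [case: (dl k)|case: (dr k)].
have H := chain_rV dc (smooth_diff openT sg I).
apply: (is_derive_eq H); rewrite big_split_ord; congr (_ + _); apply: eq_bigr => k _.
  by case: (dl k) => _ ->.
by case: (dr k) => _ ->.
Qed.

(** Partial differentials of the product at (p, q): [dR p q] is the differential at p of the right
    translation by q, and [dL p q] the differential at q of the left translation by p. *)
Definition dR p q v : V := \row_j \sum_k v ord0 k * 'D_(evec (lshift N k)) (mulc j) (row_mx p q).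
Definition dL p q v : V := \row_j \sum_k v ord0 k * 'D_(evec (rshift N k)) (mulc j) (row_mx p q).

Lemma mul_is_derive (W : normedModType R) (a b : W -> V) (w v : W) (a' b' : V) :
  is_derive w v a a' -> is_derive w v b b' ->
  is_derive w v (fun s => mul (a s) (b s)) (dR (a w) (b w) a' + dL (a w) (b w) b').
Proof.
move=> da db; apply: is_derive_rV => j; rewrite rVD [X in X + _]mxE [X in _ + X]mxE.
rewrite (_ : (fun s => _) = fun s => mulc j (row_mx (a s) (b s))).
  exact: pair_is_derive (mulc_smooth j) da db.
by apply/funext => s; rewrite mulcE.
Qed.

Lemma dR_lin p q (c : R) u v : dR p q (c *: u + v) = c *: dR p q u + dR p q v.
Proof.
apply/rowP => j; rewrite !mxE mulr_sumr -big_split /=; apply: eq_bigr => k _.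
by rewrite !mxE mulrDl mulrA.
Qed.

Lemma dL_lin p q (c : R) u v : dL p q (c *: u + v) = c *: dL p q u + dL p q v.
Proof.
apply/rowP => j; rewrite !mxE mulr_sumr -big_split /=; apply: eq_bigr => k _.
by rewrite !mxE mulrDl mulrA.
Qed.

Lemma dR0 p q : dR p q 0 = 0.
Proof. by apply/rowP => j; rewrite !mxE big1 // => k _; rewrite mxE mul0r. Qed.

Lemma dL0 p q : dL p q 0 = 0.
Proof. by apply/rowP => j; rewrite !mxE big1 // => k _; rewrite mxE mul0r. Qed.

Lemma pd_lp k j p : 'D_(evec (lshift N k)) (mulc j) (row_mx p 0) = (k == j)%:R.
Proof.
have := pair_is_derive (mulc_smooth j) (is_derive_id p (evec k : V)) (is_derive_cst (0 : V) p (evec k : V)).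
rewrite (_ : (fun s => _) = fun s : V => s ord0 j); last first.
  by apply/funext => s; rewrite mulcE carnot_mulx0.
move=> [_]; have [_ ->] := derive_coord j p (evec k).
rewrite evecE => ->; rewrite [X in _ + X]big1 ?addr0; last by move=> i _; rewrite mxE mul0r.
rewrite (bigD1 k) //= evecE eqxx mul1r big1 ?addr0 // => i ik.
by rewrite evecE eq_sym (negbTE ik) mul0r.
Qed.

Lemma pd_rq k j q : 'D_(evec (rshift N k)) (mulc j) (row_mx 0 q) = (k == j)%:R.
Proof.
have := pair_is_derive (mulc_smooth j) (is_derive_cst (0 : V) q (evec k : V)) (is_derive_id q (evec k : V)).
rewrite (_ : (fun s => _) = fun s : V => s ord0 j); last first.
  by apply/funext => s; rewrite mulcE carnot_mul0x.
move=> [_]; have [_ ->] := derive_coord j q (evec k).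
rewrite evecE => ->; rewrite [X in X + _]big1 ?add0r; last by move=> i _; rewrite mxE mul0r.
rewrite (bigD1 k) //= evecE eqxx mul1r big1 ?addr0 // => i ik.
by rewrite evecE eq_sym (negbTE ik) mul0r.
Qed.

Lemma sum_delta (a : 'I_N -> R) j : \sum_k a k * (k == j)%:R = a j.
Proof.
rewrite (bigD1 j) //= eqxx mulr1 big1 ?addr0 // => i /negbTE ->.
by rewrite mulr0.
Qed.

Lemma dR_p0 p v : dR p 0 v = v.
Proof. by apply/rowP => j; rewrite mxE; under eq_bigr do rewrite pd_lp; rewrite sum_delta. Qed.

Lemma dL_0q q v : dL 0 q v = v.
Proof. by apply/rowP => j; rewrite mxE; under eq_bigr do rewrite pd_rq; rewrite sum_delta. Qed.

Lemma left_inv_fieldE v x : left_inv_field mul v x = dL x 0 v.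
Proof.
have [_] := mul_is_derive (is_derive_cst x (0 : V) v) (is_derive_id (0 : V) v).
by rewrite /left_inv_field => ->; rewrite dR0 add0r.
Qed.

(* Opaque witnesses: otherwise unification unfolds the derivatives. *)
Lemma bc_witness : {b : 'I_N -> 'I_N -> 'I_N -> R | forall i k j,
  b i k j = 'D_(evec (lshift N i)) ('D_(evec (rshift N k)) (mulc j)) (row_mx 0 0)}.
Proof. by eexists. Qed.

(** Coefficients of the bilinear term of the product at the origin; antisymmetrized, they are the
    structure constants [cst_str]. *)
Definition bc := sval bc_witness.

Lemma bcE i k j : bc i k j = 'D_(evec (lshift N i)) ('D_(evec (rshift N k)) (mulc j)) (row_mx 0 0).
Proof. exact: (svalP bc_witness). Qed.

Lemma is_derive_dL0 (W : normedModType R) (a : W -> V) (w v : W) (a' u : V) : a w = 0 ->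
  is_derive w v a a' ->
  is_derive w v (fun s => dL (a s) 0 u) (\row_j \sum_i \sum_k a' ord0 i * u ord0 k * bc i k j).
Proof.
move=> a0 da; apply: is_derive_rV => j; rewrite mxE.
rewrite (_ : (fun s => _) = fun s => \sum_k u ord0 k * 'D_(evec (rshift N k)) (mulc j) (row_mx (a s) 0));
  last by apply/funext => s; rewrite mxE.
rewrite exchange_big /=; apply: is_derive_sumf => k.
have := is_derive_mulf (is_derive_cst (u ord0 k) w v)
  (pair_is_derive (smooth_pd (rshift N k) (mulc_smooth j)) da (is_derive_cst (0 : V) w v)).
move=> H; apply: (is_derive_eq H).
rewrite mul0r add0r /= [X in _ + X]big1 ?addr0; last by move=> i _; rewrite mxE mul0r.
by rewrite mulr_sumr; apply: eq_bigr => i _; rewrite a0 bcE mulrA (mulrC (u ord0 k)).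
Qed.

Definition cst_str i k j : R := bc i k j - bc k i j.

Lemma lieE x u j : lie mul x u ord0 j = \sum_i \sum_k x ord0 i * u ord0 k * cst_str i k j.
Proof.
have F (a : V) : left_inv_field mul a = fun p => dL p 0 a by apply/funext => p; exact: left_inv_fieldE.
rewrite /lie !F.
have [_ ->] := is_derive_dL0 u (erefl : @id V 0 = 0) (is_derive_id (0 : V) x).
have [_ ->] := is_derive_dL0 x (erefl : @id V 0 = 0) (is_derive_id (0 : V) u).
rewrite rVD rVN [X in X - _]mxE [X in _ - X]mxE.
have -> : \sum_i \sum_k u ord0 i * x ord0 k * bc i k j = \sum_i \sum_k x ord0 i * u ord0 k * bc k i j.
  rewrite exchange_big; apply: eq_bigr => i _; apply: eq_bigr => k _; by rewrite (mulrC (u ord0 k)).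
rewrite -sumrB; apply: eq_bigr => i _; rewrite -sumrB; apply: eq_bigr => k _.
by rewrite /cst_str mulrBr.
Qed.

Lemma brk_witness : {b : V -> V -> V | forall x u, b x u = lie mul x u}.
Proof. by exists (lie mul). Qed.

Definition brk := sval brk_witness.

Lemma lie_brk x u : lie mul x u = brk x u.
Proof. by rewrite /brk (svalP brk_witness). Qed.

Lemma brkE x u j : brk x u ord0 j = \sum_i \sum_k x ord0 i * u ord0 k * cst_str i k j.
Proof. by rewrite -lie_brk lieE. Qed.

Lemma brk_lin_l (c : R) x y u : brk (c *: x + y) u = c *: brk x u + brk y u.
Proof.
apply/rowP => j; rewrite rVD rVZ !brkE mulr_sumr -big_split; apply: eq_bigr => i _.
rewrite mulr_sumr -big_split; apply: eq_bigr => k _ /=; rewrite rVD rVZ; ring.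
Qed.

Lemma brk_lin_r (c : R) x u v : brk x (c *: u + v) = c *: brk x u + brk x v.
Proof.
apply/rowP => j; rewrite rVD rVZ !brkE mulr_sumr -big_split; apply: eq_bigr => i _.
rewrite mulr_sumr -big_split; apply: eq_bigr => k _ /=; rewrite rVD rVZ; ring.
Qed.

Lemma brk_l0 u : brk 0 u = 0.
Proof. by have := brk_lin_l (-1) 0 0 u; rewrite scaler0 addr0 scaleN1r addNr. Qed.

Lemma brk_r0 u : brk u 0 = 0.
Proof. by have := brk_lin_r (-1) u 0 0; rewrite scaler0 addr0 scaleN1r addNr. Qed.

Lemma brk_is_derive (a b : R -> V) (t : R) a' b' : is_derive t 1 a a' -> is_derive t 1 b b' ->
  is_derive t 1 (fun s => brk (a s) (b s)) (brk a' (b t) + brk (a t) b').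
Proof.
move=> da db; apply: is_derive_rV => j; rewrite rVD !brkE.
rewrite (_ : (fun s => _) = fun s => \sum_i \sum_k a s ord0 i * b s ord0 k * cst_str i k j);
  last by apply/funext => s; rewrite brkE.
rewrite -big_split /=; apply: is_derive_sumf => i.
rewrite -big_split /=; apply: is_derive_sumf => k.
have := is_derive_mulf (is_derive_mulf (is_derive_coord i da) (is_derive_coord k db)) (is_derive_cst (cst_str i k j)
  t (1 : R)).
by move=> H; apply: (is_derive_eq H); rewrite /=; ring.
Qed.

Lemma mulNx x : mul (- x) x = 0.
Proof. by have := carnot_exp G (-1) 1 x; rewrite addNr scale0r scaleN1r scale1r. Qed.

Lemma mulxN x : mul x (- x) = 0.
Proof. by have := carnot_exp G 1 (-1) x; rewrite subrr scale0r scaleN1r scale1r. Qed.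

Lemma mulKx x y : mul (- x) (mul x y) = y.
Proof. by rewrite carnot_mulA mulNx carnot_mul0x. Qed.

Lemma mulxK x y : mul x (mul (- x) y) = y.
Proof. by rewrite carnot_mulA mulxN carnot_mul0x. Qed.

Lemma mulKr x y : mul (mul y x) (- x) = y.
Proof. by rewrite -carnot_mulA mulxN carnot_mulx0. Qed.

Lemma inv_uniq x y : mul x y = 0 -> y = - x.
Proof. by move=> h; rewrite -(mulKx x y) h carnot_mulx0. Qed.

Lemma oppM x y : - mul x y = mul (- y) (- x).
Proof.
apply/esym/inv_uniq; rewrite carnot_mulA -(carnot_mulA G x y) mulxN carnot_mulx0.
exact: mulxN.
Qed.

Lemma mul_curves0 (a b : R -> V) a' b' : a 0 = 0 -> b 0 = 0 ->
  is_derive (0 : R) (1 : R) a a' -> is_derive (0 : R) (1 : R) b b' ->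
  is_derive (0 : R) (1 : R) (fun s => mul (a s) (b s)) (a' + b').
Proof.
move=> a0 b0 da db; have := mul_is_derive da db; rewrite a0 b0.
by rewrite dR_p0 dL_0q.
Qed.

(** A curve with constant left logarithmic derivative y is a left translate of s |-> exp (s y), exp
    being the identity here: the product of g s and - (s y) has zero derivative. *)
Lemma one_parameter (g : R -> V) y :
  (forall s, is_derive (0 : R) (1 : R) (fun e => mul (- g s) (g (s + e))) y) ->
  forall s, g s = mul (g 0) (s *: y).
Proof.
move=> h s.
pose P s := mul (g s) (- (s *: y)).
have dP (t : R) : is_derive t 1 P 0.
  apply: is_derive_from0.
  (* Written so that the two inner factors pass through 0 at e = 0 with velocities y and - y, which
     cancel. *)
  rewrite (_ : (fun e => _) = fun e => mul (g t)
      (mul (mul (mul (- g t) (g (t + e))) (e *: - y)) (- (t *: y)))); last first.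
    apply/funext => e; rewrite /P -!carnot_mulA mulxK; congr mul.
    by rewrite -!scalerN carnot_exp addrC.
  have c0 : mul (- g t) (g (t + 0)) = 0 by rewrite addr0 mulNx.
  have d1 := mul_curves0 c0 (scale0r _) (h t) (is_derive_scale (- y) 0).
  rewrite subrr in d1.
  have d2 := mul_is_derive d1 (is_derive_cst (- (t *: y)) (0 : R) (1 : R)).
  rewrite dR0 dL0 addr0 in d2.
  have d3 := mul_is_derive (is_derive_cst (g t) (0 : R) (1 : R)) d2.
  by rewrite dR0 dL0 addr0 in d3.
have := derive0_const V dP s; rewrite /P scale0r oppr0 carnot_mulx0 => <-.
by rewrite -carnot_mulA mulNx carnot_mulx0.
Qed.

Definition conj x y := mul (mul x y) (- x).
Definition Ad x u := dR x (- x) (dL x 0 u).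

Lemma Ad_lin x (c : R) u v : Ad x (c *: u + v) = c *: Ad x u + Ad x v.
Proof. by rewrite /Ad dL_lin dR_lin. Qed.

Lemma conj_curve x (a : R -> V) a' : a 0 = 0 -> is_derive (0 : R) (1 : R) a a' ->
  is_derive (0 : R) (1 : R) (fun e => conj x (a e)) (Ad x a').
Proof.
move=> a0 da.
have d1 := mul_is_derive (is_derive_cst x (0 : R) (1 : R)) da.
have d2 := mul_is_derive d1 (is_derive_cst (- x) (0 : R) (1 : R)).
by move: d2; rewrite dL0 addr0 dR0 add0r a0 /= carnot_mulx0.
Qed.

Lemma conjM x y z : conj x (mul y z) = mul (conj x y) (conj x z).
Proof. by rewrite /conj -!carnot_mulA mulKx. Qed.

Lemma conj0 x : conj x 0 = 0.
Proof. by rewrite /conj carnot_mulx0 mulxN. Qed.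

Lemma conjN x y : conj x (- y) = - conj x y.
Proof. by apply: inv_uniq; rewrite -conjM mulxN conj0. Qed.

(** Conjugation by x carries s |-> s y to a one-parameter subgroup of velocity [Ad x y]; in
    exponential coordinates conjugation is therefore linear. *)
Lemma conjE x y : conj x y = Ad x y.
Proof.
have := @one_parameter (fun s => conj x (s *: y)) (Ad x y) _ 1.
rewrite scale0r conj0 carnot_mul0x !scale1r; apply=> s.
rewrite (_ : (fun e => _) = fun e => conj x (e *: y)).
  apply: conj_curve; [exact: scale0r|exact: is_derive_scale].
apply/funext => e; rewrite -conjN -conjM -scaleNr carnot_exp.
by congr (conj x (_ *: _)); ring.
Qed.

Lemma conj_comp x y z : conj (mul x y) z = conj x (conj y z).
Proof. by rewrite /conj oppM !carnot_mulA. Qed.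

Lemma AdM x y u : Ad (mul x y) u = Ad x (Ad y u).
Proof. by rewrite -!conjE conj_comp. Qed.

Lemma pd_ll0 i k j : 'D_(evec (lshift N i)) ('D_(evec (lshift N k)) (mulc j)) (row_mx 0 0) = 0.
Proof.
have := pair_is_derive (smooth_pd (lshift N k) (mulc_smooth j)) (is_derive_id (0 : V) (evec i : V)) (is_derive_cst (0
  : V) (0 : V) (evec i : V)).
rewrite (_ : (fun s => _) = cst ((k == j)%:R)); last by apply/funext => s; exact: pd_lp.
move=> [_]; rewrite derive_cst => /esym; rewrite [X in _ + X]big1 ?addr0; last by move=> l _; rewrite mxE mul0r.
rewrite (bigD1 i) //= evecE eqxx mul1r big1 ?addr0 // => l li.
by rewrite evecE eq_sym (negbTE li) mul0r.
Qed.

(** The base point h x in [dL] contributes [bc]; the inverse - (h x) in [dR] contributes - [bc] with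
    its first two indices exchanged, by Schwarz. The pure second derivatives in the first variable
    vanish at the origin since p 0 = p. *)
Lemma Ad_is_derive x u : is_derive (0 : R) (1 : R) (fun h => Ad (h *: x) u) (brk x u).
Proof.
have d1 := is_derive_scale x 0.
have d2 : is_derive (0 : R) (1 : R) (fun h : R => - (h *: x)) (- x).
  by rewrite (_ : (fun h => _) = fun h : R => h *: - x); [exact: is_derive_scale|apply/funext => h; rewrite scalerN].
apply: is_derive_rV => j.
rewrite (_ : (fun h => _) = fun h : R => \sum_k dL (h *: x) 0 u ord0 k *
  'D_(evec (lshift N k)) (mulc j) (row_mx (h *: x) (- (h *: x)))); last by apply/funext => h; rewrite mxE.
have d3 k := is_derive_mulf (is_derive_coord k (is_derive_dL0 (a := fun h : R => h *: x) u (scale0r x) d1))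
   (pair_is_derive (smooth_pd (lshift N k) (mulc_smooth j)) d1 d2).
have := is_derive_sumf d3; move=> H; apply: (is_derive_eq H).
rewrite scale0r oppr0 brkE big_split /=.
under eq_bigr do rewrite pd_lp mxE.
rewrite sum_delta dL_0q.
under [X in _ + X]eq_bigr => k _.
  rewrite [X in _ * (X + _)]big1; last by move=> i _; rewrite pd_ll0 mulr0.
  rewrite add0r.
  under eq_bigr => i _ do rewrite rVN (smooth_schwarz (rshift N i) (lshift N k) openT (mulc_smooth j) I) -(bcE k i j).
  over.
rewrite [X in X + _](_ : _ = \sum_i \sum_k x ord0 i * u ord0 k * bc i k j) //.
rewrite [X in _ + X](_ : _ = \sum_i \sum_k - (x ord0 i * u ord0 k * bc k i j)).
  by rewrite -big_split; apply: eq_bigr => i _; rewrite -big_split; apply: eq_bigr => k _; rewrite /cst_str /=; ring.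
rewrite exchange_big /=; apply: eq_bigr => k _; rewrite mulr_sumr; apply: eq_bigr => i _; ring.
Qed.

Lemma is_derive_uniq (W : normedModType R) (f : R -> W) (t : R) d d' :
  is_derive t 1 f d -> is_derive t 1 f d' -> d = d'.
Proof. by move=> [_ <-] [_ <-]. Qed.

Lemma is_derive_Nscale (W : normedModType R) (f : R -> W) d :
  is_derive (0 : R) (1 : R) f d -> is_derive (0 : R) (1 : R) (fun h => f (- h)) (- d).
Proof.
move=> df.
have df' : differentiable f (- 0) by rewrite oppr0; apply/derivable1_diffP; case: df.
have dN : derivable (fun h : R => - h) 0 1 by exact: derivable_opp.
apply: (is_derive_eq (is_derive_comp_diff dN df')).
have -> : 'D_1 (fun h : R => - h) 0 = -1 by rewrite derive_val.
by rewrite linearN /= oppr0 -deriveE; [case: df => _ ->|rewrite oppr0 in df'].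
Qed.

End GroupLaw.

(** * The dilations are automorphisms *)

Section Grading.
Context {R : realType} {N : nat} (G : carnot R N).
Local Notation V := 'rV[R]_N.
Local Notation mul := (carnot_mul G).
Local Notation deg := (carnot_deg G).
Local Notation brk := (brk G).
Local Notation Ad := (Ad G).
Implicit Types (x y z u v p q : V).

Lemma rV_linear_derive (W : normedModType R) (A : {linear V -> W}) (f : R -> V) (t : R) (d : V) :
  is_derive t 1 f d -> is_derive t 1 (fun s => A (f s)) (A d).
Proof.
move=> df.
have -> : (fun s => A (f s)) = fun s => \sum_j f s ord0 j *: A (evec j).
  apply/funext => s; rewrite {1}[f s]rV_sum_evec linear_sum; apply: eq_bigr => j _.
  exact: linearZ.
have -> : A d = \sum_j d ord0 j *: A (evec j).
  rewrite {1}[d]rV_sum_evec linear_sum; apply: eq_bigr => j _; exact: linearZ.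
apply: is_derive_sumf => j.
have := is_derive_comp_diff (@ex_derive _ _ _ _ _ _ _ (is_derive_coord j df))
   (differentiable_comp (@linear_differentiable _ _ _ (@idfun R) (f t ord0 j) (fun _ => cvg_id)) _).
move=> _; have dj := is_derive_coord j df.
have dfj : differentiable (fun s : R => s *: A (evec j)) (f t ord0 j) by exact: differentiableZl.
apply: (is_derive_eq (is_derive_comp_diff (@ex_derive _ _ _ _ _ _ _ dj) dfj)).
have [_ ->] := dj; rewrite diffZl //= diff_val //.
Qed.

HB.instance Definition _ x := GRing.isLinear.Build R V V _ (Ad x) (Ad_lin G x).

(* Differentiate A (Ad (h x) u) = Ad (h A x) (A u) at h = 0. *)
Lemma auto_brk (A : {linear V -> V}) : (forall x y, A (mul x y) = mul (A x) (A y)) ->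
  forall x u, A (brk x u) = brk (A x) (A u).
Proof.
move=> hA x u.
have d1 := rV_linear_derive A (Ad_is_derive G x u).
have d2 := Ad_is_derive G (A x) (A u).
rewrite (_ : (fun s => _) = fun h : R => Ad (h *: A x) (A u)) in d1.
  exact: is_derive_uniq d1 d2.
by apply/funext => s; rewrite -!conjE /conj !hA !linearN linearZ.
Qed.

Lemma Ad_mul x y z : Ad x (mul y z) = mul (Ad x y) (Ad x z).
Proof. by rewrite -!conjE conjM. Qed.

(** [Ad] of h x preserves the bracket, by [auto_brk]; the identity is the derivative of this at h =
    0. *)
Lemma jacobi x u v : brk x (brk u v) = brk (brk x u) v + brk u (brk x v).
Proof.
have d1 := Ad_is_derive G x (brk u v).
have d2 := brk_is_derive G (Ad_is_derive G x u) (Ad_is_derive G x v).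
rewrite (_ : (fun s => _) = fun h : R => Ad (h *: x) (brk u v)) in d2.
  have Ad0 w : Ad (0 *: x) w = w by rewrite scale0r -conjE /conj oppr0 carnot_mulx0 carnot_mul0x.
  by rewrite (is_derive_uniq d1 d2) !Ad0.
by apply/funext => h; rewrite (auto_brk (A := Ad (h *: x))) // => y z; exact: Ad_mul.
Qed.

Definition hom (i : nat) v := forall k, deg k != i -> v ord0 k = 0.

Lemma hom_lin i (c : R) u v : hom i u -> hom i v -> hom i (c *: u + v).
Proof. by move=> hu hv k dk; rewrite rVD rVZ hu // hv // mulr0 addr0. Qed.

Lemma hom_evec k : hom (deg k) (evec k).
Proof. by move=> l dl; rewrite evecE; case: eqVneq => // E; rewrite -E eqxx in dl. Qed.

Lemma span_ind (P : V -> Prop) (X : seq V) : (forall c x y, P x -> P y -> P (c *: x + y)) -> P 0 ->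
  (forall a, a \in X -> P a) -> forall x, x \in <<X>>%VS -> P x.
Proof.
move=> lin P0 hP x hx; rewrite (@coord_span _ _ _ (in_tuple X) x hx).
elim/big_ind: _ => // [y z Py Pz|l _]; first by have := lin 1 _ _ Py Pz; rewrite scale1r.
rewrite -[_ *: _]addr0; apply: lin => //; apply: hP; apply: mem_nth; exact: ltn_ord.
Qed.

Lemma stratumP i v : reflect (hom i v) (v \in stratum_of deg i).
Proof.
apply: (iffP idP).
  apply: span_ind => [c x y|k _|a]; [exact: hom_lin|by rewrite mxE|].
  by case/mapP => j; rewrite mem_filter => /andP[/eqP <- _] ->; exact: hom_evec.
move=> h; rewrite [v]rV_sum_evec; apply: memv_suml => k _.
have [dk|dk] := eqVneq (deg k) i; last by rewrite h // scale0r mem0v.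
apply: memvZ; apply: memv_span; apply: map_f.
by rewrite mem_filter dk eqxx mem_enum.
Qed.

Lemma hom_out i v : (carnot_step G < i)%N -> hom i v -> v = 0.
Proof.
move=> si h; apply/rowP => k; rewrite mxE; apply: h.
by apply: contraTneq si => <-; rewrite -leqNgt; case/andP: (carnot_deg_bounds G k).
Qed.

Lemma lie_space_mem (A B : {vspace V}) u v : u \in A -> v \in B -> brk u v \in lie_space mul A B.
Proof.
have gen a b : a \in vbasis A -> b \in vbasis B -> brk a b \in lie_space mul A B.
  move=> ha hb; apply: memv_span; apply/allpairsP.
  by exists (a, b); split=> //=; rewrite lie_brk.
have sub (P : V -> Prop) (U : {vspace V}) : (forall c x y, P x -> P y -> P (c *: x + y)) -> P 0 ->
    (forall a, a \in vbasis U -> P a) -> forall x, x \in U -> P x.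
  by move=> lin P0 hP x xU; apply: (span_ind lin P0 hP); rewrite (span_basis (vbasisP U)).
move=> uA vB; apply: (sub (fun w => brk w v \in lie_space mul A B) A) uA.
- by move=> c x y hx hy; rewrite brk_lin_l; apply: memvD; [exact: memvZ|].
- by rewrite brk_l0 mem0v.
- move=> a aA; apply: (sub (fun w => brk a w \in lie_space mul A B) B) vB.
  + by move=> c x y hx hy; rewrite brk_lin_r; apply: memvD; [exact: memvZ|].
  + by rewrite brk_r0 mem0v.
  + by move=> b bB; exact: gen.
Qed.

Lemma hom_brk1 i u v : (0 < i)%N -> hom 1 u -> hom i v -> hom i.+1 (brk u v).
Proof.
move=> i0 /stratumP hu hv; have [ilt|ige] := ltnP i (carnot_step G).
  apply/stratumP; rewrite -(carnot_lie (c := G)) ?i0 //.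
  by apply: lie_space_mem => //; apply/stratumP.
move: ige; rewrite leq_eqVlt => /predU1P[E|lt]; last by rewrite (hom_out lt hv) brk_r0 => k _; rewrite mxE.
have : brk u v \in lie_space mul (stratum_of deg 1) (stratum_of deg (carnot_step G)).
  by apply: lie_space_mem => //; apply/stratumP; rewrite E.
by rewrite carnot_lie_last memv0 => /eqP -> k _; rewrite mxE.
Qed.

Lemma hom_generated (P : V -> Prop) i : (0 < i)%N ->
  (forall c x y, P x -> P y -> P (c *: x + y)) -> P 0 ->
  (forall a b, hom 1 a -> hom i b -> P (brk a b)) -> forall u, hom i.+1 u -> P u.
Proof.
move=> i0 lin P0 hP u hu.
have [ilt|ige] := ltnP i (carnot_step G); last by rewrite (hom_out _ hu).
have : u \in lie_space mul (stratum_of deg 1) (stratum_of deg i).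
  by rewrite carnot_lie ?i0 //; apply/stratumP.
apply: span_ind => // x /allpairsP [[a b] /= [ha hb ->]].
by rewrite lie_brk; apply: hP; apply/stratumP; exact: vbasis_mem.
Qed.

(** Induction on i: layer i + 1 is generated by brackets of a in layer 1 with b in layer i, and the
    Jacobi identity reduces [[a, b], v] to brackets with a or b alone. *)
Lemma hom_brk i j u v : (0 < i)%N -> (0 < j)%N -> hom i u -> hom j v -> hom (i + j) (brk u v).
Proof.
elim: i j u v => // -[_ j u v _|i IH j u v _] j0 hu hv; first by rewrite add1n; exact: hom_brk1.
apply: (@hom_generated (fun u => hom (i.+2 + j) (brk u v)) i.+1) hu => //.
- by move=> c x y hx hy; rewrite brk_lin_l; exact: hom_lin.
- by rewrite brk_l0 => k _; rewrite mxE.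
- move=> a b ha hb.
  have -> : brk (brk a b) v = -1 *: brk b (brk a v) + brk a (brk b v).
    by rewrite (jacobi a b v) scaleN1r addrCA addNr addr0.
  apply: hom_lin.
    by rewrite addSnnS -(add1n j); apply: IH => //; rewrite add1n //; exact: hom_brk1.
  by rewrite addSn; apply: hom_brk1 => //; exact: IH.
Qed.

Lemma deg_gt0 k : (0 < deg k)%N.
Proof. by case/andP: (carnot_deg_bounds G k). Qed.

Lemma cst_strE i k j : cst_str G i k j = brk (evec i) (evec k) ord0 j.
Proof.
rewrite brkE (bigD1 i) //= (bigD1 k) //= !evecE !eqxx !mul1r big1 ?addr0.
  rewrite big1 ?addr0 // => l li; rewrite big1 // => m _.
  by rewrite !evecE (eq_sym i) (negbTE li) !mul0r.
by move=> l lk; rewrite !evecE (eq_sym k) (negbTE lk) mulr0 mul0r.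
Qed.

Lemma cst_str_deg i k j : deg j != (deg i + deg k)%N -> cst_str G i k j = 0.
Proof. by move=> h; rewrite cst_strE; apply: (hom_brk (deg_gt0 i) (deg_gt0 k)) => //; exact: hom_evec. Qed.

Lemma dilationE (t : R) x j : dilation G t x ord0 j = t ^+ deg j * x ord0 j.
Proof. by rewrite mxE. Qed.

Lemma dilation_linear (t : R) : linear (dilation G t).
Proof. by move=> c x y; apply/rowP => j; rewrite !mxE mulrDr mulrCA. Qed.

HB.instance Definition _ t := GRing.isLinear.Build R V V _ (dilation G t) (dilation_linear t).

Lemma dilation_brk (t : R) x u : dilation G t (brk x u) = brk (dilation G t x) (dilation G t u).
Proof.
apply/rowP => j; rewrite dilationE !brkE mulr_sumr; apply: eq_bigr => i _.
rewrite mulr_sumr; apply: eq_bigr => k _; rewrite !dilationE.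
have [->|h] := eqVneq (deg j) (deg i + deg k)%N; first by rewrite exprD; ring.
by rewrite cst_str_deg // !mulr0.
Qed.

(* One layer at a time, since the bracket with x raises the degree. *)
Lemma brk_ode_unique (e : R -> V) x : e 0 = 0 ->
  (forall s : R, is_derive s 1 e (- brk x (e s))) -> forall s, e s = 0.
Proof.
move=> e0 de; have key d : forall k, (deg k <= d)%N -> forall s, e s ord0 k = 0.
  elim: d => [k|d IH k dk s]; first by rewrite leqNgt deg_gt0.
  have h (t : R) : is_derive t 1 (fun s => \row_(_ < 1) e s ord0 k : 'rV[R]_1) 0.
    apply: is_derive_rV => j; rewrite mxE.
    rewrite (_ : (fun s => _) = fun s => e s ord0 k); last by apply/funext => r; rewrite mxE.
    apply: (is_derive_eq (is_derive_coord k (de t))).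
    rewrite rVN brkE big1 ?oppr0 // => i _; rewrite big1 // => l _.
    have [E|h] := eqVneq (deg k) (deg i + deg l)%N; last by rewrite cst_str_deg // mulr0.
    rewrite IH ?mulr0 ?mul0r // -ltnS; apply: leq_trans dk.
    by rewrite E -add1n leq_add2r deg_gt0.
  have := congr1 (fun w : 'rV[R]_1 => w ord0 ord0) (derive0_const R h s).
  by rewrite !mxE e0 mxE.
by move=> s; apply/rowP => k; rewrite mxE; exact: (key (deg k)).
Qed.

(** The velocity v at p brought back to the origin by left translation. *)
Definition logd p v := dL G (- p) p v.

Lemma logd_curve (c : R -> V) (s : R) (d : V) : is_derive s 1 c d ->
  is_derive (0 : R) (1 : R) (fun e => mul (- c s) (c (s + e))) (logd (c s) d).
Proof.
move=> dc; have d1 := mul_is_derive G (is_derive_cst (- c s) (0 : R) (1 : R)) (is_derive_to0 dc).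
by move: d1; rewrite dR0 add0r addr0.
Qed.

(* Left logarithmic derivative at a = 0 of a |-> s (x + a v), in Lie algebra coordinates; it solves a
   linear equation commuting with the dilations, which makes them automorphisms. *)
Definition wcurve x v (s : R) : V := logd (s *: x) (s *: v).

Lemma wcurve_phi x v s : is_derive (0 : R) (1 : R)
  (fun e => mul (- (s *: x)) (s *: (x + e *: v))) (wcurve x v s).
Proof.
have d : is_derive (0 : R) (1 : R) (fun e : R => s *: (x + e *: v)) (s *: v).
  have := is_deriveZ s (is_deriveD (is_derive_cst x (0 : R) (1 : R)) (is_derive_scale v 0)).
  by rewrite add0r.
have d1 := mul_is_derive G (is_derive_cst (- (s *: x)) (0 : R) (1 : R)) d.
by move: d1; rewrite dR0 add0r scale0r addr0.
Qed.

(** exp(-(s + h) x) exp((s + h)(x + e v)) is the conjugate by exp(-h x) of exp(-s x) exp(s (x + e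
    v)), times exp(-h x) exp(h (x + e v)); differentiate at e = 0. *)
Lemma wcurve_cocycle x v s h : wcurve x v (s + h) = Ad (- (h *: x)) (wcurve x v s) + wcurve x v h.
Proof.
have phi0 r : mul (- (r *: x)) (r *: (x + 0 *: v)) = 0 by rewrite scale0r addr0 mulNx.
have d1 := conj_curve G (- (h *: x)) (phi0 s) (wcurve_phi x v s).
have c0 : conj G (- (h *: x)) (mul (- (s *: x)) (s *: (x + 0 *: v))) = 0 by rewrite phi0 conj0.
have d2 := mul_curves0 G c0 (phi0 h) d1 (wcurve_phi x v h).
rewrite (_ : (fun e => _) = fun e : R => mul (- ((s + h) *: x)) ((s + h) *: (x + e *: v))) in d2.
  exact: is_derive_uniq (wcurve_phi x v (s + h)) d2.
apply/funext => e; rewrite /conj opprK -!carnot_mulA mulxK carnot_exp carnot_mulA.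
by congr mul; rewrite -!scaleNr carnot_exp; congr (_ *: _); ring.
Qed.

Lemma wcurve0 x v : wcurve x v 0 = 0.
Proof. by rewrite /wcurve !scale0r /logd dL0. Qed.

Lemma logd_is_derive x v : is_derive (0 : R) (1 : R) (wcurve x v) v.
Proof.
have d1 := is_derive_scale x 0.
have d2 : is_derive (0 : R) (1 : R) (fun h : R => - (h *: x)) (- x).
  by rewrite (_ : (fun h => _) = fun h : R => h *: - x); [exact: is_derive_scale|apply/funext => h; rewrite scalerN].
apply: is_derive_rV => j.
rewrite (_ : (fun h => _) = fun h : R => \sum_k (h *: v) ord0 k *
  'D_(evec (rshift N k)) (mulc G j) (row_mx (- (h *: x)) (h *: x))); last by apply/funext => h; rewrite mxE.
have d3 k := is_derive_mulf (is_derive_coord k (is_derive_scale v 0))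
   (pair_is_derive (smooth_pd (rshift N k) (mulc_smooth G j)) d2 d1).
have H := is_derive_sumf d3; apply: (is_derive_eq H).
rewrite !scale0r oppr0 big_split /= [X in _ + X]big1 ?addr0; last by move=> k _; rewrite mxE mul0r.
under eq_bigr do rewrite pd_rq.
exact: sum_delta.
Qed.

Lemma wcurve_ode x v (s : R) : is_derive s 1 (wcurve x v) (v - brk x (wcurve x v s)).
Proof.
apply: is_derive_from0.
rewrite (_ : (fun h => _) = fun h => Ad (- (h *: x)) (wcurve x v s) + wcurve x v h); last first.
  by apply/funext => h; exact: wcurve_cocycle.
have d1 : is_derive (0 : R) (1 : R) (fun h : R => Ad (- (h *: x)) (wcurve x v s)) (- brk x (wcurve x v s)).
  rewrite (_ : (fun h => _) = fun h : R => Ad ((- h) *: x) (wcurve x v s)).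
    exact: (is_derive_Nscale (Ad_is_derive G x (wcurve x v s))).
  by apply/funext => h; rewrite scaleNr.
by apply: (is_derive_eq (is_deriveD d1 (logd_is_derive x v))); rewrite addrC.
Qed.

Lemma dilation_wcurve (t : R) x v s :
  dilation G t (wcurve x v s) = wcurve (dilation G t x) (dilation G t v) s.
Proof.
pose e r := dilation G t (wcurve x v r) - wcurve (dilation G t x) (dilation G t v) r.
suff : e s = 0 by move/eqP; rewrite subr_eq0 => /eqP.
apply: (@brk_ode_unique e (dilation G t x)); first by rewrite /e !wcurve0 linear0 subrr.
move=> r; have d1 := rV_linear_derive (dilation G t) (wcurve_ode x v r).
have d2 := wcurve_ode (dilation G t x) (dilation G t v) r.
apply: (is_derive_eq (is_deriveB d1 d2)).
have E : brk (dilation G t x) (e r) =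
    brk (dilation G t x) (dilation G t (wcurve x v r)) - brk (dilation G t x) (wcurve (dilation G t x) (dilation G t
      v) r).
  have := brk_lin_r G (-1) (dilation G t x) (wcurve (dilation G t x) (dilation G t v) r) (dilation G t (wcurve x v r)).
  by rewrite !scaleN1r addrC => ->; rewrite addrC.
have L : dilation G t (v - brk x (wcurve x v r)) =
    dilation G t v - brk (dilation G t x) (dilation G t (wcurve x v r)).
  by rewrite linearB /= dilation_brk.
have : dilation G t (v - brk x (wcurve x v r)) -
    (dilation G t v - brk (dilation G t x) (wcurve (dilation G t x) (dilation G t v) r)) =
    - brk (dilation G t x) (e r) by rewrite L E opprB addrC subrKA opprB.
by [].
Qed.

Lemma dilation_logd (t : R) p v : dilation G t (logd p v) = logd (dilation G t p) (dilation G t v).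
Proof. by have := dilation_wcurve t p v 1; rewrite /wcurve !scale1r. Qed.

(** As dilations commute with [logd], the curve s |-> dilation of x exp(s y) has constant
    logarithmic derivative, the dilation of y; [one_parameter] then identifies the curve. *)
Lemma dilation_mul (t : R) x y : dilation G t (mul x y) = mul (dilation G t x) (dilation G t y).
Proof.
pose q s := mul x (s *: y).
have := @one_parameter R N G (fun s => dilation G t (q s)) (dilation G t y) _ 1.
rewrite /q scale0r carnot_mulx0 !scale1r; apply => s.
have dq : is_derive s 1 q (dL G x (s *: y) y).
  by have := mul_is_derive G (is_derive_cst x s (1 : R)) (is_derive_scale y s); rewrite dR0 add0r.
have d1 := logd_curve (rV_linear_derive (dilation G t) dq).
rewrite -dilation_logd in d1.
have d2 := logd_curve dq.
rewrite (_ : (fun e => mul (- q s) _) = fun e : R => e *: y) in d2; last first.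
  by apply/funext => e; rewrite /q oppM -carnot_mulA mulKx -scaleNr carnot_exp; congr (_ *: _); ring.
by rewrite -(is_derive_uniq (is_derive_scale y 0) d2) in d1.
Qed.

End Grading.

(** * Triangular translations, invariant integrals, invariance of L^t *)

Section Translations.
Context {R : realType} {N : nat} (G : carnot R N).
Local Notation V := 'rV[R]_N.
Local Notation mul := (carnot_mul G).
Local Notation deg := (carnot_deg G).
Implicit Types (x y z u v p q a : V).

Lemma is_derive_val_uniq (W X : normedModType R) (f : W -> X) (w v : W) (d d' : X) :
  is_derive w v f d -> is_derive w v f d' -> d = d'.
Proof. by move=> [_ <-] [_ <-]. Qed.

Lemma pow_cont (n : nat) : continuous (fun t : R => t ^+ n).
Proof. by move=> t; exact: exprn_continuous. Qed.

Lemma pdm_witness : {P : 'I_N -> 'I_(N + N) -> 'rV[R]_(N + N) -> R |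
  forall j k (z : 'rV[R]_(N + N)), P j k z = 'D_(evec k) (mulc G j) z}.
Proof. by eexists. Qed.

(* The derivative is homogeneous of degree deg j - deg i <= 0 and continuous at 0. *)
Lemma pd_mul i j a x : (deg j <= deg i)%N ->
  'D_(evec (rshift N i)) (mulc G j) (row_mx a x) = (i == j)%:R.
Proof.
move=> dij; have [P PE] := pdm_witness.
pose F (z : 'rV[R]_(N + N)) := P j (rshift N i) z.
pose d (t : R) := row_mx (dilation G t a) (dilation G t x).
have pair (b c : V -> V) (b' c' : V) : is_derive x (evec i : V) b b' -> is_derive x (evec i : V) c c' ->
   is_derive x (evec i : V) (fun s => mulc G j (row_mx (b s) (c s)))
    (\sum_k b' ord0 k * P j (lshift N k) (row_mx (b x) (c x)) +
     \sum_k c' ord0 k * P j (rshift N k) (row_mx (b x) (c x))).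
  move=> db dc; apply: (is_derive_eq (pair_is_derive (mulc_smooth G j) db dc)).
  by congr (_ + _); apply: eq_bigr => k _; rewrite PE.
have hF t : t ^+ deg i * F (d t) = t ^+ deg j * F (row_mx a x).
  have lin : is_derive x (evec i : V) (fun s : V => dilation G t s) (t ^+ deg i *: evec i).
    apply: is_derive_rV => k.
    rewrite (_ : (fun s : V => _) = fun s : V => t ^+ deg k * s ord0 k); last by apply/funext => s; exact: dilationE.
    apply: (is_derive_eq (is_derive_mulf (is_derive_cst (t ^+ deg k) x (evec i : V)) (derive_coord k x (evec i)))).
    rewrite mul0r add0r rVZ evecE /=; by case: eqVneq => [->|]; rewrite ?mulr0.
  have d1 := pair _ _ _ _ (is_derive_cst (dilation G t a) x (evec i : V)) lin.
  have d2 := is_derive_mulf (is_derive_cst (t ^+ deg j) x (evec i : V))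
    (pair _ _ _ _ (is_derive_cst a x (evec i : V)) (is_derive_id x (evec i : V))).
  have S (b : V) (c : R) (g : 'I_N -> R) : b = c *: evec i -> \sum_k b ord0 k * g k = c * g i.
    move=> ->; rewrite (bigD1 i) //= rVZ evecE eqxx mulr1 big1 ?addr0 // => k ki.
    by rewrite rVZ evecE eq_sym (negbTE ki) mulr0 mul0r.
  have S0 (g : 'I_N -> R) : \sum_k (0 : V) ord0 k * g k = 0.
    by rewrite big1 // => k _; rewrite mxE mul0r.
  rewrite (_ : (fun s : V => mulc G j _) = fun s : V => cst (t ^+ deg j) s * mulc G j (row_mx (cst a s) s)) in d1.
    have := is_derive_val_uniq d1 d2.
    by rewrite !S0 (S _ _ _ erefl) (S _ 1 _ (esym (scale1r _))) mul1r mul0r !add0r.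
  by apply/funext => s; rewrite !mulcE -dilation_mul dilationE.
(* By [hF] this function is constant for t > 0; it is continuous at 0, where [pd_rq] gives the
   value. *)
pose g t := t ^+ (deg i - deg j) * F (d t).
have gE t : 0 < t -> g t = F (row_mx a x).
  move=> t0; apply: (mulfI (lt0r_neq0 (exprn_gt0 (deg j) t0))).
  by rewrite -hF /g mulrA -exprD subnKC.
have g0 : g 0 = (i == j)%:R.
  have z b : dilation G 0 b = 0.
    by apply/rowP => k; rewrite dilationE mxE expr0n gtn_eqF ?deg_gt0 // mul0r.
  rewrite /g /d !z /F PE pd_rq; case: eqVneq => [->|ij]; last by rewrite mulr0.
  by rewrite subnn mulr1.
have cd : continuous d.
  move=> t; apply: cont_rV => k.
  case: (split_ordP k) => l ->.
    rewrite (_ : (fun y : R => _) = fun t : R => t ^+ deg l * a ord0 l).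
      by apply: cvgMl; exact: pow_cont.
    by apply/funext => y; rewrite row_mxEl dilationE.
  rewrite (_ : (fun y : R => _) = fun t : R => t ^+ deg l * x ord0 l).
    by apply: cvgMl; exact: pow_cont.
  by apply/funext => y; rewrite row_mxEr dilationE.
have cg : {for 0, continuous g}.
  apply: continuousM; first exact: pow_cont.
  apply: continuous_comp; first exact: cd.
  rewrite /F (_ : P j (rshift N i) = fun z : 'rV[R]_(N + N) => 'D_(evec (rshift N i)) (mulc G j) z);
    last by apply/funext => z; rewrite PE.
  exact: (smooth_cont (smooth_pd (rshift N i) (mulc_smooth G j)) I).
rewrite -g0 -PE -/(F (row_mx a x)).
apply/eqP; rewrite -subr_eq0 -normr_le0; apply/ler_addgt0Pl => e e0; rewrite addr0 distrC.
have /nbhs_ballP [r /= r0 hr] : \forall t \near 0, `|g 0 - g t| <= e.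
  by have /cvgrPdist_le := cg; apply.
rewrite -(gE (r / 2)); last by rewrite divr_gt0.
have bh : ball (0 : R) r (r / 2).
  by rewrite -ball_normE /ball_ /= sub0r normrN gtr0_norm ?divr_gt0 // ltr_pdivrMr // ltr_pMr // ltr1n.
exact: (hr _ bh).
Qed.

(** From y to x only coordinates of degree at least deg j change; by [pd_mul] the j-th coordinate of
    the product responds to them as the plain coordinate does, so the difference is constant along
    the segment. *)
Lemma mul_triangular a x y j : (forall i, (deg i < deg j)%N -> x ord0 i = y ord0 i) ->
  mul a x ord0 j - x ord0 j = mul a y ord0 j - y ord0 j.
Proof.
move=> h; pose v := x - y.
have v0 i : (deg i < deg j)%N -> v ord0 i = 0 by move=> /h E; rewrite /v !mxE E subrr.
pose f (s : R) : 'rV[R]_1 := \row_(_ < 1) (mulc G j (row_mx a (y + s *: v)) - (y + s *: v) ord0 j).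
have df (s : R) : is_derive s 1 f 0.
  apply: is_derive_rV => k; rewrite (_ : (fun s => _) = fun s : R => mulc G j (row_mx a (y + s *: v)) - (y + s *: v)
    ord0 j);
    last by apply/funext => r; rewrite mxE.
  have dv : is_derive s 1 (fun s : R => y + s *: v) v.
    by have := is_deriveD (is_derive_cst y s (1 : R)) (is_derive_scale v s); rewrite add0r.
  have d1 := pair_is_derive (mulc_smooth G j) (is_derive_cst a s (1 : R)) dv.
  apply: (is_derive_eq (is_deriveB d1 (is_derive_coord j dv))).
  rewrite [RHS]mxE [X in X + _ - _]big1 ?add0r; last by move=> i _; rewrite mxE mul0r.
  rewrite (eq_bigr (fun i => v ord0 i * (i == j)%:R)); first by rewrite sum_delta subrr.
  move=> i _; have [ij|ij] := ltnP (deg i) (deg j); first by rewrite v0 // !mul0r.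
  by rewrite pd_mul.
have := congr1 (fun w : 'rV[R]_1 => w ord0 ord0) (derive0_const R df 1).
have fE s : f s ord0 ord0 = mulc G j (row_mx a (y + s *: v)) - (y + s *: v) ord0 j by rewrite mxE.
have E : y + v = x by rewrite /v addrC subrK.
by rewrite !fE !mulcE scale1r scale0r addr0 E.
Qed.

Lemma mulr_smooth a j : smooth_on setT (fun y => mul a y ord0 j).
Proof.
have := @smooth_comp R N (N + N) setT setT (fun y => row_mx a y) openT openT _ (fun _ _ => I) _ (mulc_smooth G j).
rewrite (_ : _ \o _ = fun y => mul a y ord0 j); last by apply/funext => y /=; rewrite mulcE.
apply => k; case: (split_ordP k) => l ->.
  apply: (smooth_eq openT _ (smooth_cst openT (a ord0 l))) => y _; by rewrite row_mxEl.
apply: (smooth_eq openT _ (smooth_coord openT l)) => y _; by rewrite row_mxEr.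
Qed.

Lemma mulr_continuous a : continuous (mul a).
Proof. by move=> y; apply: cont_rV => j; exact: (smooth_cont (mulr_smooth a j) I). Qed.

Lemma smooth_translate f a : smooth_on setT f -> smooth_on setT (fun y : V => f (mul a y) : R).
Proof. exact: (@smooth_comp R N N setT setT (mul a) openT openT (mulr_smooth a) (fun _ _ => I)). Qed.

Lemma dil_smooth t j : smooth_on setT (fun y : V => dilation G t y ord0 j).
Proof.
apply: (smooth_eq openT _ (smoothZ openT (t ^+ deg j) (smooth_coord openT j))) => y _.
by rewrite dilationE.
Qed.

Lemma dil_continuous t : continuous (dilation G t).
Proof. by move=> y; apply: cont_rV => j; exact: (smooth_cont (dil_smooth t j) I). Qed.

Lemma smooth_dilate f t : smooth_on setT f -> smooth_on setT (fun y : V => f (dilation G t y) : R).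
Proof. exact: (@smooth_comp R N N setT setT (dilation G t) openT openT (dil_smooth t) (fun _ _ => I)). Qed.

Lemma mul2_continuous : continuous (fun z : 'rV[R]_(N + N) => mul (lsubmx z) (rsubmx z)).
Proof. by move=> z; apply: cont_rV => j; exact: (smooth_cont (mulc_smooth G j) I). Qed.

Lemma row_mx_norm_le x y (M : R) : `|x| <= M -> `|y| <= M -> `|row_mx x y : 'rV[R]_(N + N)| <= M.
Proof.
move=> hx hy; have M0 : 0 <= M by exact: le_trans hx.
apply/rV_normP => // k; case: (split_ordP k) => l ->.
  by rewrite row_mxEl; move/(rV_normP x M0): hx; exact.
by rewrite row_mxEr; move/(rV_normP y M0): hy; exact.
Qed.

Lemma mul_bounded (A : R) : exists2 B : R, 0 < B & forall x y, `|x| <= A -> `|y| <= A -> `|mul x y| <= B.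
Proof.
have := continuous_compact (continuous_subspaceT mul2_continuous) (@closed_ball0_compact R (N + N) A).
move=> /compact_norm_le [B B0 hB]; exists B => // x y hx hy; apply/ltW/hB.
by exists (row_mx x y); [exact: row_mx_norm_le|rewrite row_mxKl row_mxKr].
Qed.

Lemma ccont_translate (f : V -> R) a A : ccont A f -> exists B, ccont B (fun x => f (mul a x)).
Proof.
move=> [A0 cf z]; have [B B0 hB] := mul_bounded (A + `|a|).
exists (B + 1); split; first by rewrite addr_gt0.
  by move=> x; apply: continuous_comp; [exact: mulr_continuous|exact: cf].
move=> x hx; apply: z; rewrite leNgt; apply/negP => h.
have := hB (- a) (mul a x); rewrite mulKx normrN => /(_ _ _).
have h1 : `|a| <= A + `|a| by rewrite lerDr ltW.
have h2 : `|mul a x| <= A + `|a| by have := normr_ge0 a; lra.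
by move=> /(_ h1 h2); lra.
Qed.

(** [carnot_deg_homo] orders the coordinates by degree, so that a left translation is triangular
    with unit diagonal and [int_triangular] applies with all factors equal to 1. *)
Lemma int_translate (f : V -> R) a A : ccont A f -> integral_rV (fun x => f (mul a x)) = integral_rV f.
Proof.
move=> cf; have [B cB] := ccont_translate a cf.
have A0 : 0 < A by case: cf. have B0 : 0 < B by case: cB.
have cf' : ccont (A + B) f by apply: ccont_widen cf; lra.
have cB' : ccont (A + B) (f \o mul a) by apply: ccont_widen cB; lra.
have := int_triangular (c := fun=> 1) (T := mul a) (fun _ => ltr01) _ cf' cB'.
rewrite big1 // invr1 mul1r; apply => x y j h; rewrite !mul1r; apply: mul_triangular => i ij.
apply: h; rewrite ltnNge; apply: contraL ij => /carnot_deg_homo h; by rewrite -leqNgt h.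
Qed.

Definition qdim : nat := \sum_(j < N) deg j.

Lemma ccont_dilate (f : V -> R) (t A : R) : 0 < t -> ccont A f -> exists B, ccont B (fun x => f (dilation G t x)).
Proof.
move=> t0 [A0 cf z].
have := continuous_compact (continuous_subspaceT (@dil_continuous t^-1)) (@closed_ball0_compact R N A).
move=> /compact_norm_le [B B0 hB]; exists B; split=> //.
  by move=> x; apply: continuous_comp; [exact: dil_continuous|exact: cf].
move=> x hx; apply: z; rewrite leNgt; apply/negP => /ltW h.
have : `|dilation G t^-1 (dilation G t x)| < B by apply: hB; exists (dilation G t x).
have -> : dilation G t^-1 (dilation G t x) = x; last by rewrite ltNge hx.
by apply/rowP => j; rewrite !dilationE mulrA -exprMn mulVf ?gt_eqF // expr1n mul1r.
Qed.

Lemma prod_deg (t : R) : \prod_j t ^+ deg j = t ^+ qdim.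
Proof. by rewrite /qdim; elim/big_rec2: _ => [|j m x _ ->]; rewrite ?expr0 // exprD. Qed.

Lemma int_dilate (f : V -> R) (t A : R) : 0 < t -> ccont A f ->
  integral_rV (fun x => f (dilation G t x)) = t ^- qdim * integral_rV f.
Proof.
move=> t0 cf; have [B cB] := ccont_dilate t0 cf.
have A0 : 0 < A by case: cf. have B0 : 0 < B by case: cB.
have cf' : ccont (A + B) f by apply: ccont_widen cf; lra.
have cB' : ccont (A + B) (f \o dilation G t) by apply: ccont_widen cB; lra.
have := int_triangular (c := fun j => t ^+ deg j) (T := dilation G t) (fun j => exprn_gt0 _ t0) _ cf' cB'.
by rewrite prod_deg; apply => x y j h; rewrite !dilationE !subrr.
Qed.

Lemma differentiable_rV (W : normedModType R) n (f : W -> 'rV[R]_n) (w : W) :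
  (forall j, differentiable (fun s => f s ord0 j) w) -> differentiable f w.
Proof.
move=> h; rewrite (_ : f = \sum_(j < n) (fun s => f s ord0 j *: evec j)).
  by apply: differentiable_sum => j; apply: differentiableZl.
apply/funext => s; rewrite {1}[f s]rV_sum_evec.
by elim/big_rec2: _ => // j g b _ ->.
Qed.

Lemma det_translate a y : \det (jacobian (Defs.left_trans G a) y) = 1.
Proof.
have E i j : jacobian (Defs.left_trans G a) y i j = 'D_(evec (rshift N i)) (mulc G j) (row_mx a y).
  have dm : differentiable (Defs.left_trans G a) y.
    by apply: differentiable_rV => k; exact: (smooth_diff openT (mulr_smooth a k) I).
  rewrite mxE -[delta_mx _ _]/(evec i : V) -deriveE //.
  have [_ ->] := mul_is_derive G (is_derive_cst a y (evec i : V)) (is_derive_id y (evec i : V)).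
  rewrite dR0 add0r mxE (bigD1 i) //= evecE eqxx mul1r big1 ?addr0 // => k ki.
  by rewrite evecE eq_sym (negbTE ki) mul0r.
rewrite -det_tr det_trig.
  by rewrite big1 // => i _; rewrite mxE E pd_mul // eqxx.
apply/is_trig_mxP => i j ij; rewrite mxE E pd_mul; first by rewrite gt_eqF.
by apply: carnot_deg_homo; exact: ltnW.
Qed.

Lemma det_dilation t y : \det (jacobian (dilation G t) y) = t ^+ qdim.
Proof.
have E : jacobian (dilation G t) y = diag_mx (\row_j t ^+ deg j).
  apply/matrixP => i j; rewrite mxE diff_lin; last exact: dil_continuous.
  rewrite dilationE -[delta_mx _ _]/(evec i : V) evecE !mxE.
  by case: eqVneq => [->|]; rewrite ?mulr1 ?mulr0.
by rewrite E det_diag; under eq_bigr do rewrite mxE; exact: prod_deg.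
Qed.

Lemma hom_dimE : hom_dim G = qdim.
Proof.
have D i : \dim (stratum G i) = (\sum_(j < N) (deg j == i))%N.
  rewrite /stratum /stratum_of; set X := [seq _ | _ <- _].
  have fX : free X.
    apply: (@catl_free _ _ [seq (evec j : V) | j <- enum 'I_N & deg j != i] X).
    rewrite -map_cat (perm_free (Y := [seq (evec j : V) | j <- enum 'I_N])).
      rewrite /free size_map size_enum_ord.
      have -> : <<[seq (evec j : V) | j <- enum 'I_N]>>%VS = fullv.
        apply/vspaceP => w; rewrite memvf [w]rV_sum_evec; apply: memv_suml => k _.
        by apply: memvZ; apply: memv_span; apply: map_f; rewrite mem_enum.
      by apply/eqP; apply: (etrans (dimvf _)); apply: (etrans (dim_matrix _ _ _)); exact: mul1n.
    by apply: perm_map; exact/permPl/perm_filterC.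
  by rewrite (eqP fX) size_map size_filter -sum1_count big_mkcond big_enum /=; apply: eq_bigr => j _; case: eqP.
rewrite /hom_dim /qdim.
under eq_bigr do rewrite D big_distrr /=.
rewrite exchange_big /=; apply: eq_bigr => j _.
have /andP[d0 ds] := carnot_deg_bounds G j.
rewrite (bigD1_seq (deg j)) ?mem_index_iota ?iota_uniq ?d0 ?ltnS //= eqxx muln1 big1 ?addn0 // => i.
by rewrite eq_sym => /negbTE ->; rewrite muln0.
Qed.

Section Invariance.
Variables (L : diffop R N) (lambda : R).
Hypotheses (L_left_inv : left_invariant G L) (L_homog : homogeneous G L lambda).

Lemma diffop_trZ c phi : smooth_on setT phi ->
  diffop_tr_fun L (fun x => c * phi x) = fun x => c * diffop_tr_fun L phi x.
Proof.
move=> sp; have s0 := smooth_cst (@openT V) (0 : R).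
have Z : diffop_tr_fun L (fun _ : V => 0) = fun=> 0.
  apply/funext => x; have := congr1 (@^~ x) (diffop_tr_lin L 1 s0 s0).
  rewrite (_ : (fun x => _) = fun=> 0); last by apply/funext => y; rewrite mulr0 addr0.
  move=> /=; lra.
have := diffop_tr_lin L c sp s0; rewrite Z.
under eq_fun do rewrite addr0; by under [in RHS]eq_fun do rewrite addr0.
Qed.

(** Left invariance tested on the Dirac mass at x is a pointwise identity for the transpose; the
    Jacobian of a translation is 1. *)
Lemma tr_translate phi a : test_fun setT phi ->
  diffop_tr_fun L (fun y => phi (mul a y)) = fun y => diffop_tr_fun L phi (mul a y).
Proof.
move=> tp; apply/funext => x.
have := L_left_inv (- a) (dirac_distribution setT x) tp.
rewrite opprK => H.
have {H} : diffop_tr_fun L phi (mul a x) * `|\det (jacobian (Defs.left_trans G a) x)| =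
  diffop_tr_fun L (fun y => phi (mul a y) * `|\det (jacobian (Defs.left_trans G a) y)|) x := H.
move: (diffop_tr_fun L) => Lt H.
have D y : `|\det (jacobian (Defs.left_trans G a) y)| = 1 by rewrite det_translate normr1.
have E : Lt (fun y => phi (mul a y) * `|\det (jacobian (Defs.left_trans G a) y)|) = Lt (fun y => phi (mul a y)).
  by congr Lt; apply/funext => y; rewrite D mulr1.
rewrite -E; apply: (etrans (esym H)).
by apply: (etrans (congr1 (fun c => Lt phi (mul a x) * c) (D x))); rewrite mulr1.
Qed.

(** Homogeneity tested on the Dirac mass at x. It is used at t^-1, because composing a distribution
    with a dilation acts on test functions by the inverse one; the Jacobian t^Q cancels. *)
Lemma tr_dilate phi (t : R) : 0 < t -> test_fun setT phi ->
  diffop_tr_fun L (fun y => phi (dilation G t y)) =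
  fun y => t `^ lambda * diffop_tr_fun L phi (dilation G t y).
Proof.
move=> t0 tp; apply/funext => x.
have ti0 : 0 < t^-1 by rewrite invr_gt0.
have := L_homog ti0 (dirac_distribution setT x) tp.
rewrite invrK => H.
have {}H : diffop_tr_fun L phi (dilation G t x) * `|\det (jacobian (dilation G t) x)| =
  t^-1 `^ lambda * diffop_tr_fun L (fun y => phi (dilation G t y) * `|\det (jacobian (dilation G t) y)|) x := H.
have D y : `|\det (jacobian (dilation G t) y)| = t ^+ qdim.
  by rewrite det_dilation ger0_norm // exprn_ge0 // ltW.
have := diffop_trZ (t ^+ qdim) (smooth_dilate t (test_smooth tp)).
move: H; move: (diffop_tr_fun L) => Lt H HZ.
have E : Lt (fun y => phi (dilation G t y) * `|\det (jacobian (dilation G t) y)|) =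
    Lt (fun y => t ^+ qdim * phi (dilation G t y)).
  by congr Lt; apply/funext => y; rewrite D mulrC.
have {E HZ} E := congr1 (@^~ x) (etrans E HZ).
have {D E} H := etrans (etrans (esym (congr1 (fun c => Lt phi (dilation G t x) * c) (D x))) H)
  (congr1 (fun c => t^-1 `^ lambda * c) E).
have q0 := exprn_gt0 qdim t0.
have P1 : t `^ lambda * t^-1 `^ lambda = 1.
  by rewrite -powRM ?(ltW t0) ?(ltW ti0) // mulfV ?gt_eqF // powR1.
apply: (mulfI (lt0r_neq0 q0)).
by have := congr1 (fun c => t `^ lambda * c) H; rewrite !mulrA P1 mul1r => <-; ring.
Qed.

End Invariance.

End Translations.

(** * The Carnot-Caratheodory distance *)

Section HorizontalCurves.
Context {R : realType} {N : nat} (G : carnot R N).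
Local Notation V := 'rV[R]_N.
Local Notation mul := (carnot_mul G).
Local Notation deg := (carnot_deg G).
Local Notation dL := (dL G).
Implicit Types (x y z u v p q a : V).

Lemma curve_is_derive (h : R -> V) (s : R) :
  (forall j, smooth_on setT (fun v : 'rV[R]_1 => h (v ord0 ord0) ord0 j)) ->
  is_derive s 1 h (\row_j 'D_(evec ord0) (fun v : 'rV[R]_1 => h (v ord0 ord0) ord0 j) (0 + s *: evec ord0)).
Proof.
move=> sh; apply: is_derive_rV => j; rewrite mxE.
have := @derivable_line R 'rV[R]_1 R (fun v : 'rV[R]_1 => h (v ord0 ord0) ord0 j) 0 (evec ord0) s
  (@smooth_derivable _ _ _ _ _ ord0 (sh j) I).
rewrite (_ : (fun s => _) = fun s : R => h s ord0 j) //.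
by apply/funext => r; rewrite add0r rVZ evecE eqxx mulr1.
Qed.

Lemma smooth_curveI (h : R -> V) :
  (forall j, smooth_on setT (fun v : 'rV[R]_1 => h (v ord0 ord0) ord0 j)) -> smooth_curve h.
Proof.
move=> sh n; elim: n h sh => [|n IH] h sh t.
  by rewrite derive1n0; case: (curve_is_derive t sh).
rewrite derive1Sn; apply: IH => j.
apply: (smooth_eq openT _ (smooth_pd ord0 (sh j))) => v _.
rewrite derive1E; have [_ ->] := curve_is_derive (v ord0 ord0) sh; rewrite mxE.
have -> // : 0 + v ord0 ord0 *: evec ord0 = v.
by apply/rowP => i; rewrite !ord1 rVD rVZ evecE eqxx mulr1 mxE add0r.
Qed.

(** Integral curve of c times the left-invariant field of w, passing through y at time b. *)
Definition seg y (c b : R) (w : V) (u : R) : V := mul y ((c * (u - b)) *: w).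

Lemma seg_smooth y c b w : smooth_curve (seg y c b w).
Proof.
apply: smooth_curveI => j.
apply: (@smooth_comp R 1 N setT setT (fun v : 'rV[R]_1 => (c * (v ord0 ord0 - b)) *: w) openT openT _ _ _
  (mulr_smooth G y j)) => // k.
apply: (smooth_eq openT (f := fun v : 'rV[R]_1 => (c * (v ord0 ord0 - b)) * w ord0 k)); first by move=> v _;
  rewrite rVZ.
exact: (smoothM openT (smoothZ openT c (smoothB openT (smooth_coord openT ord0) (smooth_cst openT b))) (smooth_cst
  openT _)).
Qed.

Lemma mulr_scale_is_derive p w : is_derive (0 : R) (1 : R) (fun s : R => mul p (s *: w)) (dL p 0 w).
Proof.
have := mul_is_derive G (is_derive_cst p (0 : R) (1 : R)) (is_derive_scale w 0).
by rewrite dR0 add0r scale0r; congr is_derive.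
Qed.

Lemma seg_is_derive y c b w (u : R) : is_derive u 1 (seg y c b w) (c *: dL (seg y c b w u) 0 w).
Proof.
apply: is_derive_from0.
have := mulr_scale_is_derive (seg y c b w u) (c *: w).
have -> : dL (seg y c b w u) 0 (c *: w) = c *: dL (seg y c b w u) 0 w.
  by have := dL_lin G (seg y c b w u) 0 c w 0; rewrite dL0 !addr0.
congr is_derive; apply/funext => s; rewrite /seg scalerA -carnot_mulA carnot_exp; congr (mul _ (_ *: _)); ring.
Qed.

Definition cc_set x y (T : R) : Prop := 0 <= T /\ exists g : R -> V,
    [/\ piecewise_smooth T g, g 0 = x, g T = y & subunit G T g].

Lemma cc_dist_le x y T : cc_set x y T -> cc_dist G x y <= T.
Proof. by move=> h; apply: ge_inf h; exists 0 => t []. Qed.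

Lemma cc_dist_ge0 x y : 0 <= cc_dist G x y.
Proof.
rewrite /cc_dist; set S := (X in inf X).
have [->|/set0P S0] := eqVneq S set0; first by rewrite inf0.
by apply: lb_le_inf => // t [].
Qed.

Lemma cc_set_refl x : cc_set x x 0.
Proof.
split=> //; exists (fun=> x); split => //; last first.
  apply: (@aeW _ _ R) => t _ xi; rewrite derive1_cst.
  rewrite (_ : dotv _ _ = 0); last by rewrite /dotv big1 // => j _; rewrite mxE mul0r.
  by rewrite expr0n /= sumr_ge0 // => j _; exact: sqr_ge0.
split; last by exists [::]; split.
by apply: continuous_subspaceT => ?; exact: cvg_cst.
Qed.

Lemma dotvZl c u v : dotv (c *: u) v = c * dotv u v.
Proof. by rewrite /dotv mulr_sumr; apply: eq_bigr => j _; rewrite rVZ mulrA. Qed.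

Lemma cc_set_extend x y T (t : R) j : deg j = 1%N -> cc_set x y T ->
  cc_set x (mul y (t *: evec j)) (T + `|t|).
Proof.
move=> dj; have [->|t0] := eqVneq t 0; first by rewrite scale0r carnot_mulx0 normr0 addr0.
move=> [T0 [g [[cg [s [ps ls hs]]] g0 gT sg]]].
have nt : 0 < `|t| by rewrite normr_gt0.
split; first by rewrite addr_ge0.
pose h := seg y (Num.sg t) T (evec j).
have hT : h T = y by rewrite /h /seg subrr mulr0 scale0r carnot_mulx0.
pose f (u : R) := if u <= T then g u else h u.
have fg (u : R) : u <= T -> f u = g u by rewrite /f => ->.
have fh (u : R) : T <= u -> f u = h u.
  by rewrite /f le_eqVlt => /orP[/eqP <-|]; [rewrite lexx gT hT|rewrite leNgt => ->].
have ch : continuous h.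
  move=> u; have [d _] := seg_is_derive y (Num.sg t) T (evec j) u.
  by apply: differentiable_continuous; apply/derivable1_diffP.
exists f; split; last 1 first.
(* The concatenation may have no derivative at the junction T, a negligible point. *)
- have nT : {ae @lebesgue_measure R, forall u : R, u != T}.
    exists [set T]; split=> //; first exact: lebesgue_measure_set1.
    by move=> u /= /negP; rewrite negbK => /eqP.
  apply: (@filterS2 _ _ (ae_filter_ringOfSetsType (@lebesgue_measure R)) _ _ _ _ sg nT) => u /= su uT u0 xi.
  have [ult|uge] := ltP u T.
    have e : \near u, f u = g u.
      by near=> v; apply: fg; apply/ltW; near: v; exact: lt_nbhsl.
    rewrite derive1E (near_eq_derive _ e) -derive1E (fg _ (ltW ult)); apply: su.
    by case/andP: u0 => -> _; exact: ltW.
  have {uge} ugt : T < u by rewrite lt_neqAle eq_sym uT.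
  have e : \near u, f u = h u.
    by near=> v; apply: fh; apply/ltW; near: v; exact: lt_nbhsr.
  rewrite derive1E (near_eq_derive _ e); have [_ ->] := seg_is_derive y (Num.sg t) T (evec j) u.
  rewrite (fh _ (ltW ugt)) (bigD1 j) ?dj //= left_inv_fieldE dotvZl exprMn sqr_sg t0 mul1r lerDl.
  by apply: sumr_ge0 => i _; exact: sqr_ge0.
- split.
    rewrite (_ : [set` `[0, T + `|t|]] = `[0, T]%classic `|` `[T, T + `|t|]%classic); last first.
      apply/seteqP; split=> u /=; rewrite !in_itv /=.
        case/andP => -> ->; rewrite andbT /=.
        by have [c|c] := leP u T; [left|right; exact: ltW].
      case=> /andP[a b]; first by rewrite a (le_trans b) // lerDl ltW.
      by rewrite b (le_trans T0 a).
    apply: withinU_continuous; [exact: interval_closed|exact: interval_closed| |].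
      by apply: (@subspace_eq_continuous _ _ _ g f _ cg) => u; rewrite inE /= in_itv /= => /andP[_ ?]; rewrite fg.
    apply: (@subspace_eq_continuous _ _ _ h f); last exact: continuous_subspaceT.
    by move=> u; rewrite inE /= in_itv /= => /andP[? _]; rewrite fh.
  exists (rcons s (T + `|t|)); split.
  + by rewrite rcons_path ps ls ltrDl.
  + by rewrite last_rcons.
  + move=> i; rewrite size_rcons ltnS leq_eqVlt => /orP[/eqP ->|ilt].
      exists h; first exact: seg_smooth.
      move=> u; rewrite -rcons_cons nth_rcons /= ltnS leqnn.
      have -> : nth 0 (0 :: s) (size s) = T by rewrite -ls (last_nth 0).
      by case/andP => ? _; exact: fh.
    have [k sk hk] := hs i ilt; exists k => // u.
    rewrite -rcons_cons !nth_rcons /= ltnS (ltnW ilt) ilt => ui; rewrite -hk // fg //.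
    case/andP: ui => _ ui; apply: (le_trans ui).
    rewrite -ls (last_nth 0); change (nth 0 s i) with (nth 0 (0 :: s) i.+1).
    have srt : sorted <=%R (0 :: s) by apply: (sub_path _ ps) => a b /ltW.
    by apply: (sorted_leq_nth le_trans lexx 0 srt) => //=; rewrite inE /= ltnS.
- by rewrite fg.
- rewrite fh ?lerDl ?(ltW nt) // /h /seg; congr (mul _ (_ *: _)).
  by rewrite addrC addKr -numEsg.
Unshelve. all: by end_near. Qed.

(** An entry (t, j) is a move of signed duration t along X_j, so that [cost] is the total
    duration. *)
Fixpoint route x (l : seq (R * 'I_N)) : V :=
  if l is m :: l' then route (mul x (m.1 *: evec m.2)) l' else x.
Definition cost (l : seq (R * 'I_N)) : R := \sum_(m <- l) `|m.1|.
Definition horizontal (l : seq (R * 'I_N)) : bool := all (fun m => deg m.2 == 1%N) l.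

Lemma route_cc x l : horizontal l -> cc_set x (route x l) (cost l).
Proof.
suff H y T : cc_set x y T -> horizontal l -> cc_set x (route y l) (T + cost l).
  by move=> hl; have := H x 0 (cc_set_refl x) hl; rewrite add0r.
elim: l y T => [|m l IH] y T h /=; first by rewrite /cost big_nil addr0.
case/andP => /eqP dm hl; rewrite /cost big_cons addrA; apply: IH => //.
exact: cc_set_extend.
Qed.

Lemma route_cat x l l' : route x (l ++ l') = route (route x l) l'.
Proof. by elim: l x => //= m l IH x; rewrite IH. Qed.

Lemma route_mul x l : route x l = mul x (route 0 l).
Proof.
elim/last_ind: l => [|l m IH]; first by rewrite /= carnot_mulx0.
by rewrite -cats1 !route_cat /= IH carnot_mulA.
Qed.

Lemma cost_cat l l' : cost (l ++ l') = cost l + cost l'.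
Proof. by rewrite /cost big_cat. Qed.

Definition back (l : seq (R * 'I_N)) := rev [seq (- m.1, m.2) | m <- l].

Lemma route_back l : route 0 (back l) = - route 0 l.
Proof.
elim: l => [|m l IH]; first by rewrite /= oppr0.
rewrite /back /= rev_cons -cats1 route_cat -/(back l) IH /= scaleNr carnot_mul0x.
by rewrite [in RHS]route_mul oppM.
Qed.

Lemma horizontal_back l : horizontal (back l) = horizontal l.
Proof. by rewrite /horizontal /back all_rev all_map. Qed.

Lemma cost_back l : cost (back l) = cost l.
Proof.
have pr : perm_eq (back l) [seq (- m.1, m.2) | m <- l] by rewrite /back perm_rev.
by rewrite /cost (perm_big _ pr) big_map; apply: eq_bigr => m _ /=; rewrite normrN.
Qed.

Lemma route_dilate (r : R) l : horizontal l ->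
  route 0 [seq (r * m.1, m.2) | m <- l] = dilation G r (route 0 l).
Proof.
elim/last_ind: l => [|l m IH]; first by rewrite /= linear0.
rewrite /horizontal all_rcons map_rcons -!cats1 !route_cat /= => /andP[/eqP dm hl].
rewrite dilation_mul IH //; congr mul; apply/rowP => k; rewrite dilationE !rVZ evecE.
by case: eqVneq => [<-|]; rewrite ?mulr0 // dm expr1 !mulr1.
Qed.

Lemma cost_dilate (r : R) l : cost [seq (r * m.1, m.2) | m <- l] = `|r| * cost l.
Proof. by rewrite /cost big_map mulr_sumr; apply: eq_bigr => m _ /=; rewrite normrM. Qed.

Definition reachable g := exists2 l, horizontal l & route 0 l = g.

Lemma reachable_mul g h : reachable g -> reachable h -> reachable (mul g h).
Proof.
move=> [l hl <-] [l' hl' <-]; exists (l ++ l'); first by move: hl hl'; rewrite /horizontal all_cat => -> ->.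
by rewrite route_cat [LHS]route_mul.
Qed.

Lemma reachable_evec (t : R) j : deg j = 1%N -> reachable (t *: evec j).
Proof. by move=> dj; exists [:: (t, j)]; rewrite /horizontal /= ?dj // carnot_mul0x. Qed.

(* Stability under the brackets with e_j: differentiate Ad_{g (h e_j)} b at h = 0. *)
Lemma Ad_reachable_span (W : {vspace V}) :
  (forall g j, reachable g -> deg j = 1%N -> Ad G g (evec j) \in W) -> W = fullv.
Proof.
(* Quantifying over all reachable g is what makes P stable under brackets with e_j: g times s e_j is
   again reachable. *)
move=> hW; pose P u := forall g, reachable g -> Ad G g u \in W.
have PL c u v : P u -> P v -> P (c *: u + v).
  by move=> Pu Pv g rg; rewrite Ad_lin memvD ?memvZ ?Pu ?Pv.
have P0 : P 0.
  move=> g _; rewrite (_ : Ad G g 0 = 0) ?mem0v //.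
  by have := Ad_lin G g (-1) 0 0; rewrite scaler0 addr0 scaleN1r addNr.
(* The map 1 - proj_W vanishes along the curve, hence on its velocity. *)
have closed_derive (f : R -> V) (d : V) : (forall s, f s \in W) -> is_derive (0 : R) (1 : R) f d -> d \in W.
  move=> fW df; pose pi : 'End(V) := (\1 - projv W)%VF.
  have pi0 w : w \in W -> pi w = 0 by move=> wW; rewrite /pi !lfunE /= !lfunE /= projv_id ?subrr.
  have := rV_linear_derive [the {linear V -> V} of fun_of_lfun pi] df.
  change (is_derive (0 : R) (1 : R) (fun s : R => pi (f s)) (pi d) -> d \in W).
  rewrite (_ : (fun s => _) = cst 0); last by apply/funext => s; rewrite pi0.
  move=> dp; have := is_derive_uniq dp (is_derive_cst 0 (0 : R) (1 : R)).
  rewrite /pi !lfunE /= !lfunE /= => /eqP; rewrite subr_eq0 => /eqP ->; exact: memv_proj.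
have P1 u : hom G 1 u -> P u.
  move/stratumP; apply: span_ind => // e /mapP [j]; rewrite mem_filter => /andP[/eqP dj _] -> g rg.
  exact: hW.
have Pi i : (0 < i)%N -> forall u, hom G i u -> P u.
  elim: i => // -[_ _|i IH _]; first exact: P1.
  apply: (@hom_generated _ _ G P i.+1) => // a b /stratumP ha hb.
  have Pb := IH isT b hb.
  move: a ha; apply: span_ind.
  - by move=> c x y Px Py; rewrite brk_lin_l; exact: PL.
  - by rewrite brk_l0.
  - move=> e /mapP [j]; rewrite mem_filter => /andP[/eqP dj _] -> g rg.
    apply: (closed_derive (fun h => Ad G g (Ad G (h *: evec j) b))).
      by move=> s; rewrite -AdM; apply: Pb; apply: reachable_mul => //; exact: reachable_evec.
    pose A : V -> V := Ad G g.
    have lA : linear A by exact: Ad_lin.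
    pose L := HB.pack A (GRing.isLinear.Build R V V *:%R A lA) : {linear V -> V}.
    exact: (rV_linear_derive L (Ad_is_derive G (evec j) b)).
have rch0 : reachable 0 by exists [::].
have Ad0 u : Ad G 0 u = u by rewrite -conjE /conj oppr0 carnot_mulx0 carnot_mul0x.
apply/vspaceP => v; rewrite memvf (rV_sum_evec v).
apply/idP/memv_suml => j _; apply: memvZ; rewrite -(Ad0 (evec j)).
by apply: (Pi (deg j)) => //; [exact: deg_gt0|exact: hom_evec].
Qed.

End HorizontalCurves.

(** * Local surjectivity *)

Section LocalSurjectivity.
Context {R : realType}.

Lemma near_forall (T : topologicalType) (I : finType) (Q : I -> T -> Prop) (x : T) :
  (forall i, \forall t \near x, Q i t) -> \forall t \near x, forall i, Q i t.
Proof. exact: filter_forall. Qed.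

Lemma mulmx_norm_le n (B : 'M[R]_n) : exists2 C : R, 0 < C & forall x : 'rV[R]_n, `|x *m B| <= C * `|x|.
Proof.
pose S j := \sum_i `|B i j|.
exists (1 + \sum_j S j); first by rewrite ltr_wpDr // sumr_ge0 // => j _; exact: sumr_ge0.
have S0 j : 0 <= S j by exact: sumr_ge0.
have C0 : 0 <= 1 + \sum_j S j by rewrite addr_ge0 // sumr_ge0.
move=> x; apply/rV_normP; first by rewrite mulr_ge0.
move=> j; rewrite mxE; apply: le_trans (lform_le (fun i => B i j) x) _.
apply: ler_wpM2r => //; rewrite -/(S j) (bigD1 j) //= addrCA lerDl addr_ge0 // sumr_ge0 //.
Qed.

(* A minimum of |F t - y|^2 interior to a small ball is a zero, the Jacobian being invertible there. *)
Lemma locally_onto n (F : 'rV[R]_n -> 'rV[R]_n) (P : 'I_n -> 'I_n -> 'rV[R]_n -> R) :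
  F 0 = 0 -> (forall j, smooth_on setT (fun t => F t ord0 j)) ->
  (forall i j, smooth_on setT (P i j)) ->
  (forall i j t, is_derive t (evec i : 'rV[R]_n) (fun t => F t ord0 j) (P i j t)) ->
  (\matrix_(i, j) P i j 0) \in unitmx ->
  exists rho r : R, [/\ 0 < rho, 0 < r & forall y, `|y| <= r -> exists2 t, `|t| <= rho & F t = y].
Proof.
move=> F0 sF sP dF uJ.
pose J t : 'M[R]_n := \matrix_(i, j) P i j t.
have [C C0 hC] := mulmx_norm_le (invmx (J 0)).
have cP i j : continuous (P i j) by move=> t; exact: (smooth_cont (sP i j) I).
have cdet : continuous (fun t => \det (J t)).
  have sd : smooth_on setT (fun t => \det (J t)).
    rewrite /determinant; apply: (smooth_sum openT) => s.
    apply: (smoothZ openT); apply: (smooth_prod openT) => i.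
    have h k : smooth_on setT (fun t => J t i k).
      by apply: (smooth_eq openT _ (sP i k)) => t _; rewrite mxE.
    exact: h.
  by move=> t; exact: (smooth_cont sd I).
(* With this e, replacing the Jacobian by its value at 0 costs at most half of |t| in the lower
   bound [low]. *)
pose e : R := (2 * C * (n%:R + 1))^-1.
have n1 : 0 < n%:R + 1 :> R by rewrite ltr_wpDl.
have e0 : 0 < e by rewrite invr_gt0 !mulr_gt0.
have [rho rho0 hrho] : exists2 rho : R, 0 < rho & forall t : 'rV[R]_n, `|t| <= rho ->
    \det (J t) != 0 /\ forall i j, `|P i j t - P i j 0| <= e.
  have h : \forall t \near (0 : 'rV[R]_n), \det (J t) != 0 /\ forall i j, `|P i j t - P i j 0| <= e.
    apply: filterI; last first.
      apply: (near_forall (Q := fun i t => forall j, `|P i j t - P i j 0| <= e)) => i.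
      apply: (near_forall (Q := fun j t => `|P i j t - P i j 0| <= e)) => j.
      have /cvgrPdist_le /(_ e e0) := cP i j 0.
      by apply: filterS => t; rewrite distrC.
    have d0 : 0 < `|\det (J 0)| by rewrite normr_gt0; move: uJ; rewrite unitmxE unitfE.
    have /cvgrPdist_lt /(_ _ d0) := cdet 0.
    by apply: filterS => t; apply: contraTneq => ->; rewrite subr0 ltxx.
  have /nbhs_ballP [r /= r0 hr] := h.
  exists (r / 2); first exact: divr_gt0.
  move=> t tr; apply: hr; rewrite -ball_normE /ball_ /= sub0r normrN; apply: le_lt_trans tr _.
  by rewrite ltr_pdivrMr // ltr_pMr // ltr1n.
have low t : `|t| <= rho -> `|t| <= 2 * C * `|F t|.
  move=> tr.
  have /choice [s hs] : forall j, exists s : R, 0 <= s <= 1 /\ F t ord0 j = \sum_i t ord0 i * P i j (s *: t).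
    move=> j; have dj (s : R) : 0 <= s <= 1 -> derivable (fun t => F t ord0 j) (0 + (s * 1) *: t) t.
      by move=> _; apply: diff_derivable; exact: (smooth_diff openT (sF j) I).
    have [s s1] := MVT_line dj.
    rewrite scale1r !add0r F0 mxE subr0 mul1r mulr1 => E; exists s; split => //.
    rewrite E (smooth_deriveE openT t (sF j) I); apply: eq_bigr => i _.
    by have [_ ->] := dF i j (s *: t).
  have st j : `|s j *: t| <= rho.
    have [/andP[a b] _] := hs j; rewrite normrZ ger0_norm //; apply: le_trans tr.
    by rewrite ler_piMl.
  have E : F t - t *m J 0 = \row_j \sum_i t ord0 i * (P i j (s j *: t) - P i j 0).
    apply/rowP => j; rewrite rVD rVN (proj2 (hs j)) !mxE -sumrB; apply: eq_bigr => i _.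
    by rewrite mxE mulrBr.
  have Ele : `|F t - t *m J 0| <= n%:R * e * `|t|.
    rewrite E; apply/rV_normP; first by rewrite !mulr_ge0 // ltW.
    move=> j; rewrite mxE; apply: le_trans (ler_norm_sum _ _ _) _.
    rewrite -mulrA mulr_natl -[X in _ *+ X](card_ord n) -sumr_const; apply: ler_sum => i _.
    rewrite normrM mulrC ler_pM //; last exact: rV_coord_le.
    exact: (proj2 (hrho _ (st j))).
  have T : `|t| <= C * `|t *m J 0| by rewrite -{1}(mulmxK uJ t); exact: hC.
  have T2 : `|t *m J 0| <= `|F t| + n%:R * e * `|t|.
    rewrite (_ : t *m J 0 = F t - (F t - t *m J 0)); last by rewrite opprB addrC subrK.
    by apply: le_trans (ler_normB _ _) _; rewrite lerD2l.
  have ne : C * (n%:R * e) <= 1 / 2.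
    rewrite /e invfM mulrA [C * _]mulrC -!mulrA ler_pdivlMr //.
    rewrite (_ : _ * 2 = n%:R * (n%:R + 1)^-1); last by field; rewrite ?lt0r_neq0.
    by rewrite ler_pdivrMr // mul1r lerDl.
  have h : `|t| <= C * `|F t| + 1 / 2 * `|t|.
    apply: le_trans T _; apply: le_trans (ler_wpM2l (ltW C0) T2) _.
    by rewrite mulrDr lerD2l !mulrA ler_wpM2r // -mulrA.
  by rewrite -mulrA; lra.
pose b := rho / (2 * C).
have b0 : 0 < b by rewrite divr_gt0 // mulr_gt0.
(* On the sphere |t| = rho some coordinate satisfies |F_j - y_j| >= b - r = (n + 1) r, while [phi]
   at 0 is at most n r^2: the minimum is not on the sphere. *)
pose r := b / (n%:R + 2).
have n2 : 0 < n%:R + 2 :> R by rewrite ltr_wpDl.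
have r0 : 0 < r by rewrite divr_gt0.
exists rho, r; split=> // y yr.
pose phi t := \sum_j (F t ord0 j - y ord0 j) ^+ 2.
have dphi i t : is_derive t (evec i : 'rV[R]_n) phi (2 * \sum_j P i j t * (F t ord0 j - y ord0 j)).
  have d j : is_derive t (evec i : 'rV[R]_n) (fun t => (F t ord0 j - y ord0 j) ^+ 2) (2 * (P i j t * (F t ord0 j - y
    ord0 j))).
    have d1 : is_derive t (evec i : 'rV[R]_n) (fun t => F t ord0 j - y ord0 j) (P i j t).
      by have := is_deriveB (dF i j t) (is_derive_cst (y ord0 j) t (evec i : 'rV[R]_n)); rewrite subr0.
    rewrite (_ : (fun t => _) = fun t => (F t ord0 j - y ord0 j) * (F t ord0 j - y ord0 j)); last first.
      by apply/funext => u; rewrite expr2.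
    by apply: (is_derive_eq (is_derive_mulf d1 d1)); ring.
  by apply: (is_derive_eq (is_derive_sumf d)); rewrite mulr_sumr.
have cphi : continuous phi.
  have sphi : smooth_on setT phi.
    apply: (smooth_sum openT) => j.
    have s1 := smoothB openT (sF j) (smooth_cst openT (y ord0 j)).
    by apply: (smooth_eq openT _ (smoothM openT s1 s1)) => t _; rewrite expr2.
  by move=> t; exact: (smooth_cont sphi I).
pose B := [set t : 'rV[R]_n | `|t| <= rho].
have [c /set_mem cB cmin] : exists2 c, c \in B & forall t, t \in B -> phi c <= phi t.
  apply: EVT_min_rV; [|exact: closed_ball0_compact|exact: continuous_subspaceT].
  by exists 0; rewrite /B /= normr0 ltW.
have clt : `|c| < rho.
  rewrite lt_neqAle cB andbT; apply/eqP => ce.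
  have bF : b <= `|F c|.
    by rewrite /b ler_pdivrMr ?mulr_gt0 // mulrC -ce; exact: low.
  have [j bj] : exists j, b <= `|F c ord0 j|.
    apply/not_existsP => h; move: bF; apply/negP; rewrite -ltNge.
    pose M := \big[Num.max/0]_j `|F c ord0 j|.
    apply: (@le_lt_trans _ _ M).
      apply/rV_normP => [|i]; first exact: bigmax_ge_id.
      exact: (le_bigmax _ (fun j => `|F c ord0 j|)).
    by apply/bigmax_ltP; split => // i _; rewrite ltNge; apply/negP => /h.
  have h1 : phi c <= n%:R * r ^+ 2.
    have := cmin 0; rewrite inE /B /= normr0 (ltW rho0) => /(_ isT) h; apply: le_trans h _.
    rewrite mulr_natl -[X in _ *+ X](card_ord n) -sumr_const; apply: ler_sum => i _.
    rewrite F0 mxE sub0r sqrrN -[_ ^+ 2]real_normK ?num_real // lerXn2r ?nnegrE ?(ltW r0) //.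
    exact: le_trans (rV_coord_le y i) yr.
  have h2 : ((n%:R + 1) * r) ^+ 2 <= phi c.
    rewrite /phi (bigD1 j) //= -[leLHS]addr0 lerD //; last by apply: sumr_ge0 => i _; exact: sqr_ge0.
    have nr0 : 0 <= (n%:R + 1) * r by apply: mulr_ge0; exact: ltW.
    rewrite -[leRHS]real_normK ?num_real // lerXn2r ?nnegrE //.
    have br : b = (n%:R + 2) * r by rewrite /r mulrC divfK // lt0r_neq0.
    have yj : `|y ord0 j| <= r by exact: le_trans (rV_coord_le y j) yr.
    have := lerB_dist (F c ord0 j) (y ord0 j); rewrite br in bj; lra.
  have := le_trans h2 h1; rewrite exprMn ler_pM2r ?exprn_gt0 //.
  have : 0 <= n%:R :> R by []. nra.
exists c; first exact: ltW.
have grad i : \sum_j P i j c * (F c ord0 j - y ord0 j) = 0.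
  have dl (s : R) := derivable_line (@ex_derive _ _ _ _ _ _ _ (dphi i (c + s *: evec i))).
  have d1 : is_derive (0 : R) (1 : R) (fun s : R => phi (c + s *: evec i)) (2 * \sum_j P i j c * (F c ord0 j - y ord0
    j)).
    by have := dl 0; have [_ ->] := dphi i (c + 0 *: evec i); rewrite scale0r addr0.
  pose d := (rho - `|c|) / 2.
  have dpos : 0 < d by rewrite divr_gt0 // subr_gt0.
  have d2 : is_derive (0 : R) (1 : R) (fun s : R => phi (c + s *: evec i)) 0.
    apply: (@derive1_at_min R _ (- d) d 0).
    - by rewrite -subr_ge0 opprK addr_ge0 // ltW.
    - by move=> t _; case: (dl t).
    - by rewrite in_itv /= oppr_lt0 dpos.
    - move=> t; rewrite in_itv /= scale0r addr0 -ltr_norml => td; apply: cmin.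
      rewrite inE /B /=; apply: le_trans (ler_normD _ _) _; rewrite normrZ.
      have te : `|t| * `|evec i : 'rV[R]_n| <= `|t| by rewrite ler_piMr // norm_evec.
      by rewrite /d in td; lra.
  by have /eqP := is_derive_val_uniq d1 d2; rewrite mulf_eq0 pnatr_eq0 /= => /eqP.
apply/rowP => j; apply/eqP; rewrite -subr_eq0; apply/eqP.
have uc : J c \in unitmx by rewrite unitmxE unitfE; exact: (proj1 (hrho c cB)).
pose z : 'cV[R]_n := \col_j (F c ord0 j - y ord0 j).
have z0 : z = 0.
  rewrite -(mulKmx uc z) (_ : J c *m z = 0) ?mulmx0 //.
  by apply/colP => i; rewrite mxE [RHS]mxE -[RHS](grad i); apply: eq_bigr => k _; rewrite !mxE.
by have := congr1 (fun z : 'cV[R]_n => z j ord0) z0; rewrite !mxE.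
Qed.

End LocalSurjectivity.

(** * Chow's theorem *)

Section Chow.
Context {R : realType} {N : nat} (G : carnot R N).
Local Notation V := 'rV[R]_N.
Local Notation mul := (carnot_mul G).
Local Notation deg := (carnot_deg G).
Implicit Types (x y z u v p q a : V).

Lemma free_seq_of_span (P : V -> Prop) :
  (forall W : {vspace V}, (forall v, P v -> v \in W) -> W = fullv) ->
  forall k, (k <= N)%N -> exists X : seq V, [/\ free X, size X = k & forall v, v \in X -> P v].
Proof.
move=> span; elim=> [_|k IH kN]; first by exists [::]; split => //; exact: nil_free.
have [X [fX sX PX]] := IH (ltnW kN).
have [v [Pv vX]] : exists v, P v /\ v \notin <<X>>%VS.
  apply/not_existsP => h; have := span <<X>>%VS.
  have H v : P v -> v \in <<X>>%VS by move=> Pv; apply/negPn/negP => vX; exact: (h v).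
  move=> /(_ H) /(congr1 (fun W : {vspace V} => \dim W)); move/eqP: fX => ->.
  by rewrite dimvf /dim /= mul1n sX => E; rewrite E ltnn in kN.
exists (v :: X); split; first by rewrite free_cons vX.
  by rewrite /= sX.
by move=> w; rewrite inE => /orP[/eqP ->|/PX].
Qed.

Lemma free_unitmx (X : N.-tuple V) : free X -> (\matrix_(i, j) X`_i ord0 j : 'M[R]_N) \in unitmx.
Proof.
move=> /freeP fX; rewrite -row_free_unit -kermx_eq0; apply/eqP/row_matrixP => i; rewrite row0.
set B := (X in kermx X); set t := row i (kermx B).
have tB : t *m B = 0 by rewrite /t -row_mul mulmx_ker row0.
apply/rowP => j; rewrite [RHS]mxE; apply: (fX (fun j => t ord0 j)).
apply: etrans tB; apply/rowP => k; rewrite summxE [RHS]mxE; apply: eq_bigr => l _.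
by rewrite rVZ [B _ _]mxE.
Qed.

Section Product.
Variable b : 'I_N -> V.

Definition prodm (r : seq 'I_N) (t : V) : V := foldr (fun i p => mul (t ord0 i *: b i) p) 0 r.

Lemma prodm_smooth r j : smooth_on setT (fun t => prodm r t ord0 j).
Proof.
elim: r j => [|i r IH] j /=.
  by apply: (smooth_eq openT _ (smooth_cst openT 0)) => t _; rewrite mxE.
have sh k : smooth_on setT (fun t : V => row_mx (t ord0 i *: b i) (prodm r t) ord0 k).
  case: (split_ordP k) => l ->.
    apply: (smooth_eq openT _ (smoothM openT (smooth_coord openT i) (smooth_cst openT (b i ord0 l)))) => t _.
    by rewrite row_mxEl rVZ.
  by apply: (smooth_eq openT _ (IH l)) => t _; rewrite row_mxEr.
apply: (smooth_eq openT _ (smooth_comp openT openT sh (fun _ _ => I) (mulc_smooth G j))) => t _ /=.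
by rewrite mulcE.
Qed.

Lemma prodm_line r i (s : R) : uniq r -> prodm r (s *: evec i) = if i \in r then s *: b i else 0.
Proof.
elim: r => //= k r IH /andP[kr ur]; rewrite IH // rVZ evecE inE.
case: eqVneq => [ik|ik] /=; last by rewrite mulr0 scale0r carnot_mul0x.
by rewrite ik mulr1 (negbTE kr) carnot_mulx0.
Qed.

End Product.

(** A basis is chosen among the vectors Ad g (e_j) with g reachable. Following a route to g, then s
    e_j, then the route backwards, one reaches s Ad g (e_j) at the cost |s| + 2 cost(g); the product
    of these N moves has an invertible differential at 0. *)
Lemma chow_unit : exists C r : R, [/\ 0 < C, 0 < r & forall y, `|y| <= r ->
  exists l, [/\ horizontal G l, route G 0 l = y & cost l <= C]].
Proof.
pose P v := exists g j, [/\ reachable G g, deg j = 1%N & v = Ad G g (evec j)].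
have [X [fX sX PX]] : exists X : seq V, [/\ free X, size X = N & forall v, v \in X -> P v].
  apply: (@free_seq_of_span P _ N (leqnn _)) => W hW; apply: (@Ad_reachable_span _ _ G) => g j rg dj.
  by apply: hW; exists g, j.
pose b (i : 'I_N) := X`_i.
have hb i : exists l, horizontal G l /\ forall s : R, exists l', [/\ horizontal G l',
  route G 0 l' = s *: b i & cost l' = 2 * cost l + `|s|].
  have [g [j [[l hl lg] dj E]]] : P (b i) by apply: PX; rewrite mem_nth ?sX.
  exists l; split => // s; exists (l ++ (s, j) :: back l); split.
  - by rewrite /horizontal all_cat /= dj -!/(horizontal G _) horizontal_back hl.
  - rewrite route_cat /= route_mul route_back lg -[mul _ _]/(conj G g (s *: evec j)) conjE E.
    by have := Ad_lin G g s (evec j) 0; rewrite (_ : Ad G g 0 = 0) ?addr0 // -conjE conj0.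
  - by rewrite cost_cat /cost big_cons /= -/(cost (back l)) cost_back -/(cost l); ring.
have [l /all_and2 [hl hs]] := choice hb.
pose F := prodm b (enum 'I_N).
have [Pd PdE] : exists Pd : 'I_N -> 'I_N -> V -> R, forall i j t, Pd i j t = 'D_(evec i) (fun t => F t ord0 j) t.
  by exists (fun i j t => 'D_(evec i) (fun t => F t ord0 j) t).
have sF j : smooth_on setT (fun t => F t ord0 j) by exact: prodm_smooth.
have sP i j : smooth_on setT (Pd i j).
  by rewrite (_ : Pd i j = pd i (fun t => F t ord0 j)); [exact: (smooth_pd i (sF j))|apply/funext => t; rewrite PdE].
have dF i j t : is_derive t (evec i : V) (fun t => F t ord0 j) (Pd i j t).
  by split; [exact: (smooth_derivable (sF j) I)|rewrite PdE].
have Pd0 i j : Pd i j 0 = b i ord0 j.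
  have dl := derivable_line (V := V) (W := R) (f := fun t => F t ord0 j) (x := 0) (v := evec i) (t := 0).
  have d1 : is_derive (0 : R) (1 : R) (fun s : R => F (0 + s *: evec i) ord0 j) (Pd i j 0).
    by rewrite PdE; move: dl; rewrite scale0r addr0; apply; case: (dF i j 0).
  have d2 : is_derive (0 : R) (1 : R) (fun s : R => F (0 + s *: evec i) ord0 j) (b i ord0 j).
    have := is_derive_coord j (is_derive_scale (b i) (0 : R)).
    congr is_derive; apply/funext => s.
    by rewrite add0r /F prodm_line ?enum_uniq // mem_enum.
  exact: is_derive_val_uniq d1 d2.
have F0 : F 0 = 0.
  have : F (0 *: 0) = 0.
    rewrite /F; elim: (enum 'I_N) => //= i r ->.
    by rewrite carnot_mulx0 rVZ mul0r scale0r.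
  by rewrite scale0r.
have uJ : (\matrix_(i, j) Pd i j 0) \in unitmx.
  have := @free_unitmx (Tuple (introT eqP sX)) fX.
  by congr (_ \in unitmx); apply/matrixP => i j; rewrite !mxE Pd0.
have [rho [r [rho0 r0 hr]]] := locally_onto F0 sF sP dF uJ.
exists (1 + \sum_i (2 * cost (l i) + rho)), r; split => //.
  rewrite ltr_wpDr // sumr_ge0 // => i _.
  by rewrite addr_ge0 ?(ltW rho0) // mulr_ge0 // /cost sumr_ge0.
move=> y yr; have [t tr <-] := hr y yr.
suff [k [hk rk ck]] : exists k, [/\ horizontal G k,
  route G 0 k = F t & cost k <= \sum_(i <- enum 'I_N) (2 * cost (l i) + rho)].
  by exists k; split => //; apply: le_trans ck _; rewrite big_enum /= lerDr.
rewrite /F; elim: (enum 'I_N) => [|i e [k [hk rk ck]]] /=.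
  by exists [::]; rewrite /cost !big_nil.
have [k' [hk' rk' ck']] := hs i (t ord0 i).
exists (k' ++ k); split.
- by move: hk hk'; rewrite /horizontal all_cat => -> ->.
- by rewrite route_cat route_mul rk' rk.
- rewrite cost_cat ck' big_cons lerD // lerD2l; exact: le_trans (rV_coord_le t i) tr.
Qed.

Lemma dilationM (s t : R) x : dilation G s (dilation G t x) = dilation G (s * t) x.
Proof. by apply/rowP => j; rewrite !dilationE exprMn mulrA. Qed.

Lemma dilation1 x : dilation G 1 x = x.
Proof. by apply/rowP => j; rewrite dilationE expr1n mul1r. Qed.

Lemma dilation_norm_le (s : R) x : 0 <= s <= 1 -> `|dilation G s x| <= s * `|x|.
Proof.
move=> /andP[s0 s1]; apply/rV_normP; first exact: mulr_ge0.
move=> j; rewrite dilationE normrM ger0_norm ?exprn_ge0 //.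
apply: ler_pM; rewrite ?exprn_ge0 ?normr_ge0 //; last exact: rV_coord_le.
by rewrite -[X in _ <= X]expr1; apply: ler_wiXn2l => //; exact: deg_gt0.
Qed.

(* Gauge balls of the dilations, comparable to the balls of cc_dist. *)
Definition box (r : R) x : bool := `|dilation G r^-1 x| <= 1.

(** [chow_unit] transported by a dilation, which multiplies costs by the ratio; e' shrinks the unit
    box into the ball where [chow_unit] applies. *)
Lemma cc_set_box : exists2 C : R, 0 < C & forall (r : R) x y, 0 < r -> box r (mul (- x) y) ->
  exists2 T : R, cc_set G x y T & T <= C * r.
Proof.
have [C [e [C0 e0 h]]] := chow_unit.
pose e' := Num.min e 1; have e'0 : 0 < e' by rewrite lt_min e0 /=.
have e'1 : 0 <= e' <= 1 by rewrite (ltW e'0) ge_min lexx orbT.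
exists (C / e'); first exact: divr_gt0.
move=> r x y r0 bx.
have /h [l [hl rl cl]] : `|dilation G e' (dilation G r^-1 (mul (- x) y))| <= e.
  apply: le_trans (dilation_norm_le _ e'1) _; apply: (@le_trans _ _ e'); last by rewrite ge_min lexx.
  by rewrite ler_piMr // ltW.
pose s := r / e'; have s0 : 0 < s by exact: divr_gt0.
have hs : horizontal G [seq (s * m.1, m.2) | m <- l].
  by move: hl; rewrite /horizontal all_map; apply: sub_all => m.
have E : route G x [seq (s * m.1, m.2) | m <- l] = y.
  rewrite route_mul route_dilate // rl !dilationM /s -!mulrA (mulrA e'^-1) mulVf ?gt_eqF // mul1r divff ?gt_eqF //.
  by rewrite dilation1 mulxK.
exists (s * cost l); first by have := route_cc x hs; rewrite E cost_dilate gtr0_norm.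
rewrite (_ : C / e' * r = s * C); first by rewrite ler_pM2l.
by rewrite /s [LHS]mulrC -mulrA (mulrC _ C).
Qed.

Lemma cc_dist_box : exists2 C : R, 0 < C & forall (r : R) x y, 0 < r -> box r (mul (- x) y) ->
  cc_dist G x y <= C * r.
Proof.
have [C C0 h] := cc_set_box; exists C => // r x y r0 b.
by have [T hT] := h r x y r0 b; apply: le_trans; exact: cc_dist_le.
Qed.

Lemma cc_set_neq0 x y : exists T, cc_set G x y T.
Proof.
have [C C0 h] := cc_set_box; pose r := 1 + `|mul (- x) y|.
have r1 : 1 <= r by rewrite lerDl.
have r0 : 0 < r by exact: lt_le_trans r1.
have [T hT _] : exists2 T : R, cc_set G x y T & T <= C * r; last by exists T.
apply: h => //; rewrite /box; apply: le_trans (dilation_norm_le _ _) _.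
  by rewrite invr_ge0 (ltW r0) invf_le1.
by rewrite mulrC ler_pdivrMr // mul1r lerDr.
Qed.

End Chow.

(** * Lipschitz estimates from horizontal derivatives *)

Section LipschitzFromHorizontal.
Context {R : realType} {N : nat} (G : carnot R N).
Local Notation V := 'rV[R]_N.
Local Notation mul := (carnot_mul G).
Local Notation deg := (carnot_deg G).
Implicit Types (x y z v p q a : V) (u : V -> R).

Lemma cont_sum (T : topologicalType) (I : Type) (r : seq I) (F : I -> T -> R) :
  (forall i, continuous (F i)) -> continuous (fun t : T => \sum_(i <- r) F i t).
Proof.
move=> cF; elim: r => [|i r IH] x.
  by rewrite (_ : (fun t : T => _) = cst 0); [exact: cvg_cst|by apply/funext => t; rewrite big_nil].
rewrite (_ : (fun t : T => _) = fun t => F i t + \sum_(k <- r) F k t); last by apply/funext => t; rewrite big_cons.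
exact: (continuousD (cF i x) (IH x)).
Qed.

Lemma ae_meets (P : R -> Prop) (c r : R) : {ae @lebesgue_measure R, forall t : R, P t} -> 0 < r ->
  exists2 t : R, `|c - t| < r & P t.
Proof.
move=> [M [mM M0 PM]] r0; apply/not_exists2P => h.
have sub : `]c - r, c + r[%classic `<=` M.
  move=> t; rewrite /= in_itv /= => /andP[a b]; apply: PM => /= Pt.
  by case: (h t) => // H; apply: H; rewrite distrC ltr_norml; apply/andP; split; lra.
have : (@lebesgue_measure R `](c - r)%R, (c + r)%R[%classic <= @lebesgue_measure R M)%E.
  by apply: le_measure => //; rewrite inE; [exact: measurable_itv|exact: mM].
rewrite M0 lebesgue_measure_itv /= lte_fin; case: ifP => [_|].
  by rewrite -EFinB lee_fin; lra.
by move=> /negbT; rewrite -leNgt => + _; lra.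
Qed.

Lemma grad_witness u : {g : V -> V | forall p k, g p ord0 k = 'D_(evec k) u p}.
Proof. by exists (fun p => \row_k 'D_(evec k) u p) => p k; rewrite mxE. Qed.

Definition grad u := sval (grad_witness u).

Lemma gradE u p k : grad u p ord0 k = 'D_(evec k) u p.
Proof. by rewrite /grad; case: (grad_witness u). Qed.

Lemma grad_is_derive u (h : R -> V) (t : R) (h' : V) : smooth_on setT u -> is_derive t 1 h h' ->
  is_derive t 1 (fun s => u (h s)) (dotv h' (grad u (h t))).
Proof.
move=> su dh.
have dj j := is_derive_coord j dh.
have := @chain_rV R R N h u t 1 (fun j => @ex_derive _ _ _ _ _ _ _ (dj j)) (smooth_diff openT su I).
move=> H; apply: (is_derive_eq H); apply: eq_bigr => j _; rewrite gradE; have [_ ->] := dj j.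
by [].
Qed.

(* X_j u, for the left-invariant field X_j equal to evec j at 0. *)
Definition Xd (j : 'I_N) u p : R := dotv (dL G p 0 (evec j)) (grad u p).

Lemma Xd_is_derive j u p : smooth_on setT u -> is_derive (0 : R) (1 : R) (fun s : R => u (mul p (s *: evec j))) (Xd j
  u p).
Proof.
move=> su; have := grad_is_derive su (mulr_scale_is_derive G p (evec j)).
by rewrite scale0r carnot_mulx0.
Qed.

(** The subunit condition with xi the gradient of u bounds the derivative of u along the curve
    almost everywhere. On a smooth piece this derivative is continuous and an open interval is not
    negligible, so the bound also holds at the mean value point. The constant N comes from N B^2 <=
    (N B)^2. *)
Lemma lip_piece u (B T a b : R) (g h : R -> V) : smooth_on setT u -> 0 <= B ->
  (forall p j, deg j = 1%N -> `|Xd j u p| <= B) -> subunit G T g -> smooth_curve h ->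
  0 <= a -> a < b -> b <= T -> (forall t : R, a <= t <= b -> g t = h t) ->
  `|u (h b) - u (h a)| <= N%:R * B * (b - a).
Proof.
move=> su B0 hB sg sh a0 ab bT gh.
have dh (t : R) : is_derive t 1 h (derive1 h t) by split; [have := sh 0%N t; rewrite derive1n0|rewrite derive1E].
pose f' (t : R) := dotv (derive1 h t) (grad u (h t)).
have df (t : R) : is_derive t 1 (fun s => u (h s)) (f' t) by exact: grad_is_derive.
have ch : continuous h by move=> t; apply: differentiable_continuous; apply/derivable1_diffP; case: (dh t).
have cf' : continuous f'.
  apply: cont_sum => k t; apply: continuousM.
    have c1 : {for t, continuous (derive1 h)}.
      by apply: differentiable_continuous; apply/derivable1_diffP; have := sh 1%N t; rewrite derive1n1.
    exact: (@continuous_comp _ _ _ (derive1 h) (fun y : V => y ord0 k) t c1 (smooth_cont (smooth_coord openT k) I)).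
  rewrite (_ : (fun s => _) = (pd k u) \o h); last by apply/funext => s /=; rewrite gradE.
  exact: (@continuous_comp _ _ _ h (pd k u) t (ch t) (smooth_cont (smooth_pd k su) I)).
have cuh : {within `[a, b], continuous (fun s => u (h s))}.
  apply: continuous_subspaceT => t.
  by apply: differentiable_continuous; apply/derivable1_diffP; case: (df t).
have [c cab ->] := MVT ab (fun t _ => df t) cuh.
move: cab; rewrite in_itv /= => /andP[ac cb].
have ba : 0 < b - a by rewrite subr_gt0.
rewrite normrM (gtr0_norm ba) ler_pM2r //.
rewrite leNgt; apply/negP => big.
pose e := `|f' c| - N%:R * B; have e0 : 0 < e by rewrite subr_gt0.
have /cvgrPdist_lt /(_ _ e0) /nbhs_ballP [r /= r0 hr] := cf' c.
pose r' := Num.min r (Num.min (c - a) (b - c)).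
have r'0 : 0 < r' by rewrite !lt_min r0 !subr_gt0 ac cb.
have [t tc St] := ae_meets c sg r'0.
move: tc; rewrite !lt_min => /and3P[t1 t2 t3].
have ta : a < t by move: t2; rewrite ltr_norml => /andP[_]; lra.
have tb : t < b by move: t3; rewrite ltr_norml => /andP[]; lra.
have ft : N%:R * B < `|f' t|.
  have := hr t t1; rewrite /= => H; have := lerB_dist (f' c) (f' t); rewrite /e in H; lra.
have gt : g t = h t by rewrite gh // !ltW.
have dg : derive1 g t = derive1 h t.
  rewrite !derive1E; apply: near_eq_derive.
  near=> s; apply: gh; apply/andP; split; apply: ltW; near: s; [exact: lt_nbhsr|exact: lt_nbhsl].
have t0T : 0 <= t <= T by rewrite (le_trans a0 (ltW ta)) (le_trans (ltW tb) bT).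
have := St t0T (grad u (h t)); rewrite dg gt -/(f' t) leNgt => /negP; apply.
apply: (@le_lt_trans _ _ ((N%:R * B) ^+ 2)); last first.
  rewrite -[ltRHS]real_normK ?num_real // ltrXn2r ?nnegrE //=; exact: mulr_ge0.
apply: (@le_trans _ _ (\sum_(j < N) B ^+ 2)).
  rewrite big_mkcond /=; apply: ler_sum => j _; case: ifP => [/eqP dj|_]; last exact: sqr_ge0.
  rewrite left_inv_fieldE -/(Xd j u (h t)) -[leLHS]real_normK ?num_real // lerXn2r ?nnegrE //.
  exact: hB.
rewrite sumr_const card_ord exprMn -[leLHS]mulr_natl ler_wpM2r ?sqr_ge0 //.
rewrite -natrX ler_nat; case: (N) => // k; rewrite expnS leq_pmulr //= expn1 //.
Unshelve. all: by end_near. Qed.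

Lemma lip_cc u (B : R) : smooth_on setT u -> 0 <= B -> (forall p j, deg j = 1%N -> `|Xd j u p| <= B) ->
  forall x y, `|u x - u y| <= N%:R * B * cc_dist G x y.
Proof.
move=> su B0 hB x y.
have H T : cc_set G x y T -> `|u x - u y| <= N%:R * B * T.
  move=> [T0 [g [[cg [s [ps ls hs]]] <- <- sg]]].
  have srt : sorted <=%R (0 :: s) by apply: (sub_path _ ps) => a b /ltW.
  have nT i : (i <= size s)%N -> 0 <= nth 0 (0 :: s) i <= T.
    move=> si; apply/andP; split.
      by apply: (sorted_leq_nth le_trans lexx 0 srt 0%N i) => //; rewrite inE.
    by rewrite -ls (last_nth 0); apply: (sorted_leq_nth le_trans lexx 0 srt i (size s)) => //; rewrite inE /=.
  have K i : (i <= size s)%N -> `|u (g 0) - u (g (nth 0 (0 :: s) i))| <= N%:R * B * nth 0 (0 :: s) i.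
    elim: i => [_|i IH si]; first by rewrite subrr normr0 mulr0.
    have [h sh gh] := hs i si.
    have ab : nth 0 (0 :: s) i < nth 0 s i by move: ps => /(pathP 0); apply.
    have /andP[a0 _] := nT i (ltnW si); have /andP[_ bT] := nT i.+1 si.
    have := lip_piece su B0 hB sg sh a0 ab bT gh.
    rewrite -!gh ?lexx ?(ltW ab) // => P.
    have := IH (ltnW si) => Q.
    have -> : N%:R * B * nth 0 (0 :: s) i.+1 = N%:R * B * nth 0 (0 :: s) i + N%:R * B * (nth 0 s i - nth 0 (0 :: s)
      i) by rewrite -mulrDr subrKC.
    apply: le_trans (lerD Q P); rewrite [`|u (g (s`_i)) - _|]distrC /=.
    exact: ler_distD.
  by have := K (size s) (leqnn _); rewrite -(last_nth 0) ls.
(* The infimum over T is taken after division by N B; when that is 0, any admissible T will do. *)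
have [NB|NB] := eqVneq (N%:R * B) 0.
  by have [T hT] := cc_set_neq0 G x y; have := H T hT; rewrite NB !mul0r.
have NB0 : 0 < N%:R * B by rewrite lt_neqAle eq_sym NB mulr_ge0.
rewrite -ler_pdivrMl //; apply: lb_le_inf; first exact: cc_set_neq0.
by move=> T hT; rewrite ler_pdivrMl //; exact: H.
Qed.

(** X_j is left-invariant, and homogeneous of degree 1 since j has weight 1. *)
Lemma Xd_translate_dilate j u p a (s : R) : deg j = 1%N -> smooth_on setT u ->
  Xd j (fun q => u (dilation G s (mul a q))) p = s * Xd j u (dilation G s (mul a p)).
Proof.
move=> dj su.
have sv : smooth_on setT (fun q => u (dilation G s (mul a q))).
  exact: (smooth_translate G a (smooth_dilate G s su)).
apply: (is_derive_val_uniq (Xd_is_derive j p sv)).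
have E : (fun r : R => u (dilation G s (mul a (mul p (r *: evec j))))) =
    (fun r : R => u (mul (dilation G s (mul a p)) (r *: (s *: evec j)))).
  apply/funext => r; rewrite carnot_mulA dilation_mul; congr (u (mul _ _)).
  apply/rowP => k; rewrite dilationE !rVZ evecE; case: eqVneq => [<-|]; last by rewrite !mulr0.
  by rewrite dj expr1 !mulr1 mulrC.
rewrite E.
have d1 := grad_is_derive su (mulr_scale_is_derive G (dilation G s (mul a p)) (s *: evec j)).
apply: (is_derive_eq d1).
have -> : dL G (dilation G s (mul a p)) 0 (s *: evec j) = s *: dL G (dilation G s (mul a p)) 0 (evec j).
  by have := dL_lin G (dilation G s (mul a p)) 0 s (evec j) 0; rewrite dL0 !addr0.
by rewrite scale0r carnot_mulx0 dotvZl.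
Qed.

Lemma Xd_bounded u : test_fun setT u -> exists2 A : R, 0 <= A & forall j p, `|Xd j u p| <= A.
Proof.
move=> tu; have su := test_smooth tu.
have cX j : continuous (Xd j u).
  have sL k : smooth_on setT (fun p => dL G p 0 (evec j) ord0 k).
    apply: (smooth_eq openT (f := fun p => 'D_(evec (rshift N j)) (mulc G k) (row_mx p 0))).
      by move=> p _; rewrite mxE (bigD1 j) //= evecE eqxx mul1r big1 ?addr0 // => i /negbTE ij;
        rewrite evecE eq_sym ij mul0r.
    apply: (@smooth_comp R N (N + N) setT setT (fun p => row_mx p 0) openT openT _ (fun _ _ => I) _ (smooth_pd
      (rshift N j) (mulc_smooth G k))) => i.
    case: (split_ordP i) => l ->.
      by apply: (smooth_eq openT _ (smooth_coord openT l)) => p _; rewrite row_mxEl.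
    by apply: (smooth_eq openT _ (smooth_cst openT 0)) => p _; rewrite row_mxEr mxE.
  have sX : smooth_on setT (Xd j u).
    apply: (smooth_sum openT) => k; apply: (smoothM openT (sL k)).
    by apply: (smooth_eq openT _ (smooth_pd k su)) => p _; rewrite gradE.
  by move=> p; exact: (smooth_cont sX I).
have [A [A0 _ zA]] := test_ccont tu.
have B j : exists M : R, 0 <= M /\ forall p, `|p| <= A -> `|Xd j u p| <= M.
  by have [M M0 h] := continuous_bounded_ball A (cX j); exists M.
have [M hM] := choice B.
have M0 j : 0 <= M j by case: (hM j).
exists (\sum_j M j); first exact: sumr_ge0.
move=> j p; have [pA|pA] := lerP `|p| A.
  apply: (le_trans (proj2 (hM j) p pA)); rewrite (bigD1 j) //= lerDl; exact: sumr_ge0.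
rewrite (_ : Xd j u p = 0) ?normr0 ?sumr_ge0 //.
rewrite /Xd /dotv big1 // => k _; rewrite gradE.
pose U := [set q : V | A < `|q|].
have oU : open U by apply: (@open_comp _ _ (fun q : V => `|q|) [set r | A < r]); [move=> ? _;
  exact: norm_continuous|exact: open_gt].
have e : forall q, U q -> u q = (fun=> 0) q by move=> q /ltW; exact: zA.
by rewrite (eq_on_pd (evec k) oU pA e) derive_cst mulr0.
Qed.

(** [lip_cc] is tested on a cutoff at scale rho around x: its horizontal derivatives are at most A /
    rho, it is 1 at x, and it vanishes at y when the dilate of - x y has norm at least 2; with rho =
    (N A + 1) r such a y is at distance at least r. *)
Lemma box_cc_dist : exists2 C : R, 0 < C & forall (r : R) x y, 0 < r -> cc_dist G x y < r ->
  box G (C * r) (mul (- x) y).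
Proof.
have tc : test_fun setT (@chi R N).
  by apply: (@testI R N 2); [exact: chi_smooth|move=> x; exact: chi_eq0].
have [A A0 hA] := Xd_bounded tc.
pose C := 2 * (N%:R * A + 1).
have NA : 0 <= N%:R * A by exact: mulr_ge0.
exists C; first by rewrite mulr_gt0 // ltr_wpDl.
move=> r x y r0 dr.
pose rho := (N%:R * A + 1) * r.
have rho0 : 0 < rho by rewrite mulr_gt0 // ltr_wpDl.
pose u q := chi (dilation G rho^-1 (mul (- x) q)).
have su : smooth_on setT u by exact: (smooth_translate G (- x) (smooth_dilate G rho^-1 (@chi_smooth R N))).
have hu p j : deg j = 1%N -> `|Xd j u p| <= rho^-1 * A.
  move=> dj; rewrite (Xd_translate_dilate p (- x) rho^-1 dj (@chi_smooth R N)) normrM ger0_norm ?invr_ge0 ?(ltW rho0)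
    //.
  by rewrite ler_wpM2l ?hA // invr_ge0 ltW.
have B0 : 0 <= rho^-1 * A by rewrite mulr_ge0 // invr_ge0 ltW.
have := lip_cc su B0 hu x y.
rewrite {1}/u mulNx linear0 chi_eq1 ?normr0 // => H.
have lt2 : `|dilation G rho^-1 (mul (- x) y)| < 2.
  rewrite ltNge; apply/negP => ge2; move: H; rewrite /u chi_eq0 // subr0 normr1; apply/negP; rewrite -ltNge.
  apply: (@le_lt_trans _ _ (N%:R * (rho^-1 * A) * r)); first by apply: ler_wpM2l; [exact: mulr_ge0|exact: ltW].
  rewrite mulrCA -mulrA -ltr_pdivlMl ?invr_gt0 // invrK mulr1 /rho ltr_pM2r // ltrDl //.
rewrite /box (_ : (C * r)^-1 = 2^-1 * rho^-1); last by rewrite /C /rho -mulrA invfM.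
rewrite -dilationM; apply: le_trans (dilation_norm_le _ _ _) _; first by apply/andP; split; lra.
by rewrite -ler_pdivlMl ?invr_gt0 // invrK mulr1 ltW.
Qed.

End LipschitzFromHorizontal.

(** * Derivative bounds, gauge balls and ultralimits *)

Section DerivativeBounds.
Context {R : realType} {n : nat}.
Local Notation V := 'rV[R]_n.
Implicit Types (U : set V) (f g : V -> R).

Definition ckb m U (M : R) f : Prop := forall l x, (size l <= m)%N -> U x -> `|partials l f x| <= M.

Lemma ckb_pd m U M f i : ckb m.+1 U M f -> ckb m U M (pd i f).
Proof. by move=> h l x lm Ux; rewrite -partials_rcons; apply: h => //; rewrite size_rcons. Qed.

Lemma ckb_le m m' U U' M M' f : (m' <= m)%N -> U' `<=` U -> M <= M' -> ckb m U M f -> ckb m' U' M' f.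
Proof.
move=> mm UU MM h l x lm Ux; apply: le_trans MM; apply: h; first exact: leq_trans mm.
exact: UU.
Qed.

Lemma partials_eq l f g : f =1 g -> partials l f = partials l g.
Proof. by move=> /funext ->. Qed.

Lemma partialsD U f g l x : open U -> smooth_on U f -> smooth_on U g -> U x ->
  partials l (fun y => f y + g y) x = partials l f x + partials l g x.
Proof.
move=> oU; elim/last_ind: l f g => [//|l i IH] f g sf sg Ux.
rewrite !partials_rcons -(IH _ _ (smooth_pd i sf) (smooth_pd i sg) Ux).
apply: (eq_on_partials l oU _ Ux) => y Uy.
by rewrite deriveD //; [exact: (smooth_derivable sf Uy)|exact: (smooth_derivable sg Uy)].
Qed.

Lemma pdM U f g i x : smooth_on U f -> smooth_on U g -> U x ->
  pd i (fun y => f y * g y) x = pd i f x * g x + f x * pd i g x.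
Proof.
move=> sf sg Ux.
have df : is_derive x (evec i : V) f (pd i f x) by split => //; exact: (smooth_derivable sf Ux).
have dg : is_derive x (evec i : V) g (pd i g x) by split => //; exact: (smooth_derivable sg Ux).
by have [_ ->] := is_derive_mulf df dg.
Qed.

Lemma partialsM_rcons U f g l i x : open U -> smooth_on U f -> smooth_on U g -> U x ->
  partials (rcons l i) (fun y => f y * g y) x =
  partials l (fun y => pd i f y * g y) x + partials l (fun y => f y * pd i g y) x.
Proof.
move=> oU sf sg Ux; rewrite partials_rcons.
rewrite -(partialsD l oU (smoothM oU (smooth_pd i sf) sg) (smoothM oU sf (smooth_pd i sg)) Ux).
by apply: (eq_on_partials l oU _ Ux) => y Uy; exact: (pdM i sf sg Uy).
Qed.

(** Each derivative doubles the number of terms of the Leibniz formula, whence 2^m. *)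
Lemma ckbM U f g A B m : open U -> smooth_on U f -> smooth_on U g -> 0 <= A -> 0 <= B ->
  ckb m U A f -> ckb m U B g -> ckb m U (2 ^+ m * (A * B)) (fun y => f y * g y).
Proof.
move=> oU sf sg A0 B0 hf hg l x lm Ux.
apply: (@le_trans _ _ (2 ^+ size l * (A * B))); last first.
  by rewrite ler_wpM2r ?mulr_ge0 // ler_weXn2l // ler1n.
elim/last_ind: l m f g sf sg hf hg lm => [|l i IH] m f g sf sg hf hg lm.
  by rewrite mul1r /= normrM ler_pM //; [exact: (hf [::])|exact: (hg [::])].
case: m hf hg lm => [|m] hf hg; rewrite size_rcons // ltnS => lm.
rewrite (partialsM_rcons l i oU sf sg Ux) exprS -mulrA mulr_natl mulr2n.
apply: le_trans (ler_normD _ _) (lerD _ _).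
  exact: (IH m _ _ (smooth_pd i sf) sg (ckb_pd i hf) (ckb_le (leqnSn m) (fun _ h => h) (lexx _) hg) lm).
exact: (IH m _ _ sf (smooth_pd i sg) (ckb_le (leqnSn m) (fun _ h => h) (lexx _) hf) (ckb_pd i hg) lm).
Qed.

(** Only the Leibniz term in which g is not differentiated is free of e. A long product of such
    factors thus has a bounded C^m norm as soon as the numbers e have a bounded sum; see
    [ckb_prod]. *)
Lemma ckbM1 U f g M e m : open U -> smooth_on U f -> smooth_on U g -> 0 <= M -> 0 <= e ->
  ckb m U M f -> (forall x, U x -> `|g x| <= 1) ->
  (forall l x, (0 < size l <= m)%N -> U x -> `|partials l g x| <= e) ->
  ckb m U (M * (1 + 2 ^+ m * e)) (fun y => f y * g y).
Proof.
move=> oU sf sg M0 e0 hf g1 hg l x lm Ux.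
apply: (@le_trans _ _ (M * (1 + (2 ^+ size l - 1) * e))); last first.
  rewrite ler_wpM2l // lerD2l ler_wpM2r // lerBlDr; apply: (@le_trans _ _ (2 ^+ m)); last by rewrite lerDl.
  by rewrite ler_weXn2l // ler1n.
elim/last_ind: l m f sf hf hg lm => [|l i IH] m f sf hf hg lm.
  by rewrite subrr mul0r addr0 /= normrM ler_pM //; [exact: (hf [::])|exact: g1].
case: m hf hg lm => [|m] hf hg; rewrite size_rcons // ltnS => lm.
rewrite (partialsM_rcons l i oU sf sg Ux).
have hf' := ckb_le (leqnSn m) (fun _ h => h) (lexx _) hf.
have hgS k y : (0 < size k <= m)%N -> U y -> `|partials k g y| <= e.
  by case/andP => k0 km; apply: hg; rewrite k0 ltnW.
have h1 := IH m _ (smooth_pd i sf) (ckb_pd i hf) hgS lm.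
have hg' : ckb m U e (pd i g).
  by move=> k y km Uy; rewrite -partials_rcons; apply: hg => //; rewrite size_rcons.
have h2 := ckbM oU sf (smooth_pd i sg) M0 e0 (ckb_le lm (fun _ h => h) (lexx _) hf') (ckb_le lm (fun _ h => h) (lexx
  _) hg') (leqnn (size l)) Ux.
apply: le_trans (ler_normD _ _) (le_trans (lerD h1 h2) _).
by rewrite exprS; lra.
Qed.

Lemma smooth_ckb f (A : R) m : smooth_on setT f -> exists2 B : R, 0 <= B & ckb m [set x | `|x| <= A] B f.
Proof.
elim: m f => [|m IH] f sf.
  have [B B0 h] := continuous_bounded_ball A (smoothT_cont sf).
  by exists B => // -[|//] x _; exact: h.
have [B0 B00 h0] := continuous_bounded_ball A (smoothT_cont sf).
have /choice [B hB] : forall i, exists B : R, 0 <= B /\ ckb m [set x | `|x| <= A] B (pd i f).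
  by move=> i; have [B ? ?] := IH _ (smooth_pd i sf); exists B.
have S0 : 0 <= \sum_i B i by apply: sumr_ge0 => i _; case: (hB i).
exists (B0 + \sum_i B i); first exact: addr_ge0.
elim/last_ind => [|l i _] x lm xA; first by apply: le_trans (h0 x xA) _; rewrite lerDl.
rewrite partials_rcons; have [_ h] := hB i.
apply: (@le_trans _ _ (B i)); first by apply: h => //; move: lm; rewrite size_rcons.
rewrite (bigD1 i) //= addrCA lerDl addr_ge0 // sumr_ge0 // => j _; by case: (hB j).
Qed.

Lemma ckb_sum U (I : finType) (F : I -> V -> R) (B : I -> R) m : open U -> (forall i, smooth_on U (F i)) ->
  (forall i, ckb m U (B i) (F i)) -> ckb m U (\sum_i B i) (fun x => \sum_i F i x).
Proof.
move=> oU sF hF l x lm Ux.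
have E (r : seq I) : partials l (fun x => \sum_(i <- r) F i x) x = \sum_(i <- r) partials l (F i) x.
  elim: r => [|i r IH].
    rewrite big_nil (eq_on_partials (g := fun=> 0) l oU _ Ux) ?partials0 // => y _; exact: big_nil.
  rewrite big_cons -IH -(partialsD l oU (sF i) (smooth_sum oU r sF) Ux).
  by apply: (eq_on_partials l oU _ Ux) => y _; rewrite big_cons.
rewrite E; apply: le_trans (ler_norm_sum _ _ _) _; apply: ler_sum => i _; exact: hF.
Qed.

Lemma open_norm_lt (A : R) : @open V [set x : V | `|x| < A].
Proof. by apply: (@open_comp _ _ (fun q : V => `|q|) [set r | r < A]); [move=> ? _;
  exact: norm_continuous|exact: open_lt]. Qed.

Lemma ckb_comp (h : V -> V) (A : R) m : (forall j, smooth_on setT (fun y => h y ord0 j)) ->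
  exists2 C : R, 0 < C & forall f M, smooth_on setT f -> 0 <= M -> ckb m setT M f ->
    ckb m [set x | `|x| < A] (C * M) (fun x => f (h x)).
Proof.
move=> sh; elim: m => [|m [C C0 IH]].
  by exists 1 => // f M sf M0 hf [|//] x _ _; rewrite mul1r; exact: (hf [::]).
have /choice [B hB] : forall ij : 'I_n * 'I_n, exists B : R,
  0 <= B /\ ckb m [set x | `|x| <= A] B (pd ij.1 (fun y => h y ord0 ij.2)).
  by move=> ij; have [B ? ?] := smooth_ckb A m (smooth_pd ij.1 (sh ij.2)); exists B.
pose S := \sum_ij B ij; have S0 : 0 <= S by apply: sumr_ge0 => i _; case: (hB i).
exists (1 + 2 ^+ m * (n%:R * (S * C))).
  by rewrite ltr_wpDr // !mulr_ge0 // ltW.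
move=> f M sf M0 hf.
have oA := @open_norm_lt A.
elim/last_ind => [|l i _] x lm xA.
  apply: le_trans (hf [::] (h x) isT I) _; rewrite ler_peMl // lerDl !mulr_ge0 // ltW //.
rewrite partials_rcons; have {}lm : (size l <= m)%N by move: lm; rewrite size_rcons.
rewrite (partials_eq l (g := fun x => \sum_j pd i (fun y => h y ord0 j) x * pd j f (h x))); last first.
  by move=> y; have [_ ->] := pd_comp openT sh (fun _ _ => I) i sf (I : setT y).
have sc j : smooth_on [set x | `|x| < A] (fun x => pd j f (h x)).
  exact: (smooth_sub (@subsetT _ _) (smooth_comp openT openT sh (fun _ _ => I) (smooth_pd j sf))).
have sp j : smooth_on [set x | `|x| < A] (pd i (fun y => h y ord0 j)).
  exact: (smooth_sub (@subsetT _ _) (smooth_pd i (sh j))).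
apply: le_trans (_ : \sum_(j < n) 2 ^+ m * (S * (C * M)) <= _); last first.
  rewrite sumr_const card_ord -mulr_natl [leRHS]mulrDl mul1r -[leLHS]addr0 addrC lerD //.
  by rewrite le_eqVlt; apply/orP; left; apply/eqP; ring.
apply: (@ckb_sum _ _ _ (fun=> 2 ^+ m * (S * (C * M))) m oA _ _ l x lm xA) => j.
  exact: (smoothM oA (sp j) (sc j)).
apply: (ckbM oA (sp j) (sc j) S0 (mulr_ge0 (ltW C0) M0)).
  have [Bij0 hij] := hB (i, j); apply: (ckb_le (leqnn m) _ _ hij); first by move=> y /ltW.
  by rewrite /S (bigD1 (i, j)) //= lerDl; apply: sumr_ge0 => k _; case: (hB k).
by apply: (IH _ _ (smooth_pd j sf) M0) => k y km _; rewrite -partials_rcons; apply: hf => //; rewrite size_rcons.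
Qed.

End DerivativeBounds.

(** * Gauge balls *)

Section Boxes.
Context {R : realType} {N : nat} (G : carnot R N).
Local Notation V := 'rV[R]_N.
Local Notation mul := (carnot_mul G).
Local Notation dil := (dilation G).
Local Notation box := (box G).
Implicit Types (x y z p q a : V).

Lemma dilationN (t : R) x : dil t (- x) = - dil t x.
Proof. by apply/rowP => j; rewrite rVN !dilationE rVN mulrN. Qed.

Lemma dilK (t : R) x : t != 0 -> dil t (dil t^-1 x) = x.
Proof. by move=> t0; rewrite dilationM divff // dilation1. Qed.

Lemma dilVK (t : R) x : t != 0 -> dil t^-1 (dil t x) = x.
Proof. by move=> t0; rewrite dilationM mulVf // dilation1. Qed.

Lemma box_le (r s : R) x : 0 < r -> r <= s -> box r x -> box s x.
Proof.
move=> r0 rs bx; have s0 := lt_le_trans r0 rs.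
rewrite /box (_ : s^-1 = r / s * r^-1); last by rewrite mulrAC divff ?gt_eqF // mul1r.
rewrite -dilationM; apply: le_trans (dilation_norm_le _ _ _) _.
  by rewrite divr_ge0 ?(ltW r0) ?(ltW s0) // ler_pdivrMr // mul1r.
rewrite mulr_ile1 ?divr_ge0 ?(ltW r0) ?(ltW s0) //.
by rewrite ler_pdivrMr // mul1r.
Qed.

Lemma box0 (r : R) : box r 0.
Proof. by rewrite /box linear0 normr0. Qed.

Lemma boxN (r : R) x : box r (- x) <-> box r x.
Proof. by rewrite /box dilationN normrN. Qed.

Lemma box_dil (r s : R) x : s != 0 -> box r (dil s x) <-> box (r / s) x.
Proof. by move=> s0; rewrite /box dilationM invfM invrK. Qed.

Lemma norm_box (A : R) x : 1 <= A -> `|x| <= A -> box A x.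
Proof.
move=> A1 xA; have A0 : 0 < A by exact: lt_le_trans A1.
apply: le_trans (dilation_norm_le _ _ _) _; first by rewrite invr_ge0 (ltW A0) invf_le1.
by rewrite mulrC ler_pdivrMr // mul1r.
Qed.

Lemma box_norm (A : R) : 0 < A -> exists2 B : R, 0 < B & forall x, box A x -> `|x| <= B.
Proof.
move=> A0; have S0 : 0 <= \sum_j A ^+ carnot_deg G j by apply: sumr_ge0 => j _; rewrite exprn_ge0 // ltW.
exists (1 + \sum_j A ^+ carnot_deg G j); first by rewrite ltr_wpDr.
move=> x bx; apply/rV_normP; first exact: addr_ge0.
move=> j; rewrite -(dilK x (lt0r_neq0 A0)) dilationE normrM normrX gtr0_norm //.
apply: (@le_trans _ _ (A ^+ carnot_deg G j * 1)).
  by rewrite ler_wpM2l ?exprn_ge0 ?(ltW A0) //; exact: le_trans (rV_coord_le _ j) bx.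
rewrite mulr1 (bigD1 j) //= addrCA lerDl addr_ge0 // sumr_ge0 // => k _; rewrite exprn_ge0 // ltW //.
Qed.

Lemma box_mul : exists2 K : R, 1 <= K & forall (r : R) x y, 0 < r -> box r x -> box r y ->
  box (K * r) (mul x y).
Proof.
have [B B0 hB] := mul_bounded G 1.
have K1 : 1 <= Num.max 1 B by rewrite le_max lexx.
exists (Num.max 1 B) => // r x y r0 bx by_.
have := hB _ _ bx by_; rewrite -dilation_mul => h.
have := norm_box K1 (le_trans h _); rewrite le_max lexx orbT => /(_ isT).
by rewrite box_dil ?invrK // invr_neq0 // gt_eqF.
Qed.

Lemma mul_near_diag (c : V) : exists2 d : R, 0 < d & forall y z, `|c - y| < d -> `|c - z| < d -> `|mul (- y) z| <= 1.
Proof.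
have /cvgrPdist_le /(_ 1 ltr01) /nbhs_ballP [d /= d0 hd] := @mul2_continuous _ _ G (row_mx (- c) c).
exists (d / 2); first exact: divr_gt0.
move=> y z yc zc.
have : ball (row_mx (- c) c : 'rV[R]_(N + N)) d (row_mx (- y) z).
  rewrite -ball_normE /ball_ /= opp_row_mx add_row_mx.
  apply: (@le_lt_trans _ _ (d / 2)); last by rewrite ltr_pdivrMr // ltr_pMr // ltr1n.
  by apply: row_mx_norm_le; [rewrite -opprD normrN; exact: ltW|exact: ltW].
by move=> /hd /=; rewrite !row_mxKl !row_mxKr mulNx sub0r normrN.
Qed.

(** After translation by - a and dilation by 1/r the points lie in a fixed compact set. It is
    covered by finitely many balls in which any two points differ by an element of the unit box, so
    each ball receives at most one point. *)
Lemma box_packing (A : R) : 0 < A -> exists P : nat, forall (r : R) a (s : seq V), 0 < r -> uniq s ->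
  (forall y, y \in s -> box (A * r) (mul (- a) y)) ->
  (forall y z, y \in s -> z \in s -> y != z -> ~ box r (mul (- y) z)) -> (size s <= P)%N.
Proof.
move=> A0; have [B B0 hB] := box_norm A0.
have /choice [d hd] : forall c : V, exists d : R, 0 < d /\ forall y z, `|c - y| < d -> `|c - z| < d ->
  `|mul (- y) z| <= 1.
  by move=> c; have [d d0 h] := mul_near_diag c; exists d.
have [s0 _ cov] := ball_cover (@closed_ball0_compact R N B) (fun c _ => proj1 (hd c)).
exists (size s0) => r a s r0 us bs sep.
pose h y := dil r^-1 (mul (- a) y).
have nr : r^-1 != 0 by rewrite invr_neq0 // gt_eqF.
have /choice [f hf] : forall y, exists c, y \in s -> c \in s0 /\ `|c - h y| < d c.
  move=> y; have [ys|] := boolP (y \in s); last by exists 0.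
  have [|c cs cd] := cov (h y); last by exists c.
  by apply: hB; rewrite box_dil // invrK; exact: bs.
rewrite -(size_map f); apply: uniq_leq_size.
  rewrite map_inj_in_uniq // => y z ys zs fyz; apply/eqP/negPn/negP => /(sep y z ys zs); apply.
  have [_ hy] := hf y ys; have [_ hz] := hf z zs.
  rewrite fyz in hy; have := proj2 (hd (f z)) (h y) (h z) hy hz.
  by rewrite /box /h -dilationN -dilation_mul oppM opprK -carnot_mulA mulxK.
by move=> c /mapP [y ys ->]; case: (hf y ys).
Qed.

End Boxes.

Lemma ultra_fmap (S T : Type) (f : S -> T) (F : set_system S) : UltraFilter F -> UltraFilter (f @ F).
Proof.
move=> UF; have PF : ProperFilter F by case: UF.
split; first exact: fmap_proper_filter.
move=> G PG sub; apply/seteqP; split=> A; last exact: sub.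
move=> GA; have [//|FC] := in_ultra_setVsetC (f @^-1` A) UF.
have GC : G (~` A) by exact: sub.
have : G (A `&` ~` A) by apply: filterI.
by rewrite setICr => /filter_not_empty.
Qed.

(** * Limits along an ultrafilter *)

Section UltraLimits.
Context {R : realType}.
Implicit Types (u v : nat -> R).

Definition bdd u := exists M : R, forall n, `|u n| <= M.

(* Limits along a fixed ultrafilter replace the extraction of subsequences. *)
Lemma ultra_witness : {G : set_system nat | UltraFilter G /\ (\oo : set_system nat) `<=` G}.
Proof. exact: cid (ultraFilterLemma _). Qed.

Definition ultra : set_system nat := sval ultra_witness.

#[local] Instance ultra_proper : ProperFilter ultra.
Proof. by rewrite /ultra; case: ultra_witness => G [[]]. Qed.

Definition ulim u : R := lim (u @ ultra).

Lemma ultra_le (P : nat -> Prop) n0 : (forall n, (n0 <= n)%N -> P n) -> ultra P.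
Proof. by rewrite /ultra; case: ultra_witness => G [uG h] /= H; apply: h; exists n0. Qed.

Lemma ulimP u : bdd u -> u @ ultra --> ulim u.
Proof.
move=> [M hM].
have UU : UltraFilter (u @ ultra).
  rewrite /ultra; case: ultra_witness => G [uG h] /=; exact: ultra_fmap.
have [l [_ ul]] : `[- M, M]%classic `&` [set t | u @ ultra --> t] !=set0.
  have := @segment_compact R (- M) M; rewrite compact_ultra; apply => //.
  by apply: (ultra_le (n0 := 0)) => n _; rewrite /= in_itv /= -ler_norml.
by rewrite /ulim; apply/cvg_ex; exists l.
Qed.

Lemma ulim_eq u l : u @ ultra --> l -> ulim u = l.
Proof. exact: cvg_lim. Qed.

Lemma ulim_lin (a : R) u v : bdd u -> bdd v -> ulim (fun n => a * u n + v n) = a * ulim u + ulim v.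
Proof.
move=> bu bv; apply: ulim_eq; apply: cvgD; last exact: ulimP.
by apply: cvgMr; exact: ulimP.
Qed.

Lemma bdd_lin (a : R) u v : bdd u -> bdd v -> bdd (fun n => a * u n + v n).
Proof.
move=> [A hA] [B hB]; exists (`|a| * A + B) => n.
by apply: le_trans (ler_normD _ _) _; rewrite normrM lerD // ler_wpM2l.
Qed.

Lemma bdd_cst (c : R) : bdd (fun=> c).
Proof. by exists `|c|. Qed.

Lemma ulim_le u (c : R) n0 : bdd u -> (forall n, (n0 <= n)%N -> u n <= c) -> ulim u <= c.
Proof.
by move=> bu h; apply: limr_le; [apply/cvg_ex; exists (ulim u); exact: ulimP|exact: (ultra_le h)].
Qed.

Lemma ulim_ge u (c : R) n0 : bdd u -> (forall n, (n0 <= n)%N -> c <= u n) -> c <= ulim u.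
Proof.
by move=> bu h; apply: limr_ge; [apply/cvg_ex; exists (ulim u); exact: ulimP|exact: (ultra_le h)].
Qed.

Lemma ulim_norm_le u (c : R) n0 : bdd u -> (forall n, (n0 <= n)%N -> `|u n| <= c) -> `|ulim u| <= c.
Proof.
move=> bu h; rewrite ler_norml; apply/andP; split.
  by apply: (ulim_ge (n0 := n0) bu) => n /h; rewrite ler_norml => /andP[].
by apply: (ulim_le (n0 := n0) bu) => n /h; rewrite ler_norml => /andP[].
Qed.

Lemma ulim_approx u (c : R) : (forall e : R, 0 < e -> exists n0, forall n, (n0 <= n)%N -> `|u n - c| <= e) ->
  ulim u = c.
Proof.
move=> h; apply: ulim_eq; apply/cvgrPdist_le => e e0.
by have [n0 hn] := h e e0; apply: (ultra_le (n0 := n0)) => n /hn; rewrite distrC.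
Qed.

Lemma ulim_dist u : bdd u -> ulim (fun n => `|u n - ulim u|) = 0.
Proof.
move=> bu; apply: ulim_eq; rewrite -[0](normr0 R) -(subrr (ulim u)).
by apply: cvg_norm; apply: cvgB; [exact: ulimP|exact: cvg_cst].
Qed.

Lemma ulim_sum (I : Type) (r : seq I) (F : I -> nat -> R) : (forall i, bdd (F i)) ->
  bdd (fun n => \sum_(i <- r) F i n) /\ ulim (fun n => \sum_(i <- r) F i n) = \sum_(i <- r) ulim (F i).
Proof.
move=> bF; elim: r => [|i r [IHb IH]].
  rewrite (_ : (fun n => _) = fun=> 0); last by apply/funext => n; rewrite big_nil.
  by rewrite big_nil; split; [exact: bdd_cst|apply: ulim_eq; exact: cvg_cst].
rewrite (_ : (fun n => _) = fun n => 1 * F i n + \sum_(j <- r) F j n); last by apply/funext => n;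
  rewrite big_cons mul1r.
by rewrite big_cons; split; [exact: bdd_lin|rewrite ulim_lin // mul1r IH].
Qed.

End UltraLimits.

(** * Consequences of hypoellipticity *)

Section Operators.
Context {R : realType} {N : nat}.
Local Notation V := 'rV[R]_N.
Implicit Types (f g phi psi : V -> R) (U : set V).

Record local_op (P : (V -> R) -> V -> R) : Prop := LocalOp {
  op_smooth : forall U phi, open U -> smooth_on U phi -> smooth_on U (P phi);
  op_test : forall U phi, test_fun U phi -> test_fun U (P phi);
  op_local : forall U phi psi, open U -> (forall y, U y -> phi y = psi y) ->
    forall y, U y -> P phi y = P psi y
}.

Definition dual_ops (P Q : (V -> R) -> V -> R) : Prop := forall g phi, smooth_on setT g -> test_fun setT phi ->
  integral_rV (fun x => g x * Q phi x) = integral_rV (fun x => P g x * phi x).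

(** The operator whose transpose is Q, acting on distributions: [op_dist Lt] is L and [op_dist Lf]
    is L^t. *)
Definition op_dist (Q : (V -> R) -> V -> R) (T : @prefunctional R N) : prefunctional := fun phi => T (Q phi).

Definition annulus (k : nat) : set V := [set x | 2^-1 ^+ k.+1 < `|x| /\ `|x| < 2^-1 ^+ k].

Lemma half_pow_gt0 k : 0 < 2^-1 ^+ k :> R.
Proof. by rewrite exprn_gt0 // invr_gt0. Qed.

Lemma half_pow_le j k : (j <= k)%N -> 2^-1 ^+ k <= 2^-1 ^+ j :> R.
Proof. by move=> jk; apply: ler_wiXn2l => //; rewrite ?invr_ge0 // invf_le1 // ler1n. Qed.

Lemma half_pow_small (e : R) : 0 < e -> exists n, forall k, (n <= k)%N -> 2^-1 ^+ k < e :> R.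
Proof.
move=> e0; have [n _ h] : \forall n \near \oo, `|2^-1 ^+ n : R| < e.
  have := @cvg_expr R (2^-1); rewrite gtr0_norm ?invr_gt0 // invf_lt1 // ltr1n => /(_ isT).
  by move/cvgr0_norm_lt; apply.
by exists n => k nk; have := h k nk; rewrite /= gtr0_norm // half_pow_gt0.
Qed.

Lemma annulus_uniq j k x : annulus j x -> annulus k x -> j = k.
Proof.
wlog jk : j k / (j < k)%N.
  by move=> H aj ak; have [jk|jk|//] := ltngtP j k; [exact: H|apply/esym; exact: H].
move=> [j1 _] [_ k2]; have := lt_trans j1 k2; rewrite ltNge half_pow_le //.
Qed.

Lemma sum_one (I : eqType) (r : seq I) (F : I -> R) (B : R) : uniq r -> 0 <= B -> (forall i, `|F i| <= B) ->
  (forall i j, F i != 0 -> F j != 0 -> i = j) -> `|\sum_(i <- r) F i| <= B.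
Proof.
move=> ur B0 FB F1; have [/hasP [i ir Fi]|/hasPn h] := boolP (has (fun i => F i != 0) r).
  rewrite (bigD1_seq i) //= big1_seq ?addr0 // => j /andP[ji jr].
  by apply/eqP/negPn/negP => Fj; rewrite (F1 j i) ?eqxx in ji.
rewrite big1_seq ?normr0 // => i /= ir; exact/eqP/negPn/h.
Qed.

Lemma glue_index_witness : {n : V -> nat | forall x, x != 0 -> 2^-1 ^+ n x < `|x|}.
Proof.
apply: cid.
have /choice [n hn] : forall x : V, exists n : nat, x != 0 -> 2^-1 ^+ n < `|x|.
  move=> x; have [->|x0] := eqVneq x 0; first by exists 0%N.
  by have [n h] := @half_pow_small `|x| (ltac:(by rewrite normr_gt0)); exists n => _; exact: h.
by exists n.
Qed.

(** The infinite sum of the psi k, supported in disjoint annuli accumulating at 0 only. It is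
    encoded as a finite sum whose length depends on x: the terms past the chosen index vanish at
    x. *)
Definition glue (psi : nat -> V -> R) (x : V) : R := \sum_(k < sval glue_index_witness x) psi k x.

Section Glue.
Variable psi : nat -> V -> R.
Hypothesis tpsi : forall k, test_fun (annulus k) (psi k).


Lemma psi_out k x : ~ annulus k x -> psi k x = 0.
Proof. by case: (tpsi k) => _ [K [_ KU z]] nx; apply: z => /KU. Qed.

Lemma psi0 k : psi k 0 = 0.
Proof. by apply: psi_out => -[]; rewrite normr0 ltNge (ltW (half_pow_gt0 _)). Qed.

Lemma psi_uniq (x : V) i j : psi i x != 0 -> psi j x != 0 -> i = j.
Proof.
move=> hi hj; apply: (@annulus_uniq _ _ x); apply: contrapT => h.
  by rewrite psi_out ?eqxx in hi.
by rewrite psi_out ?eqxx in hj.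
Qed.

Lemma glueE n (x : V) : 2^-1 ^+ n <= `|x| -> glue psi x = \sum_(k < n) psi k x.
Proof.
move=> nx; rewrite /glue; case: glue_index_witness => /= ix hix.
have x0 : x != 0 by rewrite -normr_gt0 (lt_le_trans _ nx) // half_pow_gt0.
have H p m : (p <= m)%N -> 2^-1 ^+ p <= `|x| -> \sum_(k < m) psi k x = \sum_(k < p) psi k x.
  move=> pm px; rewrite -!(big_mkord xpredT (fun k => psi k x)) (@big_cat_nat _ _ _ p) //=.
  rewrite -[RHS]addr0; congr (_ + _); rewrite big_nat big1 // => k /andP[pk _].
  by apply: psi_out => -[_]; rewrite ltNge (le_trans _ px) // half_pow_le.
have [h|h] := leqP n (ix x); first exact: H.
by apply/esym/H; [exact: ltnW|exact/ltW/hix].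
Qed.

Lemma glue0 : glue psi 0 = 0.
Proof. by rewrite /glue big1 // => k _; exact: psi0. Qed.

Lemma glue_le (B : R) x k0 : 0 <= B -> `|x| < 2^-1 ^+ k0 -> (forall k, (k0 <= k)%N -> `|psi k x| <= B) ->
  `|glue psi x| <= B.
Proof.
move=> B0 xk h; rewrite /glue -(big_mkord xpredT (fun k => psi k x)); apply: sum_one => //; first exact: iota_uniq.
  move=> k; have [kk|kk] := leqP k0 k; first exact: h.
  rewrite psi_out ?normr0 // => -[a _]; have := lt_trans a xk; rewrite ltNge half_pow_le //.
exact: psi_uniq.
Qed.

End Glue.

Lemma outer_open n : @open V [set x | 2^-1 ^+ n < `|x|].
Proof. by apply: (@open_comp _ _ (fun q : V => `|q|) [set r | 2^-1 ^+ n < r]); [move=> ? _;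
  exact: norm_continuous|exact: open_gt]. Qed.

Lemma norm_sq_derivable0 f (d : R) v : 0 < d -> f 0 = 0 -> (forall x, `|x| < d -> `|f x| <= `|x| ^+ 2) ->
  {for 0, continuous f} /\ is_derive (0 : V) v f 0.
Proof.
move=> d0 f0 h.
have nbd (e : R) : 0 < e -> \forall x \near (0 : V), `|x| < e.
  by move=> e0; apply/nbhs_ballP; exists e => // y; rewrite -ball_normE /ball_ /= sub0r normrN.
have [df dE] : differentiable f 0 /\ 'd f 0 = (\0 : {linear V -> R}) :> (V -> R).
  apply: differentiableI; first by apply: (@linear_bound_continuous R V R _ 0) => y; rewrite /= normr0 mul0r.
  move=> e e0; have m0 : 0 < Num.min d e by rewrite lt_min d0.
  apply: filterS (nbd _ m0) => x; rewrite lt_min => /andP[xd xe].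
  rewrite add0r f0 !subr0; apply: le_trans (h x xd) _; by rewrite expr2; apply: ler_wpM2r => //; exact: ltW.
split; first exact: differentiable_continuous.
by split; [exact: diff_derivable|rewrite deriveE // dE].
Qed.

(** Off 0 the sum is locally finite. Near 0 only the terms with k >= size l are alive, so each glued
    derivative is O(|x|^2), and it is continuous with zero gradient at 0. *)
Lemma glue_smooth (psi : nat -> V -> R) : (forall k, test_fun (annulus k) (psi k)) ->
  (forall k l x, (size l <= k)%N -> `|partials l (psi k) x| <= `|x| ^+ 2) -> smooth_on setT (glue psi).
Proof.
move=> tpsi hpsi.
have tl l k : test_fun (annulus k) (partials l (psi k)) by exact: test_partials.
pose P f := exists l, f = glue (fun k => partials l (psi k)).
apply: (@smooth_coind _ _ _ P); last by exists [::].
move=> _ [l ->]; set f := glue _.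
have near n (x : V) : 2^-1 ^+ n < `|x| -> forall y, [set x | 2^-1 ^+ n < `|x|] y ->
  (fun y => \sum_(k < n) partials l (psi k) y) y = f y.
  by move=> _ y /= ny; rewrite /f (glueE (tl l) (ltW ny)).
have sn n : smooth_on setT (fun y => \sum_(k < n) partials l (psi k) y).
  by apply: (smooth_sum openT) => k; exact: (test_smooth (tl l k)).
have out (x : V) : x != 0 -> exists n, 2^-1 ^+ n < `|x|.
  by move=> x0; have [n h] := @half_pow_small `|x| (ltac:(by rewrite normr_gt0)); exists n; exact: h.
have at0 v : {for 0, continuous f} /\ is_derive (0 : V) v f 0.
  apply: (@norm_sq_derivable0 _ (2^-1 ^+ size l)); [exact: half_pow_gt0|exact: glue0|].
  by move=> x xl; apply: (glue_le (tl l) (k0 := size l)) => // k lk; exact: hpsi.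
split.
- move=> x _; have [->|x0] := eqVneq x 0; first by case: (at0 0).
  have [n nx] := out x x0; exact: (eq_on_cont (@outer_open n) nx (near n x nx) (smooth_cont (sn n) I)).
- move=> i x _; have [->|x0] := eqVneq x 0; first by case: (at0 (evec i)) => _ [].
  have [n nx] := out x x0; exact: (eq_on_derivable (@outer_open n) nx (near n x nx) (smooth_derivable (sn n) I)).
- move=> i; exists (i :: l); apply/funext => x; have [->|x0] := eqVneq x 0.
    by case: (at0 (evec i)) => _ [_ ->]; rewrite glue0 //; exact: (tl (i :: l)).
  have [n nx] := out x x0.
  rewrite (glueE (tl (i :: l)) (ltW nx)).
  rewrite -(eq_on_pd (evec i) (@outer_open n) nx (near n x nx)).
  have sk k : is_derive x (evec i : V) (partials l (psi k)) (partials (i :: l) (psi k) x).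
    by split => //; exact: (smooth_derivable (test_smooth (tl l k)) I).
  by have [_ ->] := is_derive_sumf (fun k : 'I_n => sk k).
Qed.

Section Gliding.
Variables (Lf Lt : (V -> R) -> V -> R) (i0 : 'I_N).
Hypotheses (oLf : local_op Lf) (oLt : local_op Lt) (dual : dual_ops Lf Lt).

Lemma test_int_bound f phi (A M : R) : (forall x, `|f x| <= 1) -> continuous f -> test_fun setT phi -> 0 < A ->
  (forall x, A <= `|x| -> phi x = 0) -> (forall x, `|phi x| <= M) ->
  `|integral_rV (fun x => f x * phi x)| <= M * (2 * A) ^+ N.
Proof.
move=> f1 cf tp A0 zA hM; apply: int_bound.
  apply: ccontM => //; split => //; exact: (smoothT_cont (test_smooth tp)).
by move=> x; rewrite normrM -[leRHS]mul1r ler_pM.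
Qed.

Lemma test_bound phi : test_fun setT phi -> exists A M : R, [/\ 0 < A, forall x, A <= `|x| ->
  phi x = 0 & forall x, `|phi x| <= M].
Proof.
move=> tp; have [A [A0 cp zA]] := test_ccont tp; have [M M0 hM] := continuous_bounded_ball A cp.
by exists A, M; split => // x; have [xA|xA] := lerP `|x| A; [exact: hM|rewrite zA ?normr0 // ltW].
Qed.

(* Otherwise sum_k g_k would be a distribution with smooth image, equal off the origin to a
   function which is not continuous at 0. *)
Lemma no_gliding_hump (g : nat -> V -> R) : hypoelliptic (op_dist Lf) ->
  (forall k, test_fun (annulus k) (g k)) -> (forall k x, `|g k x| <= 1) ->
  (forall k l x, (size l <= k)%N -> `|partials l (Lt (g k)) x| <= `|x| ^+ 2) ->
  ~ forall k, exists y, g k y = 1.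
Proof.
move=> hypo tg g1 hg hy.
have tpsi k : test_fun (annulus k) (Lt (g k)) by exact: op_test (tg k).
have tgT k : test_fun setT (g k) by exact: testT (tg k).
have tpsiT k : test_fun setT (Lt (g k)) by exact: testT (tpsi k).
pose S n x := \sum_(k < n) g k x.
have S1 n x : `|S n x| <= 1.
  rewrite /S -(big_mkord xpredT (fun k => g k x)); apply: sum_one => //; first exact: iota_uniq.
  exact: psi_uniq.
have tS n : test_fun setT (S n) by apply: test_sum => k.
have cS n : continuous (S n) by exact: (smoothT_cont (test_smooth (tS n))).
pose I n phi := integral_rV (fun x => S n x * phi x).
have bI phi : test_fun setT phi -> bdd (fun n => I n phi).
  move=> tp; have [A [M [A0 zA hM]]] := test_bound tp.
  by exists (M * (2 * A) ^+ N) => n; exact: test_int_bound.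
pose T phi := ulim (fun n => I n phi).
have dT : is_distribution setT T.
  split=> [a phi psi tp tq|K cK _].
    rewrite /T -ulim_lin //; try exact: bI.
    congr ulim; apply/funext => n; rewrite /I.
    rewrite -(int_test_lin a (testM (test_smooth (tS n)) tp) (testM (test_smooth (tS n)) tq)).
    by congr integral_rV; apply/funext => x; ring.
  have [A A0 KA] := compact_norm_le cK.
  exists ((2 * A) ^+ N), 0%N => phi M tp zK hM.
  apply: (ulim_norm_le (n0 := 0)); first exact: bI.
  move=> n _; rewrite mulrC; apply: test_int_bound => //.
    by move=> x Ax; apply: zK => /KA; rewrite ltNge Ax.
  by move=> x; exact: (hM [::] x isT).
pose F := glue (fun k => Lt (g k)).
have sF : smooth_on setT F by exact: glue_smooth.
(* F differs from its n-th partial sum only where |x| < 2^-n, and there F is at most |x|^2. *)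
have E : eq_dist setT (op_dist Lf T) (dist_of F).
  move=> phi tp; rewrite /op_dist /T /dist_of; apply: ulim_approx => e e0.
  have [A [M [A0 zA hM]]] := test_bound tp.
  pose c := `|M| * (2 * A) ^+ N + 1.
  have c0 : 0 < c by rewrite ltr_wpDl // mulr_ge0 // exprn_ge0 // mulr_ge0 // ltW.
  have [n0 hn0] := half_pow_small (divr_gt0 e0 c0).
  exists n0 => n nn.
  have -> : I n (Lf phi) = integral_rV (fun x => (\sum_(k < n) Lt (g k) x) * phi x).
    have sphi := test_smooth tp; have sLf := op_smooth oLf openT sphi.
    rewrite /I (_ : (fun x => S n x * _) = fun x => \sum_(k < n) Lf phi x * g k x); last first.
      by apply/funext => x; rewrite /S mulr_suml; apply: eq_bigr => k _; rewrite mulrC.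
    rewrite (int_sum_test _ (fun k : 'I_n => testM sLf (tgT k))).
    rewrite (_ : (fun x => _ * phi x) = fun x => \sum_(k < n) phi x * Lt (g k) x); last first.
      by apply/funext => x; rewrite mulr_suml; apply: eq_bigr => k _; rewrite mulrC.
    rewrite (int_sum_test _ (fun k : 'I_n => testM sphi (tpsiT k))); apply: eq_bigr => k _.
    by rewrite (dual sphi (tgT k)).
  have tF : test_fun setT (fun x => F x * phi x) by exact: testM.
  have tFn : test_fun setT (fun x => (\sum_(k < n) Lt (g k) x) * phi x).
    by apply: testM tp; apply: (smooth_sum openT) => k; exact: test_smooth (tpsiT k).
  have := int_test_lin (-1) tF tFn; rewrite mulN1r addrC => <-.
  apply: (@le_trans _ _ ((2^-1 ^+ n * `|M|) * (2 * A) ^+ N)); last first.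
    rewrite -mulrA; apply: (@le_trans _ _ (e / c * c)); last by rewrite divfK // gt_eqF.
    apply: ler_pM; [exact/ltW/half_pow_gt0|by rewrite mulr_ge0 // exprn_ge0 // mulr_ge0 // ltW|exact/ltW/hn0|by
      rewrite lerDl].
  apply: int_bound.
    have tt := test_lin (-1) tF tFn; split => //; first exact: (smoothT_cont (test_smooth tt)).
    by move=> x Ax; rewrite zA // !mulr0 addr0.
  move=> x; rewrite mulN1r addrC -mulrBl normrM ler_pM //; last by rewrite (le_trans (hM x)) // ler_norm.
  have [nx|xn] := leP (2^-1 ^+ n) `|x|; first by rewrite /F (glueE tpsi nx) subrr normr0 ltW // half_pow_gt0.
  rewrite big1 ?sub0r ?normrN; last first.
    move=> k _; apply: (psi_out tpsi) => -[kx _]; have := lt_trans kx xn; rewrite ltNge half_pow_le //.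
  have B : `|F x| <= `|x| ^+ 2.
    by apply: (glue_le tpsi (k0 := n)) => // k _; exact: (hg k [::] x).
  apply: (le_trans B); rewrite expr2 -[leRHS]mulr1; apply: ler_pM => //; first exact: ltW.
  by rewrite ltW // (lt_le_trans xn) // exprn_ile1 // ?invr_ge0 // invf_le1 // ler1n.
have [u su uT] := hypo setT T F openT dT sF E.
have uS n x : 2^-1 ^+ n < `|x| -> u x = S n x.
  move=> nx; apply/eqP; rewrite -subr_eq0; apply/eqP.
  have ss : smooth_on setT (fun x => u x - S n x) by exact: (smoothB openT su (test_smooth (tS n))).
  apply: (@fundamental_lemma _ _ [set x | 2^-1 ^+ n < `|x|] (fun x => u x - S n x)) nx; first exact: outer_open.
    by move=> y _; exact: (smooth_cont ss Logic.I).
  move=> phi tp; have tpT := testT tp.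
  have := int_test_lin (-1) (testM (test_smooth (tS n)) tpT) (testM su tpT).
  rewrite (_ : (fun x => -1 * _ + _) = fun x => (u x - S n x) * phi x); last by apply/funext => y; ring.
  move=> ->; have := uT phi tpT; rewrite /dist_of => <-.
  rewrite mulN1r addrC; apply/eqP; rewrite subr_eq0; apply/eqP.
  apply: ulim_approx => e e0; exists n => m nm; rewrite /I.
  rewrite (_ : (fun x => S m x * phi x) = fun x => S n x * phi x) ?subrr ?normr0 ?(ltW e0) //.
  apply/funext => y; have [ny|yn] := ltP (2^-1 ^+ n) `|y|.
    have gE k : 2^-1 ^+ k <= `|y| -> glue g y = S k y by move=> ky; exact: (glueE tg ky).
    by rewrite -!gE ?(ltW ny) // (le_trans _ (ltW ny)) // half_pow_le.
  by case: tp => _ [K [_ KU zK]]; rewrite zK ?mulr0 // => /KU /=; rewrite ltNge yn.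
have /cvgrPdist_lt /(_ (1 / 2)) := smooth_cont su (Logic.I : setT (0 : V)).
rewrite divr_gt0 // => /(_ isT) /nbhs_ballP [d /= d0 hd].
have [k hk] := half_pow_small d0.
have [y gy] := hy k.
have ya : annulus k y.
  by apply: contrapT => h; have := psi_out tg h; rewrite gy => /eqP; rewrite oner_eq0.
(* The annuli are open, so a point of norm exactly 2^-k lies in none of them and u vanishes there,
   whereas u y = 1: u oscillates by 1 arbitrarily close to 0. *)
pose z : V := 2^-1 ^+ k *: evec i0.
have nz : `|z| = 2^-1 ^+ k.
  apply/eqP; rewrite eq_le; apply/andP; split.
    by rewrite normrZ gtr0_norm ?half_pow_gt0 // ler_piMr ?norm_evec // ltW // half_pow_gt0.
  by have := rV_coord_le z i0; rewrite rVZ evecE eqxx mulr1 gtr0_norm // half_pow_gt0.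
have uy : u y = 1.
  case: ya => y1 y2; rewrite (uS k.+1 y y1) /S (bigD1 (inord k)) //= inordK // gy big1 ?addr0 // => j jk.
  apply: (psi_out tg) => aj; have E2 := annulus_uniq aj (Logic.conj y1 y2); move/negP: jk; apply.
  by apply/eqP/val_inj; rewrite /= inordK.
have uz : u z = 0.
  have kz : 2^-1 ^+ k.+1 < `|z| by rewrite nz exprS gtr_pMl ?half_pow_gt0 // invf_lt1 // ltr1n.
  rewrite (uS k.+1 z kz) /S big1 // => j _; apply: (psi_out tg); rewrite /annulus /= nz => -[a b].
  move: b; rewrite ltNge => /negP; apply; apply: half_pow_le; move: a.
  by rewrite leqNgt; apply: contraTN => jk; rewrite -leNgt half_pow_le.
have b w : `|w| <= 2^-1 ^+ k -> `|u 0 - u w| < 1 / 2.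
  by move=> wk; apply: (hd w); rewrite -ball_normE /ball_ /= sub0r normrN (le_lt_trans wk) // hk.
have := b y (ltac:(by case: ya => _ /ltW)); have := b z (ltac:(by rewrite nz)).
by rewrite uy uz subr0 !ltr_norml => /andP[_ ?] /andP[? _]; lra.
Qed.

End Gliding.

End Operators.

(** * The a priori estimate *)

Section Apriori.
Context {R : realType} {N : nat} (G : carnot R N).
Local Notation V := 'rV[R]_N.
Local Notation mul := (carnot_mul G).
Local Notation dil := (dilation G).
Implicit Types (f g phi psi : V -> R) (U : set V).

(* Lf and Lt stand for the operator and its transpose. *)
Record inv_ops (Lf Lt : (V -> R) -> V -> R) (lambda : R) : Prop := InvOps {
  inv_f : local_op Lf;
  inv_t : local_op Lt;
  inv_dual : dual_ops Lf Lt;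
  inv_lin : forall (a : R) phi psi, smooth_on setT phi -> smooth_on setT psi ->
    Lt (fun x => a * phi x + psi x) = fun x => a * Lt phi x + Lt psi x;
  inv_translate : forall phi a, test_fun setT phi -> Lt (fun y => phi (mul a y)) = fun y => Lt phi (mul a y);
  inv_dilate : forall phi (t : R), 0 < t -> test_fun setT phi ->
    Lt (fun y => phi (dil t y)) = fun y => t `^ lambda * Lt phi (dil t y)
}.

Variables (Lf Lt : (V -> R) -> V -> R) (lambda : R).
Hypothesis ops : inv_ops Lf Lt lambda.
Hypothesis hypo_t : hypoelliptic (op_dist Lf).

Lemma Lt_test U phi : test_fun U phi -> test_fun U (Lt phi).
Proof. exact: (op_test (inv_t ops)). Qed.

Lemma Lt0 : Lt (fun=> 0) = fun=> 0.
Proof.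
have s0 := smooth_cst (@openT V) (0 : R); apply/funext => x.
have := congr1 (@^~ x) (inv_lin ops 1 s0 s0).
rewrite (_ : (fun x => _) = fun=> 0); last by apply/funext => y; rewrite mulr0 addr0.
by move=> /=; lra.
Qed.

Lemma LtZ (a : R) phi : smooth_on setT phi -> Lt (fun x => a * phi x) = fun x => a * Lt phi x.
Proof.
move=> sp; have := inv_lin ops a sp (smooth_cst (@openT V) (0 : R)); rewrite Lt0.
by under eq_fun do rewrite addr0; under [in RHS]eq_fun do rewrite addr0.
Qed.

Lemma ckbZ m U M (a : R) f : smooth_on setT f -> ckb m U M f -> ckb m U (`|a| * M) (fun x => a * f x).
Proof.
move=> sf h l x lm Ux; have := congr1 (@^~ x) (partials_lin l a sf (smooth_cst (@openT V) (0 : R))).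
rewrite partials0 (partials_eq l (g := fun x => a * f x)); last by move=> y; rewrite addr0.
by move=> /= ->; rewrite addr0 normrM ler_wpM2l // h.
Qed.

(** The estimate of order k with constant 1/e fails for some phi; divided by its value at a point
    where |phi| is largest, phi gets height 1 and an image below e. *)
Lemma normalized_hump (k : nat) (e : R) : 0 < e ->
  ~ (exists m (C : R), 0 <= C /\ forall phi M, test_fun setT phi -> (forall x, 1 <= `|x| -> phi x = 0) ->
     ckb m setT M (Lt phi) -> forall x, `|phi x| <= C * M) ->
  exists phi, [/\ test_fun setT phi, forall x, 1 <= `|x| -> phi x = 0, forall x, `|phi x| <= 1,
    exists x, phi x = 1 & ckb k setT e (Lt phi)].
Proof.
move=> e0 nH; apply: contrapT => H; apply: nH; exists k, e^-1; split; first by rewrite invr_ge0 ltW.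
move=> phi M tp zp hM x; rewrite leNgt; apply/negP => big; apply: H.
have M0 : 0 <= M by apply: le_trans (hM [::] 0 isT I).
have cp : continuous (fun y => `|phi y|).
  by move=> y; apply: (@continuous_comp _ _ _ phi (fun r : R => `|r|));
    [exact: (smoothT_cont (test_smooth tp))|exact: norm_continuous].
have [c /set_mem _ cmax] : exists2 c, c \in [set y : V | `|y| <= 1] & forall t, t \in [set y : V | `|y| <= 1] ->
  `|phi t| <= `|phi c|.
  apply: EVT_max_rV; [by exists 0; rewrite /= normr0|exact: closed_ball0_compact|exact: continuous_subspaceT].
have {}cmax y : `|phi y| <= `|phi c|.
  have [y1|y1] := leP `|y| 1; first by apply: cmax; rewrite inE.
  by rewrite zp ?normr0 // ltW.
have c0 : 0 < `|phi c|.
  by apply: lt_le_trans (cmax x); apply: le_lt_trans big; rewrite mulr_ge0 // invr_ge0 ltW.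
have pc : phi c != 0 by rewrite -normr_gt0.
exists (fun y => (phi c)^-1 * phi y); split.
- exact: testZ.
- by move=> y y1; rewrite (zp y y1) mulr0.
- by move=> y; rewrite normrM normfV mulrC ler_pdivrMr // mul1r.
- by exists c; rewrite mulVf.
- rewrite (LtZ _ (test_smooth tp)).
  apply: (ckb_le (leqnn k) (fun _ h => h) _ (ckbZ (phi c)^-1 (test_smooth (Lt_test tp)) hM)).
  rewrite normfV mulrC ler_pdivrMr // -ler_pdivrMl // (le_trans _ (cmax x)) // ltW //.
Qed.

Lemma annulus_chart (i0 : 'I_N) k : exists (a : V) (t : R), 0 < t /\ forall u, `|u| <= 1 ->
  annulus k (mul a (dil t^-1 u)).
Proof.
pose c : R := 2^-1 ^+ k; have c0 : 0 < c by exact: half_pow_gt0.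
(* Halfway between the radii c / 2 and c of the annulus; the norm is then allowed to vary by c /
   8. *)
pose a : V := (3 / 4 * c) *: evec i0.
have p0 : 0 < 3 / 4 * c by lra.
have na : `|a| = 3 / 4 * c.
  apply/eqP; rewrite eq_le; apply/andP; split.
    by rewrite normrZ gtr0_norm // ler_piMr ?norm_evec // ltW.
  by have := rV_coord_le a i0; rewrite rVZ evecE eqxx mulr1 gtr0_norm.
have c4 : 0 < c / 8 by lra.
have /cvgrPdist_lt /(_ _ c4) /nbhs_ballP [d /= d0 hd] := @mulr_continuous _ _ G a 0.
pose s := Num.min (d / 2) 1; have s0 : 0 < s by rewrite lt_min divr_gt0 //= ltr01.
exists a, s^-1; split; first by rewrite invr_gt0.
move=> u u1; rewrite invrK.
have ds : `|dil s u| < d.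
  apply: le_lt_trans (dilation_norm_le _ _ _) _; first by rewrite (ltW s0) /s ge_min lexx orbT.
  apply: (@le_lt_trans _ _ s); first by rewrite ler_piMr // ltW.
  by rewrite /s gt_min ltr_pdivrMr // ltr_pMr // ltr1n.
have := hd (dil s u); rewrite -ball_normE /ball_ /= sub0r normrN carnot_mulx0 => /(_ ds) H.
have e1 := lerB_dist a (mul a (dil s u)); have e2 := lerB_dist (mul a (dil s u)) a.
rewrite distrC in e2; rewrite /annulus /= exprS -/c; rewrite na in e1 e2.
by split; lra.
Qed.

Lemma apriori (i0 : 'I_N) : exists m (C : R), 0 <= C /\
  forall phi M, test_fun setT phi -> (forall x, 1 <= `|x| -> phi x = 0) ->
     ckb m setT M (Lt phi) -> forall x, `|phi x| <= C * M.
Proof.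
apply: contrapT => nH.
have hump := normalized_hump _ _ nH.
have /choice [at_ hat] : forall k, exists at_ : V * R, 0 < at_.2 /\ forall u, `|u| <= 1 ->
  annulus k (mul at_.1 (dil at_.2^-1 u)).
  by move=> k; have [a [t h]] := annulus_chart i0 k; exists (a, t).
pose a k := (at_ k).1; pose t k := (at_ k).2.
have t0 k : 0 < t k by case: (hat k).
have tn k : t k != 0 by rewrite gt_eqF.
have hann k u : `|u| <= 1 -> annulus k (mul (a k) (dil (t k)^-1 u)) by case: (hat k) => _; exact.
pose h k x := dil (t k) (mul (- a k) x).
have sh k j : smooth_on setT (fun y => h k y ord0 j).
  exact: (smooth_translate G (- a k) (dil_smooth G (t k) j)).
have /choice [C hC] : forall k, exists C : R, 0 < C /\ forall f M, smooth_on setT f -> 0 <= M -> ckb k setT M f ->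
    ckb k [set x | `|x| < 2] (C * M) (fun x => f (h k x)).
  by move=> k; have [C ? ?] := ckb_comp 2 k (sh k); exists C.
(* Compensates in advance the constant C k of the change of variables and the homogeneity factor;
   what remains is the square of the inner radius of annulus k, hence at most |x|^2 on the
   annulus. *)
pose e k : R := (2^-1 ^+ k.+1) ^+ 2 / (C k * t k `^ lambda).
have Ct k : 0 < C k * t k `^ lambda by rewrite mulr_gt0 ?powR_gt0 //; case: (hC k).
have e0 k : 0 < e k by rewrite divr_gt0 // exprn_gt0 // half_pow_gt0.
have /choice [phi hphi] := fun k => hump k (e k) (e0 k).
have tp k : test_fun setT (phi k) by case: (hphi k).
pose g k x := phi k (h k x).
have gE k : g k = fun x => (fun y => phi k (dil (t k) y)) (mul (- a k) x) by [].
have hK k u : h k (mul (a k) (dil (t k)^-1 u)) = u by rewrite /h mulKx dilK.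
have tdil k : test_fun setT (fun y => phi k (dil (t k) y)).
  have [A cA] := test_ccont (tp k); have [B cB] := ccont_dilate G (t0 k) cA.
  exact: ccont_test (smooth_dilate G (t k) (test_smooth (tp k))) cB.
have tg k : test_fun (annulus k) (g k).
  split; first exact: (smooth_translate G (- a k) (smooth_dilate G (t k) (test_smooth (tp k)))).
  exists ((fun u => mul (a k) (dil (t k)^-1 u)) @` [set u | `|u| <= 1]); split.
  - apply: continuous_compact; last exact: closed_ball0_compact.
    apply: continuous_subspaceT => u; apply: (@continuous_comp _ _ _ (dil (t k)^-1) (mul (a k))).
      exact: dil_continuous.
    exact: mulr_continuous.
  - by move=> _ [u u1 <-]; exact: hann.
  - move=> x nx; case: (hphi k) => _ zp _ _ _; apply: zp; rewrite leNgt; apply/negP => hx.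
    by apply: nx; exists (h k x); [exact: ltW|rewrite /h dilVK // mulxK].
have LtE k : Lt (g k) = fun x => t k `^ lambda * Lt (phi k) (h k x).
  rewrite gE (inv_translate ops (- a k) (tdil k)); apply/funext => x.
  by rewrite (inv_dilate ops (t0 k) (tp k)).
refine (no_gliding_hump i0 (inv_f ops) (inv_t ops) (inv_dual ops) hypo_t tg _ _ _).
- by move=> k x; case: (hphi k) => _ _ h1 _ _; exact: h1.
- move=> k l x lk; have [ax|nax] := pselect (annulus k x); last first.
    by rewrite (psi_out (psi := fun j => partials l (Lt (g j))) (fun j => test_partials l (Lt_test (tg j))) nax)
      normr0 sqr_ge0.
  have [x1 x2] := ax.
  have xlt2 : `|x| < 2 by apply: (lt_trans x2); apply: (@le_lt_trans _ _ 1);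
    [rewrite exprn_ile1 // ?invr_ge0 // invf_le1 // ler1n|rewrite ltr1n].
  rewrite LtE.
  have sL : smooth_on setT (Lt (phi k)) := test_smooth (Lt_test (tp k)).
  have B : ckb k setT (t k `^ lambda * e k) (fun y => t k `^ lambda * Lt (phi k) y).
    case: (hphi k) => _ _ _ _ b; have := ckbZ (t k `^ lambda) sL b.
    by rewrite ger0_norm // powR_ge0.
  have te : 0 <= t k `^ lambda * e k by rewrite mulr_ge0 ?powR_ge0 // ltW.
  have := (proj2 (hC k)) _ _ (smoothZ openT (t k `^ lambda) sL) te B l x lk xlt2.
  move=> H; apply: (le_trans H); rewrite mulrA /e mulrCA divff ?gt_eqF // mulr1.
  by rewrite lerXn2r ?nnegrE // ltW // half_pow_gt0.
- move=> k; case: (hphi k) => _ _ _ [u hu] _.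
  by exists (mul (a k) (dil (t k)^-1 u)); rewrite /g hK.
Qed.

End Apriori.

(** * Hahn-Banach and the parametrix *)

Section HahnBanach.
Context {R : realType} {X : lmodType R}.
Variables (D : X -> Prop) (Bd : X -> R -> Prop) (G0 : set (X * R)).
Hypothesis D_lin : forall (a : R) x y, D x -> D y -> D (a *: x + y).
Hypothesis BdD : forall x y M M', D x -> D y -> Bd x M -> Bd y M' -> Bd (x + y) (M + M').
Hypothesis BdZ : forall (t : R) x M, 0 < t -> D x -> Bd x M -> Bd (t *: x) (t * M).
Hypothesis BdE : forall x, D x -> exists M, Bd x M.

(** Partial linear functionals are handled as graphs, and the dominating sublinear function as a
    relation: [Bd x M] says that M is an admissible bound for x, which avoids an infimum. *)
Definition dominated_graph (A : set (X * R)) : Prop :=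
  (forall (a : R) x y r s, A (x, r) -> A (y, s) -> A (a *: x + y, a * r + s)) /\
  (forall x r, A (x, r) -> D x /\ forall M, Bd x M -> r <= M).

Hypotheses (G00 : G0 (0, 0)) (G0_dom : dominated_graph G0).

Lemma graph_scale A (a : R) x r : dominated_graph A -> A (0, 0) -> A (x, r) -> A (a *: x, a * r).
Proof. by move=> [lA _] A0 Ax; have := lA a _ _ _ _ Ax A0; rewrite !addr0. Qed.

Lemma graph_add A x y r s : dominated_graph A -> A (x, r) -> A (y, s) -> A (x + y, r + s).
Proof. by move=> [lA _] Ax Ay; have := lA 1 _ _ _ _ Ax Ay; rewrite scale1r mul1r. Qed.

Lemma graph_extend A x0 : dominated_graph A -> A (0, 0) -> D x0 ->
  exists2 B, dominated_graph B & A `<=` B /\ exists a, B (x0, a).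
Proof.
move=> gA A0 Dx0; have [lA dA] := gA.
have D0 : D 0 by case: (dA _ _ A0).
have DN x : D x -> D (- x) by move=> Dx; have := D_lin (-1) Dx D0; rewrite addr0 scaleN1r.
have DD x y : D x -> D y -> D (x + y) by move=> Dx Dy; have := D_lin 1 Dx Dy; rewrite scale1r.
have DZ t x : D x -> D (t *: x) by move=> Dx; have := D_lin t Dx D0; rewrite addr0.
have sep x r y s M M' : A (x, r) -> A (y, s) -> Bd (x + x0) M -> Bd (y - x0) M' -> s - M' <= M - r.
  move=> Ax Ay bx by_; have [Dx _] := dA _ _ Ax; have [Dy _] := dA _ _ Ay.
  have b := BdD (DD _ _ Dx Dx0) (DD _ _ Dy (DN _ Dx0)) bx by_.
  rewrite addrACA subrr addr0 in b.
  have [_ h] := dA _ _ (graph_add gA Ax Ay); have := h _ b; lra.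
(* The value at x0 has to lie above all s - M' and below all M - r; the supremum of the former is
   taken. *)
pose L : set R := [set c | exists y s M', [/\ A (y, s), Bd (y - x0) M' & c = s - M']].
have [M1 hM1] := BdE (DD _ _ D0 (DN _ Dx0)).
have [M2 hM2] := BdE (DD _ _ D0 Dx0).
have L0 : L !=set0 by exists (0 - M1); exists 0, 0, M1.
have ubL : has_ubound L.
  exists (M2 - 0) => _ [y [s [M' [Ay b ->]]]]; exact: sep A0 Ay hM2 b.
pose a := sup L.
have a_ge y s M' : A (y, s) -> Bd (y - x0) M' -> s - M' <= a.
  by move=> Ay b; apply: ub_le_sup => //; exists y, s, M'.
have a_le x r M : A (x, r) -> Bd (x + x0) M -> a <= M - r.
  by move=> Ax b; apply: ge_sup => // _ [y [s [M' [Ay b' ->]]]]; exact: sep Ax Ay b b'.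
exists [set z | exists x r t, [/\ A (x, r), z.1 = x + t *: x0 & z.2 = r + t * a]].
  split=> [c x y r s [x1 [r1 [t1 [A1 /= -> ->]]]] [x2 [r2 [t2 [A2 /= -> ->]]]]|].
    exists (c *: x1 + x2), (c * r1 + r2), (c * t1 + t2); split => /=; first exact: lA.
      by rewrite scalerDr scalerDl scalerA addrACA.
    by ring.
  move=> _ _ [x [r [t [Ax /= -> ->]]]]; have [Dx dx] := dA _ _ Ax.
  split; first by rewrite addrC; exact: D_lin.
  move=> M; have [t0|t0|->] := ltgtP t 0.
  - have n0 : 0 < - t by rewrite oppr_gt0.
    move=> b; have := BdZ (t := (- t)^-1) _ (DD _ _ Dx (DZ t _ Dx0)) b; rewrite invr_gt0 => /(_ n0).
    rewrite scalerDr scalerA invrN mulNr mulVf ?lt_eqF // scaleN1r => b'.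
    have := a_ge _ _ _ (graph_scale (- t^-1) gA A0 Ax) b'.
    have -> : - t^-1 * r - - t^-1 * M = (- t)^-1 * (r - M) by rewrite invrN; ring.
    by rewrite -[leRHS]mul1r -(mulVf (lt0r_neq0 n0)) -mulrA ler_pM2l ?invr_gt0 //; lra.
  - move=> b; have := BdZ (t := t^-1) _ (DD _ _ Dx (DZ t _ Dx0)) b; rewrite invr_gt0 => /(_ t0).
    rewrite scalerDr scalerA mulVf ?gt_eqF // scale1r => b'.
    have := a_le _ _ _ (graph_scale t^-1 gA A0 Ax) b'.
    have -> : t^-1 * M - t^-1 * r = t^-1 * (M - r) by ring.
    by rewrite -[leLHS]mul1r -(mulVf (lt0r_neq0 t0)) -mulrA ler_pM2l ?invr_gt0 //; lra.
  - by rewrite scale0r mul0r !addr0; exact: dx.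
split=> [[x r] Ax|]; first by exists x, r, 0; rewrite scale0r mul0r !addr0.
by exists a, 0, 0, 1; rewrite scale1r mul1r !add0r.
Qed.

Lemma graph_fun A x r s : dominated_graph A -> A (0, 0) -> A (x, r) -> A (x, s) -> r = s.
Proof.
move=> gA A0 Ar As; have [lA dA] := gA.
have A1 : A (0, r - s).
  by have := lA (-1) _ _ _ _ As Ar; rewrite scaleN1r addNr mulN1r addrC.
have [D0 _] := dA _ _ A0; have [M hM] := BdE D0.
apply: contrapT => rs; have c0 : r - s != 0 by rewrite subr_eq0; exact/eqP.
have := graph_scale ((`|M| + 1) / (r - s)) gA A0 A1; rewrite scaler0 divfK // => A2.
have [_ h] := dA _ _ A2; have := h _ hM; have := ler_norm M; lra.
Qed.

Lemma hahn_banach : exists T : X -> R,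
  [/\ forall (a : R) x y, D x -> D y -> T (a *: x + y) = a * T x + T y,
      forall x r, G0 (x, r) -> T x = r & forall x M, D x -> Bd x M -> T x <= M].
Proof.
(* Adjoining [G0] makes the union of the empty chain admissible as well. *)
pose P (A : set (X * R)) := dominated_graph (A `|` G0).
have [A [PA maxA]] : exists A, P A /\ forall B, A `<` B -> ~ P B.
  apply: Zorn_bigcup => F FP tF; split.
    move=> a x y r s [[C FC Cx]|Gx] [[C' FC' Cy]|Gy].
    - have [CC|CC] := tF _ _ FC FC'.
        have [l _] := FP _ FC'; have [h|h] := l a _ _ _ _ (or_introl (CC _ Cx)) (or_introl Cy).
          by left; exists C'.
        by right.
      have [l _] := FP _ FC; have [h|h] := l a _ _ _ _ (or_introl Cx) (or_introl (CC _ Cy)).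
        by left; exists C.
      by right.
    - have [l _] := FP _ FC; have [h|h] := l a _ _ _ _ (or_introl Cx) (or_intror Gy).
        by left; exists C.
      by right.
    - have [l _] := FP _ FC'; have [h|h] := l a _ _ _ _ (or_intror Gx) (or_introl Cy).
        by left; exists C'.
      by right.
    - by right; case: G0_dom => l _; exact: l.
  move=> x r [[C FC Cx]|Gx]; first by case: (FP _ FC) => _ d; apply: d; left.
  by case: G0_dom => _; exact.
pose B := A `|` G0; have gB : dominated_graph B by [].
have B0 : B (0, 0) by right.
have tot x : D x -> exists r, B (x, r).
  move=> Dx; have [C gC [BC [a Ca]]] := graph_extend gB B0 Dx.
  exists a; left; apply: contrapT => nA; apply: (maxA C).
    by split; [move=> z Az; apply: BC; left|move=> CA; apply: nA; exact: CA].
  rewrite /P (_ : C `|` G0 = C) //; apply/seteqP; split=> z; last by left.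
  by case=> // Gz; apply: BC; right.
have /choice [T TB] : forall x, exists r, D x -> B (x, r).
  by move=> x; have [/tot [r Br]|nD] := pselect (D x); [exists r|exists 0].
have TE x r : B (x, r) -> T x = r.
  move=> Bx; have [_ dB] := gB; have [Dx _] := dB _ _ Bx.
  exact: graph_fun gB B0 (TB x Dx) Bx.
exists T; split.
- by move=> a x y Dx Dy; apply: TE; case: gB => l _; apply: l; exact: TB.
- by move=> x r Gx; apply: TE; right.
- by move=> x M Dx b; case: gB => _ d; have [_ h] := d _ _ (TB x Dx); exact: h.
Qed.

End HahnBanach.

Section TestInvariance.
Context {R : realType} {N : nat} (G : carnot R N).
Local Notation V := 'rV[R]_N.
Local Notation mul := (carnot_mul G).
Local Notation dil := (dilation G).
Implicit Types (f g phi psi : V -> R) (U : set V).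

Lemma test_dilate phi (t : R) : 0 < t -> test_fun setT phi -> test_fun setT (fun y => phi (dil t y)).
Proof.
move=> t0 tp; have [A cA] := test_ccont tp; have [B cB] := ccont_dilate G t0 cA.
exact: ccont_test (smooth_dilate G t (test_smooth tp)) cB.
Qed.

Lemma test_translate phi a : test_fun setT phi -> test_fun setT (fun y => phi (mul a y)).
Proof.
move=> tp; have [A cA] := test_ccont tp; have [B cB] := ccont_translate G a cA.
exact: ccont_test (smooth_translate G a (test_smooth tp)) cB.
Qed.

Lemma shell_compact (a b : R) : compact ([set x : V | `|x| <= b] `&` [set x : V | a <= `|x|]).
Proof.
apply: compact_closedI; first exact: closed_ball0_compact.
apply: (@preimage_closed _ _ (fun q : V => `|q|) [set r | a <= r]); last exact: closed_ge.
by move=> ? _; exact: norm_continuous.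
Qed.

Lemma test_ball phi (A : R) : (forall x, A <= `|x| -> phi x = 0) -> test_fun setT phi ->
  test_fun [set x | `|x| < A + 1] phi.
Proof.
move=> z tp; split; first exact: test_smooth tp.
exists [set x | `|x| <= A]; split; first exact: closed_ball0_compact.
  by move=> x /= xA; rewrite (le_lt_trans xA) // ltrDl.
by move=> x /= /negP; rewrite -ltNge => /ltW /z.
Qed.

Lemma test_out U phi l x : test_fun U phi -> ~ U x -> partials l phi x = 0.
Proof. by move=> tp nU; have [_ [K [_ KU z]]] := test_partials l tp; apply: z => /KU. Qed.

Lemma test_ckb phi m : test_fun setT phi -> exists2 M : R, 0 <= M & ckb m setT M phi.
Proof.
move=> tp; have [A [A0 _ z]] := test_ccont tp; have tb := test_ball z tp.
have [M M0 h] := smooth_ckb (A + 1) m (test_smooth tp).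
exists M => // l x lm _; have [xA|xA] := ltP `|x| (A + 1); first by apply: h => //; exact: ltW.
by rewrite (test_out l tb) ?normr0 //= ltNge xA.
Qed.

End TestInvariance.

(** * Parametrix and corrector *)

Section Parametrix.
Context {R : realType} {N : nat} (G : carnot R N).
Local Notation V := 'rV[R]_N.
Local Notation mul := (carnot_mul G).
Local Notation dil := (dilation G).
Implicit Types (f g phi psi : V -> R) (U : set V).
Variables (Lf Lt : (V -> R) -> V -> R) (lambda : R).
Hypothesis ops : inv_ops G Lf Lt lambda.
Hypotheses (hypo_t : hypoelliptic (op_dist Lf)) (hypo_f : hypoelliptic (op_dist Lt)).
Hypothesis lambda_gt0 : 0 < lambda.

Lemma Lt_eq_local U phi psi : open U -> (forall y, U y -> phi y = psi y) -> forall y, U y -> Lt phi y = Lt psi y.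
Proof. exact: (op_local (inv_t ops)). Qed.

(** Near 0, phi is unchanged by the dilation of ratio 1/2, so locality and homogeneity give
    [Lt phi 0] = 2^-lambda [Lt phi 0] with lambda > 0. *)
Lemma Lt_const0 phi (d : R) : 0 < d -> test_fun setT phi -> (forall x, `|x| < d -> phi x = 1) -> Lt phi 0 = 0.
Proof.
move=> d0 tp h1.
have oU := @open_norm_lt R N (d / 2).
have U0 : [set x : V | `|x| < d / 2] 0 by rewrite /= normr0 divr_gt0.
have t0 : 0 < 2^-1 :> R by rewrite invr_gt0.
have E : forall y, [set x : V | `|x| < d / 2] y -> phi (dil 2^-1 y) = phi y.
  move=> y /= yd; have y2 : `|y| < d by apply: (lt_le_trans yd); rewrite ler_pdivrMr // ler_peMr ?ler1n // ltW.
  rewrite !h1 //; apply: le_lt_trans (dilation_norm_le _ _ _) _; first by rewrite ltW //= invf_le1 // ler1n.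
  by rewrite (le_lt_trans _ y2) // ler_piMl // invf_le1 // ler1n.
have := Lt_eq_local oU E U0; rewrite (inv_dilate ops t0 tp) linear0 => H.
have p1 : 2^-1 `^ lambda < 1 :> R.
  have := @gt0_ltr_powR R lambda lambda_gt0 2^-1 1; rewrite !nnegrE invr_ge0 powR1; apply => //.
  by rewrite invf_lt1 // ltr1n.
by apply/eqP; move/eqP: H; rewrite -subr_eq0 -[X in _ - X]mul1r -mulrBl mulf_eq0 => /orP[|//]; rewrite subr_eq0 lt_eqF.
Qed.

Lemma Lt_locally_const U phi x : open U -> U x -> test_fun setT phi -> (forall y, U y -> phi y = 1) -> Lt phi x = 0.
Proof.
move=> oU Ux tp h1.
have := congr1 (@^~ 0) (inv_translate ops x tp); rewrite carnot_mulx0 => <-.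
have : nbhs (0 : V) (mul x @^-1` U).
  by apply: mulr_continuous; rewrite carnot_mulx0; exact: open_nbhs_nbhs.
move=> /nbhs_ballP [d /= d0 hd]; apply: (Lt_const0 d0); first exact: test_translate.
by move=> y yd; apply: h1; apply: hd; rewrite -ball_normE /ball_ /= sub0r normrN.
Qed.

Lemma local_inverse (i0 : 'I_N) : exists T : @prefunctional R N, is_distribution setT T /\
  forall phi, test_fun setT phi -> (forall x, 1 <= `|x| -> phi x = 0) -> T (Lt phi) = phi 0.
Proof.
have [m [C [C0 hC]]] := apriori ops hypo_t i0.
pose X := V -> R^o.
pose D (f : X) := test_fun setT (f : V -> R).
pose Bd (f : X) (M : R) := exists M0 : R, [/\ 0 <= M0, ckb m setT M0 (f : V -> R) & C * M0 <= M].
pose G0 : set (X * R) := [set z | exists phi : V -> R, [/\ test_fun setT phi, forall x, 1 <= `|x| ->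
  phi x = 0, z.1 = Lt phi & z.2 = phi 0]].
have [T [Tl TG TB]] : exists T : X -> R,
  [/\ forall (a : R) x y, D x -> D y -> T (a *: x + y) = a * T x + T y,
      forall x r, G0 (x, r) -> T x = r & forall x M, D x -> Bd x M -> T x <= M].
  apply: hahn_banach.
  - by move=> a f g tf tg; exact: (test_lin a tf tg).
  - move=> f g M M' tf tg [M0 [M00 b c]] [M1 [M10 b' c']]; exists (M0 + M1); split.
    + exact: addr_ge0.
    + move=> l x lm _.
      rewrite (@partialsD R N setT f g l x openT (test_smooth tf) (test_smooth tg) I).
      by apply: le_trans (ler_normD _ _) (lerD _ _); [exact: b|exact: b'].
    + by rewrite mulrDr lerD.
  - move=> t f M t0 tf [M0 [M00 b c]]; exists (t * M0); split.
    + by rewrite mulr_ge0 // ltW.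
    + by have := ckbZ t (test_smooth tf) b; rewrite gtr0_norm.
    + by rewrite mulrCA ler_pM2l.
  - by move=> f tf; have [M M0 h] := test_ckb m tf; exists (C * M), M; split.
  - by exists (fun=> 0); split => //; [exact: test0|rewrite (Lt0 ops)].
  - split.
      move=> a f g r s [phi [tp zp /= -> ->]] [psi [tq zq /= -> ->]].
      exists (fun x => a * phi x + psi x); split => //=; first exact: test_lin.
        by move=> x x1; rewrite zp // zq // mulr0 addr0.
      by rewrite (inv_lin ops a (test_smooth tp) (test_smooth tq)).
    move=> f r [phi [tp zp /= -> ->]]; split; first exact: (Lt_test ops).
    move=> M [M0 [M00 b c]]; apply: le_trans c; apply: le_trans (ler_norm _) _; exact: (hC phi M0 tp zp b).
exists T; split; last by move=> phi tp zp; apply: TG; exists phi.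
split=> [a phi psi tp tq|K cK _]; first exact: Tl.
exists C, m => phi M tp _ hM.
have M0 : 0 <= M by apply: le_trans (hM [::] 0 isT).
have b : Bd phi (C * M) by exists M; split => // l x lm _; exact: hM.
rewrite ler_norml (TB phi) // andbT.
have bN : Bd (fun x => -1 * phi x) (C * M).
  exists M; split => //; have := ckbZ (-1) (test_smooth tp) (fun l x lm (_ : setT x) => hM l x lm).
  by rewrite normrN1 mul1r.
have := TB _ _ (testZ (-1) tp) bN.
have -> : T (fun x => -1 * phi x) = - T phi.
  have T0 : T (fun=> 0) = 0.
    have := Tl 1 _ _ (test0 setT) (test0 setT).
    rewrite (_ : 1 *: (fun=> 0) + (fun=> 0) = (fun=> 0) :> X); last by apply/funext => x; rewrite /= fctE scaler0 addr0.
    by move=> h; lra.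
  have := Tl (-1) _ _ tp (test0 setT).
  rewrite (_ : -1 *: (phi : X) + (fun=> 0) = (fun x => -1 * phi x) :> X); last by apply/funext => x;
    rewrite !fctE addr0.
  by rewrite T0 addr0 mulN1r.
by rewrite lerNl.
Qed.

(* S is chi T, where chi is a cutoff and T inverts Lt near 0 and is smooth off 0. *)
Lemma parametrix (i0 : 'I_N) : exists (S : @prefunctional R N) (omega : V -> R),
  [/\ test_fun setT omega,
    forall (a : R) phi psi, test_fun setT phi -> test_fun setT psi ->
      S (fun x => a * phi x + psi x) = a * S phi + S psi,
    exists m (C : R), 0 <= C /\ forall phi M, test_fun setT phi -> 0 <= M ->
      ckb m [set x | `|x| < 1] M phi -> `|S phi| <= C * M &
    forall phi, test_fun setT phi -> S (Lt phi) = phi 0 - integral_rV (fun x => omega x * phi x)].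
Proof.
have [T [dT TL]] := local_inverse i0.
have p8 : 0 < 8^-1 :> R by rewrite invr_gt0.
pose chi0 : V -> R := bump 0 8^-1.
have sc : smooth_on setT chi0 := bump_smooth 0 8^-1.
have chi1 x : `|x| <= 8^-1 -> chi0 x = 1 by move=> h; apply: bump_eq1; rewrite ?subr0.
have chiz x : 4^-1 <= `|x| -> chi0 x = 0 by move=> h; apply: bump_eq0; rewrite ?subr0 //; lra.
have tc : test_fun setT chi0 by apply: (@testI R N 4^-1).
pose U' := [set x : V | 0 < `|x| < 1].
have oU' : @open V U'.
  rewrite (_ : U' = [set x : V | 0 < `|x|] `&` [set x : V | `|x| < 1]); last first.
    by apply/seteqP; split=> x /= => [/andP[]|[a b]] //; apply/andP.
  apply: openI; last exact: open_norm_lt.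
  by apply: (@open_comp _ _ (fun q : V => `|q|) [set r | 0 < r]); [move=> ? _; exact: norm_continuous|exact: open_gt].
have dT' : is_distribution U' T.
  split=> [a phi psi tp tq|K cK _]; first exact: (dist_lin dT a (testT tp) (testT tq)).
  have [C [m h]] := proj2 dT K cK (@subsetT _ _); exists C, m => phi M tp; exact: h (testT tp).
have eT : eq_dist U' (op_dist Lt T) (dist_of (fun=> 0)).
  move=> phi tp; have [_ [K [_ KU z]]] := tp.
  rewrite /op_dist TL.
  - rewrite z; last by move=> /KU; rewrite /U' /= normr0 ltxx.
    by rewrite /dist_of; under eq_fun do rewrite mul0r; rewrite int0.
  - exact: testT tp.
  - by move=> x x1; apply: z => /KU /andP[_]; rewrite ltNge x1.
have [u su Tu] := hypo_f oU' dT' (smooth_cst oU' 0) eT.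
(* Vanishes near 0, where u is not defined as a smooth function, and equals 1 on a shell containing
   1/8 <= |x| <= 1/4, where the commutator of [chi0] with Lt lives; v = u th is then a test function
   on the whole space. *)
pose th (x : V) : R := bump 0 (3 / 8) x * (1 - bump 0 32^-1 x).
have p38 : 0 < 3 / 8 :> R by lra.
have p32 : 0 < 32^-1 :> R by rewrite invr_gt0.
have th1 x : 16^-1 <= `|x| <= 3 / 8 -> th x = 1.
  move=> /andP[a b]; rewrite /th bump_eq1 ?subr0 // bump_eq0 ?subr0 ?mulr1 //; lra.
have tth : test_fun U' th.
  split.
    exact: (smoothM openT (bump_smooth 0 (3 / 8)) (smoothB openT (smooth_cst openT 1) (bump_smooth 0 32^-1))).
  exists ([set x : V | `|x| <= 3 / 4] `&` [set x : V | 32^-1 <= `|x|]); split.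
  - exact: shell_compact.
  - by move=> x [/= b a]; rewrite /U' /=; apply/andP; split; lra.
  - move=> x nx; rewrite /th; have [a|a] := leP 32^-1 `|x|; last first.
      by rewrite (bump_eq1 (r := 32^-1)) ?subr0 ?subrr ?mulr0 // ltW.
    rewrite bump_eq0 ?subr0 ?mul0r // leNgt; apply/negP => b; apply: nx; split => //=.
    by move: b; lra.
pose v x := u x * th x.
have tv : test_fun setT v by exact: testT (smooth_mul_test oU' su tth).
have sv := test_smooth tv.
(* By duality, the integral of v times the commutator of [chi0] with Lt, applied to phi, is minus
   the integral of om times phi. *)
pose om x := chi0 x * Lf v x - Lf (fun y => v y * chi0 y) x.
have tvc : test_fun setT (fun y => v y * chi0 y).
  by have := testM sv tc.
have tom : test_fun setT om.
  exact: (testB (testM sc (op_test (inv_f ops) tv)) (op_test (inv_f ops) tvc)).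
have tcp phi : test_fun setT phi -> test_fun setT (fun x => chi0 x * phi x) by exact: testM.
exists (fun phi => T (fun x => chi0 x * phi x)), om; split => //.
- move=> a phi psi tp tq; rewrite -(dist_lin dT a (tcp _ tp) (tcp _ tq)).
  by congr T; apply/funext => x; ring.
- have [C [m h]] := proj2 dT [set x | `|x| <= 1] (@closed_ball0_compact R N 1) (@subsetT _ _).
  have [B B0 hB] := test_ckb m tc.
  exists m, (`|C| * (2 ^+ m * B)); split; first by rewrite mulr_ge0 // mulr_ge0 // exprn_ge0.
  move=> phi M tp M0 hM; apply: (@le_trans _ _ (C * (2 ^+ m * (B * M)))); last first.
    by rewrite -!mulrA ler_wpM2r ?ler_norm // mulr_ge0 ?exprn_ge0 // mulr_ge0.
  apply: h; first exact: tcp.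
    by move=> x /= /negP; rewrite -ltNge => /ltW x1; rewrite chiz ?mul0r //; apply: le_trans x1;
      rewrite invf_le1 // ler1n.
  have t1 : test_fun [set x : V | `|x| < 1] (fun x => chi0 x * phi x).
    split; first exact: test_smooth (tcp _ tp).
    exists [set x | `|x| <= 4^-1]; split; first exact: closed_ball0_compact.
      by move=> x /= /le_lt_trans; apply; rewrite invf_lt1 // ltr1n.
    by move=> x /= /negP; rewrite -ltNge => /ltW x1; rewrite chiz ?mul0r.
  move=> l x lm; have [x1|x1] := ltP `|x| 1; last first.
    by rewrite (test_out l t1) ?normr0 ?mulr_ge0 ?exprn_ge0 //= ltNge x1.
  have o1 := @open_norm_lt R N 1.
  apply: (@ckbM R N [set x | `|x| < 1] chi0 phi B M m o1 _ _ B0 M0 _ hM l x lm x1).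
  + exact: (smooth_sub (@subsetT _ _) sc).
  + exact: (smooth_sub (@subsetT _ _) (test_smooth tp)).
  + by apply: (ckb_le (leqnn m) (@subsetT _ _) (lexx B) hB).
- move=> phi tp.
  have tLp : test_fun setT (Lt phi) := Lt_test ops tp.
  (* The commutator of the cutoff with Lt: it vanishes off a shell on which T is the smooth function
     u. *)
  pose c x := chi0 x * Lt phi x - Lt (fun y => chi0 y * phi y) x.
  have cE x : ~ (8^-1 <= `|x| <= 4^-1) -> c x = 0.
    rewrite /c; have [x8|x8] := ltP `|x| 8^-1 => H.
      rewrite chi1 ?(ltW x8) // mul1r.
      have e y : [set x : V | `|x| < 8^-1] y -> chi0 y * phi y = phi y by move=> /= yl; rewrite chi1 ?mul1r // ltW.
      by rewrite (Lt_eq_local (@open_norm_lt R N 8^-1) e x8) subrr.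
    have x4 : 4^-1 < `|x| by rewrite ltNge; apply/negP => x4; apply: H.
    rewrite chiz ?(ltW x4) // mul0r.
    have o4 : @open V [set x | 4^-1 < `|x|].
      by apply: (@open_comp _ _ (fun q : V => `|q|) [set r | 4^-1 < r]); [move=> ? _;
        exact: norm_continuous|exact: open_gt].
    have e y : [set x : V | 4^-1 < `|x|] y -> chi0 y * phi y = (fun=> 0) y by move=> /= yl; rewrite chiz ?mul0r // ltW.
    by rewrite (Lt_eq_local o4 e x4) (Lt0 ops) subrr.
  have t1 : test_fun setT (fun x => chi0 x * Lt phi x) := tcp _ tLp.
  have t2 : test_fun setT (Lt (fun y => chi0 y * phi y)) := Lt_test ops (tcp _ tp).
  have tc' : test_fun U' c.
    split; first exact: test_smooth (testB t1 t2).
    exists ([set x : V | `|x| <= 4^-1] `&` [set x : V | 8^-1 <= `|x|]); split.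
    - exact: shell_compact.
    - by move=> x [/= b a]; rewrite /U' /=; apply/andP; split; lra.
    - by move=> x nx; apply: cE => /andP[a b]; apply: nx.
  have -> : T (fun x => chi0 x * Lt phi x) = T c + T (Lt (fun y => chi0 y * phi y)).
    by rewrite /c (distB dT t1 t2) subrK.
  rewrite (TL _ (tcp _ tp)); last by move=> x x1; rewrite chiz ?mul0r // (le_trans _ x1) // invf_le1 // ler1n.
  rewrite chi1 ?normr0 ?invr_ge0 // mul1r addrC; congr (_ + _).
  rewrite (Tu c tc') /dist_of.
  have -> : (fun x => u x * c x) = (fun x => -1 * (v x * Lt (fun y => chi0 y * phi y) x) + (v x * chi0 x) * Lt phi x).
    apply/funext => x; have [h|h] := pselect (8^-1 <= `|x| <= 4^-1).
      have -> : v x = u x by rewrite /v th1 ?mulr1 //; move: h => /andP[a b]; apply/andP; split; lra.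
      by rewrite /c; ring.
    have := cE x h; rewrite /c => /eqP; rewrite subr_eq0 => /eqP e.
    by rewrite /c e -[(v x * chi0 x) * _]mulrA e; ring.
  rewrite (int_test_lin (-1) (testM sv t2) (testM (test_smooth tvc) tLp)).
  rewrite (inv_dual ops sv (tcp _ tp)) (inv_dual ops (test_smooth tvc) tp).
  have tLv : test_fun setT (Lf v) := op_test (inv_f ops) tv.
  have tLvc : test_fun setT (Lf (fun y => v y * chi0 y)) := op_test (inv_f ops) tvc.
  have -> : (fun x => om x * phi x) = fun x => -1 * (Lf (fun y => v y * chi0 y) x * phi x) + (Lf v x * (chi0 x * phi
    x)).
    by apply/funext => x; rewrite /om; ring.
  rewrite (int_test_lin (-1) (testM (test_smooth tLvc) tp) (testM (test_smooth tLv) (tcp _ tp))).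
  by ring.
Qed.

(* The parametrix minus its dilate is mapped by Lf to a smooth function, hence is a smooth D. *)
Lemma corrector (i0 : 'I_N) (Lam : R) : 1 < Lam -> exists D omega : V -> R,
  [/\ test_fun setT D, test_fun setT omega, integral_rV omega = 1 &
    forall phi, test_fun setT phi -> integral_rV (fun x => D x * Lt phi x) =
      integral_rV (fun x => omega x * phi x) - integral_rV (fun x => omega x * phi (dil Lam x))].
Proof.
move=> Lam1; have Lam0 : 0 < Lam by exact: lt_trans Lam1.
have Li0 : 0 < Lam^-1 by rewrite invr_gt0.
have [S [om [tom Sl [m [C [C0 hC]]] SL]]] := parametrix i0.
have som := test_smooth tom.
(* The Dirac masses at 0 of S and of its dilate cancel, so that L maps S' to the smooth function F
   below. *)
pose S' phi := Lam `^ lambda * S (fun x => phi (dil Lam x)) - S phi.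
have S'L phi : test_fun setT phi -> S' (Lt phi) =
    integral_rV (fun x => om x * phi x) - integral_rV (fun x => om x * phi (dil Lam x)).
  move=> tp; have td := test_dilate G Lam0 tp.
  have E : Lam `^ lambda * S (fun x => Lt phi (dil Lam x)) = S (Lt (fun y => phi (dil Lam y))).
    rewrite (inv_dilate ops Lam0 tp).
    have := Sl (Lam `^ lambda) _ _ (test_dilate G Lam0 (Lt_test ops tp)) (test0 setT).
    have -> : S (fun=> 0) = 0.
      by have := Sl (-1) _ _ (test0 setT) (test0 setT); under eq_fun do rewrite mulr0 addr0; lra.
    by rewrite addr0 => <-; congr S; apply/funext => x; rewrite addr0.
  by rewrite /S' E !SL // linear0; ring.
have [A A0 hA] := compact_norm_le (continuous_compact (continuous_subspaceT (@dil_continuous R N G Lam))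
  (@closed_ball0_compact R N 1)).
have [C1 C10 hC1] := ckb_comp (n := N) 1 m (dil_smooth G Lam).
have S'b phi M : test_fun setT phi -> 0 <= M -> ckb m setT M phi -> `|S' phi| <= (Lam `^ lambda * (C * C1) + C) * M.
  move=> tp M0 hM; apply: le_trans (ler_normB _ _) _; rewrite mulrDl; apply: lerD.
    rewrite normrM ger0_norm ?powR_ge0 // -!mulrA ler_wpM2l ?powR_ge0 //.
    apply: hC; [exact: (test_dilate G Lam0 tp)|by rewrite mulr_ge0 // ltW|exact: (hC1 _ _ (test_smooth tp) M0 hM)].
  apply: hC => //; exact: (ckb_le (leqnn m) (@subsetT _ _) (lexx M) hM).
have dS' : is_distribution setT S'.
  split=> [a phi psi tp tq|K cK _].
    by rewrite /S' (Sl a _ _ (test_dilate G Lam0 tp) (test_dilate G Lam0 tq)) (Sl a _ _ tp tq); ring.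
  exists (Lam `^ lambda * (C * C1) + C), m => phi M tp _ hM.
  apply: S'b => //; first exact: le_trans (hM [::] 0 isT).
  by move=> l x lm _; exact: hM.
pose F x := om x - Lam ^- qdim G * om (dil Lam^-1 x).
have sF : smooth_on setT F.
  exact: (smoothB openT som (smoothZ openT _ (smooth_dilate G Lam^-1 som))).
have Lamn : Lam != 0 by rewrite gt_eqF.
have FE phi : test_fun setT phi -> integral_rV (fun x => F x * phi x) =
    integral_rV (fun x => om x * phi x) - integral_rV (fun x => om x * phi (dil Lam x)).
  move=> tp; have tod : test_fun setT (fun x => om (dil Lam^-1 x)) := test_dilate G Li0 tom.
  have t1 : test_fun setT (fun x => om (dil Lam^-1 x) * phi x) := testM (test_smooth tod) tp.
  have := int_test_lin (- Lam ^- qdim G) t1 (testM som tp).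
  have -> : (fun x => - Lam ^- qdim G * (om (dil Lam^-1 x) * phi x) + om x * phi x) = (fun x => F x * phi x).
    by apply/funext => x; rewrite /F; ring.
  move=> ->; rewrite mulNr addrC; congr (_ - _).
  have [B cB] := test_ccont t1; rewrite -(int_dilate G Lam0 cB); congr integral_rV.
  by apply/funext => x; rewrite dilVK.
have eS' : eq_dist setT (op_dist Lt S') (dist_of F).
  by move=> phi tp; rewrite /op_dist /dist_of S'L // FE.
have [D sD DS] := hypo_f openT dS' sF eS'.
(* S depends only on the restriction to the unit ball, and A bounds the image of that ball by the
   dilation: S' vanishes on test functions supported in |x| > B. *)
pose B := Num.max A 1.
have zD x : B < `|x| -> D x = 0.
  have oB : @open V [set x | B < `|x|].
    by apply: (@open_comp _ _ (fun q : V => `|q|) [set r | B < r]); [move=> ? _; exact: norm_continuous|exact: open_gt].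
  apply: (fundamental_lemma oB (f := D)); first by move=> y _; exact: (smooth_cont sD I).
  move=> phi tp; have tpT := testT tp.
  have z y : `|y| <= B -> phi y = 0.
    by move=> yB; case: tp => _ [K [_ KU zK]]; apply: zK => /KU /=; rewrite ltNge yB.
  have c0 (f : V -> R) : (forall x, `|x| < 1 -> f x = 0) -> ckb m [set x | `|x| < 1] 0 f.
    by move=> zf l y _ y1; rewrite (partials_zero l (@open_norm_lt R N 1) zf y1) normr0.
  have S0 f : test_fun setT f -> (forall x, `|x| < 1 -> f x = 0) -> S f = 0.
    move=> tf zf; apply/eqP; rewrite -normr_le0; apply: le_trans (hC f 0 tf (lexx _) (c0 f zf)) _.
    by rewrite mulr0.
  apply: (etrans (esym (DS phi tpT))); rewrite /S'.
  have S1 : S phi = 0.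
    by apply: S0 => // y y1; apply: z; rewrite /B le_max (ltW y1) orbT.
  have S2 : S (fun x => phi (dil Lam x)) = 0.
    apply: S0; first exact: (test_dilate G Lam0 tpT).
    by move=> y y1; apply: z; rewrite /B le_max ltW //; apply: hA; exists y => //=; exact: ltW.
  by rewrite S1 S2 mulr0 subrr.
have tD : test_fun setT D.
  by apply: (@testI R N (B + 1)) => // x xB; apply: zD; apply: lt_le_trans xB; rewrite ltrDl.
exists D, om; split => //.
  have [A' [A'0 _ zA]] := test_ccont tom.
  pose r := A' + 1; have r0 : 0 < r by rewrite addr_gt0.
  (* As phi is 1 on a large ball, [Lt phi] vanishes on the unit ball and S does not see it; the
     identity for S then reads 0 = 1 - integral of omega. *)
  pose phi : V -> R := bump 0 r.
  have p1 x : `|x| <= r -> phi x = 1 by move=> h; apply: bump_eq1; rewrite ?subr0.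
  have tp : test_fun setT phi by apply: bump_test.
  have := SL phi tp; rewrite p1 ?normr0 ?(ltW r0) //.
  have -> : S (Lt phi) = 0.
    apply/eqP; rewrite -normr_le0; apply: le_trans (hC (Lt phi) 0 (Lt_test ops tp) (lexx _) _) _; last by rewrite mulr0.
    move=> l x _ x1; rewrite (partials_zero l (@open_norm_lt R N 1) _ x1) ?normr0 // => y y1.
    apply: (Lt_locally_const (@open_norm_lt R N 1) y1 tp) => w /= w1; apply: p1.
    by apply: ltW; apply: (lt_trans w1); rewrite ltrDr.
  have -> : (fun x => om x * phi x) = om.
    apply/funext => x; have [xr|xr] := leP `|x| r; first by rewrite p1 // mulr1.
    by rewrite zA ?mul0r // ltW // (lt_trans _ xr) // ltrDl.
  by move=> h; lra.
move=> phi tp; rewrite -S'L //.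
exact: (esym (DS _ (Lt_test ops tp))).
Qed.

(** The integral of [Lt phi] is that of h phi with h = L 1. Left invariance makes h constant, and
    homogeneity of positive degree makes the constant 0. *)
Lemma int_Lt phi : test_fun setT phi -> integral_rV (Lt phi) = 0.
Proof.
pose h := Lf (fun=> 1).
have s1 : smooth_on setT (fun=> 1 : R) := smooth_cst (@openT V) (1 : R).
have sh : smooth_on setT h := op_smooth (inv_f ops) openT s1.
have hE psi : test_fun setT psi -> integral_rV (Lt psi) = integral_rV (fun x => h x * psi x).
  move=> tp; rewrite -(inv_dual ops s1 tp); congr integral_rV.
  by apply/funext => x; rewrite mul1r.
have hc a : h a = h 0.
  apply/eqP; rewrite -subr_eq0; apply/eqP.
  have sd : smooth_on setT (fun x => h (mul a x) - h x) := smoothB openT (smooth_translate G a sh) sh.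
  suff : h (mul a 0) - h 0 = 0 by rewrite carnot_mulx0.
  apply: (@fundamental_lemma R N setT (fun x => h (mul a x) - h x)) => //; first exact: openT.
    by move=> y _; exact: (smooth_cont sd I).
  move=> psi tp.
  have tt : test_fun setT (fun y => psi (mul (- a) y)) := test_translate G (- a) tp.
  have := int_test_lin (-1) (testM sh tp) (testM (smooth_translate G a sh) tp).
  have -> : (fun x => -1 * (h x * psi x) + h (mul a x) * psi x) = (fun x => (h (mul a x) - h x) * psi x).
    by apply/funext => x; ring.
  move=> ->; rewrite -hE // mulN1r addrC; apply/eqP; rewrite subr_eq0; apply/eqP.
  have [A cA] := test_ccont (Lt_test ops tp); rewrite -(int_translate G (- a) cA).
  have E : (fun x => Lt psi (mul (- a) x)) = Lt (fun y => psi (mul (- a) y)) by rewrite (inv_translate ops (- a) tp).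
  rewrite E (hE _ tt).
  have [B cB] := test_ccont (testM sh tt); rewrite -(int_translate G a cB); congr integral_rV.
  by apply/funext => x; rewrite mulKx.
have c0 : h 0 = 0.
  pose psi : V -> R := bump 0 1.
  have tp : test_fun setT psi by apply: bump_test.
  have [A cA] := test_ccont tp.
  have Ip : 0 < integral_rV psi.
    apply: (int_gt0 (x0 := 0) cA) => [x|]; first by case/andP: (bump01 0 1 x).
    by rewrite /psi bump_eq1 // subrr normr0.
  have hI f : test_fun setT f -> integral_rV (Lt f) = h 0 * integral_rV f.
    move=> tf; rewrite hE // -(intZ_test (h 0) tf); congr integral_rV.
    by apply/funext => x; rewrite hc.
  have p2 : 0 < 2 :> R by [].
  have := hI _ (test_dilate G p2 tp); rewrite (inv_dilate ops p2 tp).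
  have tLd := test_dilate G p2 (Lt_test ops tp).
  have [B cB] := test_ccont (Lt_test ops tp).
  rewrite (intZ_test _ tLd) (int_dilate G p2 cA) (int_dilate G p2 cB) (hI _ tp) => H.
  have q0 : 2 ^- qdim G != 0 :> R by rewrite invr_neq0 // expf_neq0.
  have : (2 `^ lambda - 1) * (2 ^- qdim G * (h 0 * integral_rV psi)) = 0.
    by rewrite mulrBl mul1r H; ring.
  move/eqP; rewrite !mulf_eq0 (negbTE q0) (gt_eqF Ip) /= !orbF => /orP[|/eqP //].
  rewrite subr_eq0 gt_eqF //.
  by have := @gt0_ltr_powR R lambda lambda_gt0 1 2; rewrite !nnegrE powR1; apply => //; rewrite ltr1n.
move=> tp; rewrite hE //.
by rewrite (_ : (fun x => h x * phi x) = fun=> 0) ?int0 //; apply/funext => x; rewrite hc c0 mul0r.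
Qed.

End Parametrix.

(** * Frostman weights *)

Section Packing.
Context {R : realType}.

Lemma positive_lower_bound (I : finType) (F : I -> R) : (forall i, 0 < F i) ->
  exists2 e : R, 0 < e & forall i, e <= F i.
Proof.
move=> F0; exists (\big[Num.min/1]_i F i); last by move=> i; exact: bigmin_le_cond.
by apply/bigmin_gtP; split.
Qed.

(* Take weights of maximal total mass. *)
Lemma saturated_weights p (J : finType) (B : J -> {set 'I_p}) (c : J -> R) :
  (forall k, 0 <= c k) -> (forall i, exists k, i \in B k) ->
  exists m : 'I_p -> R, [/\ forall i, 0 <= m i, forall k, \sum_(i in B k) m i <= c k &
    forall i, exists2 k, i \in B k & \sum_(i' in B k) m i' = c k].
Proof.
move=> c0 cov.
pose ind k (i : 'I_p) : R := (i \in B k)%:R.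
have indE k (w : 'rV[R]_p) : lform (ind k) w = \sum_(i in B k) w ord0 i.
  by rewrite /lform [RHS]big_mkcond; apply: eq_bigr => i _; rewrite /ind; case: ifP => _; rewrite ?mulr1 ?mulr0.
pose P : set 'rV[R]_p := \bigcap_(i : 'I_p) [set w : 'rV[R]_p | 0 <= w ord0 i] `&` \bigcap_k [set w : 'rV[R]_p |
  lform (ind k) w <= c k].
have cc i : continuous (fun w : 'rV[R]_p => w ord0 i) by move=> w; exact: (smooth_cont (smooth_coord openT i) I).
have P0 : P !=set0.
  exists 0; split=> [i _|k _] /=; first by rewrite mxE.
  by rewrite indE big1 // => i _; rewrite mxE.
have cP : compact P.
  apply: bounded_closed_compact.
    exists (\sum_k c k); split; first exact: num_real.
    move=> M cM w [w0 wc] /=; apply/rV_normP.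
      by apply: le_trans (ltW cM); apply: sumr_ge0.
    move=> i; have [k ik] := cov i; rewrite ger0_norm; last exact: w0.
    apply: le_trans (ltW cM); apply: (@le_trans _ _ (c k)); last first.
      by rewrite (bigD1 k) //= lerDl sumr_ge0.
    have := wc k I; rewrite /= indE (bigD1 i) //= => h; apply: le_trans h; rewrite lerDl sumr_ge0 // => j _; exact: w0.
  apply: closedI.
    apply: closed_bigI => i _.
    by apply: (@preimage_closed _ _ (fun w : 'rV[R]_p => w ord0 i) [set r | 0 <= r]); [move=> ? _;
      exact: cc|exact: closed_ge].
  apply: closed_bigI => k _.
  by apply: (@preimage_closed _ _ (lform (ind k)) [set r | r <= c k]); [move=> ? _;
    exact: lform_continuous|exact: closed_le].
have [w /set_mem [w0 wc] wmax] : exists2 w, w \in P & forall v, v \in P -> lform (fun=> 1) v <= lform (fun=> 1) w.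
  by apply: EVT_max_rV => //; apply: continuous_subspaceT; exact: lform_continuous.
exists (fun i => w ord0 i); split=> [i|k|i]; first exact: w0.
  by have := wc k I; rewrite /= indE.
(* If no constraint containing i is tight, the weight of i can be raised by the least slack e,
   against maximality. *)
apply: contrapT => nsat.
have slack k : i \in B k -> lform (ind k) w < c k.
  move=> ik; rewrite lt_neqAle; have -> := wc k I; rewrite andbT; apply/eqP => e.
  by apply: nsat; exists k; rewrite // -indE.
pose F k := if i \in B k then c k - lform (ind k) w else 1.
have [e e0 he] : exists2 e : R, 0 < e & forall k, e <= F k.
  by apply: positive_lower_bound => k; rewrite /F; case: ifP => // /slack; rewrite subr_gt0.
have lf a : lform a (e *: evec i + w) = e * a i + lform a w.
  by have := lform_linear a e (evec i) w; rewrite lform_evec.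
have : lform (fun=> 1) (e *: evec i + w) <= lform (fun=> 1) w.
  apply: wmax; rewrite inE; split=> [j _|k _] /=.
    by rewrite rVD rVZ evecE addr_ge0 ?mulr_ge0 ?(ltW e0) //; exact: w0.
  rewrite lf /ind; have := he k; rewrite /F; case: ifP => ik; rewrite ?mulr1 ?mulr0 ?add0r.
    by rewrite lerBrDr.
  by move=> _; exact: wc.
by rewrite lf mulr1 gerDr leNgt e0.
Qed.

Lemma exists_max (T : eqType) (rad : T -> R) (l : seq T) : l != [::] ->
  exists2 a, a \in l & forall b, b \in l -> rad b <= rad a.
Proof.
elim: l => // a l IH _; have [->|/IH [b bl hb]] := eqVneq l [::].
  by exists a; rewrite ?mem_head // => b; rewrite inE => /eqP ->.
have [ab|ba] := leP (rad a) (rad b).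
  by exists b; [rewrite inE bl orbT|move=> c; rewrite inE => /orP[/eqP ->|/hb]].
exists a; rewrite ?mem_head // => c; rewrite inE => /orP[/eqP ->//|/hb h]; exact: le_trans (ltW ba).
Qed.

(** Greedy selection: keep an element of largest radius, drop all that meet it, and repeat. The
    selection thus comes sorted by decreasing radius, the order used by the partition of unity. *)
Lemma vitali (T : eqType) (meets : rel T) (rad : T -> R) (l : seq T) : reflexive meets ->
  exists S : seq T, [/\ {subset S <= l}, pairwise (fun a b => (rad b <= rad a) && ~~ meets b a) S &
    forall a, a \in l -> exists b, [/\ b \in S, meets a b & rad a <= rad b]].
Proof.
move=> mxx; have [n] := ubnP (size l); elim: n l => // n IH l ln.
have [->|ln0] := eqVneq l [::]; first by exists [::]; split.
have [a al amax] := exists_max rad ln0.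
pose l' := [seq b <- l | ~~ meets b a].
have sl' : (size l' < n)%N.
  apply: (@leq_trans (size l)); last by rewrite -ltnS.
  rewrite size_filter ltn_neqAle count_size andbT.
  rewrite -all_count; apply/negP => /allP /(_ a al); by rewrite mxx.
have [S [Sl pS cS]] := IH l' sl'.
exists (a :: S); split=> [b|/=|b bl].
- by rewrite inE => /orP[/eqP ->//|/Sl]; rewrite mem_filter => /andP[].
- rewrite pS andbT; apply/allP => b /Sl; rewrite mem_filter => /andP[-> bl]; rewrite andbT; exact: amax.
- have [ba|nba] := boolP (meets b a); first by exists a; rewrite mem_head; split => //; exact: amax.
  have [|c [cS' mc rc]] := cS b; first by rewrite mem_filter nba.
  by exists c; rewrite inE cS' orbT.
Qed.

Lemma pairwise_neq (T : eqType) (r : rel T) (q : rel T) (S : seq T) a b : symmetric r ->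
  pairwise (fun a b => q a b && ~~ r b a) S -> a \in S -> b \in S -> r a b -> a = b.
Proof.
move=> sr; elim: S => //= c S IH /andP[/allP h pS]; rewrite !inE => /orP[/eqP ->|aS] /orP[/eqP ->|bS] // rab.
- by have := h b bS; rewrite sr rab andbF.
- by have := h a aS; rewrite rab andbF.
- exact: IH.
Qed.

End Packing.

(** * Discrete Frostman measures *)

Section Frostman.
Context {R : realType} {N : nat} (G : carnot R N).
Local Notation V := 'rV[R]_N.
Local Notation mul := (carnot_mul G).
Local Notation dil := (dilation G).
Local Notation box := (box G).
Implicit Types (x y z : V).

Lemma box_near (r : R) x : 0 < r -> exists2 d : R, 0 < d & forall z, `|x - z| < d -> box r (mul (- x) z).
Proof.
move=> r0; have c : continuous (fun z => dil r^-1 (mul (- x) z)).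
  by move=> z; apply: (@continuous_comp _ _ _ (mul (- x)) (dil r^-1)); [exact: mulr_continuous|exact: dil_continuous].
have /cvgrPdist_le /(_ 1 ltr01) /nbhs_ballP [d /= d0 hd] := c x.
exists d => // z zd; have := hd z; rewrite -ball_normE /ball_ /= mulNx linear0 sub0r normrN; exact.
Qed.

Lemma pow2_ge (b : R) : exists k : nat, b <= 2 ^+ k :> R.
Proof.
have b1 : 0 < (`|b| + 1)^-1 by rewrite invr_gt0 ltr_wpDl.
have [n hn] := half_pow_small b1; exists n; have := hn n (leqnn n).
rewrite exprVn ltf_pV2 ?posrE ?ltr_wpDl ?exprn_gt0 // => h.
by apply: le_trans (ltW h); rewrite (le_trans (ler_norm b)) // lerDl.
Qed.

Lemma compact_box (K : set V) : compact K -> exists k : nat, forall x y, K x -> K y -> box (2 ^+ k) (mul (- x) y).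
Proof.
move=> cK; have [A A0 hA] := compact_norm_le cK; have [B B0 hB] := mul_bounded G A.
have [k hk] := pow2_ge (Num.max 1 B); exists k => x y Kx Ky.
have k1 : 1 <= 2 ^+ k :> R by apply: le_trans hk; rewrite le_max lexx.
apply: norm_box => //; apply: (@le_trans _ _ B); last by apply: le_trans hk; rewrite le_max lexx orbT.
by apply: hB; rewrite ?normrN ltW // hA.
Qed.

(* Saturated weights for the constraints on boxes of radii 2^k, followed by a Vitali selection among
   the saturated boxes. *)
Lemma frostman (s : R) : 0 < s -> exists2 C : R, 0 < C & forall K : set V, compact K ->
  exists M : R, forall n : nat, exists (p : nat) (x : 'I_p -> V) (m : 'I_p -> R),
    [/\ forall i, K (x i) /\ 0 <= m i,
      forall y (r : R), 2^-1 ^+ n <= r -> \sum_(i | box r (mul (- y) (x i))) m i <= C * r `^ s,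
      \sum_i m i <= M &
      exists S : seq (V * R), [/\ forall a : V * R, a \in S -> 0 < a.2,
        forall z, K z -> exists2 a : V * R, a \in S & box (C * a.2) (mul (- a.1) z) &
        (\sum_(a <- S) a.2 `^ s <= \sum_i m i)]].
Proof.
move=> s0; have [K0 K01 hK0] := box_mul G.
have K00 : 0 < K0 by exact: lt_le_trans K01.
have C1 : 0 < (2 * K0) `^ s by rewrite powR_gt0 // mulr_gt0.
(* The first term serves the growth bound, where K0 recentres the box at a point of the net and 2
   rounds the radius up to an admissible one; the second is the enlargement of the selected boxes in
   the covering. *)
pose C := (2 * K0) `^ s + K0 * K0.
have C0 : 0 < C by rewrite addr_gt0 // mulr_gt0.
exists C => // K cK; have [k1 hk1] := compact_box cK.
exists ((2 ^+ k1) `^ s) => n.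
have t0 : 0 < 2^-1 ^+ n :> R by exact: half_pow_gt0.
have /choice [d hd] : forall x : V, exists d : R, 0 < d /\ forall z, `|x - z| < d -> box (2^-1 ^+ n) (mul (- x) z).
  by move=> x; have [d ? ?] := box_near x t0; exists d.
have [X XK cov] := ball_cover cK (fun x _ => proj1 (hd x)).
pose p := size X; pose x (i : 'I_p) := nth 0 X i.
have xK i : K (x i) by apply: XK; exact: mem_nth.
have net z : K z -> exists i, box (2^-1 ^+ n) (mul (- x i) z).
  move=> Kz; have [y yX yz] := cov z Kz.
  have iX : (index y X < p)%N by rewrite index_mem.
  exists (Ordinal iX); rewrite /x /= nth_index //; exact: (proj2 (hd y)).
(* The radii [rho] run from 2^-n to 2^k1, the last box around any point of K containing K. *)
pose q := (n + k1).+1.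
pose rho (j : 'I_q) : R := 2^-1 ^+ n * 2 ^+ j.
have rho0 j : 0 < rho j by rewrite mulr_gt0 // exprn_gt0.
have rho_last : rho ord_max = 2 ^+ k1.
  by rewrite /rho /= exprD mulrA exprVn mulVf ?mul1r // expf_neq0.
pose B (k : 'I_p * 'I_q) : {set 'I_p} := [set i | box (rho k.2) (mul (- x k.1) (x i))]%SET.
pose c (k : 'I_p * 'I_q) := rho k.2 `^ s.
have self i j : i \in B (i, j) by rewrite inE /= mulNx box0.
have [m [m0 mc sat]] := @saturated_weights R p _ B c (fun k => powR_ge0 _ _) (fun i => ex_intro _ (i,
  ord0) (self i ord0)).
exists p, x, m; split => //.
- move=> y r rn; have r0 : 0 < r by exact: lt_le_trans rn.
  have [/existsP [i0 hi0]|/existsPn none] := boolP [exists i, box r (mul (- y) (x i))]; last first.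
    by rewrite big1 ?mulr_ge0 ?powR_ge0 ?(ltW C0) // => i /(negP (none i)).
  have near i : box r (mul (- y) (x i)) -> box (K0 * r) (mul (- x i0) (x i)).
    move=> hi; have := hK0 r (- mul (- y) (x i0)) (mul (- y) (x i)) r0; rewrite boxN => /(_ hi0 hi).
    by rewrite oppM opprK -carnot_mulA mulxK.
  have Kr0 : 0 <= K0 * r by rewrite ltW // mulr_gt0.
  have KK0 : 0 <= 2 * K0 * r by rewrite -mulrA mulr_ge0.
  have bound j : K0 * r <= rho j \/ j = ord_max -> rho j <= 2 * K0 * r ->
    \sum_(i | box r (mul (- y) (x i))) m i <= C * r `^ s.
    move=> hj hjr; apply: (@le_trans _ _ (c (i0, j))).
      apply: le_trans (mc (i0, j)); rewrite big_mkcond [leRHS]big_mkcond /=; apply: ler_sum => i _.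
      case: ifP => hi; last by case: ifP.
      rewrite ifT // inE /=; case: hj => [hj|->]; first by apply: box_le hj (near i hi); exact: mulr_gt0.
      by rewrite rho_last; apply: hk1.
    apply: (@le_trans _ _ ((2 * K0 * r) `^ s)).
      by apply: ge0_ler_powR; rewrite ?nnegrE ?(ltW s0) ?(ltW (rho0 j)).
    have K2 : 0 <= 2 * K0 by rewrite mulr_ge0 // ltW.
    by rewrite powRM ?(ltW r0) // ler_wpM2r ?powR_ge0 // /C lerDl ltW // mulr_gt0.
  have [hl|hl] := leP (rho ord_max) (K0 * r).
    by apply: (bound ord_max); [right|apply: le_trans hl _; rewrite -mulrA ler_peMl // ler1n].
  have ex : exists j : nat, (j < q)%N && (K0 * r <= 2^-1 ^+ n * 2 ^+ j).
    by exists (n + k1)%N; rewrite ltnS leqnn /=; exact: ltW.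
  have [j /andP[jq hj] jmin] := ex_minnP ex.
  apply: (bound (Ordinal jq)); first by left.
  case: j jq hj jmin => [|j] jq hj jmin.
    rewrite /rho /= expr0 mulr1; apply: le_trans rn _; rewrite ler_peMl // ?(ltW r0) //.
    by rewrite (le_trans K01) // ler_peMl ?ler1n // ltW.
  rewrite /rho /= exprS mulrCA -mulrA ler_pM2l // leNgt; apply/negP => h.
  by have := jmin j; rewrite (ltn_trans (ltnSn j) jq) (ltW h) /= ltnn => /(_ isT).
- have [i0|np] := pickP (predT : pred 'I_p).
    move=> _; have h := mc (i0, ord_max); rewrite /c /= rho_last in h; apply: le_trans h.
    rewrite [leRHS]big_mkcond /=; apply: ler_sum => i _.
    by rewrite inE /= rho_last hk1.
  by rewrite big1 ?powR_ge0 // => i; have := np i.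
- have /choice [st hst] : forall i, exists k, i \in B k /\ \sum_(i' in B k) m i' = c k.
    by move=> i; have [k ? ?] := sat i; exists k.
  (* Only a common point of the net counts as meeting: this is enough for the masses of the selected
     boxes to add up to at most the total mass. *)
  pose meets (a b : 'I_p * 'I_q) := (a == b) || [exists i, (i \in B a) && (i \in B b)].
  have mr : reflexive meets by move=> a; rewrite /meets eqxx.
  have [S [Sl pS cS]] := vitali (fun a => rho a.2) [seq st i | i <- enum 'I_p] mr.
  have satS a : a \in S -> \sum_(i in B a) m i = c a.
    by move=> /Sl /mapP [i _ ->]; case: (hst i).
  exists [seq (x a.1, rho a.2) | a <- S]; split.
  + by move=> _ /mapP [a _ ->] /=.
  + move=> z Kz; have [i iz] := net z Kz.
    have [iB _] := hst i.
    have [|b [bS mab rab]] := cS (st i); first by rewrite map_f // mem_enum.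
    exists (x b.1, rho b.2); first exact: map_f (fun a => (x a.1, rho a.2)) _ _ bS.
    have rb := rho0 b.2; have ra := rho0 (st i).2.
    have b1 : box (rho b.2) (mul (- x (st i).1) (x i)).
      by apply: (box_le ra rab); move: iB; rewrite inE.
    have b2 : box (rho b.2) (mul (- x i) z).
      by apply: (box_le t0 _ iz); rewrite /rho ler_peMr // ?(ltW t0) // exprn_ege1 // ler1n.
    have bz : box (K0 * rho b.2) (mul (- x (st i).1) z).
      by have := hK0 _ _ _ rb b1 b2; rewrite -carnot_mulA mulxK.
    have bc : box (K0 * rho b.2) (mul (- x b.1) (x (st i).1)).
      move: mab => /orP[/eqP <-|/existsP [i' /andP[ia ib]]]; first by rewrite mulNx box0.
      have c1 : box (rho b.2) (mul (- x b.1) (x i')) by move: ib; rewrite inE.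
      have c2 : box (rho b.2) (mul (- x i') (x (st i).1)).
        have : box (rho b.2) (mul (- x (st i).1) (x i')) by apply: (box_le ra rab); move: ia; rewrite inE.
        by rewrite -boxN oppM opprK.
      by have := hK0 _ _ _ rb c1 c2; rewrite -carnot_mulA mulxK.
    have := hK0 _ _ _ (mulr_gt0 K00 rb) bc bz; rewrite -carnot_mulA mulxK mulrA => h.
    apply: box_le h; first by rewrite !mulr_gt0.
    by rewrite ler_wpM2r ?(ltW rb) // /C lerDr ltW.
  + rewrite big_map (eq_big_seq (fun a => \sum_i (if i \in B a then m i else 0))) /=; last first.
      by move=> a aS; rewrite -/(c a) -satS // big_mkcond.
    rewrite exchange_big /=; apply: ler_sum => i _.
    have uS : uniq S.
      apply: (@pairwise_uniq _ (fun a b => (rho b.2 <= rho a.2) && ~~ meets b a)) pS => a /=.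
      by rewrite /meets eqxx /= andbF.
    have sm : symmetric meets.
      move=> a b; rewrite /meets eq_sym; congr (_ || _); apply: eq_existsb => i'; exact: andbC.
    rewrite (eq_big_seq (fun a => if (a \in S) && (i \in B a) then m i else 0)) /=; last by move=> a ->.
    apply: le_trans (ler_norm _) _; apply: sum_one => //.
      by move=> a; case: ifP => _; rewrite ?normr0 // ger0_norm.
    move=> a b; case: ifP => [/andP[aS ia] _|_]; last by rewrite eqxx.
    case: ifP => [/andP[bS ib] _|_]; last by rewrite eqxx.
    apply: (pairwise_neq (q := fun a b => rho b.2 <= rho a.2) sm pS aS bS).
    by apply/orP; right; apply/existsP; exists i; rewrite ia.
Qed.

End Frostman.

Lemma cont_pointI (R : realType) (V W : normedModType R) (f : V -> W) (x : V) :
  (forall e : R, 0 < e -> exists2 r : R, 0 < r & forall z, `|x - z| < r -> `|f x - f z| <= e) ->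
  {for x, continuous f}.
Proof.
move=> h; apply/cvgrPdist_le => e e0; have [r r0 hr] := h e e0.
by apply/nbhs_ballP; exists r => // z; rewrite -ball_normE; exact: hr.
Qed.

(** * The lower bound for the capacity *)

Section HolderFunctions.
Context {R : realType} {N : nat} (G : carnot R N).
Local Notation V := 'rV[R]_N.
Local Notation mul := (carnot_mul G).
Local Notation dil := (dilation G).
Local Notation box := (box G).
Local Notation d_ := (cc_dist G).
Implicit Types (x y z : V) (f g phi psi : V -> R).

Lemma powR_small (C e delta : R) : 0 < delta -> 0 < e -> exists2 r : R, 0 < r & C * r `^ delta <= e.
Proof.
move=> d0 e0; pose c := `|C| + 1; have c0 : 0 < c by rewrite ltr_wpDl.
exists ((e / c) `^ delta^-1); first by rewrite powR_gt0 // divr_gt0.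
rewrite -powRrM mulVf ?gt_eqF // powRr1 ?divr_ge0 ?(ltW e0) ?(ltW c0) //.
rewrite mulrCA ler_piMr ?(ltW e0) // ler_pdivrMr // mul1r.
by rewrite /c (le_trans (ler_norm C)) // lerDl.
Qed.

(** The radius is chosen before f: this is the equicontinuity on which [ulim_integral] rests. *)
Lemma holder_near (C delta e : R) x : 0 <= C -> 0 < delta -> 0 < e -> exists2 r : R, 0 < r &
  forall z, `|x - z| < r -> forall f, (forall y y', `|f y - f y'| <= C * d_ y y' `^ delta) -> `|f x - f z| <= e.
Proof.
move=> C0 d0 e0; have [K K0 hK] := cc_dist_box G.
have [r r0 hr] := powR_small (C * K `^ delta) d0 e0.
have [r' r'0 hr'] := box_near G x r0.
exists r' => // z xz f hf; apply: le_trans (hf x z) _; apply: le_trans hr.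
rewrite -mulrA -powRM ?(ltW K0) ?(ltW r0) // ler_wpM2l //.
apply: ge0_ler_powR; rewrite ?nnegrE ?(ltW d0) ?cc_dist_ge0 ?mulr_ge0 ?(ltW K0) ?(ltW r0) //.
by apply: hK => //; exact: hr'.
Qed.

Lemma holder_continuous (C delta : R) f : 0 <= C -> 0 < delta ->
  (forall y y', `|f y - f y'| <= C * d_ y y' `^ delta) -> continuous f.
Proof.
move=> C0 d0 hf x; apply: cont_pointI => e e0.
by have [r r0 h] := holder_near x C0 d0 e0; exists r => // z /h; exact.
Qed.

(* By equicontinuity the convergence is locally uniform, so that a finite net suffices. *)
Lemma ulim_integral (g : nat -> V -> R) (C delta : R) psi : 0 <= C -> 0 < delta ->
  (forall n y y', `|g n y - g n y'| <= C * d_ y y' `^ delta) -> (forall y, bdd (fun n => g n y)) ->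
  test_fun setT psi ->
  bdd (fun n => integral_rV (fun x => g n x * psi x)) /\
  ulim (fun n => integral_rV (fun x => g n x * psi x)) = integral_rV (fun x => ulim (fun n => g n x) * psi x).
Proof.
move=> C0 d0 hg bg tpsi; pose f x := ulim (fun n => g n x).
have hf y y' : `|f y - f y'| <= C * d_ y y' `^ delta.
  have -> : f y - f y' = ulim (fun n => -1 * g n y' + g n y) by rewrite ulim_lin // mulN1r addrC.
  apply: (ulim_norm_le (n0 := 0)); first exact: bdd_lin.
  by move=> n _; rewrite mulN1r addrC.
have cg n : continuous (g n) by exact: holder_continuous C0 d0 (hg n).
have cf : continuous f by exact: holder_continuous C0 d0 hf.
have [A [M [A0 zA hM]]] := test_bound tpsi.
have M0 : 0 <= M by exact: le_trans (hM 0).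
have cc n : ccont A (fun x => g n x * psi x).
  by apply: (ccontM (cg n)); split => //; exact: (smoothT_cont (test_smooth tpsi)).
have ccf : ccont A (fun x => f x * psi x).
  by apply: (ccontM cf); split => //; exact: (smoothT_cont (test_smooth tpsi)).
pose W := M * (2 * A) ^+ N; have W0 : 0 <= W by rewrite mulr_ge0 // exprn_ge0 // mulr_ge0 // ltW.
(* Here s n sums the errors at the finitely many centres of a net and has ultralimit 0;
   equicontinuity adds 2 e at the other points. *)
have approx (e : R) : 0 < e -> exists s : nat -> R, [/\ bdd s, ulim s = 0 &
    forall n, `|integral_rV (fun x => g n x * psi x) - integral_rV (fun x => f x * psi x)| <= 2 * e * W + W * s n].
  move=> e0.
  have /choice [r hr] : forall x : V, exists r : R, 0 < r /\ forall z, `|x - z| < r ->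
    forall f, (forall y y', `|f y - f y'| <= C * d_ y y' `^ delta) -> `|f x - f z| <= e.
    by move=> x; have [r ? ?] := holder_near x C0 d0 e0; exists r.
  have [X _ cov] := ball_cover (@closed_ball0_compact R N A) (fun x _ => proj1 (hr x)).
  have bd x : bdd (fun n => `|g n x - f x|).
    have [B hB] := bg x; exists (B + `|f x|) => n; rewrite normr_id.
    by apply: le_trans (ler_normB _ _) _; rewrite lerD2r.
  have [bs us] := ulim_sum X (F := fun x n => `|g n x - f x|) bd.
  exists (fun n => \sum_(x <- X) `|g n x - f x|); split => //.
    by rewrite us big1 // => x _; exact: ulim_dist.
  move=> n; set sn := \sum_(x <- X) _.
  have sn0 : 0 <= sn by exact: sumr_ge0.
  have := int_lin (-1) ccf (cc n); rewrite mulN1r addrC => <-.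
  apply: le_trans (int_bound (M := (2 * e + sn) * M) (ccont_lin (-1) ccf (cc n)) _) _; last first.
    by rewrite /W le_eqVlt; apply/orP; left; apply/eqP; ring.
  move=> z; rewrite mulN1r addrC -mulrBl normrM.
  have [zA'|zA'] := leP `|z| A; last by rewrite zA ?normr0 ?mulr0 ?mulr_ge0 ?addr_ge0 ?mulr_ge0 // ltW.
  apply: ler_pM => //.
  have [x xX xz] := cov z zA'.
  have h1 := (proj2 (hr x)) z xz _ (hg n); have h2 := (proj2 (hr x)) z xz _ hf.
  have h3 : `|g n x - f x| <= sn.
    rewrite /sn; elim: X xX {cov bs us sn sn0} => // y X IH; rewrite inE big_cons => /orP[/eqP ->|/IH h].
      by rewrite lerDl; exact: sumr_ge0.
    by apply: le_trans h _; rewrite lerDr.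
  have -> : g n z - f z = - (g n x - g n z) + ((g n x - f x) + (f x - f z)) by ring.
  apply: le_trans (ler_normD _ _) _; rewrite normrN.
  have := ler_normD (g n x - f x) (f x - f z); lra.
pose I0 n := integral_rV (fun x => g n x * psi x); pose c := integral_rV (fun x => f x * psi x).
have bJ : bdd (fun n => I0 n - c).
  have [s [[B hB] _ hs]] := approx 1 ltr01; exists (2 * 1 * W + W * B) => n.
  apply: le_trans (hs n) _; rewrite lerD2l ler_wpM2l // (le_trans (ler_norm _)) //.
have bI : bdd I0.
  have := bdd_lin 1 bJ (bdd_cst c); rewrite (_ : (fun n => _) = I0) //.
  by apply/funext => n; rewrite mul1r subrK.
split => //; rewrite -/I0 -/c.
have -> : ulim I0 = ulim (fun n => I0 n - c) + c.
  have := ulim_lin 1 bJ (bdd_cst c); rewrite (_ : (fun n => 1 * _ + _) = I0); last by apply/funext => n;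
    rewrite mul1r subrK.
  by move=> ->; rewrite mul1r; congr (_ + _); apply: ulim_approx => e e0; exists 0%N => n _; rewrite subrr normr0 ltW.
suff -> : ulim (fun n => I0 n - c) = 0 by rewrite add0r.
apply/eqP; rewrite -normr_le0; apply/ler_addgt0Pl => e e0; rewrite addr0.
pose e' := e / (2 * (W + 1)); have W1 : 0 < W + 1 by rewrite ltr_wpDl.
have e'0 : 0 < e' by rewrite divr_gt0 // mulr_gt0.
have [s [bs us hs]] := approx e' e'0.
have e'W : 2 * e' * W <= e.
  have E : e' * (2 * (W + 1)) = e by rewrite divfK // gt_eqF // mulr_gt0.
  lra.
have bNJ := bdd_lin (-1) bJ (bdd_cst 0).
rewrite ler_norml; apply/andP; split.
  have : ulim (fun n => - W * s n + (-1 * (I0 n - c) + 0)) <= e.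
    apply: (ulim_le (n0 := 0)); first exact: bdd_lin.
    by move=> n _; have := hs n; rewrite ler_norml => /andP[h _]; move: h; rewrite -/(I0 n) -/c; lra.
  rewrite ulim_lin // us mulr0 add0r ulim_lin //; last exact: bdd_cst.
  rewrite (@ulim_approx _ (fun=> 0) 0); last by move=> ? ?; exists 0%N => ? _; rewrite subrr normr0 ltW.
  by rewrite addr0 mulN1r lerNl.
have : ulim (fun n => - W * s n + (I0 n - c)) <= e.
  apply: (ulim_le (n0 := 0)); first exact: bdd_lin.
  by move=> n _; have := hs n; rewrite ler_norml => /andP[_ h]; move: h; rewrite -/(I0 n) -/c; lra.
by rewrite ulim_lin // us mulr0 add0r.
Qed.

End HolderFunctions.

(** * Dyadic sums *)

Section Geometric.
Context {R : realType}.
Variables (delta : R).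
Hypotheses (delta0 : 0 < delta) (delta1 : delta < 1).

Lemma two_powR_lt1 : 2 `^ (delta - 1) < 1 :> R.
Proof.
rewrite -(opprB 1) powRN invf_lt1 ?powR_gt0 //.
have d1 : 0 < 1 - delta by rewrite subr_gt0.
by have := @gt0_ltr_powR R _ d1 1 2; rewrite !nnegrE powR1; apply => //; rewrite ltr1n.
Qed.

Lemma geometric_small (d t0 : R) n : 0 < d -> 0 < t0 ->
  \sum_(k < n) (if t0 * 2 ^+ k <= d then (t0 * 2 ^+ k) `^ delta else 0) <= (1 - 2^-1 `^ delta)^-1 * d `^ delta.
Proof.
move=> d0 t00; set c := (_)^-1.
have q1 : 2^-1 `^ delta < 1 :> R.
  have := @gt0_ltr_powR R delta delta0 2^-1 1; rewrite !nnegrE invr_ge0 powR1; apply => //.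
  by rewrite invf_lt1 // ltr1n.
have c0 : 0 < c by rewrite invr_gt0 subr_gt0.
have cE : c * 2^-1 `^ delta + 1 = c.
  have : c * (1 - 2^-1 `^ delta) = 1 by rewrite mulVf // gt_eqF // subr_gt0.
  by lra.
pose t k : R := t0 * 2 ^+ k; have tk k : 0 < t k by rewrite mulr_gt0 // exprn_gt0.
pose S n := \sum_(k < n) (if t k <= d then t k `^ delta else 0).
have half (x : R) : 0 < x -> (2^-1 * (2 * x)) `^ delta = x `^ delta.
  by move=> x0; rewrite mulrA mulVf // mul1r.
(* The second bound, by the last scale summed, is the one that carries the induction. *)
suff [h _] : S n <= c * d `^ delta /\ S n <= c * (2^-1 * t n) `^ delta by [].
elim: n => [|n [IH1 IH2]].
  by rewrite /S big_ord0; split; rewrite mulr_ge0 ?powR_ge0 // ltW.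
have tS : 2^-1 * t n.+1 = t n by rewrite /t exprS; lra.
rewrite tS /S big_ord_recr /= -/(S n) -/(t n).
have mono : c * (2^-1 * t n) `^ delta + t n `^ delta = c * t n `^ delta.
  by rewrite powRM ?invr_ge0 ?(ltW (tk n)) // mulrA -[X in _ + X]mul1r -mulrDl cE.
case: ifP => [tnd|_]; last first.
  rewrite addr0; split => //; apply: le_trans IH2 _; rewrite -mono lerDl powR_ge0 //.
have B : S n + t n `^ delta <= c * t n `^ delta by rewrite -mono lerD2r.
split => //; apply: le_trans B _; rewrite ler_pM2l //.
by apply: ge0_ler_powR; rewrite ?nnegrE ?(ltW delta0) ?(ltW (tk n)) ?(ltW d0).
Qed.

Lemma geometric_large (d t0 : R) n : 0 < d -> 0 < t0 ->
  \sum_(k < n) (if t0 * 2 ^+ k <= d then 0 else (t0 * 2 ^+ k) `^ (delta - 1)) <= (1 - 2 `^ (delta - 1))^-1 * d `^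
    (delta - 1).
Proof.
move=> d0; set c := (_)^-1.
have q1 : 2 `^ (delta - 1) < 1 :> R.
  exact: two_powR_lt1.
have c0 : 0 < c by rewrite invr_gt0 subr_gt0.
have cE : c * 2 `^ (delta - 1) + 1 = c.
  have : c * (1 - 2 `^ (delta - 1)) = 1 by rewrite mulVf // gt_eqF // subr_gt0.
  by lra.
have anti (x y : R) : 0 < x -> x <= y -> y `^ (delta - 1) <= x `^ (delta - 1).
  move=> x0 xy; have y0 := lt_le_trans x0 xy.
  rewrite -(opprB 1) !powRN lef_pV2 ?posrE ?powR_gt0 //.
  by apply: ge0_ler_powR; rewrite ?nnegrE ?subr_ge0 ?(ltW x0) ?(ltW y0) // ltW.
(* The induction removes the smallest scale; max d t0 records that a sum starting above d is
   controlled by its first term. *)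
move=> t00; suff H : \sum_(k < n) (if t0 * 2 ^+ k <= d then 0 else (t0 * 2 ^+ k) `^ (delta - 1)) <= c * (Num.max d
  t0) `^ (delta - 1).
  by apply: le_trans H _; rewrite ler_pM2l //; apply: anti => //; rewrite le_max lexx.
elim: n t0 t00 => [|n IH] t0 t00.
  by rewrite big_ord0 mulr_ge0 ?powR_ge0 // ltW.
rewrite big_ord_recl expr0 mulr1.
have t20 : 0 < t0 * 2 by rewrite mulr_gt0.
have := IH (t0 * 2) t20.
under eq_bigr do rewrite -mulrA -exprS.
move=> IH'; have [t0d|dt0] := leP t0 d.
  rewrite add0r; apply: le_trans IH' _; rewrite ler_pM2l //; apply: anti => //.
  by rewrite le_max lexx.
rewrite -[X in _ <= X * _]cE mulrDl mul1r addrC lerD2r; apply: le_trans IH' _.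
have -> : Num.max d (t0 * 2) = 2 * t0.
  by rewrite mulrC; apply/max_idPr; apply: ltW; apply: (lt_trans dt0); rewrite ltr_pMl // ltr1n.
by rewrite powRM ?(ltW t00) // mulrA.
Qed.

(** The bound t^delta is used for scales t <= d and t^(delta - 1) d for the larger ones. As 0 <
    delta < 1, both are geometric sums dominated by their terms nearest to t = d. *)
Lemma geometric_min : exists2 C : R, 0 < C & forall (d t0 : R) n (a : 'I_n -> R), 0 < d -> 0 < t0 ->
  (forall k, a k <= (t0 * 2 ^+ k) `^ delta) -> (forall k, a k <= (t0 * 2 ^+ k) `^ (delta - 1) * d) ->
  \sum_k a k <= C * d `^ delta.
Proof.
have q1 : 2^-1 `^ delta < 1 :> R.
  have := @gt0_ltr_powR R delta delta0 2^-1 1; rewrite !nnegrE invr_ge0 powR1; apply => //.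
  by rewrite invf_lt1 // ltr1n.
have q2 : 2 `^ (delta - 1) < 1 :> R.
  exact: two_powR_lt1.
exists ((1 - 2^-1 `^ delta)^-1 + (1 - 2 `^ (delta - 1))^-1).
  by rewrite addr_gt0 // invr_gt0 subr_gt0.
move=> d t0 n a d0 t00 h1 h2.
have h3 := geometric_small n d0 t00; have h4 := geometric_large n d0 t00.
have dd : d `^ (delta - 1) * d = d `^ delta.
  by rewrite -{2}(powRr1 (ltW d0)) -powRD ?subrK // gt_eqF // implybT.
have h5 : (\sum_(k < n) (if t0 * 2 ^+ k <= d then 0 else (t0 * 2 ^+ k) `^ (delta - 1))) * d <= (1 - 2 `^ (delta -
  1))^-1 * d `^ delta.
  by rewrite -dd mulrA ler_pM2r.
rewrite mulrDl; apply: le_trans (lerD h3 h5); rewrite mulr_suml -big_split /=; apply: ler_sum => k _.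
by case: ifP => _; rewrite ?mul0r ?addr0 ?add0r.
Qed.

End Geometric.

(** * Potentials of discrete measures *)

Section LowerBound.
Context {R : realType} {N : nat} (G : carnot R N).
Local Notation V := 'rV[R]_N.
Local Notation mul := (carnot_mul G).
Local Notation deg := (carnot_deg G).
Local Notation dil := (dilation G).
Local Notation box := (box G).
Local Notation d_ := (cc_dist G).
Local Notation Xd := (Xd G).
Implicit Types (y z : V) (f g phi psi : V -> R).

Lemma Xd_sum (I : finType) (c : I -> R) (u : I -> V -> R) j z : (forall i, smooth_on setT (u i)) ->
  Xd j (fun y => \sum_i c i * u i y) z = \sum_i c i * Xd j (u i) z.
Proof.
move=> su; have ss : smooth_on setT (fun y => \sum_i c i * u i y).
  by apply: (smooth_sum openT) => i; exact: (smoothZ openT).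
apply: (is_derive_val_uniq (Xd_is_derive G j z ss)).
have dI i : is_derive (0 : R) (1 : R) (fun s : R => c i * u i (mul z (s *: evec j))) (c i * Xd j (u i) z).
  have := is_derive_mulf (is_derive_cst (c i) (0 : R) (1 : R)) (Xd_is_derive G j z (su i)).
  by rewrite mul0r add0r.
exact: is_derive_sumf.
Qed.

Lemma Xd_out u (A : R) j z : (forall y, A <= `|y| -> u y = 0) -> A < `|z| -> Xd j u z = 0.
Proof.
move=> zA Az; rewrite /Xd /dotv big1 // => k _; rewrite gradE.
pose U := [set q : V | A < `|q|].
have oU : @open V U by apply: (@open_comp _ _ (fun q : V => `|q|) [set r | A < r]); [move=> ? _;
  exact: norm_continuous|exact: open_gt].
have e : forall q, U q -> u q = (fun=> 0) q by move=> q /ltW; exact: zA.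
by rewrite (eq_on_pd (evec k) oU Az e) derive_cst mulr0.
Qed.

Lemma powR_mulr (t a : R) : 0 < t -> t `^ (a - 1) * t = t `^ a.
Proof. by move=> t0; rewrite -[X in _ * X](powRr1 (ltW t0)) -powRD ?subrK // (gt_eqF t0) implybT. Qed.

Lemma mul_dil_near (K : set V) (A rho : R) : compact K -> 0 < rho -> exists2 s0 : R, 0 < s0 & forall a u (s : R),
  K a -> `|u| <= A -> 0 < s -> s <= s0 -> `|a - mul a (dil s u)| < rho.
Proof.
move=> cK rho0; have [B B0 hB] := compact_norm_le cK.
have [d d0 hd] := heine (@closed_ball0_compact R (N + N) B) (fun x _ => @mul2_continuous _ _ G x) rho0.
pose A' := `|A| + 1; have A'0 : 0 < A' by rewrite ltr_wpDl.
have m0 : 0 < Num.min 1 (d / (2 * A')) by rewrite lt_min ltr01 divr_gt0 // mulr_gt0.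
exists (Num.min 1 (d / (2 * A'))) => // a u s Ka uA s0 sm.
have s1 : s <= 1 by apply: (le_trans sm); rewrite ge_min lexx.
have sd : s <= d / (2 * A') by apply: (le_trans sm); rewrite ge_min lexx orbT.
have := hd (row_mx a 0) (row_mx a (dil s u)); rewrite !row_mxKl !row_mxKr carnot_mulx0; apply.
  by rewrite /=; apply: row_mx_norm_le; [exact/ltW/hB|rewrite normr0 ltW].
rewrite opp_row_mx add_row_mx subrr sub0r; apply: (@le_lt_trans _ _ (d / 2));
  last by rewrite ltr_pdivrMr // ltr_pMr // ltr1n.
apply: row_mx_norm_le; first by rewrite normr0 divr_ge0 // ltW.
rewrite normrN; apply: le_trans (dilation_norm_le _ _ _) _; first by rewrite (ltW s0).
apply: (@le_trans _ _ (d / (2 * A') * A')).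
  by apply: ler_pM => //; [exact: ltW|apply: (le_trans uA); rewrite (le_trans (ler_norm A)) // lerDl].
by rewrite invfM mulrA divfK // gt_eqF.
Qed.

Variables (Lf Lt : (V -> R) -> V -> R) (lambda delta : R).
Hypothesis ops : inv_ops G Lf Lt lambda.
Hypotheses (lambda_gt0 : 0 < lambda) (lambda_ltQ : lambda < (qdim G)%:R) (delta_gt0 : 0 < delta) (delta_lt1 : delta <
  1).
Local Notation Q := ((qdim G)%:R : R).
Local Notation s := (Q - lambda + delta).

Lemma s_gt0 : 0 < s.
Proof. by rewrite addr_gt0 // subr_gt0. Qed.

Section Potential.
Variables (D omega : V -> R).
Hypotheses (tD : test_fun setT D) (tomega : test_fun setT omega) (int_omega : integral_rV omega = 1).
Hypothesis DL : forall phi, test_fun setT phi -> integral_rV (fun x => D x * Lt phi x) =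
      integral_rV (fun x => omega x * phi x) - integral_rV (fun x => omega x * phi (dil 2 x)).

(** The factor t^(lambda - Q) is the one for which L maps the dilated kernel to a difference of
    dilates of omega of integral 1, at scales t and 2 t; see [kernel_integral]. *)
Definition layer p (x : 'I_p -> V) (m : 'I_p -> R) (t : R) y : R :=
  \sum_i (m i * t `^ (lambda - Q)) * D (dil t^-1 (mul (- x i) y)).

Lemma layer_smooth p x m t : smooth_on setT (@layer p x m t).
Proof.
apply: (smooth_sum openT) => i; apply: (smoothZ openT).
exact: (smooth_translate G (- x i) (smooth_dilate G t^-1 (test_smooth tD))).
Qed.

Lemma layer_bounds (Cf : R) : 0 < Cf -> exists2 C : R, 0 < C & forall n p (x : 'I_p -> V) (m : 'I_p -> R),
  (forall i, 0 <= m i) ->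
  (forall y (r : R), 2^-1 ^+ n <= r -> \sum_(i | box r (mul (- y) (x i))) m i <= Cf * r `^ s) ->
  forall t : R, 2^-1 ^+ n <= t -> forall y, `|layer x m t y| <= C * t `^ delta /\
    forall j, deg j = 1%N -> `|Xd j (layer x m t) y| <= C * t `^ (delta - 1).
Proof.
move=> Cf0; have sD := test_smooth tD.
have [A0 [A00 _ zA0]] := test_ccont tD; pose A := A0 + 1.
have A1 : 1 <= A by rewrite lerDr ltW.
have Apos : 0 < A by exact: lt_le_trans A1.
have [B B0 hB] := Xd_bounded G tD.
have [A' [M [_ _ hM]]] := test_bound tD.
have M0 : 0 <= M by exact: le_trans (hM 0).
have E0' : 0 < 1 + M + B by lra.
pose E := 1 + M + B; have E0 : 0 < E := E0'.
have EM : M <= E by rewrite /E; lra.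
have EB : B <= E by rewrite /E; lra.
exists (E * (Cf * A `^ s)); first by rewrite !mulr_gt0 // powR_gt0.
move=> n p x m m0 fr t tn y.
have t0 : 0 < t by apply: lt_le_trans tn; exact: half_pow_gt0.
have ti0 : 0 < t^-1 by rewrite invr_gt0.
pose u i z := D (dil t^-1 (mul (- x i) z)).
have su i : smooth_on setT (u i).
  exact: (smooth_translate G (- x i) (smooth_dilate G t^-1 sD)).
(* Only the points of the box of radius A t around y contribute, of mass at most Cf (A t)^s, and s +
   lambda - Q = delta. As A >= 1, this radius is not below the scale 2^-n. *)
have mass (c : 'I_p -> R) : (forall i, `|c i| <= E) -> (forall i, A <= `|dil t^-1 (mul (- x i) y)| -> c i = 0) ->
    `|\sum_i (m i * t `^ (lambda - Q)) * c i| <= E * (Cf * A `^ s) * t `^ delta.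
  move=> cE cz.
  apply: (@le_trans _ _ (\sum_(i | box (A * t) (mul (- y) (x i))) m i * (t `^ (lambda - Q) * E))).
    apply: le_trans (ler_norm_sum _ _ _) _; rewrite [leRHS]big_mkcond; apply: ler_sum => i _.
    case: ifP => [_|nb].
      rewrite !normrM (ger0_norm (m0 i)) (ger0_norm (powR_ge0 _ _)) -mulrA.
      by rewrite !ler_wpM2l ?powR_ge0.
    rewrite cz ?mulr0 ?normr0 //; apply: ltW; rewrite ltNge; apply/negP => h.
    have := norm_box G A1 h; rewrite box_dil ?gt_eqF // invrK => b.
    by move/negP: nb; apply; rewrite -boxN oppM opprK.
  rewrite -mulr_suml; apply: (@le_trans _ _ (Cf * (A * t) `^ s * (t `^ (lambda - Q) * E))).
    rewrite ler_wpM2r ?mulr_ge0 ?powR_ge0 ?(ltW E0) //; apply: fr; apply: (le_trans tn).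
    by rewrite ler_peMl // ltW.
  have -> : t `^ delta = t `^ s * t `^ (lambda - Q).
    by rewrite -powRD ?(gt_eqF t0) ?implybT //; congr powR; ring.
  rewrite powRM ?(ltW t0) ?(ltW Apos) // le_eqVlt; apply/orP; left; apply/eqP; ring.
have uz i : A <= `|dil t^-1 (mul (- x i) y)| -> A0 < `|dil t^-1 (mul (- x i) y)|.
  by apply: lt_le_trans; rewrite ltrDl.
split.
  apply: mass => i; first exact: le_trans (hM _) EM.
  by move=> /uz /ltW; exact: zA0.
move=> j dj; have -> : Xd j (layer x m t) y = \sum_i (m i * t `^ (lambda - Q)) * (t^-1 * Xd j D (dil t^-1 (mul (- x
  i) y))).
  rewrite (Xd_sum (fun i => m i * t `^ (lambda - Q)) j y su); apply: eq_bigr => i _.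
  by rewrite (Xd_translate_dilate y (- x i) t^-1 dj sD).
have -> : \sum_i (m i * t `^ (lambda - Q)) * (t^-1 * Xd j D (dil t^-1 (mul (- x i) y))) =
    t^-1 * \sum_i (m i * t `^ (lambda - Q)) * Xd j D (dil t^-1 (mul (- x i) y)).
  by rewrite mulr_sumr; apply: eq_bigr => i _; ring.
have -> : t `^ (delta - 1) = t^-1 * t `^ delta by rewrite -(powR_mulr delta t0) mulrCA mulVf ?mulr1 // gt_eqF.
rewrite normrM (gtr0_norm ti0) mulrCA ler_pM2l //; apply: mass => i; first exact: le_trans (hB j _) EB.
by move=> /uz; exact: Xd_out.
Qed.

(* Summing the layers of scales 2^-n, ..., 2^n telescopes to a truncated fundamental solution applied
   to the discrete measure with masses m i at x i. *)
Definition potential n p (x : 'I_p -> V) (m : 'I_p -> R) y : R :=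
  \sum_(k < (n + n).+1) layer x m (2^-1 ^+ n * 2 ^+ k) y.

Lemma potential_holder (Cf : R) : 0 < Cf -> exists2 C : R, 0 < C & forall n p (x : 'I_p -> V) (m : 'I_p -> R),
  (forall i, 0 <= m i) ->
  (forall y (r : R), 2^-1 ^+ n <= r -> \sum_(i | box r (mul (- y) (x i))) m i <= Cf * r `^ s) ->
  forall y z, `|potential n x m y - potential n x m z| <= C * d_ y z `^ delta.
Proof.
move=> Cf0; have [C C0 hC] := layer_bounds Cf0; have [Cg Cg0 hCg] := geometric_min delta_gt0 delta_lt1.
pose E := (2 + N%:R) * C; have E0 : 0 < E by rewrite mulr_gt0 // ltr_wpDr.
exists (E * Cg); first exact: mulr_gt0.
move=> n p x m m0 fr y z; pose t k : R := 2^-1 ^+ n * 2 ^+ k.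
have tn k : 2^-1 ^+ n <= t k by rewrite /t ler_peMr ?(ltW (half_pow_gt0 n)) // exprn_ege1 // ler1n.
have t0 k : 0 < t k by apply: lt_le_trans (tn k); exact: half_pow_gt0.
have NC : N%:R * C <= E by rewrite /E ler_pM2r //; lra.
have C2 : 2 * C <= E by rewrite /E ler_pM2r // lerDl.
pose a k := `|layer x m (t k) y - layer x m (t k) z|.
have a1 k : a k <= E * t k `^ delta.
  apply: le_trans (ler_normB _ _) _; have [h1 _] := hC n p x m m0 fr (t k) (tn k) y.
  have [h2 _] := hC n p x m m0 fr (t k) (tn k) z.
  apply: le_trans (lerD h1 h2) _; rewrite -mulrDl ler_wpM2r ?powR_ge0 //; lra.
have a2 k : a k <= E * (t k `^ (delta - 1) * d_ y z).
  have b0 : 0 <= C * t k `^ (delta - 1) by rewrite mulr_ge0 ?powR_ge0 // ltW.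
  have := lip_cc (layer_smooth x m (t k)) b0 (fun q j dj => proj2 (hC n p x m m0 fr (t k) (tn k) q) j dj) y z.
  move=> h; apply: (le_trans h); rewrite !mulrA ler_wpM2r ?cc_dist_ge0 // ler_wpM2r ?powR_ge0 //.
have tri : `|potential n x m y - potential n x m z| <= \sum_(k < (n + n).+1) a k.
  rewrite /potential -sumrB; exact: ler_norm_sum.
apply: (le_trans tri).
have [d0|d0] := eqVneq (d_ y z) 0.
  rewrite (_ : \sum_(k < _) _ = 0); first by rewrite mulr_ge0 ?powR_ge0 // ltW // mulr_gt0.
  apply: big1 => k _; apply/eqP; rewrite eq_le normr_ge0 andbT.
  by have := a2 k; rewrite d0 !mulr0.
have dp : 0 < d_ y z by rewrite lt_neqAle eq_sym d0 cc_dist_ge0.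
have aE k (b : R) : a k <= E * b -> E^-1 * a k <= b by move=> h; rewrite ler_pdivrMl.
have := hCg (d_ y z) (2^-1 ^+ n) (n + n).+1 (fun k => E^-1 * a k) dp (half_pow_gt0 n) (fun k => aE k _ (a1 k)) (fun k
  => aE k _ (a2 k)).
by rewrite -mulr_sumr ler_pdivrMl // mulrA.
Qed.

(** Translate by a, dilate by t and apply [DL] to u |-> phi (a dil_t u): the Jacobian contributes
    t^Q and the homogeneity of L^t contributes t^-lambda, which the factor on the left cancels. *)
Lemma kernel_integral a (t : R) phi : 0 < t -> test_fun setT phi ->
  t `^ (lambda - Q) * integral_rV (fun y => D (dil t^-1 (mul (- a) y)) * Lt phi y) =
  integral_rV (fun u => omega u * phi (mul a (dil t u))) - integral_rV (fun u => omega u * phi (mul a (dil (t * 2) u))).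
Proof.
move=> t0 tp; have ti0 : 0 < t^-1 by rewrite invr_gt0.
have tn : t != 0 by rewrite gt_eqF.
pose pa y := phi (mul a y); have tpa : test_fun setT pa by exact: test_translate.
have tL := Lt_test ops tp.
have tDt : test_fun setT (fun y => D (dil t^-1 y)) := test_dilate G ti0 tD.
have t1 : test_fun setT (fun y => D (dil t^-1 (mul (- a) y)) * Lt phi y).
  exact: (testM (test_smooth (test_translate G (- a) tDt)) tL).
have [A1 c1] := test_ccont t1.
rewrite -(int_translate G a c1).
have -> : (fun y => D (dil t^-1 (mul (- a) (mul a y))) * Lt phi (mul a y)) = fun y => D (dil t^-1 y) * Lt pa y.
  by apply/funext => y; rewrite mulKx (inv_translate ops a tp).
have tLa := Lt_test ops tpa.
have t2 : test_fun setT (fun y => D (dil t^-1 y) * Lt pa y) := testM (test_smooth tDt) tLa.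
have [A2 c2] := test_ccont t2.
have e2 := int_dilate G t0 c2.
have tdp : test_fun setT (fun y => pa (dil t y)) := test_dilate G t0 tpa.
have t3 : test_fun setT (fun y => D y * Lt pa (dil t y)) := testM (test_smooth tD) (test_dilate G t0 tLa).
have e3 : integral_rV (fun y => D y * Lt (fun w => pa (dil t w)) y) = t `^ lambda * integral_rV (fun y => D y * Lt pa
  (dil t y)).
  rewrite -(intZ_test _ t3); congr integral_rV; apply/funext => y.
  by rewrite (inv_dilate ops t0 tpa); ring.
have e4 : (fun x => D (dil t^-1 (dil t x)) * Lt pa (dil t x)) = fun y => D y * Lt pa (dil t y).
  by apply/funext => y; rewrite dilVK.
rewrite e4 in e2.
have -> : t `^ (lambda - Q) * integral_rV (fun y => D (dil t^-1 y) * Lt pa y) = t `^ lambda * integral_rV (fun y => D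
  y * Lt pa (dil t y)).
  rewrite e2 powRD; last by rewrite tn implybT.
  by rewrite powRN powR_mulrn ?(ltW t0) // mulrA.
rewrite -e3 (DL tdp); congr (_ - _); congr integral_rV; apply/funext => y.
by rewrite /pa dilationM mulrC.
Qed.

Definition average a (t : R) phi : R := integral_rV (fun u => omega u * phi (mul a (dil t u))).

Lemma potential_integral n p (x : 'I_p -> V) (m : 'I_p -> R) phi : test_fun setT phi ->
  integral_rV (fun y => potential n x m y * Lt phi y) =
  \sum_i m i * (average (x i) (2^-1 ^+ n) phi - average (x i) (2 ^+ n.+1) phi).
Proof.
move=> tp; have tL := Lt_test ops tp.
have tk k i : test_fun setT (fun y => (m i * (2^-1 ^+ n * 2 ^+ k) `^ (lambda - Q)) * (D (dil (2^-1 ^+ n * 2 ^+ k)^-1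
  (mul (- x i) y)) * Lt phi y)).
  apply: testZ; exact: (testM (smooth_translate G (- x i) (smooth_dilate G _ (test_smooth tD))) tL).
have tk' k : test_fun setT (fun y => \sum_i (m i * (2^-1 ^+ n * 2 ^+ k) `^ (lambda - Q)) * (D (dil (2^-1 ^+ n * 2 ^+
  k)^-1 (mul (- x i) y)) * Lt phi y)).
  by apply: test_sum => i; exact: tk.
have -> : (fun y => potential n x m y * Lt phi y) = fun y => \sum_(k < (n + n).+1) \sum_i (m i * (2^-1 ^+ n * 2 ^+ k)
  `^ (lambda - Q)) * (D (dil (2^-1 ^+ n * 2 ^+ k)^-1 (mul (- x i) y)) * Lt phi y).
  apply/funext => y; rewrite /potential mulr_suml; apply: eq_bigr => k _; rewrite /layer mulr_suml.
  by apply: eq_bigr => i _; rewrite mulrA.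
rewrite (int_sum_test _ (fun k : 'I_(n + n).+1 => tk' k)).
under eq_bigr => k _ do rewrite (int_sum_test _ (tk k)).
rewrite exchange_big /=; apply: eq_bigr => i _.
pose b k := average (x i) (2^-1 ^+ n * 2 ^+ k) phi.
have E k : integral_rV (fun y => (m i * (2^-1 ^+ n * 2 ^+ k) `^ (lambda - Q)) * (D (dil (2^-1 ^+ n * 2 ^+ k)^-1 (mul
  (- x i) y)) * Lt phi y)) = m i * (b k - b k.+1).
  have t0 : 0 < 2^-1 ^+ n * 2 ^+ k :> R by rewrite mulr_gt0 ?half_pow_gt0 // exprn_gt0.
  have := kernel_integral (x i) t0 tp; rewrite /b /average exprSr mulrA => <-; rewrite mulrA.
  by rewrite intZ_test //; exact: (testM (smooth_translate G (- x i) (smooth_dilate G _ (test_smooth tD))) tL).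
under eq_bigr => k _ do rewrite E.
rewrite -mulr_sumr; congr (_ * _).
have T q : \sum_(k < q) (b k - b k.+1) = b 0%N - b q.
  elim: q => [|q IH]; first by rewrite big_ord0 subrr.
  by rewrite big_ord_recr /= IH addrA subrK.
rewrite T /b expr0 mulr1 (_ : 2^-1 ^+ n * 2 ^+ (n + n).+1 = 2 ^+ n.+1 :> R) //.
by rewrite -addnS exprD mulrA exprVn mulVf ?mul1r // expf_neq0.
Qed.

(** The change of variables w = dil_t u gives t^-Q times an integral over a region bounded uniformly
    in a, because phi has compact support; omega is merely bounded there. *)
Lemma average_large (K : set V) phi : compact K -> test_fun setT phi -> exists2 W : R, 0 <= W &
  forall a (t : R), K a -> 0 < t -> `|average a t phi| <= W * t ^- qdim G.
Proof.
move=> cK tp; have [A [M [A0 zA hM]]] := test_bound tp.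
have [_ [Mo [_ _ hMo]]] := test_bound tomega.
have M0 : 0 <= M by exact: le_trans (hM 0). have Mo0 : 0 <= Mo by exact: le_trans (hMo 0).
have [B B0 hB] := compact_norm_le cK.
have [E E0 hE] := mul_bounded G (A + B).
exists (Mo * M * (2 * (E + 1)) ^+ N).
  by rewrite !mulr_ge0 // exprn_ge0 // mulr_ge0 // addr_ge0 // ltW.
move=> a t Ka t0; have ti0 : 0 < t^-1 by rewrite invr_gt0.
have t1 : test_fun setT (fun w => omega (dil t^-1 w) * phi (mul a w)).
  exact: (testM (smooth_dilate G _ (test_smooth tomega)) (test_translate G a tp)).
have [A1 c1] := test_ccont t1.
have := int_dilate G t0 c1.
have -> : (fun x => omega (dil t^-1 (dil t x)) * phi (mul a (dil t x))) = fun u => omega u * phi (mul a (dil t u)).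
  by apply/funext => u; rewrite dilVK // gt_eqF.
have ti : 0 <= t ^- qdim G by rewrite invr_ge0 exprn_ge0 // ltW.
rewrite /average => ->; rewrite normrM (ger0_norm ti) [leRHS]mulrC; apply: ler_wpM2l => //.
apply: int_bound.
  split; [by rewrite addr_gt0|exact: (smoothT_cont (test_smooth t1))|].
  move=> w wE; rewrite zA ?mulr0 // leNgt; apply/negP => h.
  have : `|w| <= E.
    rewrite -(mulKx G a w); apply: hE; last by rewrite (le_trans (ltW h)) // lerDl ltW.
    by rewrite normrN (le_trans (ltW (hB a Ka))) // lerDr ltW.
  by move=> h2; have := le_trans wE h2; rewrite gerDl ler10.
by move=> w; rewrite normrM ler_pM.
Qed.

End Potential.
End LowerBound.

(** * Passage to the limit *)

Section Extremal.
Context {R : realType} {N : nat} (G : carnot R N).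
Local Notation V := 'rV[R]_N.
Local Notation mul := (carnot_mul G).
Local Notation dil := (dilation G).
Local Notation box := (box G).
Local Notation d_ := (cc_dist G).
Implicit Types (y z : V) (f g phi psi : V -> R).
Variables (Lf Lt : (V -> R) -> V -> R) (lambda delta : R).
Hypothesis ops : inv_ops G Lf Lt lambda.
Hypotheses (lambda_gt0 : 0 < lambda) (lambda_ltQ : lambda < (qdim G)%:R) (delta_gt0 : 0 < delta) (delta_lt1 : delta <
  1).
Local Notation Q := ((qdim G)%:R : R).
Local Notation s := (Q - lambda + delta).

(** After telescoping, the term of scale 2^-n samples phi only within rho of x i, where it is the
    constant c, and omega has integral 1; the term of scale 2^(n + 1) is the error. *)
Lemma potential_value (D omega : V -> R) (K : set V) phi (c rho : R) :
  test_fun setT D -> test_fun setT omega -> integral_rV omega = 1 ->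
  (forall phi, test_fun setT phi -> integral_rV (fun x => D x * Lt phi x) =
      integral_rV (fun x => omega x * phi x) - integral_rV (fun x => omega x * phi (dil 2 x))) ->
  compact K -> test_fun setT phi -> 0 < rho -> (forall x y, K x -> `|x - y| < rho -> phi y = c) ->
  exists2 W : R, 0 <= W & exists n0, forall n, (n0 <= n)%N -> forall p (x : 'I_p -> V) (m : 'I_p -> R),
  (forall i, K (x i) /\ 0 <= m i) ->
  `|integral_rV (fun y => potential G lambda D n x m y * Lt phi y) - c * \sum_i m i| <= W * 2^-1 ^+ n * \sum_i m i.
Proof.
move=> tD to i1 DL cK tp rho0 hc.
have [A [_ [A0 zA _]]] := test_bound to.
have [s0 s00 hs] := mul_dil_near G A cK rho0.
have [W W0 hW] := average_large G to cK tp.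
have [n0 hn0] := half_pow_small s00.
exists W => //; exists n0 => n n0n p x m hx.
rewrite (potential_integral ops tD DL) // mulr_sumr -sumrB mulr_sumr.
apply: le_trans (ler_norm_sum _ _ _) _; apply: ler_sum => i _; have [Kx m0] := hx i.
have -> : average G omega (x i) (2^-1 ^+ n) phi = c.
  rewrite /average (_ : (fun u => _) = fun u => c * omega u) ?intZ_test ?i1 ?mulr1 //.
  apply/funext => u; have [uA|uA] := leP A `|u|; first by rewrite zA // mul0r mulr0.
  rewrite mulrC; congr (_ * _); apply: (hc (x i)) => //; apply: hs => //; [exact: ltW|exact/ltW/hn0].
rewrite (_ : _ - _ = - (m i * average G omega (x i) (2 ^+ n.+1) phi)); last ring.
rewrite normrN normrM (ger0_norm m0) [leRHS]mulrC; apply: ler_wpM2l => //.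
have p0 : 0 < 2 ^+ n.+1 :> R by rewrite exprn_gt0.
apply: le_trans (hW _ _ Kx p0) _; apply: ler_wpM2l => //.
have Q1 : (0 < qdim G)%N by rewrite -(ltr_nat R); exact: lt_trans lambda_ltQ.
rewrite exprVn lef_pV2 ?posrE ?exprn_gt0 // -exprM; apply: ler_weXn2l; first by rewrite ler1n.
by rewrite (leq_trans (leqnSn n)) // leq_pmulr.
Qed.

Hypotheses (hypo_t : hypoelliptic (op_dist Lf)) (hypo_f : hypoelliptic (op_dist Lt)).

(** The content enters through h, a lower bound for the sums over finite covers by boxes: the
    selected boxes of the Frostman construction form such a cover, with sum at most the mass. *)
Lemma extremal_function (i0 : 'I_N) : exists C C' : R, [/\ 0 < C, 0 < C' & forall K : set V, compact K ->
  exists f, [/\ forall y z, `|f y - f z| <= C * d_ y z `^ delta,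
    dist_support (op_dist Lt (dist_of f)) `<=` K &
    forall psi (h : R), test_fun setT psi -> set_nbhs K [set x | psi x = 1] ->
      (forall S : seq (V * R), (forall a : V * R, a \in S -> 0 < a.2) ->
        (forall z, K z -> exists2 a : V * R, a \in S & box (C' * a.2) (mul (- a.1) z)) ->
        h <= \sum_(a <- S) a.2 `^ s) ->
      h <= integral_rV (fun x => f x * Lt psi x)]].
Proof.
have [D [om [tD to i1 DL]]] := corrector ops hypo_t hypo_f lambda_gt0 i0 (ltr1n R 2).
have s0 : 0 < s := s_gt0 lambda_ltQ delta_gt0.
have [Cf Cf0 fro] := frostman G s0.
have [C C0 hol] := potential_holder G (D := D) lambda delta_gt0 delta_lt1 tD Cf0.
exists C, Cf; split=> // K cK; have [M hM] := fro K cK.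
pose good n (d : {p : nat & (('I_p -> V) * ('I_p -> R))%type}) := let x := (projT2 d).1 in let m := (projT2 d).2 in
    [/\ forall i, K (x i) /\ 0 <= m i,
      forall y (r : R), 2^-1 ^+ n <= r -> \sum_(i | box r (mul (- y) (x i))) m i <= Cf * r `^ s,
      \sum_i m i <= M &
      exists S : seq (V * R), [/\ forall a : V * R, a \in S -> 0 < a.2,
        forall z, K z -> exists2 a : V * R, a \in S & box (Cf * a.2) (mul (- a.1) z) &
        (\sum_(a <- S) a.2 `^ s <= \sum_i m i)]].
have [w hw] : {w & forall n, good n (w n)}.
  apply: choice => n; have [p [x [m H]]] := hM n; by exists (existT _ p (x, m)).
pose x n := (projT2 (w n)).1; pose m n := (projT2 (w n)).2.
have hx n : forall i, K (x n i) /\ 0 <= m n i by case: (hw n).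
have m0 n i : 0 <= m n i := proj2 (hx n i).
have mM n : \sum_i m n i <= M by case: (hw n).
have M0 : 0 <= M by apply: le_trans (mM 0); apply: sumr_ge0.
pose u n y := potential G lambda D n (x n) (m n) y.
have su n : smooth_on setT (u n) by apply: (smooth_sum openT) => k; exact: layer_smooth.
have hu n y z : `|u n y - u n z| <= C * d_ y z `^ delta by apply: hol; [exact: m0|case: (hw n)].
(* Normalized at 0, the potentials are bounded at each point, as an ultralimit requires; the
   subtracted constant is invisible to L by [int_Lt]. *)
pose g n y := u n y - u n 0.
have hg n y z : `|g n y - g n z| <= C * d_ y z `^ delta.
  by rewrite (_ : g n y - g n z = u n y - u n z) //; rewrite /g; ring.
have bg y : bdd (fun n => g n y) by exists (C * d_ y 0 `^ delta) => n; exact: hu.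
pose f y := ulim (fun n => g n y).
have fE phi : test_fun setT phi -> bdd (fun n => integral_rV (fun y => u n y * Lt phi y)) /\
    integral_rV (fun y => f y * Lt phi y) = ulim (fun n => integral_rV (fun y => u n y * Lt phi y)).
  move=> tp; have tL := Lt_test ops tp.
  have e n : integral_rV (fun y => g n y * Lt phi y) = integral_rV (fun y => u n y * Lt phi y).
    rewrite (_ : (fun y => g n y * _) = fun y => (- u n 0) * Lt phi y + u n y * Lt phi y).
      by rewrite (int_test_lin _ tL (testM (su n) tL)) (int_Lt ops) // mulr0 add0r.
    by apply/funext => y; rewrite /g; ring.
  have [h1 h2] := ulim_integral (ltW C0) delta_gt0 hg bg tL.
  by split; [move: h1|rewrite /f -h2; congr ulim; apply/funext => n]; rewrite ?e //; under eq_fun do rewrite e.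
have val phi (c rho : R) : test_fun setT phi -> 0 < rho -> (forall a y, K a -> `|a - y| < rho -> phi y = c) ->
    forall e : R, 0 < e -> exists n0, forall n, (n0 <= n)%N ->
      `|integral_rV (fun y => u n y * Lt phi y) - c * \sum_i m n i| <= e.
  move=> tp rho0 hc e e0; have [W W0 [n0 hn0]] := potential_value tD to i1 DL cK tp rho0 hc.
  have WM : 0 < W * M + 1 by rewrite ltr_wpDl // mulr_ge0.
  have [n1 hn1] := half_pow_small (divr_gt0 e0 WM).
  exists (n0 + n1)%N => n nn; apply: le_trans (hn0 n _ _ _ _ (hx n)) _; first exact: leq_trans (leq_addr _ _) nn.
  have h1 := hn1 n (leq_trans (leq_addl _ _) nn).
  apply: (@le_trans _ _ (W * 2^-1 ^+ n * M)); first by rewrite ler_wpM2l // mulr_ge0 // ltW // half_pow_gt0.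
  rewrite ltr_pdivlMr // in h1; have := half_pow_gt0 (R := R) n; set b := 2^-1 ^+ n in h1 *; move=> b0.
  have E : b * (W * M + 1) = W * b * M + b by ring.
  by rewrite E in h1; lra.
exists f; split.
- move=> y z; have -> : f y - f z = ulim (fun n => -1 * g n z + g n y) by rewrite ulim_lin // mulN1r addrC.
  apply: (ulim_norm_le (n0 := 0%N)); first exact: bdd_lin.
  by move=> n _; rewrite mulN1r addrC.
- move=> y hy; apply: contrapT => ny; apply: hy; exists (~` K); split=> //.
    by apply: closed_openC; apply: compact_closed cK; exact: norm_hausdorff.
  move=> phi tphi; have tp := testT tphi; have [_ [K' [cK' K'K zK']]] := tphi.
  have oK' : open (~` K') by apply: closed_openC; apply: compact_closed cK'; exact: norm_hausdorff.
  have [rho rho0 hr] := compact_fat cK oK' (fun z Kz K'z => K'K z K'z Kz).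
  have [b fe] := fE phi tp; rewrite /op_dist /dist_of fe.
  apply: ulim_approx => e e0; have [n0 hn0] := val phi 0 rho tp rho0 (fun a z Ka h => zK' z (hr a z Ka h)) e e0.
  by exists n0 => n nn; have := hn0 n nn; rewrite mul0r.
- move=> psi h tp nb hS.
  move/set_nbhsP: nb => [W [oW KW We]].
  have [rho rho0 hr] := compact_fat cK oW KW.
  have hc a y : K a -> `|a - y| < rho -> psi y = 1 by move=> Ka /(hr _ _ Ka)/We.
  have [b fe] := fE psi tp; rewrite fe.
  apply/ler_addgt0Pr => e e0; have [n0 hn0] := val psi 1 rho tp rho0 hc e e0.
  rewrite -lerBlDr; apply: (ulim_ge (n0 := n0) b) => n nn.
  have := hn0 n nn; rewrite mul1r ler_norml => /andP[h1 _].
  have [_ _ _ [S [S0 cS sS]]] := hw n.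
  have := hS S S0 cS; rewrite -/(m n) in sS; lra.
Qed.

End Extremal.

(** * The upper bound for the capacity *)

Section Overlap.
Context {R : realType} {N : nat} (G : carnot R N).
Local Notation V := 'rV[R]_N.
Local Notation mul := (carnot_mul G).
Local Notation deg := (carnot_deg G).
Local Notation dil := (dilation G).
Local Notation box := (box G).
Implicit Types (y z c : V) (f g phi psi eta : V -> R).

Lemma pow2_class (b : R) n : 1 <= b -> b < 2 ^+ n -> exists2 k : 'I_n, 2 ^+ k <= b & b < 2 ^+ k.+1.
Proof.
move=> b1; elim: n => [|n IH] bn; first by move: bn; rewrite expr0 ltNge b1.
have [h|h] := ltP b (2 ^+ n).
  by have [k h1 h2] := IH h; exists (widen_ord (leqnSn n) k).
by exists ord_max.
Qed.

Lemma half_sum n : \sum_(k < n) 2^-1 ^+ k <= 2 :> R.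
Proof.
suff -> : \sum_(k < n) 2^-1 ^+ k = 2 - 2 * 2^-1 ^+ n :> R.
  by rewrite gerBl mulr_ge0 // exprn_ge0 // invr_ge0.
elim: n => [|n IH]; first by rewrite big_ord0 expr0 mulr1 subrr.
by rewrite big_ord_recr /= IH exprS mulrA mulfV // mul1r; lra.
Qed.

Definition separated (x : nat -> V) (r : nat -> R) (n : nat) : Prop :=
  [/\ forall j, (j <= n)%N -> 0 < r j, forall j k, (j < k <= n)%N -> r k <= r j &
      forall j k, (j < k <= n)%N -> ~ box (r j) (mul (- x j) (x k))].

(* The boxes are grouped by the dyadic size of their radius relatively to r n. *)
Lemma overlap_sum (B : R) : 0 < B -> exists2 S : R, 0 <= S & forall x r n, separated x r n ->
  \sum_(j < n | box (B * r j) (mul (- x j) (x n))) r n / r j <= S.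
Proof.
move=> B0; have B20 : 0 < 2 * B by rewrite mulr_gt0.
have [P hP] := box_packing G B20; exists (2 * P%:R); first by rewrite mulr_ge0.
move=> x r n [r0 dec sep]; have rn := r0 n (leqnn n).
have rj (j : 'I_n) : 0 < r j by apply: r0; exact: ltnW.
have rd (j : 'I_n) : r n <= r j by apply: dec; rewrite ltn_ord leqnn.
pose b (j : 'I_n) := r j / r n.
have b1 j : 1 <= b j by rewrite ler_pdivlMr // mul1r.
have [q hq] : exists q : nat, forall j : 'I_n, b j < 2 ^+ q.
  have [q hq] := pow2_ge (1 + \sum_j b j); exists q => j; apply: lt_le_trans hq.
  rewrite (bigD1 j) //= addrCA ltr_pwDr // ltr_wpDr ?ltr01 //.
  by apply: sumr_ge0 => k _; exact: le_trans (b1 k).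
pose cl (k : 'I_q) (j : 'I_n) := [&& box (B * r j) (mul (- x j) (x n)), 2 ^+ k <= b j & b j < 2 ^+ k.+1].
(* The centres of one class are separated at scale 2^k r n and lie in a box around x n of comparable
   radius, so that [box_packing] bounds their number independently of k. *)
have card k : (#|[set j | cl k j]%SET| <= P)%N.
  have xi : {in enum [set j | cl k j]%SET &, injective (fun j : 'I_n => x j)}.
    move=> j j' _ _ e; apply/val_inj; case: (ltngtP j j') => // h; exfalso.
      apply: (sep j j'); first by rewrite h ltnW.
      by rewrite e mulNx; exact: box0.
    apply: (sep j' j); first by rewrite h ltnW.
    by rewrite e mulNx; exact: box0.
  rewrite cardE -(size_map (fun j : 'I_n => x j)); have kp : 0 < 2 ^+ k * r n by rewrite mulr_gt0 // exprn_gt0.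
  apply: (hP _ (x n) _ kp).
  - by rewrite map_inj_in_uniq // enum_uniq.
  - move=> y /mapP [j]; rewrite mem_enum inE => /and3P[bj _ b2] ->.
    rewrite -boxN oppM opprK; apply: box_le bj; first by rewrite mulr_gt0.
    rewrite (_ : 2 * B * _ = B * (2 ^+ k.+1 * r n)); last by rewrite exprS; ring.
    by rewrite ler_pM2l // -ler_pdivrMr // ltW.
  - move=> y z /mapP [j]; rewrite mem_enum inE => /and3P[_ bj _] ->
    /mapP [j']; rewrite mem_enum inE => /and3P[_ bj' _] -> ne bx.
    have lej i : 2 ^+ k <= b i -> 2 ^+ k * r n <= r i by rewrite /b ler_pdivlMr.
    case: (ltngtP j j') => h.
    + by apply: (sep j j'); [rewrite h ltnW|exact: (box_le kp (lej _ bj))].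
    + apply: (sep j' j); first by rewrite h ltnW.
      by rewrite -boxN oppM opprK; exact: (box_le kp (lej _ bj')).
    + by move: ne; rewrite h eqxx.
apply: (@le_trans _ _ (\sum_(j < n) \sum_(k < q) (if cl k j then 2^-1 ^+ k else 0))).
  rewrite big_mkcond; apply: ler_sum => j _; case: ifP => [bj|_]; last first.
    by apply: sumr_ge0 => k _; case: ifP => // _; rewrite exprn_ge0 // invr_ge0.
  have [k k1 k2] := pow2_class (b1 j) (hq j).
  rewrite (bigD1 k) //= {1}/cl bj k1 k2 /= -[leLHS]addr0 lerD //; last first.
    by apply: sumr_ge0 => k' _; case: ifP => // _; rewrite exprn_ge0 // invr_ge0.
  by rewrite ler_pdivrMr // exprVn ler_pdivlMl ?exprn_gt0 // -ler_pdivlMr.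
rewrite exchange_big /=; apply: (@le_trans _ _ (\sum_(k < q) P%:R * 2^-1 ^+ k)).
  apply: ler_sum => k _; rewrite -(big_mkcond (cl k)) /= sumr_const -[leLHS]mulr_natl ler_wpM2r ?exprn_ge0 ?invr_ge0
    // ler_nat.
  by have := card k; rewrite cardsE.
by rewrite -mulr_sumr mulrC ler_wpM2r // half_sum.
Qed.

Lemma derive_shift_eq (X Y W : normedModType R) (f : X -> W) (g : Y -> W) (v x : X) (w y : Y) :
  (forall h : R, f (h *: v + x) = g (h *: w + y)) -> 'D_v f x = 'D_w g y.
Proof.
move=> e; have e0 := e 0; rewrite !scale0r !add0r in e0.
rewrite /derive (_ : (fun h : R => _) = fun h => h^-1 *: ((g \o shift y) (h *: w) - g y)) //.
by apply/funext => h /=; rewrite e e0.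
Qed.

Lemma pd_dilate g (t : R) i x : smooth_on setT g ->
  'D_(evec i) (fun u => g (dil t u)) x = t ^+ deg i * 'D_(evec i) g (dil t x).
Proof.
move=> sg; have -> : 'D_(evec i) (fun u => g (dil t u)) x = 'D_(t ^+ deg i *: evec i) g (dil t x).
  apply: derive_shift_eq => h; congr g; apply/rowP => j; rewrite dilationE !rVD !rVZ !evecE dilationE.
  by case: eqP => [->|_]; rewrite ?mulr1 ?mulr0 ?add0r //; ring.
rewrite (smooth_deriveE openT _ sg Logic.I) (bigD1 i) //= big1 ?addr0 => [|k ki].
  by rewrite rVZ evecE eqxx mulr1.
by rewrite rVZ evecE eq_sym (negbTE ki) mulr0 mul0r.
Qed.

Lemma pdZ i (a : R) phi : smooth_on setT phi -> pd i (fun x => a * phi x) = fun x => a * pd i phi x.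
Proof.
move=> sp; have := pd_lin i a sp (smooth_cst openT 0).
rewrite (_ : (fun x => a * phi x + 0) = fun x => a * phi x); last by apply/funext => x; rewrite addr0.
by move=> ->; apply/funext => x; rewrite derive_cst addr0.
Qed.

Lemma partials_dilate g (t : R) l : smooth_on setT g ->
  partials l (fun u => g (dil t u)) = fun x => t ^+ (\sum_(i <- l) deg i) * partials l g (dil t x).
Proof.
move=> sg; elim: l => [|i l IH] /=; first by apply/funext => x; rewrite big_nil expr0 mul1r.
rewrite IH (pdZ _ _ (smooth_dilate G t (smooth_partials l sg))); apply/funext => x.
by rewrite pd_dilate ?big_cons ?exprD; [ring|exact: smooth_partials].
Qed.

Lemma partials_row_mx (H : 'rV[R]_(N + N) -> R) c l x :
  partials l (fun v => H (row_mx c v)) x = partials (map (@rshift N N) l) H (row_mx c x).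
Proof.
elim: l x => //= i l IH x.
rewrite (_ : (partials l _) = fun v => partials (map (@rshift N N) l) H (row_mx c v)); last exact/funext.
apply: derive_shift_eq => h; congr partials; apply/rowP => j.
case: (split_ordP j) => k ->; rewrite !rVD !rVZ ?row_mxEl ?row_mxEr ?rVD ?rVZ !evecE.
  by rewrite eq_rlshift mulr0 add0r.
by rewrite (inj_eq (@rshift_inj _ _)).
Qed.

(** A derivative in u_i brings out t^(deg i) with deg i >= 1, hence at least one factor t when t <=
    1. The bound is uniform in c because eta (c v) is smooth jointly in c and v. *)
Lemma translate_dilate_bound eta (A B : R) m : smooth_on setT eta ->
  exists2 E : R, 0 <= E & forall c (t : R), `|c| <= B ->
  0 <= t <= 1 -> forall l x, (0 < size l <= m)%N -> `|x| <= A ->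
    `|partials l (fun u => eta (mul c (dil t u))) x| <= E * t.
Proof.
move=> se; pose H (z : 'rV[R]_(N + N)) := eta (mul (lsubmx z) (rsubmx z)).
have sH : smooth_on setT H.
  have sm j : smooth_on setT (fun z : 'rV[R]_(N + N) => mul (lsubmx z) (rsubmx z) ord0 j) := carnot_smooth G j.
  exact: (smooth_comp openT openT sm (fun _ _ => Logic.I) se).
have [E E0 hE] := smooth_ckb (`|A| + `|B|) m sH; exists E => // c t cB t01 l x lm xA.
have sc : smooth_on setT (fun u => eta (mul c u)) := smooth_translate G c se.
have [l0 lm'] := andP lm; have [t0 t1] := andP t01.
rewrite (partials_dilate t l sc) normrM ger0_norm ?exprn_ge0 // mulrC; apply: ler_pM; rewrite ?exprn_ge0 //; last first.
  case: l l0 {lm lm'} => // i l _; rewrite big_cons exprD; apply: (@le_trans _ _ (t ^+ deg i)).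
    by rewrite ler_piMr ?exprn_ge0 // exprn_ile1.
  by rewrite -{2}(expr1 t) ler_wiXn2l // deg_gt0.
have -> : (fun u => eta (mul c u)) = fun u => H (row_mx c u) by apply/funext => u; rewrite /H row_mxKl row_mxKr.
rewrite partials_row_mx; apply: hE; first by rewrite size_map.
rewrite /=; apply: row_mx_norm_le.
  by rewrite (le_trans cB) // (le_trans (ler_norm B)) // lerDr.
apply: le_trans (dilation_norm_le G _ t01) _; apply: (@le_trans _ _ `|x|); first by rewrite ler_piMl.
by rewrite (le_trans xA) // (le_trans (ler_norm A)) // lerDl.
Qed.

(** [ckbM1] factor after factor, the product of the 1 + 2^m e j being controlled by 1 + x <= exp
    x. *)
Lemma ckb_prod (U : set V) m (M : R) phi (F : nat -> V -> R) (e : nat -> R) n : open U -> 0 <= M ->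
  smooth_on U phi -> ckb m U M phi -> (forall j, 0 <= e j) -> (forall j, smooth_on U (F j)) ->
  (forall j x, U x -> `|F j x| <= 1) ->
  (forall j l x, (j < n)%N -> (0 < size l <= m)%N -> U x -> `|partials l (F j) x| <= e j) ->
  ckb m U (M * expR (2 ^+ m * \sum_(j < n) e j)) (fun x => phi x * \prod_(j < n) F j x).
Proof.
move=> oU M0 sp cp e0 sF F1 hF.
suff H : forall k, (k <= n)%N -> ckb m U (M * \prod_(j < k) (1 + 2 ^+ m * e j)) (fun x => phi x * \prod_(j < k) F j x).
  apply: (ckb_le (leqnn m) (@subset_refl _ U) _ (H n (leqnn n))); rewrite ler_wpM2l //.
  rewrite mulr_sumr expR_sum; apply: ler_prod => j _.
  by rewrite expR_ge1Dx addr_ge0 // mulr_ge0 // exprn_ge0.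
elim=> [|k IH] kn.
  by rewrite big_ord0 mulr1 (_ : (fun x => _) = phi) //; apply/funext => x; rewrite big_ord0 mulr1.
rewrite big_ord_recr mulrA (_ : (fun x => _) = fun x => (phi x * \prod_(j < k) F j x) * F k x); last first.
  by apply/funext => x; rewrite big_ord_recr mulrA.
have sP : smooth_on U (fun x => phi x * \prod_(j < k) F j x).
  by apply: (smoothM oU sp); exact: (smooth_prod oU _ (fun j : 'I_k => sF j)).
have P0 : 0 <= M * \prod_(j < k) (1 + 2 ^+ m * e j).
  by rewrite mulr_ge0 // prodr_ge0 // => j _; rewrite addr_ge0 // mulr_ge0 // exprn_ge0.
exact: (ckbM1 oU sP (sF k) P0 (e0 k) (IH (ltnW kn)) (F1 k) (fun l x lm Ux => hF k l x kn lm Ux)).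
Qed.

End Overlap.

(** * Pieces of the partition of unity and rescaled estimates *)

Section UpperBound.
Context {R : realType} {N : nat} (G : carnot R N).
Local Notation V := 'rV[R]_N.
Local Notation mul := (carnot_mul G).
Local Notation dil := (dilation G).
Local Notation box := (box G).
Local Notation d_ := (cc_dist G).
Implicit Types (y z : V) (f g phi psi eta : V -> R).

Lemma partials_cst l (c : R) : (0 < size l)%N -> partials l (fun _ : V => c) = fun=> 0.
Proof.
case/lastP: l => // l i _; rewrite partials_rcons -(partials0 l); congr partials.
by apply/funext => x; rewrite derive_cst.
Qed.

(* The subordinate partition of unity taken in order of decreasing radius: each factor varies on a scale
   larger than r n, and the ratios of scales are summable by overlap_sum. *)
Definition piece eta (x : nat -> V) (r : nat -> R) n y : R :=
  eta (dil (r n)^-1 (mul (- x n) y)) * \prod_(j < n) (1 - eta (dil (r j)^-1 (mul (- x j) y))).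

Lemma sum_pieces eta x r n y :
  \sum_(i < n) piece eta x r i y = 1 - \prod_(j < n) (1 - eta (dil (r j)^-1 (mul (- x j) y))).
Proof.
elim: n => [|n IH]; first by rewrite !big_ord0 subrr.
by rewrite !big_ord_recr /= IH /piece; ring.
Qed.

Lemma piece_test eta x r n : test_fun setT eta -> 0 < r n -> test_fun setT (piece eta x r n).
Proof.
move=> te rn; have t1 := test_translate G (- x n) (test_dilate G (_ : 0 < (r n)^-1) te).
have {}t1 : test_fun setT (fun y => eta (dil (r n)^-1 (mul (- x n) y))) by apply: t1; rewrite invr_gt0.
have sP : smooth_on setT (fun y => \prod_(j < n) (1 - eta (dil (r j)^-1 (mul (- x j) y)))).
  apply: (smooth_prod openT) => j; apply: (smoothB openT (smooth_cst openT 1)).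
  exact: (smooth_translate G (- x j) (smooth_dilate G (r j)^-1 (test_smooth te))).
have := testM sP t1; congr test_fun; apply/funext => y; exact: mulrC.
Qed.

Lemma piece_ckb eta (A : R) m : test_fun setT eta -> 0 < A -> (forall u, A <= `|u| -> eta u = 0) ->
  (forall u, 0 <= eta u <= 1) ->
  exists2 M : R, 0 <= M & forall x r n, separated G x r n ->
    ckb m setT M (fun u => piece eta x r n (mul (x n) (dil (r n) u))).
Proof.
move=> te A0 z e01; have se := test_smooth te.
have [M0 M00 hM0] := test_ckb m te.
have [B0 B00 hB0] := mul_bounded G (A + 1).
have [E E0 hE] := translate_dilate_bound G (A + 1) B0 m se.
pose B1 := 1 + B0; have B10 : 0 < B1 by rewrite addr_gt0.
have [S S0 hS] := overlap_sum G B10.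
exists (M0 * expR (2 ^+ m * (E * S))); first by rewrite mulr_ge0 // expR_ge0.
move=> x r n sp; have [r0 dec _] := sp; have rn := r0 n (leqnn n).
pose c j := dil (r j)^-1 (mul (- x j) (x n)); pose th j := r n / r j.
pose F j (u : V) : R := -1 * eta (mul (c j) (dil (th j) u)) + 1.
have pE : (fun u => piece eta x r n (mul (x n) (dil (r n) u))) = fun u => eta u * \prod_(j < n) F j u.
  apply/funext => u; rewrite /piece mulKx dilVK ?gt_eqF //; congr (_ * _); apply: eq_bigr => j _.
  by rewrite /F /c /th carnot_mulA dilation_mul dilationM (mulrC (r n)); ring.
have sg j : smooth_on setT (fun u => eta (mul (c j) (dil (th j) u))).
  exact: (smooth_dilate G (th j) (smooth_translate G (c j) se)).
have sF j : smooth_on setT (F j) by exact: (smoothD openT (smoothZ openT (-1) (sg j)) (smooth_cst openT 1)).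
(* An earlier box that is far from box n has its cutoff equal to 0 throughout U, so its factor is 1
   and contributes no derivative. The remaining boxes are those counted by [overlap_sum]. *)
pose near j := `|c j| <= B0.
pose e j := if (j < n)%N && near j then E * th j else 0.
have rj j : (j < n)%N -> 0 < r j by move=> jn; apply: r0; exact: ltnW.
have th01 j : (j < n)%N -> 0 <= th j <= 1.
  move=> jn; rewrite /th divr_ge0 ?(ltW rn) ?(ltW (rj j jn)) //= ler_pdivrMr ?rj // mul1r.
  by apply: dec; rewrite jn leqnn.
have e0 j : 0 <= e j.
  by rewrite /e; case: ifP => // /andP[jn _]; rewrite mulr_ge0 //; case/andP: (th01 j jn).
have F1 j u : `|F j u| <= 1.
  by rewrite /F; have /andP[a b] := e01 (mul (c j) (dil (th j) u)); rewrite ger0_norm; lra.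
pose U := [set u : V | `|u| < A + 1]; have oU : @open V U by exact: open_norm_lt.
have hF j l u : (j < n)%N -> (0 < size l <= m)%N -> U u -> `|partials l (F j) u| <= e j.
  move=> jn lm Uu; have [l0 _] := andP lm; rewrite /e jn /=; case: ifP => nj.
    rewrite /F (partials_lin l (-1) (sg j) (smooth_cst openT 1)) partials_cst // addr0 mulN1r normrN.
    by apply: hE => //; [exact: th01|exact: ltW].
  have eF : forall u, U u -> F j u = 1.
    move=> v Uv; rewrite /F z ?mulr0 ?add0r // leNgt; apply/negP => h.
    move/negP: nj; apply; rewrite /near -(mulKr G (dil (th j) v) (c j)); apply: hB0.
      by rewrite (le_trans (ltW h)) // lerDl.
    rewrite normrN; apply: le_trans (dilation_norm_le G _ (th01 j jn)) _; apply: le_trans (ltW Uv).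
    by rewrite ler_piMl //; case/andP: (th01 j jn).
  by rewrite (eq_on_partials l oU eF Uu) partials_cst // normr0.
have sub f : smooth_on setT f -> smooth_on U f := smooth_sub (@subsetT _ _).
have cU : ckb m U (M0 * expR (2 ^+ m * (E * S))) (fun u => eta u * \prod_(j < n) F j u).
  have h := ckb_prod oU M00 (sub _ se) (ckb_le (leqnn m) (@subsetT _ U) (lexx M0) hM0) e0 (fun j => sub _ (sF j))
    (fun j u _ => F1 j u) hF.
  apply: (ckb_le (leqnn m) (@subset_refl _ U) _ h); rewrite ler_wpM2l // ler_expR ler_wpM2l ?exprn_ge0 //.
  apply: (@le_trans _ _ (E * \sum_(j < n | box (B1 * r j) (mul (- x j) (x n))) th j)); last by rewrite ler_wpM2l // hS.
  rewrite mulr_sumr [leRHS]big_mkcond; apply: ler_sum => j _; rewrite /e ltn_ord /=.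
  case: ifP => nj; last by case: ifP => // _; rewrite mulr_ge0 //; case/andP: (th01 j (ltn_ord j)).
  suff -> : box (B1 * r j) (mul (- x j) (x n)) by [].
  have := @norm_box _ _ G B1 (c j); rewrite /c box_dil ?invr_eq0 ?gt_eqF ?rj // invrK; apply.
    by rewrite lerDl ltW.
  by rewrite (le_trans nj) // lerDr.
have tp : test_fun U (fun u => eta u * \prod_(j < n) F j u).
  apply: test_ball => [u /z ->|]; first by rewrite mul0r.
  have := testM (smooth_prod openT (index_enum _) (fun j : 'I_n => sF j)) te.
  by congr test_fun; apply/funext => u; exact: mulrC.
rewrite pE => l u lm _; have [Uu|nU] := pselect (U u); first exact: cU.
by rewrite (test_out l tp nU) normr0 mulr_ge0 // expR_ge0.
Qed.

Variables (Lf Lt : (V -> R) -> V -> R) (lambda delta : R).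
Hypothesis ops : inv_ops G Lf Lt lambda.
Hypotheses (lambda_gt0 : 0 < lambda) (delta_gt0 : 0 < delta).
Hypothesis Lt_bound : forall A : R, 0 < A -> exists m (B : R), 0 <= B /\ forall phi M, test_fun setT phi ->
  (forall x, A <= `|x| -> phi x = 0) -> 0 <= M -> ckb m setT M phi -> forall x, `|Lt phi x| <= B * M.
Local Notation Q := ((qdim G)%:R : R).
Local Notation s := (Q - lambda + delta).

Lemma int_Lt_centered f phi (c : R) : continuous f -> test_fun setT phi ->
  integral_rV (fun y => (f y - c) * Lt phi y) = integral_rV (fun y => f y * Lt phi y).
Proof.
move=> cf tp; have tL := Lt_test ops tp.
have [A1 c1] := ccont_mul_test cf tL; have [A2 c2] := test_ccont tL.
have c1' : ccont (A1 + A2) (fun y => f y * Lt phi y) by apply: ccont_widen c1; case: c2 => h _ _; rewrite lerDl ltW.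
have c2' : ccont (A1 + A2) (Lt phi) by apply: ccont_widen c2; case: c1 => h _ _; rewrite lerDr ltW.
have := int_lin (- c) c2' c1'; rewrite (int_Lt ops) // mulr0 add0r => <-.
by congr integral_rV; apply/funext => y; ring.
Qed.

(** In the coordinates of the box, f - f x is O(r^delta), L^t contributes r^-lambda and the volume
    r^Q. The order m is fixed before M, because [piece_ckb] produces its M from m. *)
Lemma rescaled_bound (A C0 : R) : 0 < A -> 0 <= C0 -> exists m, forall M : R, 0 <= M ->
  exists2 C : R, 0 <= C & (forall f x (r : R) phi,
  (forall y z, `|f y - f z| <= C0 * d_ y z `^ delta) -> 0 < r -> test_fun setT phi ->
  (forall u, A <= `|u| -> phi (mul x (dil r u)) = 0) -> ckb m setT M (fun u => phi (mul x (dil r u))) ->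
  `|integral_rV (fun y => f y * Lt phi y)| <= C * r `^ s).
Proof.
move=> A0 C00; have [m [B [B0 hB]]] := Lt_bound A0; exists m => M M0.
have [Cb Cb0 hCb] := cc_dist_box G.
pose A1 := A + 1; have A10 : 0 < A1 by rewrite addr_gt0.
pose C1 := C0 * (Cb * A1) `^ delta * (B * M).
have C10 : 0 <= C1 by rewrite !mulr_ge0 // powR_ge0.
exists (C1 * (2 * A1) ^+ N); first by rewrite mulr_ge0 // exprn_ge0 // mulr_ge0 // ltW.
move=> f x r phi hf r0 tp zp cp; have cf := holder_continuous C00 delta_gt0 hf.
rewrite -(int_Lt_centered (f x) cf tp).
pose F y := f y - f x; have cF : continuous F by move=> y; apply: continuousB; [exact: cf|exact: cst_continuous].
have [A2 c2] := ccont_mul_test cF (Lt_test ops tp).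
have [A3 c3] := ccont_translate G x c2.
have tpx := test_translate G x tp; have tpd := test_dilate G r0 tpx.
pose phir u := phi (mul x (dil r u)).
have LE u : Lt phir u = r `^ lambda * Lt phi (mul x (dil r u)).
  rewrite /phir (inv_dilate ops r0 tpx); congr (_ * _).
  by rewrite (inv_translate ops x tp).
have rl0 : 0 < r `^ lambda by rewrite powR_gt0.
have rQ0 : 0 < r ^+ qdim G by rewrite exprn_gt0.
have e1 := int_translate G x c2; have e2 := int_dilate G r0 c3.
have -> : integral_rV (fun y => (f y - f x) * Lt phi y) =
    r ^+ qdim G * integral_rV (fun u => F (mul x (dil r u)) * Lt phi (mul x (dil r u))).
  by rewrite e2 e1 mulrA mulfV ?mul1r // gt_eqF.
have [A4 c4] := ccont_dilate G r0 c3.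
have tb := test_ball zp tpd.
have bnd : `|integral_rV (fun u => F (mul x (dil r u)) * Lt phi (mul x (dil r u)))| <= C1 * r `^ delta * r `^ (-
  lambda) * (2 * A1) ^+ N.
  have LE' u : Lt phi (mul x (dil r u)) = r `^ (- lambda) * Lt phir u.
    by rewrite LE powRN mulrA mulVf ?mul1r // gt_eqF.
  have zL u : A1 <= `|u| -> Lt phir u = 0.
    move=> h; apply: (@test_out _ _ _ _ [::] _ (Lt_test ops tb)) => /=.
    by apply/negP; rewrite -leNgt.
  apply: int_bound; first by case: c4 => _ c4 _; split=> // u /zL h; rewrite LE' h !mulr0.
  move=> u; have [uA|uA] := leP `|u| A1; last first.
    by rewrite LE' zL ?(ltW uA) // !mulr0 normr0 !mulr_ge0 ?powR_ge0.
  rewrite normrM LE' normrM (ger0_norm (powR_ge0 _ _)).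
  have h1 : `|Lt phir u| <= B * M by apply: hB.
  have h2 : `|F (mul x (dil r u))| <= C0 * ((Cb * A1) `^ delta * r `^ delta).
    rewrite /F distrC; apply: le_trans (hf _ _) _; rewrite ler_wpM2l //.
    have CA : 0 <= Cb * A1 by rewrite mulr_ge0 // ltW.
    rewrite -powRM ?(ltW r0) //; apply: ge0_ler_powR; rewrite ?nnegrE ?(ltW delta_gt0) ?cc_dist_ge0 //.
      by rewrite mulr_ge0 // ltW.
    rewrite -mulrA; apply: hCb; first by rewrite mulr_gt0.
    rewrite mulKx box_dil ?gt_eqF // mulfK ?gt_eqF //; apply: norm_box => //.
    by rewrite lerDr ltW.
  apply: le_trans (ler_pM (normr_ge0 _) _ h2 (ler_wpM2l _ h1)) _; rewrite ?mulr_ge0 ?powR_ge0 //.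
  by rewrite le_eqVlt; apply/orP; left; apply/eqP; rewrite /C1; ring.
rewrite normrM gtr0_norm //; apply: le_trans (ler_wpM2l (ltW rQ0) bnd) _.
have -> : r `^ s = r ^+ qdim G * r `^ (- lambda) * r `^ delta.
  by rewrite -powR_mulrn ?(ltW r0) // -!powRD ?(gt_eqF r0) ?implybT.
by rewrite le_eqVlt; apply/orP; left; apply/eqP; ring.
Qed.

End UpperBound.

Lemma sub_sum_le (R : realType) (T : eqType) (F : T -> R) (S l : seq T) : (forall a, 0 <= F a) -> uniq S ->
  {subset S <= l} ->
  \sum_(a <- S) F a <= \sum_(a <- l) F a.
Proof.
move=> F0; elim: S l => [|a S IH] l; first by rewrite big_nil sumr_ge0.
move=> /= /andP[aS uS] Sl; rewrite big_cons [leRHS](big_rem a (Sl a (mem_head _ _))) /= lerD2l; apply: IH => // b bS;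
  apply: rem_mem; last by apply: Sl; rewrite inE bS orbT.
by apply: contraNneq aS => <-.
Qed.

(** * Summation over a finite cover *)

Section UpperCover.
Context {R : realType} {N : nat} (G : carnot R N).
Local Notation V := 'rV[R]_N.
Local Notation mul := (carnot_mul G).
Local Notation dil := (dilation G).
Local Notation box := (box G).
Local Notation d_ := (cc_dist G).
Implicit Types (y z : V) (f g phi psi eta : V -> R).
Variables (Lf Lt : (V -> R) -> V -> R) (lambda delta : R).
Hypothesis ops : inv_ops G Lf Lt lambda.
Hypotheses (lambda_gt0 : 0 < lambda) (delta_gt0 : 0 < delta).
Hypothesis Lt_bound : forall A : R, 0 < A -> exists m (B : R), 0 <= B /\ forall phi M, test_fun setT phi ->
  (forall x, A <= `|x| -> phi x = 0) -> 0 <= M -> ckb m setT M phi -> forall x, `|Lt phi x| <= B * M.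
Local Notation Q := ((qdim G)%:R : R).
Local Notation s := (Q - lambda + delta).

Lemma op_dist_of_lin f (a : R) phi psi : continuous f -> test_fun setT phi -> test_fun setT psi ->
  op_dist Lt (dist_of f) (fun x => a * phi x + psi x) = a * op_dist Lt (dist_of f) phi + op_dist Lt (dist_of f) psi.
Proof.
move=> cf t1 t2; rewrite /op_dist (inv_lin ops a (test_smooth t1) (test_smooth t2)).
exact: (dist_of_lin a cf (Lt_test ops t1) (Lt_test ops t2)).
Qed.

Definition meets (a b : V * R) : bool := box (Num.max a.2 b.2) (mul (- a.1) b.1).

Lemma vitali_separated (l : seq (V * R)) : (forall a : V * R, a \in l -> 0 < a.2) -> exists S : seq (V * R),
  [/\ uniq S, {subset S <= l}, forall n, (n < size S)%N ->
    separated G (fun i => (nth (0, 1) S i).1) (fun i => (nth (0, 1) S i).2) n &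
    forall a, a \in l -> exists2 i, (i < size S)%N & a.2 <= (nth (0, 1) S i).2 /\ box (nth (0,
      1) S i).2 (mul (- (nth (0, 1) S i).1) a.1)].
Proof.
move=> l0; have mr : reflexive meets by move=> a; rewrite /meets mulNx; exact: box0.
have [S [Sl pS cS]] := vitali (fun a : V * R => a.2) l mr.
exists S; split=> //.
- by apply: pairwise_uniq pS => a; rewrite mr andbF.
- move=> n nS; have /pairwiseP hp := pS.
  have pr j k : (j < k <= n)%N -> ((nth (0, 1) S k).2 <= (nth (0, 1) S j).2) && ~~ meets (nth (0, 1) S k) (nth (0,
    1) S j).
    move=> /andP[jk kn]; have kS : (k < size S)%N := leq_ltn_trans kn nS.
    exact: (hp (0, 1) j k (ltn_trans jk kS) kS jk).
  split.
  + by move=> j jn; apply/l0/Sl/mem_nth; exact: leq_ltn_trans jn nS.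
  + by move=> j k jk; case/andP: (pr j k jk).
  + move=> j k jk; have /andP[h1] := pr j k jk; rewrite /meets max_r // => /negP h2 h3; apply: h2.
    by rewrite -boxN oppM opprK.
- move=> a al; have [b [bS ab rab]] := cS a al.
  exists (index b S); first by rewrite index_mem.
  rewrite nth_index //; split=> //; move: ab; rewrite /meets max_r // => ab.
  by rewrite -boxN oppM opprK.
Qed.

Lemma upper_cover (C0 : R) : 0 <= C0 -> exists2 C : R, 0 <= C & forall (K : set V) f psi (l : seq (V * R)),
  (forall y z, `|f y - f z| <= C0 * d_ y z `^ delta) ->
  dist_support (op_dist Lt (dist_of f)) `<=` K ->
  test_fun setT psi -> set_nbhs K [set x | psi x = 1] ->
  (forall a : V * R, a \in l -> 0 < a.2) ->
  (forall z, K z -> exists2 a : V * R, a \in l & box a.2 (mul (- a.1) z)) ->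
  `|integral_rV (fun x => f x * Lt psi x)| <= C * \sum_(a <- l) a.2 `^ s.
Proof.
move=> C00; have [K1 K11 hK1] := box_mul G; have K10 : 0 < K1 by exact: lt_le_trans K11.
have [B B0 hB] := box_norm G K10.
(* The cutoff eta is 1 on the box of radius K1, hence, rescaled to a selected box, on all the boxes
   that the Vitali selection discarded in its favour. *)
pose kap := B + 1; have kap0 : 0 < kap by rewrite addr_gt0.
pose eta : V -> R := bump 0 kap.
have te : test_fun setT eta by apply: bump_test.
have A0 : 0 < 2 * kap by rewrite mulr_gt0.
have ze u : 2 * kap <= `|u| -> eta u = 0 by move=> h; apply: bump_eq0; rewrite ?subr0.
have [m hm] := rescaled_bound ops lambda_gt0 delta_gt0 Lt_bound A0 C00.
have [M M0 hM] := piece_ckb G m te A0 ze (bump01 0 kap).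
have [C C_0 hC] := hm M M0; exists C => // K f psi l hf sK tpsi nb l0 cl.
have cf := holder_continuous C00 delta_gt0 hf.
have [S [uS Sl sepS cS]] := vitali_separated l0.
pose x i := (nth (0, 1) S i).1; pose r i := (nth (0, 1) S i).2; pose q := size S.
have r0 i : (i < q)%N -> 0 < r i by move=> iq; apply/l0/Sl/mem_nth.
pose T := op_dist Lt (dist_of f).
have tp (i : 'I_q) : test_fun setT (piece G eta x r i) := piece_test G x te (r0 i (ltn_ord i)).
have T0 : T (fun=> 0) = 0.
  rewrite /T /op_dist (Lt0 ops) /dist_of (_ : (fun x => _) = fun=> 0) ?int0 //.
  by apply/funext => y; rewrite mulr0.
have Tsum (I : seq 'I_q) : T (fun y => \sum_(i <- I) piece G eta x r i y) = \sum_(i <- I) T (piece G eta x r i).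
  elim: I => [|i I IH].
    by rewrite big_nil -[RHS]T0; congr T; apply/funext => y; rewrite big_nil.
  rewrite big_cons -IH -[X in X + _]mul1r -(op_dist_of_lin 1 cf (tp i) (test_sum I tp)); congr T.
  by apply/funext => y; rewrite big_cons mul1r.
pose O (i : 'I_q) := [set y | `|dil (r i)^-1 (mul (- x i) y)| < kap].
have oO i : open (O i).
  apply: (@open_comp _ _ (fun y : V => dil (r i)^-1 (mul (- x i) y)) [set u : V | `|u| < kap]);
    last exact: open_norm_lt.
  by move=> y _; apply: continuous_comp; [exact: mulr_continuous|exact: dil_continuous].
move/set_nbhsP: nb => [W [oW KW We]].
(* On this neighbourhood of K both psi and the sum F of the pieces equal 1; as L f is supported in
   K, it takes the same value on both. *)
pose U := (\bigcup_i O i) `&` W.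
have oU : open U by apply: openI => //; apply: bigcup_open => i _; exact: oO.
have KU : K `<=` U.
  move=> z Kz; split; last exact: KW.
  have [a al ab] := cl z Kz; have [i iS [ai bi]] := cS a al.
  exists (Ordinal iS) => //=; apply: (@le_lt_trans _ _ B); last by rewrite ltrDl.
  have ri := r0 i iS; apply: hB; rewrite box_dil ?invr_eq0 ?gt_eqF // invrK.
  rewrite -(mulxK G a.1 z) carnot_mulA; apply: hK1 => //.
  by apply: box_le ab => //; exact: l0.
pose F y := \sum_(i < q) piece G eta x r i y.
have tF : test_fun setT F := test_sum (index_enum 'I_q) tp.
have F1 y : U y -> F y = 1.
  move=> [[i _ yi] _]; rewrite /F sum_pieces (bigD1 i) //= /eta bump_eq1 ?subr0 ?(ltW yi) //.
  by rewrite subrr mul0r subr0.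
have Tz : T (fun y => (-1) * F y + psi y) = 0.
  apply: (support_vanish (O := U)) => //.
  - by move=> a phi1 phi2 t1 t2; exact: op_dist_of_lin.
  - exact: subset_trans KU.
  - exact: test_lin.
  - by move=> y Uy; rewrite F1 // We ?mulr1 ?addNr //; case: Uy.
have Tpsi : T psi = \sum_(i < q) T (piece G eta x r i).
  rewrite -Tsum -/F; have := op_dist_of_lin (-1) cf tF tpsi; rewrite -/T Tz; lra.
rewrite -[X in `|X|]/(T psi) Tpsi; apply: le_trans (ler_norm_sum _ _ _) _.
apply: (@le_trans _ _ (C * \sum_(a <- S) a.2 `^ s)); last first.
  by rewrite ler_wpM2l // sub_sum_le // => a; exact: powR_ge0.
rewrite (big_nth (0, 1)) big_mkord mulr_sumr; apply: ler_sum => i _.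
apply: (hC f (x i) (r i) (piece G eta x r i) hf (r0 i (ltn_ord i)) (tp i)).
  by move=> u uA; rewrite /piece mulKx dilVK ?gt_eqF ?r0 // ze // mul0r.
exact: (hM x r i (sepS i (ltn_ord i))).
Qed.

End UpperCover.

Section TransposeBound.
Context {R : realType} {N : nat}.
Local Notation V := 'rV[R]_N.

Lemma diffop_tr_bound (L : diffop R N) (A : R) : 0 < A -> exists m (B : R), 0 <= B /\ forall (phi : V ->
  R) M, test_fun setT phi ->
  (forall x, A <= `|x| -> phi x = 0) -> 0 <= M -> ckb m setT M phi -> forall x, `|diffop_tr_fun L phi x| <= B * M.
Proof.
move=> A0; pose m := \max_k size (@diffop_word R N L k); exists m.
have hk k : exists2 B : R, 0 <= B & ckb m [set x : V | `|x| <= A + 1] B (@diffop_coef R N L k) by apply: smooth_ckb;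
  exact: diffop_smooth.
pose b k := sval (cid2 (hk k)).
have b0 k : 0 <= b k by rewrite /b; case: cid2.
have hb k : ckb m [set x : V | `|x| <= A + 1] (b k) (@diffop_coef R N L k) by rewrite /b; case: cid2.
exists (\sum_k 2 ^+ m * b k); split.
  by apply: sumr_ge0 => k _; rewrite mulr_ge0 // exprn_ge0.
move=> phi M tp zp M0 cp x.
pose U := [set x : V | `|x| < A + 1]; have oU : @open V U by exact: open_norm_lt.
have [Ux|nU] := pselect (U x); last first.
  have := @test_out _ _ _ _ [::] x (diffop_tr_test L (test_ball zp tp)) nU => /= ->.
  by rewrite normr0 mulr_ge0 // sumr_ge0 // => k _; rewrite mulr_ge0 // exprn_ge0.
apply: le_trans (ler_norm_sum _ _ _) _; rewrite mulr_suml; apply: ler_sum => k _.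
rewrite normrM normrX normrN1 expr1n mul1r -mulrA.
have sub (g : V -> R) : smooth_on setT g -> smooth_on U g := smooth_sub (@subsetT _ _).
have h1 : ckb m U (b k) (@diffop_coef R N L k) by apply: ckb_le (hb k) => // y /ltW.
have h2 : ckb m U M phi by apply: ckb_le cp.
have h := ckbM oU (sub _ (diffop_smooth k)) (sub _ (test_smooth tp)) (b0 k) M0 h1 h2.
by apply: h => //; exact: (leq_bigmax k).
Qed.

End TransposeBound.

(** * Hausdorff content and capacity *)

Section Assembly.
Context {R : realType} {N : nat} (G : carnot R N).
Local Notation V := 'rV[R]_N.
Local Notation mul := (carnot_mul G).
Local Notation dil := (dilation G).
Local Notation box := (box G).
Local Notation d_ := (cc_dist G).
Implicit Types (y z : V) (f g phi psi : V -> R).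

Lemma diffop_inv_ops (L : diffop R N) (lambda : R) : left_invariant G L -> homogeneous G L lambda ->
  inv_ops G (diffop_fun L) (diffop_tr_fun L) lambda.
Proof.
move=> Li Lh; split.
- split; [exact: diffop_fun_smooth|exact: diffop_fun_test|exact: diffop_fun_local].
- split; [exact: diffop_tr_smooth|exact: diffop_tr_test|exact: diffop_tr_local].
- exact: diffop_tr_int.
- exact: diffop_tr_lin.
- move=> phi a; exact: (tr_translate Li).
- move=> phi t; exact: (tr_dilate Lh).
Qed.

Lemma cc_diam_le (E : set V) (D : R) : 0 <= D -> (forall x y, E x -> E y -> d_ x y <= D) -> (cc_diam G E <= D%:E)%E.
Proof.
move=> D0 h; rewrite /cc_diam ge_max lee_fin D0 /=; apply/ereal_supP => _ [x [y [Ex Ey ->]]].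
by rewrite lee_fin; exact: h.
Qed.

Lemma cc_diam_ge0 (E : set V) : (0 <= cc_diam G E)%E.
Proof. by rewrite /cc_diam le_max lexx. Qed.

Lemma cc_diam_ge (E : set V) x y : E x -> E y -> ((d_ x y)%:E <= cc_diam G E)%E.
Proof. by move=> Ex Ey; rewrite /cc_diam le_max; apply/orP; right; apply: ereal_sup_ubound; exists x, y. Qed.

Lemma box_set_diam (B : R) : 0 < B -> exists2 D : R, 0 < D & forall (r : R) x y z, 0 < r ->
  box (B * r) (mul (- x) y) -> box (B * r) (mul (- x) z) -> d_ y z <= D * r.
Proof.
move=> B0; have [K K1 hK] := box_mul G; have [C C0 hC] := cc_dist_box G.
have K0 : 0 < K by exact: lt_le_trans K1.
exists (C * (K * B)); first by rewrite !mulr_gt0.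
move=> r x y z r0 hy hz; rewrite -!mulrA; apply: hC; first by rewrite !mulr_gt0.
have e : mul (mul (- y) x) (mul (- x) z) = mul (- y) z by rewrite -carnot_mulA mulxK.
rewrite -e; apply: hK; rewrite ?mulr_gt0 //.
by rewrite -boxN oppM opprK.
Qed.

Lemma content_le_cover (s B : R) : 0 < s -> 0 < B -> exists2 D : R, 0 < D & forall (K : set V) (l : seq (V * R)),
  (forall a : V * R, a \in l -> 0 < a.2) ->
  (forall z, K z -> exists2 a : V * R, a \in l & box (B * a.2) (mul (- a.1) z)) ->
  (hausdorff_content G s K <= (D * \sum_(a <- l) a.2 `^ s)%:E)%E.
Proof.
move=> s0 B0; have [D D0 hD] := box_set_diam B0.
exists (D `^ s); first by rewrite powR_gt0.
move=> K l l0 cl; pose b i := nth (0, 1) l i.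
(* Indices past the end of the list give empty sets, of diameter 0, and 0 to the power s is 0
   because s > 0. *)
pose E i := [set z | (i < size l)%N /\ box (B * (b i).2) (mul (- (b i).1) z)].
have b0 i : (i < size l)%N -> 0 < (b i).2 by move=> il; apply/l0/mem_nth.
pose c i := if (i < size l)%N then (D * (b i).2) `^ s else 0.
have dE i : (poweR (cc_diam G (E i)) s <= (c i)%:E)%E.
  rewrite /c; case: ifP => il.
    rewrite -poweR_EFin; have Db : 0 <= D * (b i).2 by rewrite mulr_ge0 // ltW // b0.
    apply: (gt0_ler_poweR (ltW s0)); rewrite ?in_itv /= ?leey ?andbT ?cc_diam_ge0 //.
    by apply: cc_diam_le => // x y [_ Ex] [_ Ey]; apply: (hD _ (b i).1) => //; exact: b0.
  have -> : cc_diam G (E i) = 0%E.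
    apply/eqP; rewrite eq_le cc_diam_ge0 andbT; apply: cc_diam_le => // x y [].
    by rewrite il.
  by rewrite poweR0r // gt_eqF.
apply: (@le_trans _ _ (\sum_(0 <= i <oo) poweR (cc_diam G (E i)) s)%E).
  apply: ereal_inf_lbound; exists E; split=> // z Kz; have [a al ab] := cl z Kz.
  by exists (index a l) => //; rewrite /E /= /b index_mem nth_index.
apply: lime_le; first by apply: is_cvg_nneseries => n _ _; exact: poweR_ge0.
apply: nearW => n; apply: (@le_trans _ _ (\sum_(0 <= i < n) (c i)%:E)%E); first by apply: lee_sum => i _; exact: dE.
rewrite sumEFin lee_fin.
have -> : D `^ s * \sum_(a <- l) a.2 `^ s = \sum_(0 <= i < size l) (D * (b i).2) `^ s.
  rewrite (big_nth (0, 1)) mulr_sumr; apply: eq_big_nat => i /andP[_ il].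
  by rewrite powRM // ltW // b0.
rewrite /c -big_mkcond -big_filter; apply: sub_sum_le.
- by move=> i; exact: powR_ge0.
- by rewrite filter_uniq // iota_uniq.
- by move=> i; rewrite mem_filter !mem_index_iota => /andP[-> _].
Qed.

(** A covering set may have diameter 0, and [box_cc_dist] asks for a strict inequality: the radius
    is enlarged at a controlled cost in the power s. *)
Lemma powR_approx (e s eps : R) : 0 <= e -> 0 < s -> 0 < eps -> exists2 r : R, e < r & r `^ s <= e `^ s + eps.
Proof.
move=> e0 s0 eps0; pose t := e `^ s + eps; have t0 : 0 <= t by rewrite addr_ge0 ?powR_ge0 // ltW.
have sn : s != 0 by rewrite gt_eqF.
exists (t `^ s^-1); last by rewrite -powRrM mulVf // powRr1.
rewrite -{1}(powRr1 e0) -(mulfV sn) powRrM.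
apply: (@gt0_ltr_powR R s^-1); rewrite ?nnegrE ?powR_ge0 ?invr_gt0 //.
by rewrite /t ltrDl.
Qed.

Lemma cover_of_sets (s : R) : 0 < s -> exists2 C : R, 0 < C & forall (K : set V) (E : nat -> set V) (rho eta : R),
  compact K -> K `<=` \bigcup_i E i -> (\sum_(0 <= i <oo) poweR (cc_diam G (E i)) s = rho%:E)%E -> 0 < eta ->
  exists l : seq (V * R), [/\ forall a : V * R, a \in l -> 0 < a.2,
    forall z, K z -> exists2 a : V * R, a \in l & box a.2 (mul (- a.1) z) &
    \sum_(a <- l) a.2 `^ s <= C * (rho + eta)].
Proof.
move=> s0; have [C C0 hC] := box_cc_dist G; have C20 : 0 < 2 * C by rewrite mulr_gt0.
exists ((2 * C) `^ s); first by rewrite powR_gt0.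
move=> K E rho eta cK KE sumE eta0.
pose u i := poweR (cc_diam G (E i)) s.
have u0 i : (0 <= u i)%E by exact: poweR_ge0.
have part n : (\sum_(0 <= i < n) u i <= rho%:E)%E by rewrite -sumE; apply: nneseries_lim_ge.
have fin i : cc_diam G (E i) \is a fin_num.
  rewrite ge0_fin_numE ?cc_diam_ge0 //; apply: (@lty_poweRy _ _ s); first by rewrite gt_eqF.
  apply: (@le_lt_trans _ _ rho%:E); last exact: ltry.
  apply: le_trans (part i.+1); rewrite big_nat_recr //= leeDr //.
  by apply: sume_ge0.
pose e i := fine (cc_diam G (E i)).
have e0 i : 0 <= e i by rewrite /e fine_ge0 // cc_diam_ge0.
have uE i : u i = (e i `^ s)%:E by rewrite /u -poweR_EFin /e fineK.
(* The errors eta 2^-(i + 1) sum to at most eta. *)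
have hr i := powR_approx (e0 i) s0 (mulr_gt0 eta0 (half_pow_gt0 (R := R) i.+1)).
pose r i := sval (cid2 (hr i)).
have er i : e i < r i by rewrite /r; case: cid2.
have rs i : r i `^ s <= e i `^ s + eta * 2^-1 ^+ i.+1 by rewrite /r; case: cid2.
have r0 i : 0 < r i by exact: le_lt_trans (er i).
have Cr i : 0 < C * r i by rewrite mulr_gt0.
pose x i := xget 0 (E i).
(* An open enlargement of the box, from which a finite subcover can be extracted. *)
pose O i := [set y | `|dil (C * r i)^-1 (mul (- x i) y)| < 2].
have oO i : open (O i).
  apply: (@open_comp _ _ (fun y : V => dil (C * r i)^-1 (mul (- x i) y)) [set u : V | `|u| < 2]);
    last exact: open_norm_lt.
  by move=> y _; apply: continuous_comp; [exact: mulr_continuous|exact: dil_continuous].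
have KO : K `<=` cover setT O.
  move=> z /KE [i _ Eiz]; exists i => //=; rewrite /O /=.
  have Ex : E i (x i) by apply: xgetPex; exists z.
  have : box (C * r i) (mul (- x i) z).
    apply: hC => //; apply: le_lt_trans (er i).
    by rewrite -lee_fin /e fineK //; exact: cc_diam_ge.
  by rewrite /box => h; apply: le_lt_trans h _; rewrite ltr1n.
have := cK; rewrite (@compact_cover (V : ptopologicalType)) => /(_ _ setT O (fun i _ => oO i) KO) [D' _ KD].
exists [seq (x i, 2 * C * r i) | i <- finmap.enum_fset D']; split.
- by move=> a /mapP [i _ ->] /=; rewrite mulr_gt0.
- move=> z /KD [i /= iD Oz]; exists (x i, 2 * C * r i) => /=; first by apply/mapP; exists i.
  have : box 2 (dil (C * r i)^-1 (mul (- x i) z)) by apply: norm_box; rewrite ?ler1n // ltW.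
  by rewrite box_dil ?invr_eq0 ?gt_eqF // invrK mulrA.
- rewrite big_map (eq_bigr (fun i => (2 * C) `^ s * r i `^ s)) => [|i _];
  last by rewrite /= (powRM _ (ltW C20) (ltW (r0 i))).
  rewrite -mulr_sumr ler_wpM2l ?powR_ge0 //.
  pose n := (\max_(i <- finmap.enum_fset D') i).+1.
  apply: (@le_trans _ _ (\sum_(0 <= i < n) (e i `^ s + eta * 2^-1 ^+ i.+1))).
    apply: (@le_trans _ _ (\sum_(i <- finmap.enum_fset D') (e i `^ s + eta * 2^-1 ^+ i.+1))).
      by apply: ler_sum => i _; exact: rs.
    apply: sub_sum_le => [i| |i iD].
    + by rewrite addr_ge0 ?powR_ge0 // mulr_ge0 ?exprn_ge0 ?invr_ge0 // ltW.
    + exact: finmap.fset_uniq.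
    + by rewrite mem_index_iota /= ltnS; exact: (@leq_bigmax_seq nat (finmap.enum_fset D') xpredT (fun i : nat => i)
      i iD isT).
  rewrite big_split /= lerD //.
    by rewrite -lee_fin -sumEFin; under eq_bigr => i _ do rewrite -uE; exact: part.
  rewrite -mulr_sumr ler_piMr ?(ltW eta0) // big_mkord; under eq_bigr => i _ do rewrite exprS.
  by rewrite -mulr_sumr ler_pdivrMl // mulr1 half_sum.
Qed.

Section Main.
Variables (L : diffop R N) (lambda delta : R).
Hypotheses (L_left_inv : left_invariant G L) (L_homog : homogeneous G L lambda).
Hypotheses (lambda_gt0 : 0 < lambda) (lambda_ltQ : lambda < (qdim G)%:R).
Hypotheses (delta_gt0 : 0 < delta).
Local Notation s := ((qdim G)%:R - lambda + delta).

Let ops := diffop_inv_ops L_left_inv L_homog.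

Lemma int_mulZ (c : R) f psi : continuous f -> test_fun setT psi ->
  integral_rV (fun x => c * f x * diffop_tr_fun L psi x) = c * integral_rV (fun x => f x * diffop_tr_fun L psi x).
Proof.
move=> cf tp; have [A cA] := ccont_mul_test cf (Lt_test ops tp).
by rewrite -(intZ c cA); congr integral_rV; apply/funext => x; rewrite mulrA.
Qed.

Lemma content_le_capacity : hypoelliptic (diffop_dist L) -> hypoelliptic (diffop_tr_dist L) -> delta < 1 ->
  exists2 c : R, 0 < c & forall K : set V, compact K ->
    (hausdorff_content G s K <= c%:E * holder_capacity G L delta K)%E.
Proof.
move=> hL hLt delta1; have s0 : 0 < s := s_gt0 lambda_ltQ delta_gt0.
(* In dimension 0 one would have Q = 0, against 0 < lambda < Q. *)
have i0 : 'I_N.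
  have : (0 < N)%N.
    rewrite lt0n; apply/eqP => N0; have := lt_trans lambda_gt0 lambda_ltQ.
    rewrite (_ : qdim G = 0%N) ?ltxx // /qdim big1 // => j _.
    by have := leq_trans (ltn_ord j) (eq_leq N0).
  by move=> N0; exact: Ordinal N0.
have [C [B [C0 B0 ext]]] := extremal_function ops lambda_gt0 lambda_ltQ delta_gt0 delta1 hLt hL i0.
have [D D0 hD] := content_le_cover s0 B0.
exists (D * C); first exact: mulr_gt0.
move=> K cK; have [f [hf sf hv]] := ext K cK.
have [psi [d [tpsi d0 psi1 _]]] := cutoff cK openT (@subsetT _ K).
have nb : set_nbhs K [set x | psi x = 1].
  apply/set_nbhsP; exists [set y | exists2 x, K x & `|x - y| < d]; split.
  - rewrite (_ : [set y | _] = \bigcup_(x in K) [set y | `|x - y| < d]); last first.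
      by apply/seteqP; split=> [y [x Kx h]|y [x Kx h]]; exists x.
    apply: bigcup_open => x _; apply: (@open_comp _ _ (fun y : V => x - y) [set u : V | `|u| < d]);
      last exact: open_norm_lt.
    by move=> y _; apply: continuousB; [exact: cst_continuous|exact: id].
  - by move=> x Kx; exists x; rewrite // subrr normr0.
  - by move=> y [x Kx h]; exact: (psi1 x).
pose v := integral_rV (fun x => f x * diffop_tr_fun L psi x).
(* [hv] compares v with real numbers, while the content is an extended real: if it exceeded D v,
   some real h > v would still satisfy D h <= content. *)
have Hv : (hausdorff_content G s K <= (D * v)%:E)%E.
  rewrite leNgt; apply/negP => lt.
  have [h vh hH] : exists2 h : R, v < h & ((D * h)%:E <= hausdorff_content G s K)%E.
    move: lt; case: (hausdorff_content G s K) => [x| |] //=.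
      by rewrite lte_fin => h; exists (x / D); [rewrite ltr_pdivlMr // mulrC|rewrite lee_fin mulrC divfK // gt_eqF].
    by move=> _; exists (v + 1); rewrite ?ltrDl // leey.
  have : h <= v.
    apply: (hv psi h tpsi nb) => l l0 cl.
    by have := le_trans hH (hD K l l0 cl); rewrite lee_fin ler_pM2l.
  by rewrite leNgt vh.
have cf := holder_continuous (ltW C0) delta_gt0 hf.
have Ci0 : 0 < C^-1 by rewrite invr_gt0.
pose f' y := C^-1 * f y.
have b1 : lip_bounds G delta f' 1.
  split=> // x y; rewrite /f' -mulrBr normrM (gtr0_norm Ci0) mul1r ler_pdivrMl //; exact: hf.
have cap : ((C^-1 * `|v|)%:E <= holder_capacity G L delta K)%E.
  apply: ereal_sup_ubound; exists f', psi; split.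
  - by exists 1.
  - by apply: ge_inf b1; exists 0 => x [/ltW].
  - apply: subset_trans sf => x nx [U [oU Ux hU]]; apply: nx; exists U; split=> // phi tphi.
    have /= h := hU phi tphi; rewrite /diffop_dist /dist_of /f' (int_mulZ _ cf (testT tphi)).
    by rewrite /op_dist /dist_of in h; rewrite h mulr0.
  - by [].
  - by rewrite /diffop_dist /dist_of /f' (int_mulZ _ cf tpsi) normrM (gtr0_norm Ci0).
apply: (le_trans Hv); have DC : (0 <= (D * C)%:E)%E by rewrite lee_fin mulr_ge0 // ltW.
apply: le_trans (lee_wpmul2l DC cap); rewrite -EFinM lee_fin mulrA mulfK ?gt_eqF //.
by rewrite ler_wpM2l ?ler_norm // ltW.
Qed.

Lemma capacity_le_content : exists2 c : R, 0 < c & forall K : set V, compact K ->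
    (holder_capacity G L delta K <= c%:E * hausdorff_content G s K)%E.
Proof.
have s0 : 0 < s := s_gt0 lambda_ltQ delta_gt0.
have [C C0 hC] := upper_cover ops lambda_gt0 delta_gt0 (@diffop_tr_bound R N L) (ler0n R 2).
have [D D0 hD] := cover_of_sets s0.
pose c := C * D + 1; have c0 : 0 < c by rewrite ltr_wpDl // mulr_ge0 // ltW.
exists c => // K cK; apply/ereal_supP => _ [f [psi [lipf lipn sf [tpsi nb] ->]]].
(* The norm is an infimum; being at most 1 it is below 2, so 2 is a Hölder constant whether or not
   the infimum is attained. *)
have hf y z : `|f y - f z| <= 2 * d_ y z `^ delta.
  have [B [B0 hB] B2] := inf_lt lipf (le_lt_trans lipn (ltr1n R 2)).
  by apply: le_trans (hB y z) _; rewrite ler_wpM2r ?powR_ge0 // ltW.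
rewrite -lee_pdivrMl //; apply/ereal_infP => _ [E [KE ->]].
have u0 : (0 <= \sum_(0 <= i <oo) poweR (cc_diam G (E i)) s)%E by apply: nneseries_ge0 => i _ _; exact: poweR_ge0.
case e: (\sum_(0 <= i <oo) poweR (cc_diam G (E i)) s)%E u0 => [rho| |] // u0; last by rewrite leey.
rewrite -EFinM lee_fin ler_pdivrMl //; rewrite lee_fin in u0.
apply/ler_addgt0Pr => eps eps0.
have ec : 0 < eps / c by rewrite divr_gt0.
have [l [l0 cl sl]] := hD K E rho (eps / c) cK KE e ec.
apply: le_trans (hC K f psi l hf sf tpsi nb l0 cl) _.
apply: le_trans (ler_wpM2l C0 sl) _; rewrite mulrA.
have -> : c * rho + eps = c * (rho + eps / c) by rewrite mulrDr mulrCA divff ?mulr1 // gt_eqF.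
by rewrite ler_wpM2r ?addr_ge0 // ?(ltW ec) // lerDl.
Qed.

End Main.
End Assembly.

Theorem theorem1p3 (R : realType) (N : nat) (G : carnot R N) (L : diffop R N)
    (lambda delta : R)
    (L_left_inv : left_invariant G L)
    (L_homog : homogeneous G L lambda)
    (lambda_ge1 : 1 <= lambda)
    (lambda_ltQ : lambda < (hom_dim G)%:R)
    (L_hypo : hypoelliptic (diffop_dist L))
    (Lt_hypo : hypoelliptic (diffop_tr_dist L))
    (delta_gt0 : 0 < delta)
    (delta_lt1 : delta < 1) :
  exists c1 c2 : R, [/\ 0 < c1, 0 < c2 &
    forall K : set 'rV[R]_N, compact K ->
      (hausdorff_content G ((hom_dim G)%:R - lambda + delta) K
        <= c1%:E * holder_capacity G L delta K)%E /\
      (holder_capacity G L delta K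
        <= c2%:E * hausdorff_content G ((hom_dim G)%:R - lambda + delta) K)%E].
Proof.
move: lambda_ltQ; rewrite hom_dimE => lQ; have l0 := lt_le_trans ltr01 lambda_ge1.
have [c1 c10 h1] := content_le_capacity L_left_inv L_homog l0 lQ delta_gt0 L_hypo Lt_hypo delta_lt1.
have [c2 c20 h2] := capacity_le_content L_left_inv L_homog l0 lQ delta_gt0.
by exists c1, c2; split=> // K cK; split; [exact: h1|exact: h2].
Qed.
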